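(* Let $(\Sigma,g)$ be a compact Riemannian surface, $(N,h)$ a compact Riemannian manifold, $0<T<\infty$, and $u:\Sigma\times[0,T)\to N$ a solution of harmonic map flow. Suppose that for some $q\ge1$, $\sigma>0$ and $0\le\tau<T$, $$\sup_{\tau\le t<T}\|S(u(t))\|_{L^q}\le\sigma .$$ Given any $p\in\Sigma$ and $\varepsilon>0$, for all sufficiently small $\rho>0$ we have $$\lambda_{\varepsilon,\rho,p}(u(t))=O\big((T-t)^{q/2}\big)\qquad(t\nearrow T).$$
   Context: $E(u,\Omega)=\int_\Omega\frac12|du|^2\,dV_g$. Harmonic map flow is $\partial_tu=\mathcal T(u)=\operatorname{tr}_g\nabla du$; a solution on $[0,T)$ has $L^2_1$ initial data and is smooth for $0<t<T$. The stress-energy tensor is $S(u)=\langle du\otimes du\rangle-\frac12|du|^2g$, i.e. $S_{ij}=\langle\partial_iu,\partial_ju\rangle-\frac12|du|^2g_{ij}$. $B_r(p)$ is the geodesic ball and $U^R_r(p)=B_R(p)\setminus\overline{B_r(p)}$. Outer energy scale: for small $\rho>0$, $\varepsilon>0$ and an $L^2_1$ map $u:B_\rho(p)\to N$, $\lambda_{\varepsilon,\rho,p}(u)$ is the minimal number (infimum of numbers) $\lambda\in[0,\rho]$ such that $\sup_{\lambda<r<\rho}E(u,U^r_{r/2}(p))<\varepsilon$ (the condition is vacuous for $\lambda=\rho$). *)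

(* Defs.v *)
From HB Require Import structures.
From mathcomp Require Import all_boot all_order all_algebra.
From mathcomp Require Import all_classical all_reals all_analysis.

Set Implicit Arguments.
Unset Strict Implicit.
Unset Printing Implicit Defensive.

Import Order.TTheory GRing.Theory Num.Theory.
Import numFieldNormedType.Exports.

Local Open Scope classical_set_scope.
Local Open Scope ring_scope.

Section Calculus.
Context {R : realType}.

(* [diter [:: v1; ..; vk] f] is D_v1 (.. (D_vk f)). *)
Definition diter {V W : normedModType R} (vs : seq V) (f : V -> W) : V -> W :=
  foldr (fun v g => 'D_v g) f vs.

(* C^oo on an open subset A of a finite dimensional space: all iterated
   directional derivatives exist and are continuous on A. *)
Definition smooth_on {V W : normedModType R} (A : set V) (f : V -> W) : Prop :=
  forall (vs : seq V) (x : V), A x ->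
    {for x, continuous (diter vs f)} /\
    forall v : V, derivable (diter vs f) x v.

Definition pd {n : nat} (a : 'I_n) (f : 'rV[R]_n -> R) : 'rV[R]_n -> R :=
  'D_(delta_mx 0 a) f.

Definition leb2 := (@lebesgue_measure R \x @lebesgue_measure R)%E.

Definition pt (z : R * R) : 'rV[R]_2 := \row_k (if k == 0 then z.1 else z.2).

Definition locally_integrable2 (A : set 'rV[R]_2) (w : 'rV[R]_2 -> R) : Prop :=
  forall K, compact K -> K `<=` A ->
    leb2.-integrable (pt @^-1` K) (fun z => (w (pt z))%:E).

Definition test_function (A : set 'rV[R]_2) (eta : 'rV[R]_2 -> R) : Prop :=
  smooth_on [set: 'rV[R]_2] eta /\
  exists K, [/\ compact K, K `<=` A & forall y, ~ K y -> eta y = 0].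

Definition weak_pd (A : set 'rV[R]_2) (a : 'I_2) (w wa : 'rV[R]_2 -> R) : Prop :=
  [/\ locally_integrable2 A w, locally_integrable2 A wa &
   forall eta, test_function A eta ->
     \int[leb2]_(z in pt @^-1` A) (w (pt z) * pd a eta (pt z)) =
     - \int[leb2]_(z in pt @^-1` A) (wa (pt z) * eta (pt z))].

End Calculus.

(* A smooth manifold, compact and without boundary, given by a finite atlas.
   [psi i] inverts [phi i] on [phi i @` dom i]; both functions take junk values
   off their domains.  No connectedness is assumed. *)
Record compact_manifold (R : realType) (n : nat) := CompactManifold {
  carrier :> topologicalType ;
  manifold_hausdorff : hausdorff_space carrier ;
  manifold_compact : compact [set: carrier] ;
  ncharts : nat ;
  dom : 'I_ncharts.+1 -> set carrier ;
  phi : 'I_ncharts.+1 -> carrier -> 'rV[R]_n ;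
  psi : 'I_ncharts.+1 -> 'rV[R]_n -> carrier ;
  dom_cover : forall x, exists i, dom i x ;
  dom_open : forall i, open (dom i) ;
  img_open : forall i, open (phi i @` dom i) ;
  phiK : forall i x, dom i x -> psi i (phi i x) = x ;
  phi_continuous : forall i x, dom i x -> {for x, continuous (phi i)} ;
  psi_continuous : forall i x, dom i x -> {for phi i x, continuous (psi i)} ;
  transition_smooth : forall i j,
    smooth_on (phi i @` (dom i `&` dom j)) (phi j \o psi i)
}.

Definition img {R : realType} {n : nat} {M : compact_manifold R n}
    (i : 'I_(ncharts M).+1) : set 'rV[R]_n := phi i @` dom i.

(* Vectors are rows, so the components of a vector in chart j are those in
   chart i multiplied on the right by the Jacobian of the transition map. *)
Record compact_riemannian (R : realType) (n : nat) := CompactRiemannian {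
  underlying :> compact_manifold R n ;
  metric : 'I_(ncharts underlying).+1 -> 'rV[R]_n -> 'M[R]_n ;
  metric_smooth : forall (i : 'I_(ncharts underlying).+1) a b,
    smooth_on (img i) (fun y => metric i y a b) ;
  metric_sym : forall i y, img i y -> (metric i y)^T = metric i y ;
  metric_pos : forall i y (v : 'rV[R]_n), img i y -> v != 0 ->
    0 < (v *m metric i y *m v^T) 0 0 ;
  metric_transition : forall i j (x : underlying),
    dom i x -> dom j x ->
    let J := 'J (phi j \o psi i) (phi i x) in
    metric i (phi i x) = J *m metric j (phi j x) *m J^T
}.

Section Geometry.
Context {R : realType}.

(* A canonical chart around x; tensors at x are expressed in its coordinates. *)
Definition chart_at {n} {M : compact_manifold R n} (x : M) :
    'I_(ncharts M).+1 :=
  odflt ord0 [pick i | `[< dom i x >]].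

Definition metric_at {n} {M : compact_riemannian R n} (x : M) : 'M[R]_n :=
  metric (chart_at x) (phi (chart_at x) x).

(* Smooth maps from an open subset A of a normed space to M. *)
Definition smooth_into {V : normedModType R} {n} {M : compact_manifold R n}
    (A : set V) (u : V -> M) : Prop :=
  (forall x, A x -> {for x, continuous u}) /\
  forall j, smooth_on (A `&` u @^-1` (dom j)) (phi j \o u).

Definition smooth_function {n} {M : compact_manifold R n} (f : M -> R) : Prop :=
  forall i, smooth_on (img i) (f \o psi i).

Definition curve_length {n} {M : compact_riemannian R n} (c : R -> M) : \bar R :=
  \int[lebesgue_measure]_(s in `[0, 1])
    (let v : 'rV[R]_n := 'D_1 (phi (chart_at (c s)) \o c) (s : R) in
     Num.sqrt ((v *m metric_at (c s) *m v^T) 0 0))%:E.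

(* The curves are smooth but may have zero velocity, so piecewise smooth
   curves are covered, after reparametrization.  The distance between distinct
   connected components is +oo. *)
Definition riem_dist {n} {M : compact_riemannian R n} (p x : M) : \bar R :=
  ereal_inf [set curve_length c | c in
    [set c : R -> M | [/\ smooth_into setT c, c 0 = p & c 1 = x]]].

Definition geo_ball {n} {M : compact_riemannian R n} (r : R) (p : M) : set M :=
  [set x | (riem_dist p x < r%:E)%E].

(* annulus r R' p is U^{R'}_r(p) *)
Definition annulus {n} {M : compact_riemannian R n} (r R' : R) (p : M) : set M :=
  geo_ball R' p `\` closure (geo_ball r p).

(* Integral with respect to the Riemannian area: the sets [chart_at = i]
   partition the surface. *)
Definition area_integral {S : compact_riemannian R 2} (Omega : set S)
    (f : S -> \bar R) : \bar R :=
  (\sum_(i < (ncharts S).+1)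
    \int[leb2]_(z in [set z | [/\ img i (pt z),
                                  chart_at (psi i (pt z) : S) = i &
                                  Omega (psi i (pt z))]])
      (f (psi i (pt z)) * (Num.sqrt (\det (metric i (pt z))))%:E))%E.

(* Christoffel symbols of a metric g in coordinates:
   Gamma^k_ij = g^kl (d_i g_jl + d_j g_il - d_l g_ij) / 2 *)
Definition christoffel {n} (g : 'rV[R]_n -> 'M[R]_n) (k i j : 'I_n)
    (y : 'rV[R]_n) : R :=
  2^-1 * \sum_l invmx (g y) k l *
    (pd i (fun y => g y j l) y + pd j (fun y => g y i l) y
     - pd l (fun y => g y i j) y).

End Geometry.

Section Maps.
Context {R : realType} {n : nat}.
Context {S : compact_riemannian R 2} {N : compact_riemannian R n}.

(* A differential du_x : T_x S -> T_u(x) N is the matrix with entries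
   d_a u^l, in the charts [chart_at x] and [chart_at (u x)]. *)
Definition cov_diff (f : N -> R) (y : N) : 'cV[R]_n :=
  \col_l pd l (f \o psi (chart_at y)) (phi (chart_at y) y).

(* Components in chart i, at the point with coordinates y, of the covector
   d(f o u) = df o du. *)
Definition pullback_diff (f : N -> R) (u : S -> N) (D : S -> 'M[R]_(2, n))
    (i : 'I_(ncharts S).+1) (y : 'rV[R]_2) : 'cV[R]_2 :=
  let x := psi i y in
  'J (phi (chart_at x) \o psi i) y *m (D x *m cov_diff f (u x)).

(* D is a weak differential of the possibly discontinuous map u: the chain
   rule d(f o u) = df o du holds weakly for all smooth functions f on N.
   It is unique up to null sets. *)
Definition weak_differential (u : S -> N) (D : S -> 'M[R]_(2, n)) : Prop :=
  forall f : N -> R, smooth_function f ->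
  forall (i : 'I_(ncharts S).+1) (a : 'I_2),
    weak_pd (img i) a (f \o u \o psi i)
      (fun y => pullback_diff f u D i y a 0).

Definition du (u : S -> N) : S -> 'M[R]_(2, n) :=
  xget (fun=> 0) [set D | weak_differential u D].

(* <du (x) du>_ij = <d_i u, d_j u> *)
Definition pullback_metric (u : S -> N) (x : S) : 'M[R]_2 :=
  du u x *m metric_at (u x) *m (du u x)^T.

Definition du_normsq (u : S -> N) (x : S) : R :=
  \tr (invmx (metric_at x) *m pullback_metric u x).

Definition energy (u : S -> N) (Omega : set S) : \bar R :=
  area_integral Omega (fun x => (2^-1 * du_normsq u x)%:E).

(* L^2_1 maps; since N is compact, only du has to be bounded in L^2. *)
Definition L21_map (u : S -> N) : Prop :=
  (exists D, weak_differential u D) /\ (energy u setT < +oo)%E.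

Definition stress_energy (u : S -> N) (x : S) : 'M[R]_2 :=
  pullback_metric u x - (2^-1 * du_normsq u x) *: metric_at x.

(* Norm with respect to g of a symmetric 2-tensor at x *)
Definition tensor_norm (x : S) (A : 'M[R]_2) : R :=
  Num.sqrt (\tr (invmx (metric_at x) *m A *m invmx (metric_at x) *m A^T)).

Definition tensor_Lnorm (q : R) (A : S -> 'M[R]_2) : \bar R :=
  ((area_integral setT (fun x => (tensor_norm x (A x) `^ q)%:E)) `^ q^-1)%E.

(* tr_g (nabla du) at x, for u smooth near x, in the chart [chart_at (u x)]:
   g^ab (d_a d_b u^k - Gamma(g)^c_ab d_c u^k + Gamma(h)^k_lm d_a u^l d_b u^m) *)
Definition tension (u : S -> N) (x : S) : 'rV[R]_n :=
  let i := chart_at x in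
  let j := chart_at (u x) in
  let y := phi i x in
  let U (k : 'I_n) : 'rV[R]_2 -> R := fun y => phi j (u (psi i y)) 0 k in
  \row_k \sum_a \sum_b invmx (metric_at x) a b *
    (pd a (pd b (U k)) y
     - \sum_c christoffel (metric i) c a b y * pd c (U k) y
     + \sum_l \sum_m christoffel (metric j) k l m (phi j (u x))
         * pd a (U l) y * pd b (U m) y).

(* Solutions of the harmonic map flow on [0, T).  The initial map u 0 is L^2_1,
   and is attained in L^2, which follows from weak or strong convergence in
   L^2_1.  As N carries no linear structure, convergence is tested by composing
   with smooth functions on N. *)
Definition harmonic_map_flow (T : R) (u : R -> S -> N) : Prop :=
  [/\ L21_map (u 0),
      forall f : N -> R, smooth_function f ->
        area_integral setT (fun x => ((f (u t x) - f (u 0 x)) ^+ 2)%:E)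
          @[t --> 0^'+] --> 0%E,
      forall i : 'I_(ncharts S).+1,
        smooth_into [set ty : R * 'rV[R]_2 | 0 < ty.1 < T /\ img i ty.2]
          (fun ty => u ty.1 (psi i ty.2)) &
      forall t x, 0 < t < T ->
        'D_1 (fun s : R => phi (chart_at (u t x)) (u s x)) t = tension (u t) x].

Definition outer_scale (eps rho : R) (p : S) (u : S -> N) : R :=
  inf [set l : R | 0 <= l <= rho /\
    (ereal_sup [set energy u (annulus (r / 2) r p) | r in `]l, rho[] < eps%:E)%E].

End Maps.

(* Main.v *)
Require Import Defs.
From mathcomp Require Import all_boot all_order all_algebra.
From mathcomp Require Import ring lra.
From mathcomp Require Import all_classical all_reals all_analysis.
From mathcomp Require Import measurable_realfun.
Import Order.TTheory GRing.Theory Num.Theory.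
Import numFieldNormedType.Exports.
Local Open Scope classical_set_scope.
Local Open Scope ring_scope.
Set Implicit Arguments.
Unset Strict Implicit.
Unset Printing Implicit Defensive.


(** The energy of the flow in a small disc can concentrate at scale [r] only as
    fast as the stress-energy tensor allows.

    In a chart around [p], let [chi_r] be a cutoff function at scale [r], and let
    [G r t] be the integral of [chi_r] times the energy density ([local_energy]).
    Along the flow the time derivative of the energy density is the divergence of
    the momentum [<d_t u, d_b u>] minus a square ([flow_energy_time]), and, as
    [d_t u] is the tension field, the momentum is in turn the divergence of the
    stress-energy tensor [S] ([momentum_divergence]).  Two integrations by parts
    give
      [d/dt G r t <= C * r ^- 2 * (integral of |S| over a disc of radius 2 r)],
    which by the bound on the norm of [S] in [L^q] is at most
    [K r = C * r ^ (- 2 / q)] ([local_energy_growth]).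

    Hence [G r t + K r * (T - t)] does not increase in time, and its infimum over
    all [r] and [t] is nearly attained at some scale [r0]: up to a small error,
    [G r0 t - G r t <= K r * (T - t)] for all [r] and all [t] near [T]
    ([vanishing_gap]).  The difference of the two cutoff functions is positive on
    annuli between the two scales, so [G r0 t - G r t] dominates the energy of the
    annulus of geodesic radii [r / 2] and [r] ([annulus_energy_le]).  For
    [r >= D * (T - t) ^ (q / 2)] with [D] large, [K r * (T - t)] is small
    ([scale_choice]), so the energies of all these annuli are less than [eps],
    and the outer energy scale is at most [D * (T - t) ^ (q / 2)].

    The energy and the norms of [S] are defined by weak differentials, and by
    integrals over pieces of charts.  Almost everywhere the weak differential is
    the classical one ([du_classical]), a consequence of the fundamental lemma of
    the calculus of variations ([weakly_zero_ae]).  Integrals in different charts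
    are compared by the inequality
      [integral over F(A) of f <= 9 * integral over A of (f o F) * |det DF|]
    for smooth maps of the plane ([cov_le]); a universal constant suffices, since
    all estimates are up to constants.  The flow equation is transported between
    charts by Koszul's formula ([koszul]), which also expresses the pairing of the
    tension with [du] by derivatives of the pulled back metric alone
    ([flow_pairing]).  Geodesic balls are compared with coordinate squares by
    Lipschitz functions and straight segments ([annulus_square]). *)

(** * Differentiability and smooth functions *)

Section Differentiability.
Context {R : realType}.

Lemma segment_mvt {V : normedModType R} (f : V -> R) (x v : V) (s : R) :
  (forall t, `|t| <= `|s| -> derivable f (t *: v + x) v) ->
  exists2 t, `|t| <= `|s| & f (s *: v + x) - f x = s * 'D_v f (t *: v + x).
Proof.
move=> df; pose g (t : R) := f (t *: v + x).
have dg (t : R) : `|t| <= `|s| -> is_derive t 1 g ('D_v f (t *: v + x)).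
  move=> t01; suff E : (fun h : R => h^-1 *: (g (h *: (1 : R) + t) - g t)) =
      (fun h : R => h^-1 *: (f (h *: v + (t *: v + x)) - f (t *: v + x))).
    apply: DeriveDef; rewrite /derivable /derive /= E //; exact: df.
  apply/funext => h; rewrite /g; congr (_ *: (f _ - _)).
  by rewrite addrA -scalerDl; congr (_ *: _ + _); rewrite /GRing.scale/= mulr1.
have [s0|s0] := leP 0 s.
- have tP t : 0 <= t <= s -> `|t| <= `|s|.
    by move=> /andP[t0 ts]; rewrite !ger0_norm.
  have [] := @MVT_segment R g (fun t => 'D_v f (t *: v + x)) 0 s s0.
  + by move=> t; rewrite in_itv/= => /andP[t0 t1]; apply/dg/tP; rewrite !ltW.
  + by apply: derivable_within_continuous => t; rewrite in_itv/= => /tP/dg[].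
  move=> t; rewrite in_itv/= => /tP t01; rewrite /g scale0r add0r subr0 => ->.
  by exists t; rewrite // mulrC.
- have tP t : s <= t <= 0 -> `|t| <= `|s|.
    by move=> /andP[t0 ts]; rewrite !ler0_norm ?lerN2 // ltW.
  have [] := @MVT_segment R g (fun t => 'D_v f (t *: v + x)) s 0 (ltW s0).
  + by move=> t; rewrite in_itv/= => /andP[t0 t1]; apply/dg/tP; rewrite !ltW.
  + by apply: derivable_within_continuous => t; rewrite in_itv/= => /tP/dg[].
  move=> t; rewrite in_itv/= => /tP t01; rewrite /g scale0r add0r sub0r => E.
  by exists t; rewrite // -opprB E mulrN opprK mulrC.
Qed.

Lemma coord_le_norm n (v : 'rV[R]_n) j : `|v 0 j| <= `|v|.
Proof. by rewrite [leRHS]/Num.Def.normr/= mx_normrE; apply: (le_bigmax _ _ (0, j)). Qed.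

Lemma norm_rV_le n (v : 'rV[R]_n) (c : R) : 0 <= c ->
  (forall j, `|v 0 j| <= c) -> `|v| <= c.
Proof.
move=> c0 H; rewrite [leLHS]/Num.Def.normr/= mx_normrE; apply/bigmax_leP.
by split => // -[i j] _ /=; rewrite ord1.
Qed.

(** The differential is zero; [continuous_pd_differentiable] reduces to this case
    by subtracting the linear part. *)
Lemma differentiable_littleo {V W : normedModType R} (g : V -> W) (x : V) :
  (forall e : R, 0 < e ->
     \forall h \near (0 : V), `|g (h + x) - g x| <= e * `|h|) ->
  differentiable g x.
Proof.
move=> lo; have o : g \o shift x = cst (g x) + \0 +o_ 0 id.
  apply: (@eqaddoE R V W V _ _ _ (fun h => g (h + x) - g x)).
  rewrite littleoE // addr0; apply/funext => h /=.
  by rewrite !fctE/= addrC subrK.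
have d0 : 'd g x = 0 :> (V -> W).
  by apply/(@diff_unique _ _ _ _ \0) => //; exact: cst_continuous.
by apply/diff_locallyP; rewrite d0; split => //; exact: cst_continuous.
Qed.

(** Telescoping over the coordinates reduces the increment of [f] to its
    partial derivatives at nearby points, which are close to those at [x]. *)
Lemma continuous_pd_differentiable n (f : 'rV[R]_n -> R) (x : 'rV[R]_n) :
  (\near x, forall k : 'I_n, derivable f x (delta_mx 0 k)) ->
  (forall k, {for x, continuous (pd k f)}) ->
  differentiable f x.
Proof.
move=> df cf.
pose L (h : 'rV[R]_n) := \sum_(k < n) pd k f x * h 0 k.
have dL : differentiable (fun y => L y) x.
  rewrite /L (_ : (fun _ => _) = \sum_(k < n) (fun y : 'rV[R]_n => pd k f x *: (y 0 k : R))); last first.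
    by apply/funext => y; rewrite fct_sumE.
  apply: differentiable_sum => k.
  exact/differentiableZ/differentiable_coord.
pose g y := f y - L y.
suff dg : differentiable g x.
  rewrite (_ : f = g + L); first exact: differentiableD.
  by apply/funext => y; rewrite /g/= !fctE subrK.
have LD a b : L (a + b) = L a + L b.
  by rewrite /L -big_split/=; apply: eq_bigr => k _; rewrite mxE mulrDr.
have lo : forall e : R, 0 < e -> \forall h \near (0 : 'rV[R]_n), `|g (h + x) - g x| <= e * `|h|.
  move=> _/posnumP[e].
  have e1 : 0 < e%:num / (n%:R + 1) by rewrite divr_gt0 // ltr_wpDl.
  have : \forall y \near x, forall k : 'I_n, derivable f y (delta_mx 0 k) /\ `|pd k f y - pd k f x| <= e%:num / (n%:R + 1).
    apply: (@filter_forall _ 'I_n (fun k y => derivable f y (delta_mx 0 k) /\ `|pd k f y - pd k f x| <= e%:num / (n%:R + 1)) (nbhs x) _).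
    move=> k; near=> y; split; first by near: y; apply: filterS df => y; exact.
    near: y; have /cvgrPdist_le /(_ _ e1) := cf k.
    by apply: filterS => y; rewrite distrC.
  move=> /nbhs_ballP[d /= d0 bd].
  apply/nbhs_ballP; exists d => //= h; rewrite -ball_normE/= sub0r normrN => hd.
  pose hm (m : nat) : 'rV[R]_n := \row_j (if (j < m)%N then h 0 j else 0).
  have h0 : hm 0 = 0 by apply/rowP => j; rewrite !mxE.
  have hn : hm n = h by apply/rowP => j; rewrite !mxE ltn_ord.
  have hS (m : 'I_n) : hm m.+1 = h 0 m *: delta_mx 0 m + hm m.
    apply/rowP => j; rewrite !mxE eqxx/= ltnS leq_eqVlt -val_eqE/=.
    by case: (ltngtP j m) => /= jm; rewrite ?mulr0 ?mulr1 ?add0r ?addr0 //; congr (h 0 _); apply/val_inj.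
  have -> : g (h + x) - g x = \sum_(m < n) (f (hm m.+1 + x) - f (hm m + x) - pd m f x * h 0 m).
    rewrite sumrB -/(L h) -(big_mkord xpredT (fun m => f (hm m.+1 + x) - f (hm m + x))).
    rewrite telescope_sumr // h0 hn add0r /g LD; ring.
  apply: (@le_trans _ _ (\sum_(m < n) e%:num / (n%:R + 1) * `|h|)); last first.
    rewrite sumr_const card_ord -[leLHS]mulr_natr mulrAC ler_wpM2r // mulrAC ler_pdivrMr ?ltr_wpDl //.
    by rewrite ler_wpM2l // lerDl.
  apply: le_trans (ler_norm_sum _ _ _) _; apply: ler_sum => m _.
  have bdt t : `|t| <= `|h 0 m| -> ball x d (t *: delta_mx 0 m + (hm m + x)).
    move=> th; rewrite -ball_normE/= (le_lt_trans _ hd) //.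
    rewrite addrA opprD addrCA subrr addr0 normrN.
    apply: norm_rV_le => // j; rewrite !mxE eqxx/=.
    case: (ltngtP j m) => jm; rewrite -?val_eqE/= ?(ltn_eqF jm) ?(gtn_eqF jm) //= ?mulr0 ?add0r ?normr0 ?coord_le_norm //.
    by rewrite jm eqxx mulr1 addr0 (le_trans th) // coord_le_norm.
  rewrite hS -(addrA (_ *: _)).
  have [|t th ->] := @segment_mvt _ f (hm m + x) (delta_mx 0 m) (h 0 m).
    by move=> t /bdt/bd/(_ m)[].
  rewrite mulrC -mulrBl normrM ler_pM ?coord_le_norm //.
  by have [_] := bd _ (bdt _ th) m.
exact: differentiable_littleo.
Unshelve. all: by end_near. Qed.

End Differentiability.

Section SmoothCalculus.
Context {R : realType}.
Implicit Types V W : normedModType R.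

Lemma diter_rcons V W (vs : seq V) v (f : V -> W) :
  diter (rcons vs v) f = diter vs ('D_v f).
Proof. by rewrite /diter foldr_rcons. Qed.

Lemma diter_eq V W (A : set V) (f g : V -> W) vs :
  open A -> (forall x, A x -> f x = g x) ->
  forall x, A x -> diter vs f x = diter vs g x.
Proof.
move=> oA fg; elim: vs => [|v vs IH] x Ax; first exact: fg.
apply: near_eq_derive; have := open_nbhs_nbhs (conj oA Ax).
by apply: filterS => y; exact: IH.
Qed.

Lemma smooth_on_eq V W (A : set V) (f g : V -> W) :
  open A -> (forall x, A x -> f x = g x) -> smooth_on A f -> smooth_on A g.
Proof.
move=> oA fg sf vs x Ax; have [cf df] := sf vs x Ax.
have E : \near x, diter vs f x = diter vs g x.
  by have := open_nbhs_nbhs (conj oA Ax); apply: filterS => y; exact: diter_eq.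
split; last by move=> v; exact: near_eq_derivable (df v).
apply: (cvg_trans _ (_ : diter vs f @ x --> diter vs g x)); last first.
  by rewrite -(nbhs_singleton E).
by apply: near_eq_cvg; apply: filterS E => y.
Qed.

Lemma smooth_onW V W (A B : set V) (f : V -> W) :
  B `<=` A -> smooth_on A f -> smooth_on B f.
Proof. by move=> BA sf vs x /BA; exact: sf. Qed.

Lemma smooth_on_derive V W (A : set V) (f : V -> W) v :
  smooth_on A f -> smooth_on A ('D_v f).
Proof. by move=> sf vs x Ax; rewrite -diter_rcons; exact: sf. Qed.

Lemma smooth_on_continuous V W (A : set V) (f : V -> W) x :
  smooth_on A f -> A x -> {for x, continuous f}.
Proof. by move=> sf Ax; have [] := sf [::] x Ax. Qed.

Lemma smooth_on_derivable V W (A : set V) (f : V -> W) x v :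
  smooth_on A f -> A x -> derivable f x v.
Proof. by move=> sf Ax; have [_] := sf [::] x Ax; exact. Qed.

(** A class of functions stable under directional derivatives consists of
    smooth functions; all closure properties below are instances. *)
Lemma smooth_on_class V W (A : set V) (P : (V -> W) -> Prop) : open A ->
  (forall f x, P f -> A x -> {for x, continuous f}) ->
  (forall f v, P f -> exists2 g, P g & forall x, A x -> is_derive x v f (g x)) ->
  forall f, P f -> smooth_on A f.
Proof.
move=> oA Pc Pd f Pf vs; elim/last_ind: vs f Pf => [|vs v IH] f Pf x Ax.
  split; first exact: Pc.
  by move=> v; have [g _ /(_ _ Ax)[]] := Pd f v Pf.
have [g Pg fg] := Pd f v Pf; rewrite diter_rcons.
have E y : A y -> diter vs ('D_v f) y = diter vs g y.
  by apply: diter_eq oA _ _ => z Az; exact: (@derive_val _ _ _ _ _ _ _ (fg z Az)).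
have nE : \near x, diter vs g x = diter vs ('D_v f) x.
  by have := open_nbhs_nbhs (conj oA Ax); apply: filterS => y /E ->.
have [cg dg] := IH g Pg x Ax; split; last first.
  by move=> w; exact: near_eq_derivable (dg w).
apply: (cvg_trans _ (_ : diter vs g @ x --> diter vs ('D_v f) x)); last first.
  by rewrite -(nbhs_singleton nE).
by apply: near_eq_cvg; apply: filterS nE => y.
Qed.

Lemma smooth_on_differentiable n (A : set 'rV[R]_n) (f : 'rV[R]_n -> R) x :
  open A -> smooth_on A f -> A x -> differentiable f x.
Proof.
move=> oA sf Ax; apply: continuous_pd_differentiable; last first.
  by move=> k; exact: (smooth_on_continuous (smooth_on_derive _ sf) Ax).
have := open_nbhs_nbhs (conj oA Ax); apply: filterS => y Ay k.
exact: smooth_on_derivable sf Ay.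
Qed.

Lemma derivable_rVP V n (G : V -> 'rV[R]_n) x v :
  derivable G x v <-> forall k, derivable (fun z => G z 0 k) x v.
Proof.
split=> [/derivable_mxP H k|H]; first exact: H.
by apply/derivable_mxP => i k; rewrite ord1; exact: H.
Qed.

Lemma derive_coord V n (G : V -> 'rV[R]_n) x v k :
  derivable G x v -> ('D_v G x) 0 k = 'D_v (fun z => G z 0 k) x.
Proof. by move=> /derive_mx ->; rewrite mxE. Qed.

Lemma diff_coord n (f : 'rV[R]_n -> R) x h :
  differentiable f x -> 'd f x h = \sum_k pd k f x * h 0 k.
Proof.
move=> df; rewrite {1}(row_sum_delta h) linear_sum; apply: eq_bigr => k _.
by rewrite linearZ /pd deriveE // mulrC.
Qed.

Lemma derive_line V W (f : V -> W) x v :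
  'D_1 (fun h : R => f (h *: v + x)) 0 = 'D_v f x.
Proof.
suff E : (fun h : R => h^-1 *: (f ((h *: (1 : R) + 0) *: v + x) - f (0 *: v + x))) =
         (fun h => h^-1 *: (f (h *: v + x) - f x)) by rewrite /derive /= E.
apply/funext => h; rewrite scale0r add0r addr0.
by congr (_ *: (f (_ *: _ + _) - _)); rewrite /GRing.scale/= mulr1.
Qed.

Lemma chain_rule V n (F : 'rV[R]_n -> R) (G : V -> 'rV[R]_n) x v :
  differentiable F (G x) -> derivable G x v ->
  is_derive x v (F \o G) (\sum_k pd k F (G x) * 'D_v (fun z => G z 0 k) x).
Proof.
move=> dF dG; pose g (h : R) := G (h *: v + x).
have g0 : g 0 = G x by rewrite /g scale0r add0r.
have /derivable1P/derivable1_diffP dg := dG.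
have dFg : differentiable (F \o g) 0 by apply: differentiable_comp => //; rewrite g0.
apply: DeriveDef; first by apply/derivable1P/derivable1_diffP.
rewrite -derive_line -/(F \o g) deriveE // diff_comp ?g0 //= diff_coord //.
apply: eq_bigr => k _; congr (_ * _).
by rewrite -deriveE // derive_line derive_coord.
Qed.

Lemma chain_rule1 V (F : R -> R) (f : V -> R) x v :
  derivable F (f x) 1 -> derivable f x v ->
  is_derive x v (F \o f) ('D_1 F (f x) * 'D_v f x).
Proof.
move=> /derivable1_diffP dF df; pose g (h : R) := f (h *: v + x).
have g0 : g 0 = f x by rewrite /g scale0r add0r.
have /derivable1P/derivable1_diffP dg := df.
have dFg : differentiable (F \o g) 0 by apply: differentiable_comp => //; rewrite g0.
apply: DeriveDef; first by apply/derivable1P/derivable1_diffP.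
rewrite -derive_line -/(F \o g) -derive1E derive1_comp.
- by rewrite !derive1E g0 derive_line.
- exact/derivable1_diffP.
- by rewrite g0; exact/derivable1_diffP.
Qed.

End SmoothCalculus.

Section SmoothClosure.
Context {R : realType}.
Implicit Types V W : normedModType R.

Lemma continuous_coord V n (G : V -> 'rV[R]_n) k x :
  {for x, continuous G} -> {for x, continuous (fun z => G z 0 k)}.
Proof.
move=> cG; apply/cvgrPdist_le => e e0.
have /cvgrPdist_le /(_ _ e0) := cG; apply: filterS => z; apply: le_trans.
by have := coord_le_norm (G x - G z) k; rewrite !mxE.
Qed.

Lemma is_derive_coord V n (G : V -> 'rV[R]_n) k x v : derivable G x v ->
  is_derive x v (fun z => G z 0 k) (('D_v G x) 0 k).
Proof.
move=> dG; rewrite derive_coord; last exact: dG.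
apply: DeriveDef; last by [].
by move/derivable_rVP: dG => /(_ k).
Qed.

Lemma smooth_on_coord V n (A : set V) (G : V -> 'rV[R]_n) k : open A ->
  smooth_on A G -> smooth_on A (fun z => G z 0 k).
Proof.
move=> oA sG; apply: (@smooth_on_class _ V _ A (fun f : V -> R =>
  exists2 G : V -> 'rV[R]_n, smooth_on A G & f = fun z => G z 0 k)).
- exact: oA.
- move=> _ x [H sH ->] Ax; apply: continuous_coord.
  exact: smooth_on_continuous sH Ax.
- move=> _ v [H sH ->]; exists (fun z => ('D_v H z) 0 k).
    by exists ('D_v H); [exact: smooth_on_derive|].
  by move=> x Ax; apply: is_derive_coord; exact: smooth_on_derivable sH Ax.
- by exists G.
Qed.

Lemma continuous_rV V n (G : V -> 'rV[R]_n) x :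
  (forall k, {for x, continuous (fun z => G z 0 k)}) -> {for x, continuous G}.
Proof.
move=> cG; apply/cvgrPdist_le => e e0.
have : \forall z \near x, forall k : 'I_n, `|G x 0 k - G z 0 k| <= e.
  apply: (@filter_forall _ 'I_n (fun k z => `|G x 0 k - G z 0 k| <= e) (nbhs x) _).
  by move=> k; have /cvgrPdist_le := cG k; exact.
apply: filterS => z H; apply: norm_rV_le; first exact: ltW.
by move=> k; rewrite !mxE.
Qed.

Lemma smooth_on_rV V n (A : set V) (G : V -> 'rV[R]_n) : open A ->
  (forall k, smooth_on A (fun z => G z 0 k)) -> smooth_on A G.
Proof.
move=> oA; apply: (@smooth_on_class _ V _ A (fun G : V -> 'rV[R]_n =>
  forall k, smooth_on A (fun z => G z 0 k))) => //.
- move=> {}G x sG Ax; apply: continuous_rV => k.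
  exact: smooth_on_continuous (sG k) Ax.
- move=> {}G v sG; exists (fun z => \row_k 'D_v (fun z => G z 0 k) z).
    move=> k; apply: (@smooth_on_eq _ _ _ _ ('D_v (fun z => G z 0 k))) => //.
      by move=> x _; rewrite mxE.
    exact: smooth_on_derive.
  move=> x Ax; have dG : derivable G x v.
    by apply/derivable_rVP => k; exact: smooth_on_derivable (sG k) Ax.
  apply: DeriveDef; first exact: dG.
  by apply/rowP => k; rewrite mxE derive_coord.
Qed.

Lemma smooth_on_cst V W (A : set V) (c : W) : open A -> smooth_on A (cst c).
Proof.
move=> oA; apply: (@smooth_on_class _ V _ A (fun f => exists c, f = cst c)) => //.
- by move=> _ x [d ->] _; exact: cst_continuous.
- by move=> _ v [d ->]; exists (cst 0); [exists 0|move=> x _; exact: is_derive_cst].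
- by exists c.
Qed.

Section Algebra.
Context {V : normedModType R} (A : set V).

(** Closed under directional derivatives by the rules of calculus, because every
    constructor admits arbitrary smooth functions at its leaves; this is the class
    to which [smooth_on_class] is applied. *)
Inductive smooth_expr : (V -> R) -> Prop :=
| se_base f : smooth_on A f -> smooth_expr f
| se_add f g : smooth_expr f -> smooth_expr g -> smooth_expr (fun x => f x + g x)
| se_mul f g : smooth_expr f -> smooth_expr g -> smooth_expr (fun x => f x * g x)
| se_comp n (B : set 'rV[R]_n) F G : open B -> smooth_on B F ->
    (forall x, A x -> B (G x)) -> smooth_on A G -> smooth_expr (F \o G)
| se_comp1 (B : set R) (F : R -> R) f : open B -> smooth_on B F ->
    (forall x, A x -> B (f x)) -> smooth_on A f -> smooth_expr (F \o f).

Lemma smooth_expr_sum (I : finType) (f : I -> V -> R) : open A ->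
  (forall i, smooth_expr (f i)) -> smooth_expr (fun x => \sum_i f i x).
Proof.
move=> oA sf; have : forall s : seq I, smooth_expr (fun x => \sum_(i <- s) f i x).
  elim=> [|i s IH].
    rewrite (_ : (fun _ => _) = cst 0); last by apply/funext => x; rewrite big_nil.
    exact/se_base/smooth_on_cst.
  rewrite (_ : (fun _ => _) = fun x => f i x + \sum_(i <- s) f i x).
    exact: se_add.
  by apply/funext => x; rewrite big_cons.
exact.
Qed.

Lemma smooth_expr_smooth f : open A -> smooth_expr f -> smooth_on A f.
Proof.
move=> oA; apply: smooth_on_class => //.
- move=> {}f x sf Ax; elim: sf => {f}.
  + by move=> f sf; exact: smooth_on_continuous sf Ax.
  + by move=> f g _ cf _ cg; exact: continuousD.
  + by move=> f g _ cf _ cg; exact: continuousM.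
  + move=> n B F G oB sF AB sG; apply: continuous_comp.
      exact: smooth_on_continuous sG Ax.
    exact: smooth_on_continuous sF (AB _ Ax).
  + move=> B F G oB sF AB sG; apply: continuous_comp.
      exact: smooth_on_continuous sG Ax.
    exact: smooth_on_continuous sF (AB _ Ax).
- move=> {}f v; elim=> {f}.
  + move=> f sf; exists ('D_v f); first exact/se_base/smooth_on_derive.
    by move=> x Ax; apply/derivableP; exact: smooth_on_derivable sf Ax.
  + move=> f g _ [f' sf' df] _ [g' sg' dg]; exists (fun x => f' x + g' x).
      exact: se_add.
    by move=> x Ax; have := df x Ax; have := dg x Ax; move=> ? ?; exact: is_deriveD.
  + move=> f g sf [f' sf' df] sg [g' sg' dg].
    exists (fun x => f x * g' x + g x * f' x).
      by apply: se_add; apply: se_mul.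
    by move=> x Ax; have := df x Ax; have := dg x Ax; move=> ? ?; exact: is_deriveM.
  + move=> n B F G oB sF AB sG.
    exists (fun x => \sum_k (pd k F \o G) x * 'D_v (fun z => G z 0 k) x).
      apply: smooth_expr_sum => // k; apply: se_mul.
        exact: (@se_comp n B (pd k F) G oB (smooth_on_derive _ sF) AB sG).
      exact/se_base/smooth_on_derive/smooth_on_coord.
    move=> x Ax; apply: chain_rule.
      exact: smooth_on_differentiable oB sF (AB _ Ax).
    exact: smooth_on_derivable sG Ax.
  + move=> B F G oB sF AB sG.
    exists (fun x => ('D_1 F \o G) x * 'D_v G x).
      apply: se_mul; last exact/se_base/smooth_on_derive.
      exact: (@se_comp1 B ('D_1 F) G oB (smooth_on_derive _ sF) AB sG).
    move=> x Ax; apply: chain_rule1.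
      exact: smooth_on_derivable sF (AB _ Ax).
    exact: smooth_on_derivable sG Ax.
Qed.

Hypothesis oA : open A.

Lemma smooth_onD (f g : V -> R) : smooth_on A f -> smooth_on A g ->
  smooth_on A (fun x => f x + g x : R).
Proof. by move=> sf sg; apply: smooth_expr_smooth => //; apply: se_add; apply: se_base. Qed.

Lemma smooth_onM (f g : V -> R) : smooth_on A f -> smooth_on A g ->
  smooth_on A (fun x => f x * g x : R).
Proof. by move=> sf sg; apply: smooth_expr_smooth => //; apply: se_mul; apply: se_base. Qed.

Lemma smooth_onZ c (f : V -> R) : smooth_on A f -> smooth_on A (fun x => c * f x : R).
Proof. by move=> sf; exact: (smooth_onM (smooth_on_cst _ oA) sf). Qed.

Lemma smooth_onN (f : V -> R) : smooth_on A f -> smooth_on A (fun x => - f x : R).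
Proof.
move=> sf; rewrite (_ : (fun _ => _) = fun x => -1 * f x); first exact: smooth_onZ.
by apply/funext => x; rewrite mulN1r.
Qed.

Lemma smooth_onB (f g : V -> R) : smooth_on A f -> smooth_on A g ->
  smooth_on A (fun x => f x - g x : R).
Proof. by move=> sf sg; exact: smooth_onD sf (smooth_onN sg). Qed.

Lemma smooth_on_sum (I : finType) (f : I -> V -> R) :
  (forall i, smooth_on A (f i)) -> smooth_on A (fun x => \sum_i f i x).
Proof.
move=> sf; apply: smooth_expr_smooth => //; apply: smooth_expr_sum => // i.
exact: se_base.
Qed.

Lemma smooth_on_comp n (B : set 'rV[R]_n) (F : 'rV[R]_n -> R) (G : V -> 'rV[R]_n) :
  open B -> smooth_on B F -> (forall x, A x -> B (G x)) -> smooth_on A G ->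
  smooth_on A (F \o G).
Proof. by move=> oB sF AB sG; exact: (smooth_expr_smooth oA (se_comp oB sF AB sG)). Qed.

Lemma smooth_on_comp1 (B : set R) (F : R -> R) (f : V -> R) :
  open B -> smooth_on B F -> (forall x, A x -> B (f x)) -> smooth_on A f ->
  smooth_on A (F \o f).
Proof. by move=> oB sF AB sf; exact: (smooth_expr_smooth oA (se_comp1 oB sF AB sf)). Qed.

Lemma smooth_on_comp_rV n m (B : set 'rV[R]_n) (F : 'rV[R]_n -> 'rV[R]_m)
    (G : V -> 'rV[R]_n) :
  open B -> smooth_on B F -> (forall x, A x -> B (G x)) -> smooth_on A G ->
  smooth_on A (F \o G).
Proof.
move=> oB sF AB sG; apply: smooth_on_rV => // k.
exact: (smooth_on_comp oB (smooth_on_coord k oB sF)).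
Qed.

End Algebra.

Lemma smooth_on_linear V (A : set V) (l : V -> R) : open A -> continuous l ->
  (forall a x y, l (a *: x + y) = a * l x + l y) -> smooth_on A l.
Proof.
move=> oA cl ll; apply: (@smooth_on_class _ V _ A (fun f : V -> R => smooth_on A f \/ f = l)) => //.
- by move=> f x [sf /(smooth_on_continuous sf)//|->] _; exact: cl.
- move=> f v [sf|->].
    exists ('D_v f); first by left; exact: smooth_on_derive.
    by move=> x Ax; apply/derivableP; exact: smooth_on_derivable sf Ax.
  exists (cst (l v)); first by left; exact: smooth_on_cst.
  move=> x Ax; have E : (fun h : R => h^-1 *: (l (h *: v + x) - l x)) @ 0^' --> l v.
    apply: (@cvg_trans _ ((fun=> l v) @ (0 : R)^')); last exact: cvg_cst.
    apply: near_eq_cvg; near=> h.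
    rewrite ll addrK /GRing.scale/= mulKf //.
    by near: h; exact: nbhs_dnbhs_neq.
  by apply: DeriveDef; [apply/cvg_ex; exists (l v)|exact: cvg_lim E].
- by right.
Unshelve. all: by end_near. Qed.

(** The mixed second difference of [f] is an increment in either order, so the
    mean value theorem applied twice gives both mixed derivatives. *)
Lemma schwarz V (A : set V) (f : V -> R) v w x : open A -> smooth_on A f ->
  A x -> 'D_v ('D_w f) x = 'D_w ('D_v f) x.
Proof.
move=> oA sf Ax.
pose S (h : R) (a b : V) := f (h *: b + (h *: a + x)) - f (h *: a + x)
   - (f (h *: b + x) - f x).
have key (a b : V) (e : R) : 0 < e -> \forall h \near (0 : R)^'+,
    `|h^-1 * h^-1 * S h a b - 'D_b ('D_a f) x| <= e.
  move=> e0; have sD := smooth_on_derive b (smooth_on_derive a sf).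
  have /cvgrPdist_le /(_ _ e0) nD := smooth_on_continuous sD Ax.
  have : nbhs x ((fun t => `|'D_b ('D_a f) x - 'D_b ('D_a f) t| <= e) `&` A).
    by apply: filterI; [exact: nD|exact: (open_nbhs_nbhs (conj oA Ax))].
  move=> /nbhs_ballP[d /= d0 bd].
  pose M := `|a| + `|b| + 1.
  have M0 : 0 < M by rewrite ltr_wpDl ?addr_ge0.
  have bdt (s t h : R) : `|h| <= d / (M * 2) -> `|s| <= `|h| -> `|t| <= `|h| ->
      ball x d (s *: a + (t *: b + x)).
    move=> hd sh th; rewrite -ball_normE/= addrA opprD addrCA subrr addr0 normrN.
    apply: (@le_lt_trans _ _ (`|h| * M)).
      rewrite (le_trans (ler_normD _ _)) // !normrZ /M mulrDr mulr1 ler_wpDr //.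
      by rewrite mulrDr lerD // ler_wpM2r.
    apply: (@le_lt_trans _ _ (d / (M * 2) * M)); first by rewrite ler_wpM2r // ltW.
    have -> : d / (M * 2) * M = d / 2 by field; rewrite gt_eqF.
    by rewrite ltr_pdivrMr // ltr_pMr // ltr1n.
  near=> h.
  have h0 : 0 < h by [].
  have hd : `|h| <= d / (M * 2).
    by rewrite gtr0_norm //; near: h; apply: nbhs_right_le; rewrite divr_gt0 // mulr_gt0.
  have bdA s t : `|s| <= `|h| -> `|t| <= `|h| -> A (s *: a + (t *: b + x)).
    by move=> sh th; have [_] := bd _ (bdt s t h hd sh th).
  pose g (z : V) := f (h *: b + z) - f z.
  have gE s : `|s| <= `|h| -> is_derive (s *: a + x) a g
      ('D_a f (h *: b + (s *: a + x)) - 'D_a f (s *: a + x)).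
    move=> sh; have A1 : A (h *: b + (s *: a + x)).
      by rewrite addrCA; apply: bdA.
    have A2 : A (s *: a + x).
      by have := bdA s 0 sh; rewrite scale0r add0r normr0; apply.
    have d2 : is_derive (s *: a + x) a f ('D_a f (s *: a + x)).
      by apply/derivableP; exact: smooth_on_derivable sf A2.
    have d1 : is_derive (s *: a + x) a (fun z => f (h *: b + z)) ('D_a f (h *: b + (s *: a + x))).
      have D1 : derivable f (h *: b + (s *: a + x)) a.
        exact: smooth_on_derivable sf A1.
      have E : (fun r : R => r^-1 *: (f (h *: b + (r *: a + (s *: a + x))) - f (h *: b + (s *: a + x)))) =
        (fun r : R => r^-1 *: (f (r *: a + (h *: b + (s *: a + x))) - f (h *: b + (s *: a + x)))).
        by apply/funext => r; rewrite [h *: b + (r *: a + _)]addrCA.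
      by apply: DeriveDef; rewrite /derivable /derive /= E.
    exact: is_deriveB.
  have [|s sh] := @segment_mvt _ _ g x a h.
    by move=> s /gE[].
  have [_ ->] := gE s sh.
  have [|t th ->] := @segment_mvt _ _ ('D_a f) (s *: a + x) b h.
    move=> t th; apply: smooth_on_derivable (smooth_on_derive a sf) _.
    by rewrite addrCA; exact: bdA.
  move=> gg; have -> : S h a b = h * (h * 'D_b ('D_a f) (t *: b + (s *: a + x))).
    by rewrite -gg /g /S.
  set X := 'D_b ('D_a f) (t *: b + _).
  have -> : h^-1 * h^-1 * (h * (h * X)) = X by field; rewrite gt_eqF.
  rewrite distrC /X (addrCA (t *: b)).
  exact: (bd _ (bdt s t h hd sh th)).1.
have SC h a b : S h a b = S h b a by rewrite /S [h *: a + (_ + _)]addrCA; ring.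
apply/eqP; rewrite -subr_eq0 -normr_le0; apply/ler_addgt0Pl => e e0.
rewrite addr0; have e2 : 0 < e / 2 by rewrite divr_gt0.
have [h [hvw hwv]] := filter_ex (filterI (key v w _ e2) (key w v _ e2)).
rewrite (splitr e) -(subrKA (h^-1 * h^-1 * S h w v)) (le_trans (ler_normD _ _)) //.
rewrite lerD; [by []|by rewrite distrC; exact: hwv|by rewrite (SC h w v); exact: hvw].
Unshelve. all: by end_near. Qed.

End SmoothClosure.

(** * Explicit bump functions *)

Section SmoothExamples.
Context {R : realType}.

Lemma smooth_on_local {V W : normedModType R} (A : set V) (f : V -> W) :
  (forall x, A x -> exists2 B, B x & smooth_on B f) -> smooth_on A f.
Proof. by move=> H vs x /H[B Bx sf]; exact: sf. Qed.

Lemma smooth_is_derive {V W : normedModType R} (A : set V) (f : V -> W) x v :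
  smooth_on A f -> A x -> is_derive x v f ('D_v f x).
Proof. by move=> sf Ax; apply/derivableP; exact: smooth_on_derivable sf Ax. Qed.

Lemma is_derive_real (f : R -> R) (x v d : R) :
  is_derive x 1 f d -> is_derive x v f (d * v).
Proof.
move=> [df fd]; have := @chain_rule1 R _ f id x v df (@derivable_id R _ x v).
by rewrite fd derive_id.
Qed.

(** In one variable differentiation along 1 suffices, up to constant factors. *)
Lemma smooth_on_class1 (A : set R) (P : (R -> R) -> Prop) : open A ->
  (forall f, P f -> exists2 g, P g & forall x : R, A x -> is_derive x 1 f (g x)) ->
  (forall f c, P f -> P (fun x => f x * c)) ->
  forall f, P f -> smooth_on A f.
Proof.
move=> oA Pd Pc; apply: smooth_on_class => //.
  move=> f x /Pd[g _ fg] Ax; apply: differentiable_continuous.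
  by apply/derivable1_diffP; have [] := fg x Ax.
move=> f v /Pd[g Pg fg]; exists (fun x => g x * v); first exact: Pc.
by move=> x Ax; apply: is_derive_real; exact: fg.
Qed.

Lemma smooth_on_powR (a : R) : smooth_on [set x : R | 0 < x] (fun x : R => x `^ a).
Proof.
have oA : open [set x : R | 0 < x] by exact: open_gt.
have := @smooth_on_class1 _ (fun f => exists c b, f = fun x => x `^ b * c) oA.
move=> /(_ _ _ (fun x => x `^ a)); apply.
- move=> _ [c [b ->]]; exists (fun x => x `^ (b - 1) * (b * c)); first by do 2 eexists.
  move=> x x0; have xi : x \in `]0, +oo[ by rewrite in_itv/= andbT.
  have dx : is_derive x 1 (fun x => x `^ b) (b * x `^ (b - 1)).
    by apply: DeriveDef; [exact: derivable_powR|rewrite -derive1E powR_derive1].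
  have := @is_deriveM _ _ _ (cst c) x 1 _ _ dx (is_derive_cst c x 1).
  rewrite scaler0 add0r => /= H; apply: is_derive_eq H _.
  by rewrite /GRing.scale/=; ring.
- by move=> _ d [c [b ->]]; exists (c * d), b; apply/funext => x; rewrite mulrA.
- by exists 1, a; apply/funext => x; rewrite mulr1.
Qed.

Lemma smooth_on_expR : smooth_on [set: R] (@expR R).
Proof.
have := @smooth_on_class1 _ (fun f => exists c, f = fun x : R => expR x * c) openT.
move=> /(_ _ _ (@expR R)); apply.
- move=> _ [c ->]; exists (fun x => expR x * c); first by eexists.
  move=> x _; have := @is_deriveM _ _ _ (cst c) x 1 _ _ (is_derive_expR x) (is_derive_cst c x 1).
  rewrite scaler0 add0r => /= H; apply: is_derive_eq H _.
  by rewrite /GRing.scale/= mulrC.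
- by move=> _ d [c ->]; exists (c * d); apply/funext => x; rewrite mulrA.
- by exists 1; apply/funext => x; rewrite mulr1.
Qed.

(** The functions [x ^- k * expR (- x^-1)] extended by 0 to [x <= 0]: their
    linear span is stable under differentiation and consists of functions that
    are flat at 0. *)
Definition flat (k : nat) (x : R) : R :=
  if 0 < x then x^-1 ^+ k * expR (- x^-1) else 0.

Lemma flat_ge0 k x : 0 <= flat k x.
Proof.
rewrite /flat; case: ifP => // x0.
by rewrite mulr_ge0 ?expR_ge0 // exprn_ge0 // invr_ge0 ltW.
Qed.

Lemma flat_gt0 k x : 0 < x -> 0 < flat k x.
Proof. by move=> x0; rewrite /flat x0 mulr_gt0 ?expR_gt0 // exprn_gt0 // invr_gt0. Qed.

Lemma flat_le0 k x : x <= 0 -> flat k x = 0.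
Proof. by rewrite /flat ltNge => ->. Qed.

Lemma flat_bound k x : flat k x <= k.+1`!%:R * `|x|.
Proof.
rewrite /flat; case: ifP => x0; last by rewrite mulr_ge0.
rewrite gtr0_norm // expRN ler_pdivrMr ?expR_gt0 //.
have y0 : 0 <= x^-1 by rewrite invr_ge0 ltW.
apply: (@le_trans _ _ (k.+1`!%:R * x * (x^-1 ^+ k.+1 / k.+1`!%:R))); last first.
  rewrite ler_wpM2l //; first by rewrite mulr_ge0 // ltW.
  by apply: le_trans (expR_ge1Dxn k y0); rewrite lerDr.
rewrite exprS le_eqVlt; apply/orP; left; apply/eqP; field.
by rewrite (gt_eqF x0) andbT gt_eqF // ltr0n fact_gt0.
Qed.

Lemma flat_derive k (x : R) :
  is_derive x 1 (flat k) (flat k.+2 x - k%:R * flat k.+1 x).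
Proof.
have [x0|x0|<-] := ltgtP 0 x.
- pose f (y : R) := y^-1 ^+ k * expR (- y^-1).
  have nf : \forall y \near x, f y = flat k y.
    have := open_nbhs_nbhs (conj (@open_gt R 0) x0).
    by apply: filterS => y; rewrite /f /flat /= => ->.
  apply: (near_eq_is_derive nf).
  have xn0 : x != 0 by rewrite gt_eqF.
  have dV : is_derive x 1 (fun y : R => y^-1) (- x ^- 2).
    have dI := @derivable_id R R x 1.
    apply: DeriveDef; first exact: (@derivableV R R id x 1 xn0 dI).
    by rewrite (@deriveV R R id x 1 xn0 dI) derive_id /GRing.scale/= mulr1.
  have d1 : is_derive x 1 (fun y : R => y^-1 ^+ k) (k%:R * x^-1 ^+ k.-1 * - x ^- 2).
    have := @is_deriveX _ _ _ k x 1 _ dV.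
    have -> : (fun y : R => y^-1) ^+ k = fun y => y^-1 ^+ k by apply/funext => y; rewrite exprfctE.
    by move=> H; apply: is_derive_eq H _; rewrite /GRing.scale/= mulr_natl.
  have d2 : is_derive x 1 (fun y : R => expR (- y^-1)) (expR (- x^-1) * x ^- 2).
    have dN : is_derive x 1 (fun y : R => - y^-1) (x ^- 2).
      by have := @is_deriveN _ _ _ _ x 1 _ dV; rewrite opprK.
    have [D1 D2] := dN.
    have := @chain_rule1 R _ (@expR R) (fun y : R => - y^-1) x 1 (@derivable_expR R _) D1.
    by have [_ ->] := is_derive_expR (- x^-1); rewrite D2.
  have := @is_deriveM _ _ _ _ x 1 _ _ d1 d2.
  move=> H; apply: is_derive_eq H _; rewrite /GRing.scale/= /flat x0.
  case: k {f nf d1} => [|k]; first by rewrite !expr0 -exprVn; ring.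
  by rewrite -!exprVn !exprS; ring.
- have nf : \forall y \near x, cst 0 y = flat k y.
    have := open_nbhs_nbhs (conj (@open_lt R 0) x0).
    by apply: filterS => y; rewrite /flat /= => y0; rewrite ltNge ltW.
  rewrite !flat_le0 ?(ltW x0) // mulr0 subr0.
  exact: (near_eq_is_derive nf (is_derive_cst _ _ _)).
rewrite !flat_le0 // mulr0 subr0.
have H : (fun h : R => h^-1 *: (flat k (h *: (1 : R) + 0) - flat k 0)) @ 0^' --> (0 : R).
  apply/cvgrPdist_le => e e0; near=> h.
  rewrite (flat_le0 _ (lexx 0)) addr0 subr0 sub0r normrN /GRing.scale/= mulr1.
  have -> : h^-1 * flat k h = flat k.+1 h.
    by rewrite /flat; case: ifP; rewrite ?mulr0 // exprS mulrA.
  rewrite ger0_norm ?flat_ge0 // (le_trans (flat_bound _ _)) //.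
  rewrite -ler_pdivlMl ?ltr0n ?fact_gt0 //; near: h; apply: dnbhs0_le.
  by rewrite mulr_gt0 // invr_gt0 ltr0n fact_gt0.
by apply: DeriveDef; [apply/cvg_ex; exists 0|exact: cvg_lim H].
Unshelve. all: by end_near. Qed.

Inductive flat_comb : (R -> R) -> Prop :=
| flat_comb_base k : flat_comb (flat k)
| flat_comb_add f g : flat_comb f -> flat_comb g -> flat_comb (fun x => f x + g x)
| flat_comb_scale f c : flat_comb f -> flat_comb (fun x => f x * c).

Lemma smooth_on_flat k : smooth_on [set: R] (flat k).
Proof.
apply: (@smooth_on_class1 _ flat_comb openT); last exact: flat_comb_base.
  move=> f; elim=> {f k} [k|f g _ [f' Pf' df] _ [g' Pg' dg]|f c _ [f' Pf' df]].
  - exists (fun x => flat k.+2 x + flat k.+1 x * - k%:R).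
      by apply: flat_comb_add; [|apply: flat_comb_scale]; exact: flat_comb_base.
    by move=> x _; apply: is_derive_eq (flat_derive k x) _; ring.
  - exists (fun x => f' x + g' x); first exact: flat_comb_add.
    by move=> x _; have := df x I; have := dg x I => ? ?; exact: is_deriveD.
  - exists (fun x => f' x * c); first exact: flat_comb_scale.
    move=> x _; have dfx := df x I.
    have := @is_deriveM _ _ _ (cst c) x 1 _ _ dfx (is_derive_cst c x 1).
    rewrite scaler0 add0r => /= H; apply: is_derive_eq H _.
    by rewrite /GRing.scale/= mulrC.
by move=> f c; exact: flat_comb_scale.
Qed.

Lemma smooth_on_coordinate n (A : set 'rV[R]_n) k : open A ->
  smooth_on A (fun y : 'rV[R]_n => y 0 k : R).
Proof.
move=> oA; apply: smooth_on_linear => //; first by move=> x; exact: coord_continuous.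
by move=> a x y; rewrite !mxE.
Qed.

(** Positive exactly on the Euclidean ball of radius 2; the norm on row vectors is
    the maximum norm. *)
Definition bump {n} (z : 'rV[R]_n) : R := flat 0 (4 - \sum_k z 0 k * z 0 k).

Lemma smooth_on_bump n : smooth_on [set: 'rV[R]_n] (@bump n).
Proof.
apply: (@smooth_on_comp1 _ _ _ openT setT (flat 0)) => //; first exact: openT.
  exact: smooth_on_flat.
apply: smooth_onB; [exact: openT|exact/smooth_on_cst/openT|].
apply: smooth_on_sum; first exact: openT.
by move=> k; apply: smooth_onM; first exact: openT; apply/smooth_on_coordinate/openT.
Qed.

Definition cutoff {n} (c : 'rV[R]_n) (r : R) (y : 'rV[R]_n) : R :=
  bump (r^-1 *: (y - c)).

Lemma smooth_on_cutoff n (c : 'rV[R]_n) r : smooth_on [set: 'rV[R]_n] (cutoff c r).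
Proof.
apply: (@smooth_on_comp _ _ _ openT _ setT (@bump n)) => //; first exact: openT.
  exact: smooth_on_bump.
apply: smooth_on_rV; first exact: openT.
move=> k; rewrite (_ : (fun _ => _) = fun y : 'rV[R]_n => r^-1 * (y 0 k - c 0 k)); last first.
  by apply/funext => y; rewrite !mxE.
apply: smooth_onZ; first exact: openT.
apply: smooth_onB; [exact: openT| |exact/smooth_on_cst/openT].
exact/smooth_on_coordinate/openT.
Qed.

Lemma cutoff_ge0 n (c : 'rV[R]_n) r y : 0 <= cutoff c r y.
Proof. exact: flat_ge0. Qed.

Lemma cutoff_center n (c : 'rV[R]_n) r : 0 < cutoff c r c.
Proof.
rewrite /cutoff /bump subrr scaler0 big1 ?subr0 ?flat_gt0 // => k _.
by rewrite mxE mulr0.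
Qed.

Lemma cutoff_support n (c : 'rV[R]_n) r y : 0 < r ->
  2 * r <= `|y - c| -> cutoff c r y = 0.
Proof.
move=> r0 yr; rewrite /cutoff /bump flat_le0 // subr_le0.
have [k yk] : exists k, 2 * r <= `|(y - c) 0 k|.
  apply/not_existsP => H; have : `|y - c| < 2 * r; last by rewrite ltNge yr.
  rewrite [ltLHS]/Num.Def.normr/= mx_normrE; apply: bigmax_lt; first by rewrite mulr_gt0.
  by move=> [i j] _ /=; rewrite ord1 ltNge; apply/negP; exact: H.
rewrite (bigD1 k) //= ler_wpDr //.
  by apply: sumr_ge0 => j _; rewrite -expr2 sqr_ge0.
have zk : 2 <= `|(r^-1 *: (y - c)) 0 k|.
  by rewrite mxE normrM gtr0_norm ?invr_gt0 // mulrC ler_pdivlMr.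
rewrite -expr2 -real_normK ?num_real // expr2.
by apply: le_trans (ler_pM _ _ zk zk); rewrite // -natrM.
Qed.

Lemma flat0_homo (x y : R) : x <= y -> flat 0 x <= flat 0 y.
Proof.
have [x0|x0 xy] := leP x 0; first by rewrite flat_le0 // flat_ge0.
have y0 := lt_le_trans x0 xy.
by rewrite /flat x0 y0 !expr0 !mul1r ler_expR lerN2 lef_pV2.
Qed.

Lemma cutoff_homo n (c : 'rV[R]_n) (r s : R) y : 0 < r -> r <= s ->
  cutoff c r y <= cutoff c s y.
Proof.
move=> r0 rs; apply: flat0_homo; rewrite lerD2l lerN2; apply: ler_sum => k _.
have s0 := lt_le_trans r0 rs; rewrite !mxE -!expr2 !exprMn ler_wpM2r ?sqr_ge0 //.
by apply: lerXn2r; rewrite ?nnegrE ?invr_ge0 ?(ltW r0) ?(ltW s0) // lef_pV2.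
Qed.

Lemma cutoff_ge (c : 'rV[R]_2) (r : R) y : 0 < r -> `|y - c| <= r ->
  flat 0 2 <= cutoff c r y.
Proof.
move=> r0 yr; apply: flat0_homo; rewrite lerBrDr -lerBrDl.
have -> : (4 : R) - 2 = \sum_(k < 2) 1 by rewrite big_ord_recl big_ord1; ring.
apply: ler_sum => k _; rewrite -expr2 -real_normK ?num_real // expr_le1 // mxE.
rewrite normrM gtr0_norm ?invr_gt0 // mulrC ler_pdivrMr // mul1r.
exact: le_trans (coord_le_norm _ _) yr.
Qed.

Lemma derive_affine n (F : 'rV[R]_n -> R) (a : R) c v y :
  smooth_on [set: 'rV[R]_n] F ->
  'D_v (fun y => F (a *: (y - c))) y = a * 'D_v F (a *: (y - c)).
Proof.
move=> sF; have dF := smooth_on_differentiable openT sF (I : setT (a *: (y - c))).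
have dc k : is_derive y v (fun y : 'rV[R]_n => (a *: (y - c)) 0 k) (a * v 0 k).
  have E : (fun y : 'rV[R]_n => (a *: (y - c)) 0 k) = (fun y => a *: (y 0 k - c 0 k : R)).
    by apply/funext => z; rewrite !mxE.
  have dk : is_derive y v (fun y : 'rV[R]_n => y 0 k : R) (v 0 k).
    by have := is_derive_coord k (@derivable_id _ _ y v); rewrite derive_id.
  rewrite E; have := @is_deriveB _ _ _ _ _ y v _ _ dk (is_derive_cst (c 0 k : R) y v).
  rewrite subr0 => H; exact: is_deriveZ.
have dG : derivable (fun y : 'rV[R]_n => a *: (y - c)) y v.
  by apply/derivable_rVP => k; have [] := dc k.
have [_ D] := @chain_rule R _ n F (fun y => a *: (y - c)) y v dF dG.
apply: (etrans D).
rewrite (deriveE _ dF) diff_coord // mulr_sumr; apply: eq_bigr => k _.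
by have [_ ->] := dc k; rewrite mulrCA.
Qed.

Lemma bounded_support n (g : 'rV[R]_n -> R) (M : R) : continuous g ->
  (forall z, M < `|z| -> g z = 0) -> exists2 C, 0 <= C & forall z, `|g z| <= C.
Proof.
move=> cg g0; have cK : compact [set z : 'rV[R]_n | `|z| <= M].
  apply: bounded_closed_compact.
    by exists M; split; [exact: num_real|move=> r Mr z /= /le_trans; apply; exact: ltW].
  apply: closed_comp (@closed_le _ M) => z _; exact: norm_continuous.
have [[z0 zM]|K0] := pselect (exists z : 'rV[R]_n, `|z| <= M); last first.
  exists 0 => // z; rewrite g0 ?normr0 //; apply: contra_notT K0.
  by rewrite -leNgt => zM; exists z.
have [||c _ cmax] := @compact_EVT_max _ _ (fun z => `|g z|) _ _ cK.
- by exists z0.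
- apply: continuous_subspaceT => z; apply: continuous_comp; first exact: cg.
  exact: norm_continuous.
exists `|g c| => // z; have [zM'|/g0 ->] := leP `|z| M; last by rewrite normr0.
by apply: cmax; rewrite inE.
Qed.

Lemma derive_support n (g : 'rV[R]_n -> R) (M : R) v :
  (forall z, M < `|z| -> g z = 0) -> forall z, M < `|z| -> 'D_v g z = 0.
Proof.
move=> g0 z zM; rewrite -(@derive_cst R _ R^o 0 z v).
apply: near_eq_derive; have oM : open [set z : 'rV[R]_n | M < `|z|].
  by apply: open_comp (@open_gt _ M) => y _; exact: norm_continuous.
by have := open_nbhs_nbhs (conj oM zM); apply: filterS => y /= /g0.
Qed.

(** By scaling, from the bounds for the fixed function [bump]. *)
Lemma cutoff_pd_bound n : exists2 C, 0 <= C &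
  forall (c : 'rV[R]_n) (r : R) y (a b : 'I_n), 0 < r ->
    `|pd a (cutoff c r) y| <= C / r /\ `|pd b (pd a (cutoff c r)) y| <= C / r ^+ 2.
Proof.
have b0 (z : 'rV[R]_n) : 2 < `|z| -> bump z = 0.
  move=> z2; have := @cutoff_support n 0 1 z ltr01.
  by rewrite /cutoff subr0 invr1 scale1r mulr1; apply; exact: ltW.
have s1 v := smooth_on_derive v (@smooth_on_bump n).
have s2 w v := smooth_on_derive w (s1 v).
have B1 (a : 'I_n) : exists2 C, 0 <= C & forall z, `|pd a (@bump n) z| <= C.
  apply: (@bounded_support _ _ 2) => [z|]; first exact: smooth_on_continuous (s1 _) _.
  exact: derive_support.
have B2 (a b : 'I_n) : exists2 C, 0 <= C & forall z, `|pd b (pd a (@bump n)) z| <= C.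
  apply: (@bounded_support _ _ 2) => [z|]; first exact: smooth_on_continuous (s2 _ _) _.
  exact/derive_support/derive_support.
have [C1 C1P] := choice (fun a => let: ex_intro2 C C0 H := B1 a in ex_intro (fun C => 0 <= C /\ _) C (conj C0 H)).
have [C2 C2P] := choice (fun ab : 'I_n * 'I_n => let: ex_intro2 C C0 H := B2 ab.1 ab.2 in ex_intro (fun C => 0 <= C /\ _) C (conj C0 H)).
exists (\sum_a C1 a + \sum_ab C2 ab).
  by rewrite addr_ge0 ?sumr_ge0 // => i _; [have [] := C1P i|have [] := C2P i].
move=> c r y a b r0.
have E1 z : pd a (cutoff c r) z = r^-1 * pd a (@bump n) (r^-1 *: (z - c)).
  by rewrite /pd derive_affine //; exact: smooth_on_bump.
have S1 : C1 a <= \sum_a C1 a.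
  by rewrite (bigD1 a) //= lerDl sumr_ge0 // => i _; have [] := C1P i.
have S2 : C2 (a, b) <= \sum_ab C2 ab.
  by rewrite (bigD1 (a, b)) //= lerDl sumr_ge0 // => i _; have [] := C2P i.
have P1 : 0 <= \sum_a C1 a by rewrite sumr_ge0 // => i _; have [] := C1P i.
have P2 : 0 <= \sum_ab C2 ab by rewrite sumr_ge0 // => i _; have [] := C2P i.
split.
  rewrite E1 normrM gtr0_norm ?invr_gt0 // mulrC ler_wpM2r ?invr_ge0 ?(ltW r0) //.
  by have [_ /(_ (r^-1 *: (y - c))) H] := C1P a; apply: le_trans H _; lra.
rewrite (funext E1 : pd a (cutoff c r) = _).
have sA : smooth_on [set: 'rV[R]_n] (fun y => 'D_(delta_mx 0 a) (@bump n) (r^-1 *: (y - c))).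
  apply: (@smooth_on_comp _ _ _ openT _ setT ('D_(delta_mx 0 a) (@bump n)) (fun y => r^-1 *: (y - c))).
  - exact: openT.
  - exact: s1.
  - by [].
  - apply: smooth_on_rV; first exact: openT.
    move=> k; rewrite (_ : (fun _ => _) = fun y : 'rV[R]_n => r^-1 * (y 0 k - c 0 k)); last first.
      by apply/funext => z; rewrite !mxE.
    apply: smooth_onZ; first exact: openT.
    apply: smooth_onB; [exact: openT| |exact/smooth_on_cst/openT].
    exact/smooth_on_coordinate/openT.
have -> : pd b (fun z => r^-1 * pd a (@bump n) (r^-1 *: (z - c))) y =
    r^-1 * pd b (fun z => pd a (@bump n) (r^-1 *: (z - c))) y.
  by apply: deriveZ; exact: smooth_on_derivable sA _.
rewrite {1}/pd (derive_affine r^-1 c _ y (s1 _)) mulrA normrM gtr0_norm ?mulr_gt0 ?invr_gt0 //.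
rewrite mulrC expr2 invfM ler_wpM2r ?mulr_ge0 ?invr_ge0 ?(ltW r0) //.
by have [_ /(_ (r^-1 *: (y - c))) H] := C2P (a, b); apply: le_trans H _; lra.
Qed.


(** Increases to the indicator of the open box as [m] tends to infinity. *)
Definition box_bump (a b c d : R) (m : R) (y : 'rV[R]_2) : R :=
  1 - expR (- (m * (flat 0 (y 0 0 - a) * flat 0 (b - y 0 0) *
                    (flat 0 (y 0 1 - c) * flat 0 (d - y 0 1))))).

Lemma smooth_on_box_bump a b c d m : smooth_on [set: 'rV[R]_2] (box_bump a b c d m).
Proof.
have oT : open [set: 'rV[R]_2] by exact: openT.
have sc e : smooth_on [set: 'rV[R]_2] (cst (e : R)) by exact: smooth_on_cst.
have sk (k : 'I_2) : smooth_on [set: 'rV[R]_2] (fun y => y 0 k : R).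
  exact: smooth_on_coordinate.
have sf f : smooth_on [set: 'rV[R]_2] f -> smooth_on [set: 'rV[R]_2] (flat 0 \o f).
  by move=> sf; apply: (smooth_on_comp1 oT openT (smooth_on_flat 0)) sf => x _.
have sN : smooth_on [set: 'rV[R]_2] (fun y => - (m * (flat 0 (y 0 0 - a) *
    flat 0 (b - y 0 0) * (flat 0 (y 0 1 - c) * flat 0 (d - y 0 1))))); last first.
  apply: (smooth_onB oT (sc 1)).
  exact: (smooth_on_comp1 oT openT smooth_on_expR (fun _ _ => I) sN).
apply: (smooth_onN oT); apply: (smooth_onZ oT); apply: (smooth_onM oT).
  apply: (smooth_onM oT).
    exact: (sf _ (smooth_onB oT (sk 0) (sc a))).
  exact: (sf _ (smooth_onB oT (sc b) (sk 0))).
apply: (smooth_onM oT).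
  exact: (sf _ (smooth_onB oT (sk 1) (sc c))).
exact: (sf _ (smooth_onB oT (sc d) (sk 1))).
Qed.

Lemma box_bump_out a b c d m (y : 'rV[R]_2) :
  ~ [/\ a < y 0 0, y 0 0 < b, c < y 0 1 & y 0 1 < d] -> box_bump a b c d m y = 0.
Proof.
move=> H; rewrite /box_bump; set p := flat 0 _ * _ * _.
suff -> : p = 0 by rewrite mulr0 oppr0 expR0 subrr.
rewrite /p; have [y1|y1] := leP (y 0 0 - a) 0; first by rewrite (flat_le0 _ y1) !mul0r.
have [y2|y2] := leP (b - y 0 0) 0; first by rewrite (flat_le0 _ y2) mulr0 mul0r.
have [y3|y3] := leP (y 0 1 - c) 0; first by rewrite (flat_le0 _ y3) mul0r mulr0.
have [y4|y4] := leP (d - y 0 1) 0; first by rewrite (flat_le0 _ y4) !mulr0.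
by exfalso; apply: H; rewrite -subr_gt0 y1 -subr_gt0 y2 -subr_gt0 y3 -subr_gt0 y4.
Qed.

Lemma box_bump_itv a b c d m (y : 'rV[R]_2) : 0 <= m ->
  0 <= box_bump a b c d m y <= 1.
Proof.
move=> m0; rewrite /box_bump; set p := flat 0 _ * _ * _.
have p0 : 0 <= p by rewrite !mulr_ge0 ?flat_ge0.
rewrite subr_ge0 expR_le1 oppr_le0 mulr_ge0 //= gerBl expR_ge0 //.
Qed.

Lemma box_bump_cvg a b c d (y : 'rV[R]_2) :
  [/\ a < y 0 0, y 0 0 < b, c < y 0 1 & y 0 1 < d] ->
  box_bump a b c d m%:R y @[m --> \oo] --> (1 : R).
Proof.
move=> [y1 y2 y3 y4]; rewrite /box_bump; set p := flat 0 _ * _ * _.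
have p0 : 0 < p by rewrite !mulr_gt0 // flat_gt0 // subr_gt0.
apply/cvgrPdist_le => e e0; near=> m.
have m0 : 0 < m%:R :> R by near: m; exact: nbhs_infty_gtr.
rewrite opprB addrC subrK ger0_norm ?expR_ge0 // expRN.
have mp : 0 < m%:R * p by rewrite mulr_gt0.
apply: (@le_trans _ _ (m%:R * p)^-1).
  rewrite lef_pV2 ?posrE ?expR_gt0 // (le_trans _ (expR_ge1Dx _)) //.
  by rewrite lerDr.
rewrite -[leRHS]invrK lef_pV2 ?posrE ?invr_gt0 // -ler_pdivrMr //.
by near: m; exact: nbhs_infty_ger.
Unshelve. all: by end_near. Qed.

End SmoothExamples.

(** * Overlaps of charts and extension by zero *)

Section OverlapsAndExtension.
Context {R : realType}.

Lemma overlap_open n (M : compact_manifold R n) (i j : 'I_(ncharts M).+1) :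
  open (phi i @` (dom i `&` dom j)).
Proof.
rewrite openE => y [x [xi xj] <-]; rewrite /interior.
have oi : nbhs (phi i x) (phi i @` dom i).
  by apply: open_nbhs_nbhs; split; [exact: img_open|exists x].
have cj : nbhs (phi i x) (psi i @^-1` dom j).
  apply: (psi_continuous xi); apply: open_nbhs_nbhs; split; first exact: dom_open.
  by rewrite phiK.
apply: filterS (filterI oi cj) => _ [[z zi <-] /=]; rewrite phiK // => zj.
by exists z.
Qed.

Lemma img_psi n (M : compact_manifold R n) (i : 'I_(ncharts M).+1) y :
  img i y -> dom i (psi i y : M) /\ phi i (psi i y : M) = y.
Proof. by move=> [x xi <-]; rewrite phiK. Qed.

Lemma psi_cts n (M : compact_manifold R n) (i : 'I_(ncharts M).+1) y :
  img i y -> {for y, continuous (psi i : _ -> M)}.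
Proof. by move=> [x xi <-]; exact: psi_continuous. Qed.

Lemma psi_compact n (M : compact_manifold R n) (i : 'I_(ncharts M).+1) K :
  compact K -> K `<=` img i -> compact ((psi i : _ -> M) @` K).
Proof.
move=> cK Ki; apply: continuous_compact => //; apply: continuous_in_subspaceT => y.
by rewrite inE => /Ki; exact: psi_cts.
Qed.

Definition extend0 n (M : compact_manifold R n) (i : 'I_(ncharts M).+1)
    (F : 'rV[R]_n -> R) (x : M) : R :=
  if `[< dom i x >] then F (phi i x) else 0.

Lemma extend0E n (M : compact_manifold R n) (i : 'I_(ncharts M).+1) F (x : M) :
  dom i x -> extend0 i F x = F (phi i x).
Proof. by move=> xi; rewrite /extend0; case: asboolP. Qed.

(** The complement of the image of [K] under the chart is open because [M] is
    Hausdorff, and the extension vanishes there. *)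
Lemma smooth_extend0 n (M : compact_manifold R n) (i : 'I_(ncharts M).+1) F K :
  smooth_on [set: 'rV[R]_n] F -> compact K -> K `<=` img i ->
  (forall y, ~ K y -> F y = 0) -> smooth_function (extend0 i F : M -> R).
Proof.
move=> sF cK Ki F0 j; apply: smooth_on_local => y yj.
have [xj yE] := img_psi yj; set x := psi j y in xj yE.
have [xi|xi] := pselect (dom i x).
  exists (phi j @` (dom j `&` dom i)); first by exists x.
  apply: (@smooth_on_eq _ _ _ _ (F \o (phi i \o psi j))).
  - exact: overlap_open.
  - by move=> _ [z [zj zi] <-] /=; rewrite phiK // extend0E.
  - have sT : smooth_on (phi j @` (dom j `&` dom i)) (phi i \o psi j).
      exact: transition_smooth.
    have oO : open (phi j @` (dom j `&` dom i)) by exact: overlap_open.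
    have H := smooth_on_comp oO openT sF (fun _ _ => I) sT.
    exact: H.
have cL := psi_compact cK Ki.
have oL : open (~` ((psi i : _ -> M) @` K)).
  by apply: closed_openC; apply: compact_closed cL; exact: manifold_hausdorff.
have xL : (~` ((psi i : _ -> M) @` K)) x.
  by move=> [z /Ki/img_psi[zi _] zx]; apply: xi; rewrite -zx.
have nL : nbhs y (fun z => (~` ((psi i : _ -> M) @` K)) (psi j z)).
  exact: (psi_cts yj (open_nbhs_nbhs (conj oL xL))).
have {}nL : nbhs y (fun z => extend0 i F (psi j z : M) = 0).
  apply: filterS nL => z /= zL; rewrite /extend0; case: asboolP => // zi.
  by apply: F0 => Kz; apply: zL; exists (phi i (psi j z : M)) => //; rewrite phiK.
move: nL => /nbhs_interior nL.
exists (interior (fun z => extend0 i F (psi j z : M) = 0)); first exact: nbhs_singleton nL.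
apply: (@smooth_on_eq _ _ _ _ (cst 0)).
- exact: open_interior.
- by move=> z /interior_subset.
- by apply: smooth_on_cst; exact: open_interior.
Qed.

End OverlapsAndExtension.

(** * Integration in the plane *)

Section LowerIntegral.
Context d (T : measurableType d) (R : realType) (mu : {measure set T -> \bar R}).
Import HBNNSimple.

(** Integrals of nonnegative functions are suprema over the simple functions
    below them, so that monotonicity, even up to a null set, needs no
    measurability. *)
Lemma le_integral_off_null (D E Z : set T) (f g : T -> \bar R) :
  measurable Z -> mu Z = 0%E ->
  (forall x, D x -> (0 <= f x)%E) -> (forall x, E x -> (0 <= g x)%E) ->
  (forall x, D x -> ~ Z x -> E x /\ (f x <= g x)%E) ->
  (\int[mu]_(x in D) f x <= \int[mu]_(x in E) g x)%E.
Proof.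
move=> mZ Z0 f0 g0 fg; rewrite !ge0_integralE //.
apply: ub_ereal_sup => _ [h hf <-].
have mZC : measurable (~` Z) by exact: measurableC.
pose h' := proj_nnsfun h mZC.
have h'E x : h' x = if x \in ~` Z then h x else 0.
  by rewrite /h' /= mindicE; case: ifP; rewrite ?mulr1 ?mulr0.
have -> : sintegral mu h = sintegral mu h'.
  rewrite -!integralT_nnsfun; apply: ge0_ae_eq_integral => //.
  - exact/measurable_EFinP.
  - exact/measurable_EFinP.
  - by move=> x _; rewrite lee_fin.
  - by move=> x _; rewrite lee_fin.
  exists Z; split => // x /= H; apply: contrapT => Zx; apply: H => _.
  by rewrite mindicE mem_set // mulr1.
apply: ereal_sup_ubound; exists h'; last by []; move=> x; rewrite (h'E x).
rewrite /patch; case: ifPn => [/set_mem Zx|_]; last first.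
  by case: ifPn => // /set_mem /g0.
have := hf x; rewrite /patch; case: ifPn => [/set_mem Dx|_] hx.
  by have [Ex fgx] := fg x Dx Zx; rewrite mem_set //; exact: le_trans fgx.
apply: le_trans hx _; case: ifPn => // /set_mem; exact: g0.
Qed.

Lemma le_integral_ge0 (D E : set T) (f g : T -> \bar R) :
  (forall x, D x -> (0 <= f x)%E) -> (forall x, E x -> (0 <= g x)%E) ->
  (forall x, D x -> E x /\ (f x <= g x)%E) ->
  (\int[mu]_(x in D) f x <= \int[mu]_(x in E) g x)%E.
Proof.
by move=> f0 g0 fg; apply: (@le_integral_off_null _ _ set0) => // x Dx _; exact: fg.
Qed.

(** Dynkin's pi-lambda argument. *)
Lemma pi_integral0 d' (T' : measurableType d') (f : T -> T') (D : set T)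
    (w : T -> \bar R) (G : set (set T')) :
  measurable_fun setT f -> measurable D -> mu.-integrable D w ->
  setI_closed G -> G `<=` measurable -> (\int[mu]_(x in D) w x = 0)%E ->
  (forall E, G E -> (\int[mu]_(x in D `&` f @^-1` E) w x = 0)%E) ->
  forall E, <<s G >> E -> (\int[mu]_(x in D `&` f @^-1` E) w x = 0)%E.
Proof.
move=> mf mD iw GI Gm w0 GE.
have mfE E : measurable E -> measurable (D `&` f @^-1` E).
  by move=> mE; apply: measurableI => //; rewrite -[_ @^-1` _]setTI; exact: mf.
have mw := measurable_int mu iw.
suff : <<s G >> `<=` [set E | measurable E /\ (\int[mu]_(x in D `&` f @^-1` E) w x = 0)%E].
  by move=> H E /H[].
rewrite -setI_closed_g_dynkin_g_sigma_algebra //; apply: smallest_sub; last first.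
  by move=> E GEx; split; [exact: Gm|exact: GE].
split.
- by split; [exact: measurableT|rewrite preimage_setT setIT].
- move=> E [mE E0]; split; first exact: measurableC.
  have := w0; have {1}-> : D = (D `&` f @^-1` E) `|` (D `&` f @^-1` (~` E)).
    by rewrite -setIUr -preimage_setU setUv preimage_setT setIT.
  rewrite integral_setU //=.
  + by rewrite E0 add0e.
  + exact: mfE.
  + by apply: mfE; exact: measurableC.
  + by rewrite -setIUr -preimage_setU setUv preimage_setT setIT.
  + by apply/disj_setPS => x [[_ Ex] [_ /=]].
- move=> F tF FE; split; first by apply: bigcup_measurable => k _; have [] := FE k.
  rewrite preimage_bigcup setI_bigcupr integral_bigcup.
  + by apply: eseries0 => k _ _; have [] := FE k.
  + move=> i j _ _ [x [[_ Fi] [_ Fj]]]; apply: tF => //; exists (f x); split => //.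
  + by move=> k; apply: mfE; have [] := FE k.
  + apply: integrableS iw => //.
      by apply: bigcup_measurable => k _; apply: mfE; have [] := FE k.
    by move=> x [k _ []].
Qed.

(** Dominated convergence, for a density against bounded multipliers. *)
Lemma cvg_integral0 (D : set T) (w g : T -> R) (g_ : nat -> T -> R) :
  measurable D -> mu.-integrable D (EFin \o w) ->
  (forall n, measurable_fun D (g_ n)) -> measurable_fun D g ->
  (forall n x, D x -> `|g_ n x| <= 1) ->
  (forall x, D x -> g_ n x @[n --> \oo] --> g x) ->
  (forall n, (\int[mu]_(x in D) (w x * g_ n x)%:E = 0)%E) ->
  (\int[mu]_(x in D) (w x * g x)%:E = 0)%E.
Proof.
move=> mD iw mg_ mg g1 gg g0.
have mw : measurable_fun D w by apply/measurable_EFinP; exact: (measurable_int mu iw).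
have [|||||_ _] := @dominated_convergence _ _ _ mu _ mD
  (fun n x => (w x * g_ n x)%:E) (fun x => (w x * g x)%:E) (fun x => `|(w x)%:E|%E).
- by move=> n; apply/measurable_EFinP; exact: measurable_funM.
- by apply/measurable_EFinP; exact: measurable_funM.
- apply: aeW => x Dx; apply: cvg_EFin; first exact: nearW.
  by apply: (@cvgM _ _ _ _ (fun=> w x) (g_ ^~ x)); [exact: cvg_cst|exact: gg].
- exact: integrable_abse.
- apply: aeW => x n Dx; by rewrite abse_EFin lee_fin normrM ler_piMr // g1.
under eq_fun do rewrite g0.
by move=> /cvg_unique; apply; [exact: ereal_hausdorff|exact: cvg_cst].
Qed.

End LowerIntegral.

Section Plane.
Context {R : realType}.
Notation leb2 := (@leb2 R).
Notation RR := (measurableTypeR R * measurableTypeR R)%type.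

Lemma pt0 z : pt z 0 0 = z.1 :> R. Proof. by rewrite mxE. Qed.
Lemma pt1 z : pt z 0 1 = z.2 :> R. Proof. by rewrite mxE. Qed.

Lemma ord2P (P : 'I_2 -> Prop) : P 0 -> P 1 -> forall j, P j.
Proof.
by move=> P0 P1 [[|[|//]] j]; [move: P0|move: P1]; congr P; exact/val_inj.
Qed.

Lemma norm_lt_2 (y : 'rV[R]_2) (r : R) :
  (`|y| < r) = (`|y 0 0| < r) && (`|y 0 1| < r).
Proof.
apply/idP/andP => [yr|[y0 y1]]; first by split; exact: le_lt_trans (coord_le_norm _ _) yr.
rewrite [ltLHS]/Num.Def.normr/= mx_normrE; apply: bigmax_lt; first exact: le_lt_trans y0.
by move=> [i j] _ /=; rewrite ord1; move: j; exact: ord2P.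
Qed.

Lemma norm_le_2 (y : 'rV[R]_2) (r : R) :
  (`|y| <= r) = (`|y 0 0| <= r) && (`|y 0 1| <= r).
Proof.
apply/idP/andP => [yr|[y0 y1]]; first by split; exact: le_trans (coord_le_norm _ _) yr.
apply: norm_rV_le; first exact: le_trans y0.
exact: ord2P.
Qed.

(** Centers at rational points and radii among the [1 / (k + 1)] suffice. *)
Lemma rational_balls (A : set 'rV[R]_2) : open A ->
  exists c : nat -> 'rV[R]_2, exists r : nat -> R, (forall m, 0 < r m) /\
    forall y, A y -> exists m, `|y - c m| < r m /\
      forall z, `|z - c m| <= r m -> A z.
Proof.
move=> oA; pose e (m : nat) : rat * rat * nat := odflt (0, 0, 0%N) (unpickle m).
pose c m : 'rV[R]_2 := pt (ratr (e m).1.1, ratr (e m).1.2).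
pose r m : R := ((e m).2.+1%:R)^-1.
exists c, r; split => [m|y Ay]; first by rewrite invr_gt0.
have /nbhs_ballP[s /= s0 sA] := open_nbhs_nbhs (conj oA Ay).
have [k ks] : exists k : nat, k.+1%:R^-1 < s / 2.
  have s2 : 0 < s / 2 by rewrite divr_gt0.
  by have [k _ /(_ k (leqnn k))] := near_infty_natSinv_lt (PosNum s2); exists k.
have k0 : 0 < k.+1%:R^-1 :> R by rewrite invr_gt0.
have rq (x : R) : exists q : rat, `|x - ratr q| < k.+1%:R^-1.
  have [q] := @rat_in_itvoo R (x - k.+1%:R^-1) (x + k.+1%:R^-1) ltac:(by rewrite ltrD2l gtrN).
  rewrite in_itv/= => /andP[q1 q2]; exists q.
  by rewrite ltr_distlC q1.
have [q0 H0] := rq (y 0 0); have [q1 H1] := rq (y 0 1).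
exists (pickle (q0, q1, k)); rewrite /c /r /e pickleK /=.
have H : `|y - pt (ratr q0, ratr q1)| < k.+1%:R^-1.
  by rewrite norm_lt_2 !mxE /= H0 H1.
split => // z zc; apply: sA; rewrite -ball_normE/=.
rewrite -(subrKA (pt (ratr q0, ratr q1))) (le_lt_trans (ler_normD _ _)) //.
by rewrite [X in _ + X]distrC (splitr s) ltrD // ?(lt_trans H) // (le_lt_trans zc).
Qed.

Lemma measurable_square (c : 'rV[R]_2) r :
  measurable (pt @^-1` [set y : 'rV[R]_2 | `|y - c| < r] : set RR).
Proof.
rewrite (_ : _ @^-1` _ = ball (c 0 0) r `*` ball (c 0 1) r).
  by apply: measurableX; exact: measurable_ball.
apply/seteqP; split => z /=; rewrite norm_lt_2 !mxE/= -!ball_normE/= ![`|_ 0 _ - _|]distrC.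
  by move=> /andP.
by move=> [? ?]; apply/andP.
Qed.

Lemma measurable_open2 (A : set 'rV[R]_2) : open A -> measurable (pt @^-1` A : set RR).
Proof.
move=> oA; have [c [r [r0 cr]]] := rational_balls oA.
pose P m := forall z, `|z - c m| <= r m -> A z.
rewrite (_ : _ @^-1` _ = \bigcup_m
  (if `[< P m >] then pt @^-1` [set y : 'rV[R]_2 | `|y - c m| < r m] else set0)).
  apply: bigcup_measurable => m _; case: asboolP => _; first exact: measurable_square.
  exact: measurable0.
apply/seteqP; split => [z /= /cr[m [zm mP]]|z [m _]].
  by exists m => //; case: asboolP.
by case: asboolP => // mP /= zm; apply: mP; exact: ltW.
Qed.

Lemma measurable_closed2 (A : set 'rV[R]_2) : closed A -> measurable (pt @^-1` A : set RR).
Proof.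
move=> /closed_openC/measurable_open2/measurableC.
by rewrite -preimage_setC setCK.
Qed.

Lemma compact_closed_rV n (K : set 'rV[R]_n) : compact K -> closed K.
Proof. by apply: compact_closed; exact: norm_hausdorff. Qed.

Lemma continuous_measurable2 (A : set 'rV[R]_2) (w : 'rV[R]_2 -> R) : open A ->
  (forall y, A y -> {for y, continuous w}) ->
  measurable_fun (pt @^-1` A : set RR) (w \o pt).
Proof.
move=> oA cw; apply: (measurability (@RGenOInfty.G R)); first exact: RGenOInfty.measurableE.
move=> _ [_ [a ->] <-].
rewrite (_ : _ `&` _ = pt @^-1` (A `&` w @^-1` `]a, +oo[)) //.
apply: measurable_open2; rewrite openE => y [Ay wy].
apply: filterI; first exact: open_nbhs_nbhs.
by apply: (cw _ Ay); apply: open_nbhs_nbhs; split => //; exact: interval_open.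
Qed.

Lemma leb2_box a b c d : a <= b -> c <= d ->
  leb2 (`[a, b] `*` `[c, d] : set RR) = ((b - a) * (d - c))%:E.
Proof.
move=> ab cd; transitivity (lebesgue_measure (`[a, b] : set R) *
  lebesgue_measure (`[c, d] : set R))%E; first exact: product_measure1E.
rewrite !lebesgue_measure_itv /= !lte_fin.
case: (ltgtP a b) ab => // [ab _|-> _]; last by rewrite mul0e subrr mul0r.
have [->|cd'] := eqVneq c d; first by rewrite ltxx mule0 subrr mulr0.
by rewrite lt_neqAle cd' cd.
Qed.

Lemma compact_sub_square n (K : set 'rV[R]_n) : compact K ->
  exists2 M, 0 < M & forall y, K y -> `|y| <= M.
Proof.
move=> /compact_bounded[M [Mr HM]]; exists (`|M| + 1); first by rewrite ltr_wpDl.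
by move=> y Ky; apply: (HM (`|M| + 1)) => //; rewrite (le_lt_trans (ler_norm _)) // ltrDl.
Qed.

Lemma compact_leb2 (K : set 'rV[R]_2) : compact K -> (leb2 (pt @^-1` K) < +oo)%E.
Proof.
move=> cK; have [M M0 KM] := compact_sub_square cK.
apply: (@le_lt_trans _ _ (leb2 (`[- M, M] `*` `[- M, M]))).
  apply: le_measure; rewrite ?inE.
  - by apply: measurable_closed2; exact: compact_closed_rV.
  - by apply: measurableX.
  - move=> z /= /KM; rewrite norm_le_2 pt0 pt1 !ler_norml.
    by rewrite !in_itv => /andP[].
by rewrite leb2_box ?ltry // lerNl; lra.
Qed.

Lemma continuous_integrable2 (A K : set 'rV[R]_2) (w : 'rV[R]_2 -> R) :
  open A -> compact K -> K `<=` A -> (forall y, A y -> {for y, continuous w}) ->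
  leb2.-integrable (pt @^-1` K) (EFin \o (w \o pt)).
Proof.
move=> oA cK KA cw; have mK := measurable_closed2 (compact_closed_rV cK).
have mA := measurable_open2 oA.
apply: measurable_bounded_integrable => //; first exact: compact_leb2.
  by apply: measurable_funS (continuous_measurable2 oA cw) => // z /KA.
have cwK : {within K, continuous w}.
  by apply: continuous_in_subspaceT => y; rewrite inE => /KA; exact: cw.
have [M M0 wM] : exists2 M, 0 < M & forall y, K y -> `|w y| <= M.
  have := compact_bounded (continuous_compact cwK cK).
  move=> [M [Mr HM]]; exists (`|M| + 1); first by rewrite ltr_wpDl.
  move=> y Ky; apply: (HM (`|M| + 1)); last by exists y.
  by rewrite (le_lt_trans (ler_norm _)) // ltrDl.
exists M; split; first exact: num_real.
by move=> N MN z /= Kz; apply: le_trans (ltW MN); exact: wM.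
Qed.

Lemma compact_square n (c : 'rV[R]_n) (r : R) : compact [set y | `|y - c| <= r].
Proof.
apply: bounded_closed_compact.
  exists (`|c| + r); split; first exact: num_real.
  move=> s Ms z /= zK; apply: le_trans (ltW Ms); rewrite -[z](subrK c) addrC.
  by apply: le_trans (ler_normD _ _) _; rewrite lerD2l.
have cN : continuous (fun y : 'rV[R]_n => `|y - c|).
  move=> z; apply: continuous_comp; last exact: norm_continuous.
  exact: (cvgB cvg_id (cvg_cst _)).
by apply: closed_comp (@closed_le _ r) => z _; exact: cN.
Qed.

Lemma continuous_supp_integrable (M : R) (w : 'rV[R]_2 -> R) : continuous w ->
  (forall y, M < `|y| -> w y = 0) -> leb2.-integrable setT (EFin \o (w \o pt)).
Proof.
move=> cw w0; pose K := [set y : 'rV[R]_2 | `|y| <= M].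
have cK : compact K.
  rewrite (_ : K = [set y | `|y - 0| <= M]); first exact: compact_square.
  by apply/seteqP; split => y; rewrite /K /= subr0.
have iK : leb2.-integrable (pt @^-1` K) (EFin \o (w \o pt)).
  by apply: (@continuous_integrable2 setT K) => //; [exact: openT|move=> y _; exact: cw].
have mK := measurable_closed2 (compact_closed_rV cK).
rewrite (_ : EFin \o (w \o pt) = (EFin \o (w \o pt)) \_ (pt @^-1` K)).
  exact: (integrable_mkcond _ mK).1 iK.
apply/funext => z; rewrite /patch /=; case: ifPn => // /negP zK.
by rewrite w0 // ltNge; apply/negP => zM; apply: zK; rewrite inE.
Qed.

Lemma pt_line0 (x y : R) (h : R) : pt (h + x, y) = h *: delta_mx 0 0 + pt (x, y).
Proof.
apply/rowP; apply: ord2P; rewrite !mxE /=; first by rewrite mulr1.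
by rewrite mulr0 add0r.
Qed.

Lemma pt_line1 (x y : R) (h : R) : pt (x, h + y) = h *: delta_mx 0 1 + pt (x, y).
Proof.
apply/rowP; apply: ord2P; rewrite !mxE /=; last by rewrite mulr1.
by rewrite mulr0 add0r.
Qed.

Lemma integral_line0 (f df : R -> R) (M : R) : 0 < M ->
  (forall x : R, is_derive x 1 f (df x)) -> continuous df ->
  (forall x, M < `|x| -> f x = 0) -> (forall x, M < `|x| -> df x = 0) ->
  (\int[lebesgue_measure]_x (df x)%:E = 0)%E.
Proof.
move=> M0 dff cdf f0 df0.
pose I : set R := `[- (M + 1), M + 1]%classic.
have -> : (\int[lebesgue_measure]_x (df x)%:E =
           \int[lebesgue_measure]_(x in I) (df x)%:E)%E.
  rewrite [RHS]integral_mkcond; apply: eq_integral => x _; rewrite /patch.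
  case: ifPn => // /negP xM; rewrite df0 // ltNge; apply/negP => xM'; apply: xM.
  by rewrite inE /I /= in_itv /= -ler_norml (le_trans xM') // lerDl.
have cf : continuous f.
  by move=> x; apply/differentiable_continuous/derivable1_diffP; have [] := dff x.
rewrite /I (@continuous_FTC2 _ df f).
- rewrite !f0 ?subee // ?normrN gtr0_norm ?ltrDl //; lra.
- lra.
- exact: continuous_subspaceT.
- split => [x _|//|]; first by have [] := dff x.
    by apply: cvg_at_right_filter; exact: cf.
  by apply: cvg_at_left_filter; exact: cf.
- by move=> x _; rewrite derive1E; have [_ ->] := dff x.
Qed.

(** Fubini reduces this to [integral_line0] on the lines parallel to an axis. *)
Lemma integral_pd (F : 'rV[R]_2 -> R) (M : R) (a : 'I_2) : 0 < M ->
  (forall y, is_derive y (delta_mx 0 a) F (pd a F y)) -> continuous (pd a F) ->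
  (forall y, M < `|y| -> F y = 0) -> (forall y, M < `|y| -> pd a F y = 0) ->
  (\int[leb2]_z (pd a F (pt z))%:E = 0)%E.
Proof.
move=> M0 dF cF F0 dF0; have iF := continuous_supp_integrable cF dF0.
have cpt0 (y : R) : continuous (fun x : R => pt (x, y)).
  move=> x; apply: continuous_rV; apply: ord2P.
    by rewrite (_ : (fun _ => _) = id); [exact: cvg_id|apply/funext => z; rewrite pt0].
  by rewrite (_ : (fun _ => _) = cst y); [exact: cst_continuous|apply/funext => z; rewrite pt1].
have cpt1 (x : R) : continuous (fun y : R => pt (x, y)).
  move=> y; apply: continuous_rV; apply: ord2P.
    by rewrite (_ : (fun _ => _) = cst x); [exact: cst_continuous|apply/funext => z; rewrite pt0].
  by rewrite (_ : (fun _ => _) = id); [exact: cvg_id|apply/funext => z; rewrite pt1].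
have n0 (x y : R) : `|x| <= `|pt (x, y)| by have := coord_le_norm (pt (x, y)) 0; rewrite mxE.
have n1 (x y : R) : `|y| <= `|pt (x, y)| by have := coord_le_norm (pt (x, y)) 1; rewrite mxE.
move: a dF cF dF0 iF; apply: ord2P => dF cF dF0 iF.
- rewrite -[LHS](integral21_prod_meas1 iF); apply: integral0_eq => y _.
  rewrite /fubini_G; apply: (@integral_line0 (fun x => F (pt (x, y))) _ M) => //.
  + move=> x; have [D1 D2] := dF (pt (x, y)).
    have E : (fun h : R => h^-1 *: (F (pt (h *: (1 : R) + x, y)) - F (pt (x, y)))) =
        (fun h => h^-1 *: (F (h *: delta_mx 0 0 + pt (x, y)) - F (pt (x, y)))).
      by apply/funext => h; rewrite -pt_line0 /GRing.scale/= mulr1.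
    by apply: DeriveDef; rewrite /derivable /derive /= E.
  + have H : continuous (pd 0 F \o (fun x : R => pt (x, y))).
      by move=> x; apply: continuous_comp; [exact: cpt0|exact: cF].
    exact: H.
  + by move=> x xM; apply: F0; exact: lt_le_trans (n0 x y).
  + by move=> x xM; apply: dF0; exact: lt_le_trans (n0 x y).
- rewrite -[LHS](integral12_prod_meas1 iF); apply: integral0_eq => x _.
  rewrite /fubini_F; apply: (@integral_line0 (fun y => F (pt (x, y))) _ M) => //.
  + move=> y; have [D1 D2] := dF (pt (x, y)).
    have E : (fun h : R => h^-1 *: (F (pt (x, h *: (1 : R) + y)) - F (pt (x, y)))) =
        (fun h => h^-1 *: (F (h *: delta_mx 0 1 + pt (x, y)) - F (pt (x, y)))).
      by apply/funext => h; rewrite -pt_line1 /GRing.scale/= mulr1.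
    by apply: DeriveDef; rewrite /derivable /derive /= E.
  + have H : continuous (pd 1 F \o (fun y : R => pt (x, y))).
      by move=> y; apply: continuous_comp; [exact: cpt1|exact: cF].
    exact: H.
  + by move=> y yM; apply: F0; exact: lt_le_trans (n1 x y).
  + by move=> y yM; apply: dF0; exact: lt_le_trans (n1 x y).
Qed.

(** The open sets [A] and the complement of [K] cover the space. *)
Lemma smooth_zero_extension {V : normedModType R} (A K : set V) (f : V -> R) :
  open A -> closed K -> K `<=` A -> smooth_on A f -> (forall y, ~ K y -> f y = 0) ->
  smooth_on setT f.
Proof.
move=> oA cK KA sf f0; apply: smooth_on_local => y _.
have [Ky|Ky] := pselect (K y); first by exists A => //; exact: KA.
exists (~` K) => //; apply: (@smooth_on_eq _ _ _ _ (cst 0)).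
- exact: closed_openC.
- by move=> z /= /f0.
- by apply: smooth_on_cst; exact: closed_openC.
Qed.

Lemma integral_pd_compact (A K : set 'rV[R]_2) (F : 'rV[R]_2 -> R) (a : 'I_2) :
  open A -> compact K -> K `<=` A -> smooth_on A F -> (forall y, ~ K y -> F y = 0) ->
  (\int[leb2]_z (pd a F (pt z))%:E = 0)%E.
Proof.
move=> oA cK KA sF F0; have [M M0 KM] := compact_sub_square cK.
have sT := smooth_zero_extension oA (compact_closed_rV cK) KA sF F0.
have FM y : M < `|y| -> F y = 0.
  by move=> My; apply: F0 => /KM; rewrite leNgt My.
apply: (@integral_pd _ M) => //.
- by move=> y; exact: smooth_is_derive sT _.
- by move=> y; exact: smooth_on_continuous (smooth_on_derive _ sT) _.
- exact: derive_support.
Qed.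

(** The fundamental lemma of the calculus of variations: test functions
    increasing to the indicators of boxes show that the integral of [w] over
    every small box vanishes. *)
Lemma weakly_zero_ae (A : set 'rV[R]_2) (w : 'rV[R]_2 -> R) : open A ->
  locally_integrable2 A w ->
  (forall eta, test_function A eta ->
    (\int[leb2]_(z in pt @^-1` A) (w (pt z) * eta (pt z))%:E = 0)%E) ->
  exists Z : set RR, [/\ measurable Z, leb2 Z = 0%E &
    forall z, A (pt z) -> ~ Z z -> w (pt z) = 0].
Proof.
move=> oA iw w0; have [c [r [r0 cr]]] := rational_balls oA.
pose P m := forall z, `|z - c m| <= r m -> A z.
pose Q m : set RR := pt @^-1` [set y : 'rV[R]_2 | `|y - c m| < r m].
have mQ m : measurable (Q m) by exact: measurable_square.
have iQ m : P m -> leb2.-integrable (Q m) (EFin \o (w \o pt)).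
  move=> Pm; pose K := [set y : 'rV[R]_2 | `|y - c m| <= r m].
  have cK : compact K by exact: compact_square.
  have := iw K cK Pm; apply: integrableS.
  - by apply: measurable_closed2; exact: compact_closed_rV.
  - exact: mQ.
  - by move=> z; exact: ltW.
pose bx a b a' b' : set RR := `]a, b[ `*` `]a', b'[.
have key m a b a' b' : P m -> bx a b a' b' `<=` Q m ->
    (\int[leb2]_(z in bx a b a' b') (w (pt z))%:E = 0)%E.
  move=> Pm bQ; have mb : measurable (bx a b a' b') by exact: measurableX.
  have ib : leb2.-integrable (bx a b a' b') (EFin \o (w \o pt)).
    exact: (integrableS (mQ m) mb bQ (iQ m Pm)).
  transitivity (\int[leb2]_(z in bx a b a' b') ((w \o pt) z * cst 1 z)%:E)%E.
    by apply: eq_integral => z _; rewrite mulr1.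
  apply: (@cvg_integral0 _ RR R _ _ (w \o pt) (cst 1)
    (fun k z => box_bump a b a' b' k%:R (pt z))) => //.
  - move=> k; apply: measurable_funTS.
    have := @continuous_measurable2 setT (box_bump a b a' b' k%:R) openT.
    rewrite preimage_setT; apply => y _.
    exact: smooth_on_continuous (smooth_on_box_bump _ _ _ _ _) _.
  - by move=> k z _; have /andP[? ?] := box_bump_itv a b a' b' (pt z) (ler0n R k); rewrite ger0_norm.
  - move=> z [] /=; rewrite !in_itv/= => /andP[? ?] /andP[? ?].
    by apply: box_bump_cvg; rewrite pt0 pt1.
  move=> k; rewrite integral_mkcond.
  transitivity (\int[leb2]_(z in pt @^-1` A) (w (pt z) * box_bump a b a' b' k%:R (pt z))%:E)%E.
    rewrite [RHS]integral_mkcond; apply: eq_integral => z _; rewrite /patch.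
    have [zb|zb] := boolP (z \in bx a b a' b').
      rewrite ifT // inE; move: zb; rewrite inE => /bQ zQ; apply: Pm; exact: ltW zQ.
    case: ifP => // _; rewrite box_bump_out ?mulr0 // pt0 pt1 => -[? ? ? ?].
    by move/negP: zb; apply; rewrite inE /bx; split => /=; rewrite in_itv/=; apply/andP.
  apply: w0; split; first exact: smooth_on_box_bump.
  exists [set y : 'rV[R]_2 | `|y - c m| <= r m]; split.
  - exact: compact_square.
  - exact: Pm.
  - move=> y yK; apply: box_bump_out => -[y1 y2 y3 y4]; apply: yK.
    have /ltW // : `|pt (y 0 0, y 0 1) - c m| < r m.
      by apply: bQ; split => /=; rewrite in_itv/=; apply/andP.
    by rewrite (_ : pt _ = y) //; apply/rowP; apply: ord2P; rewrite mxE.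
have zQ m : P m -> exists Z : set RR, [/\ measurable Z, leb2 Z = 0%E &
    forall z, Q m z -> ~ Z z -> w (pt z) = 0].
  move=> Pm.
  have bI a b a' b' x y : bx a b a' b' `&` fst @^-1` `]x, +oo[ `&` snd @^-1` `]y, +oo[ =
      bx (Num.max a x) b (Num.max a' y) b'.
    apply/seteqP; split => z; rewrite /bx /= !in_itv/= !andbT !gt_max.
      by move=> [[[/andP[-> ->] /andP[-> ->]] ->] ->].
    by move=> [/andP[/andP[-> ->] ->] /andP[/andP[-> ->] ->]].
  have Gpi : setI_closed (@RGenOInfty.G R).
    move=> _ _ [x ->] [y ->]; exists (Num.max x y).
    by apply/seteqP; split => z /=; rewrite !in_itv/= !andbT gt_max => /andP.
  have QE : Q m = bx (c m 0 0 - r m) (c m 0 0 + r m) (c m 0 1 - r m) (c m 0 1 + r m).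
    apply/seteqP; split => z; rewrite /Q /bx /= norm_lt_2 !mxE/= !in_itv/= ![`|_ - c m _ _| < _]ltr_distl.
      by move=> /andP.
    by move=> [-> ->].
  set a := c m 0 0 - r m in QE; set b := c m 0 0 + r m in QE.
  set a' := c m 0 1 - r m in QE; set b' := c m 0 1 + r m in QE.
  have sub x y : bx (Num.max a x) b (Num.max a' y) b' `<=` Q m.
    by rewrite QE -bI => z [[]].
  have mS B : measurable B -> measurable (Q m `&` snd @^-1` B).
    move=> mB; apply: measurableI => //; rewrite -[_ @^-1` _]setTI; exact: measurable_snd.
  have mF B : measurable B -> measurable (Q m `&` fst @^-1` B).
    move=> mB; apply: measurableI => //; rewrite -[_ @^-1` _]setTI; exact: measurable_fst.
  have Gm : @RGenOInfty.G R `<=` (measurable : set (set (measurableTypeR R))).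
    by move=> _ [x ->]; exact: measurable_itv.
  have GE : (measurable : set (set (measurableTypeR R))) = <<s @RGenOInfty.G R >>.
    exact: RGenOInfty.measurableE.
  have GR (B : set (measurableTypeR R)) : measurable B -> <<s @RGenOInfty.G R >> B.
    by rewrite GE.
  have max_id (x : R) : Num.max x x = x by rewrite maxxx.
  have QS y : Q m `&` snd @^-1` `]y, +oo[ = bx (Num.max a a) b (Num.max a' y) b'.
    rewrite -bI -QE; apply/seteqP; split => [z [Qz zy]|z [[Qz _] zy]]; split => //.
    by split => //; move: Qz; rewrite QE /bx /= !in_itv/= => -[/andP[-> _]].
  have QF x : Q m `&` fst @^-1` `]x, +oo[ = bx (Num.max a x) b (Num.max a' a') b'.
    rewrite -bI -QE; apply/seteqP; split => [z [Qz zx]|z [[Qz zx] _]]; split => //.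
    by move: Qz; rewrite QE /bx /= !in_itv/= => -[_ /andP[-> _]].
  have I0 : (\int[leb2]_(z in Q m) (w (pt z))%:E = 0)%E.
    by rewrite QE; apply: (key m) => //; rewrite -QE.
  have I1 y A1 : measurable A1 ->
      (\int[leb2]_(z in (Q m `&` snd @^-1` `]y, +oo[) `&` fst @^-1` A1) (w (pt z))%:E = 0)%E.
    move=> /GR; apply: (@pi_integral0 _ RR R _ _ (measurableTypeR R) fst _ (EFin \o (w \o pt)) (@RGenOInfty.G R)) => //.
    - by apply: mS; exact: measurable_itv.
    - apply: (integrableS (mQ m) _ _ (iQ m Pm)); first by apply: mS; exact: measurable_itv.
      by move=> z [].
    - by rewrite QS; exact: (key m).
    - by move=> _ [x ->]; rewrite setIAC QE bI; exact: (key m).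
  have I1' A1 : measurable A1 -> (\int[leb2]_(z in Q m `&` fst @^-1` A1) (w (pt z))%:E = 0)%E.
    move=> /GR; apply: (@pi_integral0 _ RR R _ _ (measurableTypeR R) fst _ (EFin \o (w \o pt)) (@RGenOInfty.G R)) => //.
    - exact: iQ.
    - by move=> _ [x ->]; rewrite QF; exact: (key m).
  have I2 A1 B1 : measurable A1 -> measurable B1 ->
      (\int[leb2]_(z in (Q m `&` fst @^-1` A1) `&` snd @^-1` B1) (w (pt z))%:E = 0)%E.
    move=> mA1 /GR; apply: (@pi_integral0 _ RR R _ _ (measurableTypeR R) snd _ (EFin \o (w \o pt)) (@RGenOInfty.G R)) => //.
    - exact: mF.
    - by apply: (integrableS (mQ m) _ _ (iQ m Pm)); [exact: mF|move=> z []].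
    - exact: I1'.
    - by move=> _ [y ->]; rewrite setIAC; exact: I1.
  have I3 E : measurable E -> (\int[leb2]_(z in Q m `&` E) (w (pt z))%:E = 0)%E.
    rewrite measurable_prod_measurableType.
    apply: (@pi_integral0 _ RR R _ _ RR id _ (EFin \o (w \o pt)) _) => //.
    - exact: iQ.
    - move=> _ _ [A1 mA1 [B1 mB1 <-]] [A2 mA2 [B2 mB2 <-]].
      exists (A1 `&` A2); first exact: measurableI.
      exists (B1 `&` B2); first exact: measurableI.
      by rewrite setXI.
    - by move=> _ [A1 mA1 [B1 mB1 <-]]; exact: measurableX.
    - move=> _ [A1 mA1 [B1 mB1 <-]].
      rewrite (_ : _ `&` _ = (Q m `&` fst @^-1` A1) `&` snd @^-1` B1); first exact: I2.
      by apply/seteqP; split => [z [Qz [z1 z2]]|z [[Qz z1] z2]].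
  have [Z [mZ Z0 HZ]] : ae_eq leb2 (Q m) (EFin \o (w \o pt)) (cst 0%E).
    apply: integral_ae_eq => //; first exact: iQ.
    by move=> E EQ mE; rewrite integral_cst // mul0e -(setIidr EQ); exact: I3.
  exists Z; split => // z Qz Zz; apply/EFin_inj; apply: contrapT => wz.
  by apply: Zz; apply: HZ => /= H; apply: wz; exact: H.
pose Z m := if pselect (P m) is left Pm then sval (cid (zQ m Pm)) else set0.
have ZP m : measurable (Z m) /\ leb2 (Z m) = 0%E.
  by rewrite /Z; case: pselect => // Pm; case: (cid _) => z [].
exists (\bigcup_m Z m); split.
- by apply: bigcup_measurable => m _; have [] := ZP m.
- apply/eqP; rewrite -measure_le0.
  apply: (@le_trans _ _ (\sum_(m <oo) leb2 (Z m))%E).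
    apply: (@measure_sigma_subadditive _ _ _ _ (\bigcup_m Z m) Z).
    + by move=> m; have [] := ZP m.
    + by apply: bigcup_measurable => m _; have [] := ZP m.
    + by [].
  by rewrite eseries0 // => m _ _; have [] := ZP m.
- move=> z /cr[m [zm Pm]] zZ.
  have {}zZ : ~ Z m z by move=> Zz; apply: zZ; exists m.
  by move: zZ; rewrite /Z; case: pselect => // Pm'; case: (cid _) => /= Z' [_ _]; apply.
Qed.

End Plane.

(** * An inequality for changes of variables *)

Section ChangeOfVariables.
Context {R : realType}.
Notation leb2 := (@leb2 R).
Notation RR := (measurableTypeR R * measurableTypeR R)%type.

(** A parallelogram with two sides parallel to the axis of the coordinate [s']. *)
Definition slab (s s' : 'I_2) (c : 'rV[R]_2) (k h1 h2 : R) : set 'rV[R]_2 :=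
  [set y | `|y 0 s - c 0 s| <= h1 /\
           `|y 0 s' - c 0 s' - k * (y 0 s - c 0 s)| <= h2].

Lemma slab_closed s s' c k h1 h2 : closed (slab s s' c k h1 h2).
Proof.
have cc j : continuous (fun y : 'rV[R]_2 => y 0 j - c 0 j : R).
  by move=> y; apply: continuousB; [exact: coord_continuous|exact: cst_continuous].
apply: closedI.
  by apply: closed_comp (@closed_le _ h1) => y _; exact: (cvg_norm (cc s y)).
apply: closed_comp (@closed_le _ h2) => y _.
exact: (cvg_norm (cvgB (cc s' y) (cvgM (cvg_cst k) (cc s y)))).
Qed.

Lemma leb_centered (x h : R) : 0 <= h ->
  (@lebesgue_measure R : {measure set (measurableTypeR R) -> \bar R})
    `[x - h, x + h]%classic = (2 * h)%:E.
Proof.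
move=> h0; have := @lebesgue_measure_itv R `[x - h, x + h]; rewrite /= lte_fin => E.
apply: etrans E _; case: ltP => [_|xh]; first by rewrite -EFinD; congr EFin; ring.
by congr EFin; lra.
Qed.

Lemma integral_slab (f : R -> \bar R) (x0 h1 h2 : R) : 0 <= h1 -> 0 <= h2 ->
  (forall x, (0 <= f x)%E) -> (forall x, ~ `|x - x0| <= h1 -> f x = 0%E) ->
  (forall x, (f x <= (2 * h2)%:E)%E) ->
  (\int[@lebesgue_measure R]_x f x <= (4 * h1 * h2)%:E)%E.
Proof.
move=> h10 h20 f0 fout fle.
pose I : set (measurableTypeR R) := `[x0 - h1, x0 + h1]%classic.
apply: (@le_trans _ _ (\int[@lebesgue_measure R]_(x in I) (cst (2 * h2)%:E x))%E).
  rewrite [leRHS]integral_mkcond; apply: le_integral_ge0 => // x _.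
    by rewrite /patch; case: ifP => // _; rewrite lee_fin mulr_ge0.
  split => //; rewrite /patch; case: ifPn => [_|/negP xI]; first exact: fle.
  rewrite fout // => xh; apply: xI; rewrite inE /I /= in_itv /=.
  by move: xh; rewrite ler_distl.
rewrite integral_cst; last exact: measurable_itv.
rewrite leb_centered // -EFinM lee_fin le_eqVlt; apply/orP; left; apply/eqP; ring.
Qed.

Lemma slab_section (y0 h2 : R) (P : set R) : 0 <= h2 ->
  (forall y, P y -> `|y - y0| <= h2) ->
  (\int[@lebesgue_measure R]_y (\1_P y)%:E <= (2 * h2)%:E)%E.
Proof.
move=> h20 Py.
pose I : set (measurableTypeR R) := `[y0 - h2, y0 + h2]%classic.
apply: (@le_trans _ _ (\int[@lebesgue_measure R]_y (\1_I y)%:E)%E).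
  apply: le_integral_ge0 => // y _; split => //; rewrite lee_fin !indicE.
  have [/set_mem /Py yP|_] := boolP (y \in P); last by rewrite ler0n.
  by rewrite mem_set // /I /= in_itv /= -ler_distl.
rewrite integral_indic ?setIT; [|exact: measurableT|exact: measurable_itv].
by rewrite leb_centered.
Qed.

Section Slices.
Variables (P : set RR) (x0 h1 h2 : R) (l : R -> R).
Hypotheses (mP : measurable P) (h10 : 0 <= h1) (h20 : 0 <= h2).

Let mI : measurable_fun setT (fun z : RR => (\1_P z)%:E : \bar R).
Proof. by apply/measurable_EFinP; exact: measurable_indic. Qed.

Let I0 (z : RR) : (0 <= (\1_P z)%:E :> \bar R)%E.
Proof. by rewrite lee_fin. Qed.

Let leb2E : (leb2 P = \int[@lebesgue_measure R]_x \int[@lebesgue_measure R]_y (\1_P (x, y))%:E)%E.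
Proof.
rewrite -(@fubini_tonelli1 _ _ _ _ R (@lebesgue_measure R) (@lebesgue_measure R) _ mI I0).
by rewrite integral_indic ?setIT //; exact: measurableT.
Qed.

Lemma slices1_measure :
  (forall z, P z -> `|z.1 - x0| <= h1 /\ `|z.2 - l z.1| <= h2) ->
  (leb2 P <= (4 * h1 * h2)%:E)%E.
Proof.
move=> PP; rewrite leb2E; apply: (@integral_slab _ x0) => // x.
- by apply: integral_ge0.
- move=> xh; apply: integral0_eq => y _; rewrite indicE memNset // => /PP[].
  by move=> /xh.
- by apply: (@slab_section (l x) _ [set y | P (x, y)]) => // y /PP[].
Qed.

Lemma slices2_measure :
  (forall z, P z -> `|z.2 - x0| <= h1 /\ `|z.1 - l z.2| <= h2) ->
  (leb2 P <= (4 * h1 * h2)%:E)%E.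
Proof.
move=> PP; rewrite leb2E.
rewrite (@fubini_tonelli _ _ _ _ R (@lebesgue_measure R) (@lebesgue_measure R) _ mI I0).
apply: (@integral_slab _ x0) => // y.
- by apply: integral_ge0.
- move=> xh; apply: integral0_eq => x _; rewrite indicE memNset // => /PP[].
  by move=> /xh.
- by apply: (@slab_section (l y) _ [set x | P (x, y)]) => // x /PP[].
Qed.

End Slices.

(** The area of a parallelogram, computed slice by slice. *)
Lemma slab_measure (s s' : 'I_2) c k h1 h2 : s != s' -> 0 <= h1 -> 0 <= h2 ->
  (leb2 (pt @^-1` slab s s' c k h1 h2) <= (4 * h1 * h2)%:E)%E.
Proof.
have mP s1 s2 : measurable (pt @^-1` slab s1 s2 c k h1 h2 : set RR).
  by apply: measurable_closed2; exact: slab_closed.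
move: s s'; apply: ord2P; apply: ord2P => //= _ h10 h20.
- apply: (@slices1_measure _ (c 0 0) _ _ (fun x => c 0 1 + k * (x - c 0 0))) => //.
  by move=> z []; rewrite pt0 pt1 opprD addrA.
- apply: (@slices2_measure _ (c 0 1) _ _ (fun x => c 0 0 + k * (x - c 0 1))) => //.
  by move=> z []; rewrite pt0 pt1 opprD addrA.
Qed.

Definition gradF (F : 'rV[R]_2 -> 'rV[R]_2) (b a : 'I_2) (y : 'rV[R]_2) : R :=
  pd a (fun y => F y 0 b) y.

Definition jdet (F : 'rV[R]_2 -> 'rV[R]_2) (y : 'rV[R]_2) : R :=
  gradF F 0 0 y * gradF F 1 1 y - gradF F 0 1 y * gradF F 1 0 y.

Lemma sum2 (f : 'I_2 -> R) : \sum_k f k = f 0 + f 1.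
Proof. by rewrite big_ord_recl big_ord1; congr (_ + f _); exact/val_inj. Qed.

(** Shearing along the larger of the two rows makes the other one thin: the
    product of the two widths is controlled by the determinant alone. *)
Lemma shear_bound (a b : 'I_2 -> R) (i0 : 'I_2) : a 0 * b 1 - a 1 * b 0 != 0 ->
  (forall i, `|a i| <= `|a i0|) -> (forall i, `|b i| <= `|a i0|) ->
  exists m k, [/\ 0 < m, `|k| <= 1 & forall (w : 'I_2 -> R) r, (forall i, `|w i| <= r) ->
    `|\sum_i a i * w i| <= 2 * m * r /\
    `|\sum_i b i * w i - k * \sum_i a i * w i| <= `|a 0 * b 1 - a 1 * b 0| / m * r].
Proof.
move=> d0 am bm; have m0 : a i0 != 0.
  apply/negP => /eqP a0; move: d0; have z i : a i = 0.
    by apply/eqP; rewrite -normr_le0 (le_trans (am i)) // a0 normr0.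
  by rewrite !z !mul0r subrr eqxx.
exists `|a i0|, (b i0 / a i0); split; first by rewrite normr_gt0.
  by rewrite normrM normfV ler_pdivrMr ?normr_gt0 // mul1r.
move=> w r wr; have r0 : 0 <= r by apply: le_trans (wr 0).
split.
  rewrite sum2 (le_trans (ler_normD _ _)) // !normrM.
  have -> : 2 * `|a i0| * r = `|a i0| * r + `|a i0| * r by ring.
  by rewrite lerD // ler_pM.
rewrite !sum2; move: i0 m0 {am bm} => i0.
have H (i : 'I_2) : a i != 0 -> `|a 0 * b 1 - a 1 * b 0| / `|a i| * r >=
   `|(a 0 * b 1 - a 1 * b 0) / a i * w (if i == 0 then 1 else 0)|.
  by move=> ai; rewrite normrM normrM normfV ler_wpM2l ?mulr_ge0 ?invr_ge0.
move: i0; apply: ord2P => ai; apply: le_trans (H _ ai); rewrite /=.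
  rewrite (_ : _ - _ = (a 0 * b 1 - a 1 * b 0) / a 0 * w 1) //; field.
  exact: ai.
rewrite (_ : _ - _ = - ((a 0 * b 1 - a 1 * b 0) / a 1 * w 0)) ?normrN //; field.
exact: ai.
Qed.

(** The mean value theorem on the segment from [y2] to [y1], along which the
    partial derivatives are close to those at [z]. *)
Lemma strict_differentiable (A : set 'rV[R]_2) (f : 'rV[R]_2 -> R) z eta :
  open A -> smooth_on A f -> A z -> 0 < eta ->
  exists2 d, 0 < d & forall y1 y2, `|y1 - z| < d -> `|y2 - z| < d ->
    [/\ A y1, A y2 & `|f y1 - f y2 - \sum_k pd k f z * (y1 - y2) 0 k| <= eta * `|y1 - y2|].
Proof.
move=> oA sf Az e0; have e2 : 0 < eta / 2 by rewrite divr_gt0.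
have : nbhs z (fun y => A y /\ forall k : 'I_2, `|pd k f z - pd k f y| <= eta / 2).
  apply: filterI; first exact: open_nbhs_nbhs.
  apply: (@filter_forall _ 'I_2 (fun k y => `|pd k f z - pd k f y| <= eta / 2) (nbhs z) _) => k.
  by have /cvgrPdist_le := smooth_on_continuous (smooth_on_derive (delta_mx 0 k) sf) Az; exact.
move=> /nbhs_ballP[d /= d0 bd]; exists (d / 3); first by rewrite divr_gt0.
move=> y1 y2 y1d y2d.
have seg (t : R) : `|t| <= `|1 : R| -> ball z d (t *: (y1 - y2) + y2).
  rewrite normr1 => t1; rewrite -ball_normE/= distrC -addrA.
  apply: le_lt_trans (ler_normD _ _) _; rewrite normrZ.
  have y12 : `|y1 - y2| < d / 3 + d / 3.
    by rewrite -(subrKA z) (le_lt_trans (ler_normD _ _)) // [X in _ + X]distrC ltrD.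
  apply: (@le_lt_trans _ _ (`|y1 - y2| + `|y2 - z|)).
    by rewrite lerD2r ler_piMl.
  lra.
have [|t t1] := @segment_mvt _ _ f y2 (y1 - y2) 1.
  by move=> t /seg/bd[At _]; exact: smooth_on_derivable sf At.
have [At dt] := bd _ (seg t t1).
rewrite scale1r mul1r subrK => ->.
have [A1 _] : A y1 /\ True.
  by split => //; have := seg 1 (lexx _); rewrite scale1r subrK => /bd[].
have [A2 _] : A y2 /\ True.
  by split => //; have := seg 0; rewrite scale0r add0r normr0 => /(_ ltac:(done)) /bd[].
split => //; rewrite deriveE; last exact: smooth_on_differentiable oA sf At.
rewrite diff_coord; last exact: smooth_on_differentiable oA sf At.
rewrite -sumrB (le_trans (ler_norm_sum _ _ _)) // sum2.
have B (k : 'I_2) : `|pd k f (t *: (y1 - y2) + y2) * (y1 - y2) 0 k - pd k f z * (y1 - y2) 0 k|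
    <= eta / 2 * `|y1 - y2|.
  by rewrite -mulrBl normrM ler_pM ?coord_le_norm // distrC.
apply: le_trans (lerD (B 0) (B 1)) _; lra.
Qed.

(** The slab given by [shear_bound] for the differential at [z] is widened by the
    error of linearization.  The constant is universal, however ill-conditioned
    the differential is, since only the determinant enters its area. *)
Lemma image_square (O : set 'rV[R]_2) (F : 'rV[R]_2 -> 'rV[R]_2) z : open O ->
  smooth_on O F -> O z -> jdet F z != 0 ->
  \forall y \near z & h \near (0 : R)^'+,
    exists P : set 'rV[R]_2, [/\ closed P,
      (leb2 (pt @^-1` P) <= (9 * `|jdet F z| * h ^+ 2)%:E)%E &
      forall y', `|y' - y| <= h -> O y' /\ P (F y')].
Proof.
move=> oO sF Oz dz; pose D := `|jdet F z|; have D0 : 0 < D by rewrite normr_gt0.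
have sFb b := smooth_on_coord b oO sF.
have [[s i0] _ smax] : exists2 p : 'I_2 * 'I_2, true &
    forall q : 'I_2 * 'I_2, `|gradF F q.1 q.2 z| <= `|gradF F p.1 p.2 z|.
  have [p _ pP] := @arg_maxP _ _ _ (0, 0) xpredT (fun q : 'I_2 * 'I_2 => `|gradF F q.1 q.2 z|) isT.
  by exists p => // q; exact: pP.
have [s' [ss DE]] : exists s', s != s' /\
    `|gradF F s 0 z * gradF F s' 1 z - gradF F s 1 z * gradF F s' 0 z| = D.
  rewrite /D /jdet; move: s {smax}; apply: ord2P; [by exists 1|exists 0; split => //].
  by rewrite -normrN; congr `|_|; ring.
have [m [k [m0 k1 mk]]] := @shear_bound (gradF F s ^~ z) (gradF F s' ^~ z) i0
  ltac:(by rewrite -normr_gt0 DE) (fun i => smax (s, i)) (fun i => smax (s', i)).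
rewrite DE in mk.
(* The two widths alone give the area 8 D h^2; [eta] is so small that the error
   of linearization adds at most D h^2. *)
pose eta := Num.min 1 (D / (4 * (4 * m + D / m + 2))).
have q0 : 0 < 4 * (4 * m + D / m + 2) by have := divr_gt0 D0 m0; lra.
have eta0 : 0 < eta by rewrite lt_min ltr01 divr_gt0.
have eta1 : eta <= 1 by rewrite ge_min lexx.
have etaD : eta * (4 * (4 * m + D / m + 2)) <= D.
  by rewrite -ler_pdivlMr // ge_min lexx orbT.
have [d1 d10 H1] := strict_differentiable oO (sFb s) Oz eta0.
have [d2 d20 H2] := strict_differentiable oO (sFb s') Oz eta0.
pose d := Num.min d1 d2; have d0 : 0 < d by rewrite lt_min d10.
near=> y h.
have yd : `|y - z| < d / 2.
  rewrite distrC; near: y; apply: cvgr_dist_lt; last by rewrite divr_gt0.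
  exact: cvg_id.
have h0 : 0 < h by [].
have hd : h < d / 2 by near: h; apply: nbhs_right_lt; rewrite divr_gt0.
pose h1 := (2 * m + eta) * h; pose h2 := (D / m + 2 * eta) * h.
have Dm := divr_gt0 D0 m0.
exists (slab s s' (F y) k h1 h2); split.
- exact: slab_closed.
- apply: le_trans (slab_measure _ _ ss _ _) _.
  + by rewrite /h1 mulr_ge0 ?ltW // addr_gt0 // mulr_gt0.
  + by rewrite /h2 mulr_ge0 ?ltW // addr_gt0 // mulr_gt0.
  rewrite lee_fin /h1 /h2 -/D.
  have -> : 4 * ((2 * m + eta) * h) * ((D / m + 2 * eta) * h) =
    (8 * D + eta * (4 * (4 * m + D / m + 2 * eta))) * h ^+ 2 by field; rewrite gt_eqF.
  rewrite ler_wpM2r ?sqr_ge0 //.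
  have : eta * (4 * (4 * m + D / m + 2 * eta)) <= eta * (4 * (4 * m + D / m + 2)).
    by rewrite ler_wpM2l ?(ltW eta0) //; lra.
  lra.
- move=> y' y'h.
  have yz : `|y - z| < d by rewrite (lt_trans yd) // ltr_pdivrMr // ltr_pMr // ltr1n.
  have y'z : `|y' - z| < d.
    by rewrite -(subrKA y) (le_lt_trans (ler_normD _ _)) // (splitr d) ltrD // (le_lt_trans y'h).
  have [] := H1 y' y; rewrite ?(lt_le_trans y'z) ?(lt_le_trans yz) ?ge_min ?lexx ?orbT //.
  move=> Oy' _ E1; have [] := H2 y' y; rewrite ?(lt_le_trans y'z) ?(lt_le_trans yz) ?ge_min ?lexx ?orbT //.
  move=> _ _ E2; split => //.
  have [L1 L2] := mk (fun i => (y' - y) 0 i) h (fun i => le_trans (coord_le_norm _ _) y'h).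
  have eh : eta * `|y' - y| <= eta * h by rewrite ler_wpM2l // ltW.
  set S1 := \sum_i _ in L1 L2; set S2 := \sum_i _ in L2.
  move: E1 E2; rewrite -/S1 -/S2; set G1 := F y' 0 s - _; set G2 := F y' 0 s' - _ => E1 E2.
  split; rewrite -/G1.
    have -> : G1 = (G1 - S1) + S1 by rewrite subrK.
    by rewrite (le_trans (ler_normD _ _)) // /h1; lra.
  have -> : G2 - k * G1 = (G2 - S2) + ((S2 - k * S1) - k * (G1 - S1)) by ring.
  rewrite (le_trans (ler_normD _ _)) // /h2.
  have B3 : `|k * (G1 - S1)| <= eta * h.
    rewrite normrM -[eta * h]mul1r ler_pM //; exact: le_trans E1 eh.
  have := ler_normB (S2 - k * S1) (k * (G1 - S1)); lra.
Unshelve. all: by end_near. Qed.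

End ChangeOfVariables.

Section CoverAndLimit.
Context {R : realType}.
Notation leb2 := (@leb2 R).
Notation RR := (measurableTypeR R * measurableTypeR R)%type.

Variables (O O' : set 'rV[R]_2) (F : 'rV[R]_2 -> 'rV[R]_2) (f2 : 'rV[R]_2 -> R).
Hypotheses (oO : open O) (oO' : open O') (sF : smooth_on O F).
Hypotheses (FO : forall y, O y -> O' (F y)).
Hypotheses (cf2 : forall y, O' y -> {for y, continuous f2}).
Hypotheses (f20 : forall y, O' y -> 0 <= f2 y).
Hypotheses (dF : forall y, O y -> jdet F y != 0).

Let f1 (y : 'rV[R]_2) : R := f2 (F y) * `|jdet F y|.

Lemma smooth_jdet : smooth_on O (jdet F).
Proof.
have sg b a : smooth_on O (gradF F b a).
  exact: smooth_on_derive (smooth_on_coord b oO sF).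
by apply: (smooth_onB oO); apply: (smooth_onM oO).
Qed.

Let cf1 y : O y -> {for y, continuous f1}.
Proof.
move=> Oy; apply: continuousM.
  apply: continuous_comp; first exact: smooth_on_continuous sF Oy.
  exact/cf2/FO.
exact: (cvg_norm (smooth_on_continuous smooth_jdet Oy)).
Qed.

Let f10 y : O y -> 0 <= f1 y.
Proof. by move=> Oy; rewrite mulr_ge0 ?f20 //; exact: FO. Qed.

(** The square of radius [h] around [y] is mapped into the set [P], and the weight
    [c * leb2 P] is dominated by the integrand [f1 + e] at every point of the
    square, up to the factor 9; such bounds can be summed over a grid. *)
Definition good_square (e h : R) (y : 'rV[R]_2) : Prop :=
  exists P : set 'rV[R]_2, exists c : R, [/\ closed P, 0 <= c,
    (forall y', `|y' - y| <= h -> [/\ O y', P (F y') & f2 (F y') <= c]) &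
    (forall y', `|y' - y| <= h ->
       (c%:E * leb2 (pt @^-1` P) <= (9 * h ^+ 2 * (f1 y' + e))%:E)%E)].

(** Near each point the determinant, [f2] and [F] are almost constant, so that
    [image_square] applies; compactness makes the scale uniform. *)
Lemma good_square_near (K : set 'rV[R]_2) (e : R) : 0 < e -> compact K -> K `<=` O ->
  \forall h \near (0 : R)^'+, K `<=` good_square e h.
Proof.
move=> e0 cK KO; move/compact_near_coveringP: cK => /(_ _ _ (good_square e)); apply.
move=> z /KO Oz; pose D := `|jdet F z|; have D0 : 0 < D by rewrite normr_gt0 dF.
have e2 : 0 < e / 2 by rewrite divr_gt0.
pose eta := e / 2 / D; have eta0 : 0 < eta by rewrite divr_gt0.
have cF2 : {for z, continuous (f2 \o F)}.
  apply: continuous_comp; first exact: smooth_on_continuous sF Oz.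
  exact/cf2/FO.
have : nbhs z (fun y => `|f1 z - f1 y| <= e / 2 /\ `|(f2 \o F) z - (f2 \o F) y| <= eta).
  by apply: filterI; [have /cvgrPdist_le := cf1 Oz|have /cvgrPdist_le := cF2]; exact.
move=> /nbhs_ballP[d /= d0 bd].
have [[/= Ay Ah] [nAy nAh] ims] := image_square oO sF Oz (dF Oz).
near=> y h.
have yA : Ay y by near: y; exact: nAy.
have hA : Ah h by near: h; exact: nAh.
have yd : `|y - z| < d / 2.
  rewrite distrC; near: y; apply: cvgr_dist_lt; last by rewrite divr_gt0.
  exact: cvg_id.
have h0 : 0 < h by [].
have hd : h < d / 2 by near: h; apply: nbhs_right_lt; rewrite divr_gt0.
have [P [cP lP HP]] : exists P : set 'rV[R]_2, [/\ closed P,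
      (leb2 (pt @^-1` P) <= (9 * `|jdet F z| * h ^+ 2)%:E)%E &
      forall y', `|y' - y| <= h -> O y' /\ P (F y')].
  exact: (ims (y, h) (conj yA hA)).
have near_z y' : `|y' - y| <= h -> ball z d y'.
  move=> y'h; rewrite -ball_normE/= distrC -(subrKA y) (le_lt_trans (ler_normD _ _)) //.
  by rewrite (splitr d) ltrD // (le_lt_trans y'h).
have fz0 : 0 <= f2 (F z) := f20 (FO Oz).
have c0 : 0 <= f2 (F z) + eta := addr_ge0 fz0 (ltW eta0).
exists P, (f2 (F z) + eta); split => // y' y'h; have [Oy' Py'] := HP y' y'h;
  have [B1 B2] := bd _ (near_z _ y'h).
  split => //; move: B2; rewrite /= ler_distlC; lra.
apply: (@le_trans _ _ ((f2 (F z) + eta)%:E * (9 * `|jdet F z| * h ^+ 2)%:E)%E).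
  by rewrite lee_wpmul2l ?lee_fin.
rewrite -EFinM lee_fin.
have -> : (f2 (F z) + eta) * (9 * `|jdet F z| * h ^+ 2) =
   9 * h ^+ 2 * (f1 z + e / 2).
  rewrite /f1 /eta -/D; field; by rewrite gt_eqF.
rewrite ler_wpM2l ?mulr_ge0 ?sqr_ge0 //.
move: B1; rewrite ler_distlC; lra.
Unshelve. all: by end_near. Qed.

Definition thicken (K : set 'rV[R]_2) (h : R) : set 'rV[R]_2 :=
  [set y' | exists2 y, K y & `|y' - y| <= h].

Lemma thicken_compact K h : compact K -> compact (thicken K h).
Proof.
move=> cK; have -> : thicken K h =
    (fun p : 'rV[R]_2 * 'rV[R]_2 => p.1 + p.2) @` (K `*` [set w | `|w - 0| <= h]).
  apply/seteqP; split => [y' [y Ky yy]|_ [[y w] [/= Ky wh] <-]].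
    by exists (y, y' - y) => /=; [split => //=; rewrite subr0|rewrite addrC subrK].
  by exists y => //; rewrite addrAC subrr add0r; move: wh; rewrite subr0.
apply: continuous_compact; last by apply: compact_setX => //; exact: compact_square.
by apply: continuous_subspaceT => p; exact: add_continuous.
Qed.

Let mf2 : measurable_fun (pt @^-1` O' : set RR) (f2 \o pt).
Proof. exact: continuous_measurable2. Qed.

Let mf1 : measurable_fun (pt @^-1` O : set RR) (f1 \o pt).
Proof. exact: continuous_measurable2. Qed.

(** The image of [K] is covered by the slabs attached to the cells of a grid of
    mesh [h]; their total weight is at most the integral over the cells. *)
Lemma grid_bound (K : set 'rV[R]_2) (e h : R) : 0 < e -> 0 < h ->
  compact K -> K `<=` good_square e h ->
  (\int[leb2]_(z in pt @^-1` (F @` K)) (f2 (pt z))%:E <=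
   9%:E * \int[leb2]_(z in pt @^-1` (thicken K h)) (f1 (pt z) + e)%:E)%E.
Proof.
move=> e0 h0 cK Kgood; have [M M0 KM] := compact_sub_square cK.
pose a (i : nat) := - M + i%:R * h.
pose L := (Num.truncn (2 * M / h)).+1.
pose cell (p : 'I_L * 'I_L) : set RR :=
  `[a p.1, a p.1.+1[ `*` `[a p.2, a p.2.+1[.
have idx (x : R) : `|x| <= M -> exists i : 'I_L, a i <= x < a i.+1.
  move=> xM; have x0 : 0 <= (x + M) / h.
    by rewrite divr_ge0 ?(ltW h0) //; move: xM; rewrite ler_norml; lra.
  have /andP[t1 t2] := truncn_itv x0.
  have tL : (Num.truncn ((x + M) / h) < L)%N.
    rewrite ltnS; apply: le_truncn; rewrite ler_wpM2r ?invr_ge0 ?(ltW h0) //.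
    by move: xM; rewrite ler_norml; lra.
  exists (Ordinal tL); rewrite /a /=.
  by move: t1 t2; rewrite ler_pdivlMr // ltr_pdivrMr //; lra.
have aS i : a i.+1 = a i + h by rewrite /a -natr1; ring.
have cellP p (y y' : 'rV[R]_2) : cell p (y 0 0, y 0 1) -> cell p (y' 0 0, y' 0 1) -> `|y' - y| <= h.
  move=> [/=]; rewrite !in_itv/= !aS => /andP[? ?] /andP[? ?] [/=].
  rewrite !in_itv/= !aS => /andP[? ?] /andP[? ?].
  by rewrite norm_le_2 !mxE !ler_norml; apply/andP; split; apply/andP; split; lra.
pose meets p := `[< exists2 y : 'rV[R]_2, K y & cell p (y 0 0, y 0 1) >].
have /choice[G GP] p : exists Pc : set 'rV[R]_2 * R, [/\ closed Pc.1, 0 <= Pc.2,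
    (meets p -> forall y' : 'rV[R]_2, cell p (y' 0 0, y' 0 1) ->
       [/\ thicken K h y', O y', Pc.1 (F y') & f2 (F y') <= Pc.2]) &
    (Pc.2%:E * leb2 (pt @^-1` Pc.1) <=
      if meets p then 9%:E * \int[leb2]_(z in cell p) (f1 (pt z) + e)%:E else 0)%E].
  rewrite /meets; case: asboolP => [[y Ky yp]|_]; last first.
    exists (set0, 0); split => //; first exact: closed0.
    by rewrite /= mul0e.
  have [P [c [cP c0 HP1 HP2]]] := Kgood _ Ky.
  have cellO (y' : 'rV[R]_2) : cell p (y' 0 0, y' 0 1) -> `|y' - y| <= h by exact: cellP.
  have mc : measurable (cell p) by exact: measurableX.
  exists (P, c); split => //=.
    move=> _ y' /cellO yy'; have [Oy' Py' fy'] := HP1 _ yy'; split => //.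
    by exists y.
  have lc : leb2 (cell p) = (h ^+ 2)%:E.
    rewrite /cell /leb2; transitivity (lebesgue_measure (`[a p.1, a p.1.+1[%classic : set R) *
      lebesgue_measure (`[a p.2, a p.2.+1[%classic : set R))%E; first exact: product_measure1E.
    rewrite !lebesgue_measure_itv /= !lte_fin !aS !ltrDl h0 -!EFinD -EFinM.
    by congr EFin; rewrite expr2; ring.
  have fin : (leb2 (pt @^-1` P) * c%:E)%E \is a fin_num.
    have H := HP2 y ltac:(by rewrite subrr normr0 ltW).
    rewrite ge0_fin_numE; last by rewrite mule_ge0.
    by rewrite muleC; apply: le_lt_trans H _; rewrite ltry.
  rewrite muleC -(fineK fin); set b := fine _.
  have b0 : 0 <= b by rewrite fine_ge0 // mule_ge0.
  have -> : b%:E = (9%:E * \int[leb2]_(z in cell p) (cst (b / (9 * h ^+ 2))%:E z))%E.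
    rewrite (@integral_cst _ RR R leb2 _ mc) [X in (_ = _ * (_ * X))%E]lc -!EFinM.
    congr EFin; field.
    by rewrite gt_eqF.
  rewrite lee_wpmul2l //; apply: le_integral_ge0.
  - by move=> z _; rewrite lee_fin divr_ge0 // mulr_ge0 // sqr_ge0.
  - move=> z zp; have zp' : cell p (pt z 0 0, pt z 0 1) by rewrite pt0 pt1; case: z zp.
    have [Oz _ _] := HP1 _ (cellO _ zp').
    by rewrite lee_fin addr_ge0 ?(ltW e0) // f10.
  - move=> z zp; split => //; have zp' : cell p (pt z 0 0, pt z 0 1) by rewrite pt0 pt1; case: z zp.
    have := HP2 _ (cellO _ zp'); rewrite muleC -(fineK fin) -/b lee_fin => H.
    by rewrite lee_fin ler_pdivrMr ?mulr_gt0 ?exprn_gt0 // mulrC.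
pose W p : set RR := if meets p then cell p else set0.
have mW p : measurable (W p).
  by rewrite /W; case: ifP => _; [exact: measurableX|exact: measurable0].
have WO p z : W p z -> thicken K h (pt z) /\ O (pt z).
  rewrite /W; case: ifP => // mp zp; have [_ _ /(_ mp) H _] := GP p.
  by have [|? ? _ _] := H (pt z); [rewrite pt0 pt1; case: z zp|].
have mG p : measurable (pt @^-1` (G p).1 : set RR).
  by apply: measurable_closed2; have [] := GP p.
apply: (@le_trans _ _ (\sum_(p : 'I_L * 'I_L) (G p).2%:E * leb2 (pt @^-1` (G p).1))%E).
  rewrite (_ : (\sum_p _)%E = (\int[leb2]_z (\sum_p (G p).2%:E * (\1_(pt @^-1` (G p).1) z)%:E))%E); last first.
    rewrite ge0_integral_sum //=.
    - apply: eq_bigr => p _; rewrite ge0_integralZl //=.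
      + by rewrite integral_indic ?setIT.
      + by apply/measurable_EFinP; exact: measurable_indic.
      + by rewrite lee_fin; have [] := GP p.
    - move=> p; apply: emeasurable_funM; first exact: measurable_cst.
      by apply/measurable_EFinP; exact: measurable_indic.
    - by move=> p z _; rewrite mule_ge0 // lee_fin; have [] := GP p.
  apply: le_integral_ge0.
  - move=> z [y Ky yz]; rewrite lee_fin -yz f20 //; apply: FO.
    by have [P [c [_ _ /(_ y) H _]]] := Kgood _ Ky; have [] := H ltac:(by rewrite subrr normr0 ltW).
  - by move=> z _; apply: sume_ge0 => p _; rewrite mule_ge0 // lee_fin; have [] := GP p.
  - move=> z [y Ky yz]; split => //.
    have [i /andP[i1 i2]] := idx _ (le_trans (coord_le_norm y 0) (KM _ Ky)).
    have [j /andP[j1 j2]] := idx _ (le_trans (coord_le_norm y 1) (KM _ Ky)).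
    have yc : cell (i, j) (y 0 0, y 0 1).
      by split; rewrite /= in_itv/=; apply/andP.
    have mij : meets (i, j) by apply/asboolP; exists y.
    have [_ c0 /(_ mij _ yc) [_ _ Py fy] _] := GP (i, j).
    rewrite (bigD1 (i, j)) //= -yz -[leLHS]adde0 leeD //.
      by rewrite indicE mem_set /= ?yz -?yz // mule1 lee_fin.
    by apply: sume_ge0 => p _; rewrite mule_ge0 // lee_fin; have [] := GP p.
apply: (@le_trans _ _ (\sum_(p : 'I_L * 'I_L) 9%:E * \int[leb2]_(z in W p) (f1 (pt z) + e)%:E)%E).
  apply: lee_sum => p _; have [_ _ _] := GP p; rewrite /W.
  by case: (meets p) => //; rewrite integral_set0 mule0.
have tW : trivIset [set` index_enum ('I_L * 'I_L)%type] W.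
  move=> p q _ _ [[x y] []]; rewrite /W.
  case: ifP => // _ [/= xp yp]; case: ifP => // _ [/= xq yq].
  have au (k l : nat) (t : R) : a k <= t < a k.+1 -> a l <= t < a l.+1 -> k = l.
    rewrite /a => /andP[k1 k2] /andP[l1 l2].
    have T n : - M + n%:R * h <= t -> t < - M + n.+1%:R * h -> Num.truncn ((t + M) / h) = n.
      move=> n1 n2; apply: truncn_def; apply/andP.
      by rewrite ler_pdivlMr // ltr_pdivrMr //; split; lra.
    by rewrite -(T k) // -(T l).
  move: xp yp xq yq; rewrite !in_itv/= => xp yp xq yq.
  case: p q xp yp xq yq => [p1 p2] [q1 q2] /= xp yp xq yq.
  by congr pair; apply/val_inj; [exact: au xp xq|exact: au yp yq].
rewrite -ge0_sume_distrr; last first.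
  move=> p _; apply: integral_ge0 => z /WO[_ Oz].
  by rewrite lee_fin addr_ge0 ?(ltW e0) // f10.
rewrite lee_wpmul2l // -ge0_integral_bigsetU //=.
- apply: le_integral_ge0.
  + move=> z; rewrite -bigcup_seq => -[p _ /WO[_ Oz]].
    by rewrite lee_fin addr_ge0 ?(ltW e0) // f10.
  + move=> z [y Ky yz]; have [P [c [_ _ /(_ (pt z)) H _]]] := Kgood _ Ky.
    by have [Oz _ _] := H yz; rewrite lee_fin addr_ge0 ?(ltW e0) // f10.
  + by move=> z; rewrite -bigcup_seq => -[p _ /WO[zt _]]; split.
- exact: index_enum_uniq.
- apply/measurable_EFinP; apply: measurable_funD; last exact: measurable_cst.
  apply: measurable_funS mf1; first exact: measurable_open2.
  by move=> z; rewrite -bigcup_seq => -[p _ /WO[_ Oz]].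
- move=> z; rewrite -bigcup_seq => -[p _ /WO[_ Oz]].
  by rewrite lee_fin addr_ge0 ?(ltW e0) // f10.
Qed.

(** The grids of mesh [h] tending to 0 and errors [e] tending to 0 use
    neighbourhoods that shrink to [K]. *)
Lemma cov_compact (K : set 'rV[R]_2) : compact K -> K `<=` O ->
  (\int[leb2]_(z in pt @^-1` (F @` K)) (f2 (pt z))%:E <=
   9%:E * \int[leb2]_(z in pt @^-1` K) (f1 (pt z))%:E)%E.
Proof.
move=> cK KO.
have [h0 [hp H0]] : exists h : R, 0 < h /\ K `<=` good_square 1 h.
  have := good_square_near ltr01 cK KO => H.
  near (0 : R)^'+ => h; exists h; split; first by [].
  by near: h; exact: H.
have V0O : thicken K h0 `<=` O.
  by move=> y' [y Ky yy]; have [P [c [_ _ /(_ _ yy)[]]]] := H0 _ Ky.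
have /choice[hn hnP] (n : nat) : exists h : R, [/\ 0 < h, h <= h0, h <= n.+1%:R^-1 &
    K `<=` good_square n.+1%:R^-1 h].
  have en : 0 < n.+1%:R^-1 :> R by rewrite invr_gt0.
  have H := good_square_near en cK KO.
  near (0 : R)^'+ => h; exists h; split.
  - by [].
  - by near: h; exact: nbhs_right_le.
  - by near: h; exact: nbhs_right_le.
  - by near: h; exact: H.
pose V n := thicken K (hn n); pose D : set RR := pt @^-1` thicken K h0.
have cV n : compact (V n) by exact: thicken_compact.
have mV n : measurable (pt @^-1` V n : set RR).
  by apply: measurable_closed2; exact: compact_closed_rV.
have mD : measurable D.
  by apply: measurable_closed2; apply: compact_closed_rV; exact: thicken_compact.
have mK : measurable (pt @^-1` K : set RR).
  by apply: measurable_closed2; exact: compact_closed_rV.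
have VD n : pt @^-1` V n `<=` D.
  by move=> z [y Ky yz]; exists y => //; have [_ + _ _] := hnP n; exact: le_trans.
have KV n : K `<=` V n.
  by move=> y Ky; exists y => //; rewrite subrr normr0; have [/ltW] := hnP n.
pose g (n : nat) (z : RR) : \bar R := (f1 (pt z) + n.+1%:R^-1)%:E.
have mf1D : measurable_fun D (f1 \o pt).
  by apply: measurable_funS mf1; [exact: measurable_open2|move=> z /V0O].
have mg n : measurable_fun D (g n).
  by apply/measurable_EFinP; apply: measurable_funD => //; exact: measurable_cst.
have [|||||_ _] := @dominated_convergence _ RR R leb2 D mD
   (fun n => g n \_ (pt @^-1` V n)) ((EFin \o (f1 \o pt)) \_ (pt @^-1` K))
   (fun z => (f1 (pt z) + 1)%:E).
- move=> n; apply: (measurable_restrict (g n) (mV n) mD).1.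
  by apply: measurable_funS (mg n) => // z [].
- apply: (measurable_restrict _ mK mD).1; apply/measurable_EFinP.
  by apply: measurable_funS mf1D => // z [].
- apply: aeW => z Dz; rewrite /patch; case: ifPn => [/set_mem Kz|/negP zK].
    have -> : (fun n => if z \in pt @^-1` V n then g n z else 0%E) = (fun n => g n z).
      by apply/funext => n; rewrite mem_set //; exact: KV.
    apply: cvg_EFin; first exact: nearW.
    rewrite -[X in _ --> X]addr0; apply: cvgD; first exact: cvg_cst.
    exact: cvg_harmonic.
  have oK : open (~` K) by apply: closed_openC; exact: compact_closed_rV.
  have zK' : (~` K) (pt z) by move=> Kz; apply: zK; rewrite inE.
  have /nbhs_ballP[r /= r0 rK] := open_nbhs_nbhs (conj oK zK').
  apply: (@cvg_trans _ ((fun=> 0%E : \bar R) @ \oo)); last exact: cvg_cst.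
  apply: near_eq_cvg; have [N _ HN] := near_infty_natSinv_lt (PosNum r0).
  exists N => // n Nn /=; rewrite memNset // => -[y Ky yz]; apply: (rK y) => //.
  rewrite -ball_normE/=; apply: le_lt_trans yz _.
  by have [_ _ + _] := hnP n => /le_lt_trans; apply; exact: (HN n Nn).
- have cV0 : compact (thicken K h0) by exact: thicken_compact.
  apply: (continuous_integrable2 (w := fun y => f1 y + 1) oO cV0 V0O) => y Oy.
  by have := cvgD (cf1 Oy) (cvg_cst (1 : R)); apply.
- apply: aeW => z n Dz; have Oz := V0O _ Dz.
  have fz := f10 Oz; rewrite /patch; case: ifP => _; last by rewrite abse0 lee_fin addr_ge0.
  rewrite /g abse_EFin lee_fin ger0_norm ?addr_ge0 // lerD2l invf_le1 // ler1n //.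
move=> cvgI.
have E n : (\int[leb2]_(z in D) (g n \_ (pt @^-1` V n)) z =
    \int[leb2]_(z in pt @^-1` V n) (f1 (pt z) + n.+1%:R^-1)%:E)%E.
  by rewrite -integral_mkcondr (setIidr (VD n)).
have EK : (\int[leb2]_(z in D) ((EFin \o (f1 \o pt)) \_ (pt @^-1` K)) z =
    \int[leb2]_(z in pt @^-1` K) (f1 (pt z))%:E)%E.
  rewrite -integral_mkcondr setIidr //; apply: subset_trans (VD 0).
  by move=> z; exact: KV.
rewrite EK in cvgI; have {}cvgI := cvgeZl (@erefl _ ((9%:E : \bar R) \is a fin_num)) cvgI.
apply: cvge_ge cvgI; apply: nearW => n; rewrite /= E.
by have [? _ _ ?] := hnP n; apply: grid_bound; rewrite ?invr_gt0.
Unshelve. all: by end_near. Qed.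

(** The points of norm at most [n] and distance at least [1 / (n + 1)] from the
    complement of [O]. *)
Lemma locally_closed_exhaustion (C : set 'rV[R]_2) : closed C ->
  exists K : nat -> set 'rV[R]_2, [/\ forall n, compact (K n),
    forall n m, (n <= m)%N -> K n `<=` K m & \bigcup_n K n = O `&` C].
Proof.
move=> cC; pose E n := [set y : 'rV[R]_2 | forall w, `|w - y| < n.+1%:R^-1 -> O w].
have cE n : closed (E n).
  have -> : E n = ~` (\bigcup_(w in ~` O) ball w n.+1%:R^-1).
    apply/seteqP; split => y.
      by move=> yE [w Ow]; rewrite -ball_normE/= => wy; apply: Ow; exact: yE.
    move=> yE w wy; apply: contrapT => Ow; apply: yE; exists w => //.
    by rewrite -ball_normE.
  by apply: open_closedC; apply: bigcup_open => w _; exact: ball_open.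
exists (fun n => [set y | `|y - 0| <= n%:R] `&` (E n `&` C)); split.
- move=> n; apply: compact_closedI; first exact: compact_square.
  exact: closedI.
- move=> n m nm y [/= yn [yE yC]]; split; last split => //=.
    by rewrite (le_trans yn) // ler_nat.
  move=> w wy; apply: yE; apply: lt_le_trans wy _.
  by rewrite lef_pV2 ?posrE // ler_nat.
- apply/seteqP; split => [y [n _ [_ [yE yC]]]|y [Oy Cy]].
    by split => //; apply: yE; rewrite subrr normr0.
  have /nbhs_ballP[r /= r0 rO] := open_nbhs_nbhs (conj oO Oy).
  have [N1 _ HN] := near_infty_natSinv_lt (PosNum r0).
  pose N2 := (Num.truncn `|y|).+1; exists (maxn N1 N2) => //; split => /=.
    rewrite subr0 ltW // (lt_le_trans (truncnS_gt _)) // ler_nat.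
    exact: leq_maxr.
  split => // w wy; apply: rO; rewrite -ball_normE/= distrC (lt_trans wy) //.
  by apply: HN; rewrite /= leq_maxl.
Qed.

(** By monotone convergence along a compact exhaustion. *)
Lemma cov_le (C : set 'rV[R]_2) : closed C ->
  (\int[leb2]_(z in pt @^-1` (F @` (O `&` C))) (f2 (pt z))%:E <=
   9%:E * \int[leb2]_(z in pt @^-1` (O `&` C)) (f1 (pt z))%:E)%E.
Proof.
move=> cC; have [K [cK Kn KU]] := locally_closed_exhaustion cC.
have KO n : K n `<=` O `&` C by rewrite -KU => y Ky; exists n.
have cFK n : compact (F @` K n).
  apply: continuous_compact => //; apply: continuous_in_subspaceT => y.
  by rewrite inE => /KO[Oy _]; exact: smooth_on_continuous sF Oy.
pose G n : set RR := pt @^-1` (F @` K n).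
have mG n : measurable (G n) by apply: measurable_closed2; exact: compact_closed_rV.
have GO n : G n `<=` pt @^-1` O'.
  by move=> z [y /KO[Oy _] yz] /=; rewrite -yz; exact: FO.
have -> : pt @^-1` (F @` (O `&` C)) = \bigcup_n G n.
  rewrite -KU; apply/seteqP; split => z.
    by move=> [y [n _ Ky] yz]; exists n => //; exists y.
  by move=> [n _ [y Ky yz]]; exists y => //; exists n.
have cvgI := @ge0_nondecreasing_set_cvg_integral _ RR R G (fun z => (f2 (pt z))%:E) leb2.
have {}cvgI : (\int[leb2]_(z in G n) (f2 (pt z))%:E @[n --> \oo] -->
    \int[leb2]_(z in \bigcup_n G n) (f2 (pt z))%:E)%E.
  apply: cvgI => //.
  - move=> n m nm; apply/subsetPset => z [y Ky yz]; exists y => //; exact: Kn Ky.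
  - move=> n; apply/measurable_EFinP; apply: measurable_funS mf2; last exact: GO.
    exact: measurable_open2.
  - by move=> n z /GO /f20; rewrite lee_fin.
apply: cvge_le cvgI; apply: nearW => n.
have KnO : K n `<=` O by move=> y /KO[].
apply: le_trans (cov_compact (cK n) KnO) _.
rewrite lee_wpmul2l //; apply: le_integral_ge0.
- by move=> z /KO[Oz _]; rewrite lee_fin f10.
- by move=> z [Oz _]; rewrite lee_fin f10.
- by move=> z /KO.
Qed.

End CoverAndLimit.

(** * Velocities and pulled back metrics in charts *)

Section DerivativeRules.
Context {R : realType} {V : normedModType R}.
Implicit Types (f g : V -> R) (x v : V).

Lemma is_derive_add f g x v df dg : is_derive x v f df -> is_derive x v g dg ->
  is_derive x v (fun y => f y + g y) (df + dg).
Proof. exact: is_deriveD. Qed.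

Lemma is_derive_mul f g x v df dg : is_derive x v f df -> is_derive x v g dg ->
  is_derive x v (fun y => f y * g y) (df * g x + f x * dg).
Proof.
move=> Df Dg; apply: is_derive_eq (is_deriveM Df Dg) _.
by rewrite /GRing.scale/= addrC mulrC.
Qed.

Lemma is_derive_summ n (f : 'I_n -> V -> R) x v (df : 'I_n -> R) :
  (forall i, is_derive x v (f i) (df i)) ->
  is_derive x v (fun y => \sum_i f i y) (\sum_i df i).
Proof.
move=> Df; have -> : (fun y => \sum_i f i y) = \sum_i f i by rewrite fct_sumE.
exact: is_derive_sum.
Qed.

Lemma derive_near (A : set V) f g x v : open A -> A x ->
  (forall y, A y -> f y = g y) -> 'D_v f x = 'D_v g x.
Proof.
move=> oA Ax fg; apply: near_eq_derive.
by have := open_nbhs_nbhs (conj oA Ax); apply: filterS.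
Qed.

Lemma is_derive_val f x v df : is_derive x v f df -> 'D_v f x = df.
Proof. by move=> D; exact: derive_val. Qed.

End DerivativeRules.

Section Charts.
Context {R : realType} {n : nat}.

Lemma chart_atP (M : compact_manifold R n) (x : M) : dom (chart_at x) x.
Proof.
rewrite /chart_at; case: pickP => [i /asboolP //|H]; have [i di] := dom_cover x.
by have /asboolP := H i.
Qed.

Lemma smooth_on_differentiable_rV m k (A : set 'rV[R]_m) (F : 'rV[R]_m -> 'rV[R]_k) x :
  open A -> smooth_on A F -> A x -> differentiable F x.
Proof.
move=> oA sF Ax.
have -> : F = \sum_j (fun y => F y 0 j *: delta_mx 0 j).
  by apply/funext => y; rewrite fct_sumE [LHS]row_sum_delta.
apply: differentiable_sum => j; apply: differentiableZl.
exact: smooth_on_differentiable oA (smooth_on_coord j oA sF) Ax.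
Qed.

Lemma jacobian_smooth m k (A : set 'rV[R]_m) (F : 'rV[R]_m -> 'rV[R]_k) x :
  open A -> smooth_on A F -> A x -> 'J F x = \matrix_(a, b) pd a (fun y => F y 0 b) x.
Proof.
move=> oA sF Ax; have dF := smooth_on_differentiable_rV oA sF Ax.
apply/matrixP => a b; rewrite [RHS]mxE; have := deriveEjacobian (delta_mx 0 a) dF.
rewrite -rowE => /rowP/(_ b); rewrite [in X in _ = X -> _]mxE => <-.
by rewrite derive_coord //; exact: smooth_on_derivable sF Ax.
Qed.

Definition overlap (M : compact_manifold R n) (i j : 'I_(ncharts M).+1) :
  set 'rV[R]_n := phi i @` (dom i `&` dom j).

Lemma overlapP (M : compact_manifold R n) (i j : 'I_(ncharts M).+1) y :
  overlap i j y -> [/\ img i y, dom i (psi i y : M) & dom j (psi i y : M)].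
Proof. by move=> [x [xi xj] <-]; rewrite phiK //; split => //; exists x. Qed.

Lemma overlap_self (M : compact_manifold R n) (i : 'I_(ncharts M).+1) :
  overlap i i = img i.
Proof. by rewrite /overlap setIid. Qed.

Lemma open_overlap (M : compact_manifold R n) (i j : 'I_(ncharts M).+1) :
  open (overlap i j).
Proof. exact: overlap_open. Qed.

Lemma smooth_transition (M : compact_manifold R n) (i j : 'I_(ncharts M).+1) :
  smooth_on (overlap i j) (phi j \o psi i).
Proof. exact: transition_smooth. Qed.

(** The chain rule for the composite of the two transition maps. *)
Lemma jac_transition_inv (M : compact_manifold R n) (i j : 'I_(ncharts M).+1) (x : M) :
  dom i x -> dom j x ->
  'J (phi j \o psi i) (phi i x) *m 'J (phi i \o psi j) (phi j x) = 1%:M.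
Proof.
move=> xi xj; have yA : overlap i j (phi i x) by exists x.
have zA : overlap j i (phi j x) by exists x.
have sij := @smooth_transition M i j; have sji := @smooth_transition M j i.
rewrite (jacobian_smooth (@open_overlap M i j) sij yA).
rewrite (jacobian_smooth (@open_overlap M j i) sji zA).
apply/matrixP => a c; rewrite !mxE.
have E : 'D_(delta_mx 0 a) (fun y : 'rV[R]_n => y 0 c) (phi i x) = (a == c)%:R.
  rewrite -(@derive_coord R _ n id) ?derive_id ?mxE ?eqxx //.
  by rewrite eq_sym.
rewrite -E.
rewrite (@derive_near R _ (overlap i j) _
  ((fun y => (phi i \o psi j) y 0 c) \o (phi j \o psi i)) _ _ (@open_overlap M i j) yA).
  rewrite (is_derive_val (@chain_rule R _ n (fun y => (phi i \o psi j) y 0 c) (phi j \o psi i)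
     (phi i x) (delta_mx 0 a) _ _)).
  - by apply: eq_bigr => b _; rewrite !mxE /= phiK // mulrC.
  - rewrite /= phiK //.
    exact: smooth_on_differentiable (@open_overlap M j i) (smooth_on_coord c (@open_overlap M j i) sji) zA.
  - exact: smooth_on_derivable sij yA.
by move=> y /overlapP[yi xi' xj'] /=; rewrite phiK // (img_psi yi).2.
Qed.

End Charts.

Section Metric.
Context {R : realType} {n : nat}.

(** A row vector in the kernel would have zero length. *)
Lemma metric_unit (M : compact_riemannian R n) (i : 'I_(ncharts M).+1) y :
  img i y -> metric i y \in unitmx.
Proof.
move=> yi; rewrite -row_free_unit -kermx_eq0; apply: contrapT => /negP H.
have v0 : nz_row (kermx (metric i y)) != 0 by rewrite nz_row_eq0.
have := metric_pos yi v0; have /sub_kermxP -> := nz_row_sub (kermx (metric i y)).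
by rewrite mul0mx mxE ltxx.
Qed.

Lemma jac_transition_unit (M : compact_manifold R n) (i j : 'I_(ncharts M).+1) (x : M) :
  dom i x -> dom j x -> 'J (phi j \o psi i) (phi i x) \in unitmx.
Proof.
move=> xi xj; have H := jac_transition_inv xi xj.
by have [H1 _] := mulmx1_unit H; exact: H1.
Qed.

End Metric.

Section SmoothMaps.
Context {R : realType} {n : nat} {M : compact_riemannian R n}.
Context {V : normedModType R} (A : set V) (w : V -> M).
Hypotheses (oA : open A) (sw : smooth_into A w).

Definition chart_part (k : 'I_(ncharts M).+1) : set V := A `&` w @^-1` dom k.

Lemma open_chart_part k : open (chart_part k).
Proof.
rewrite openE => x [Ax xk]; apply: filterI; first exact: open_nbhs_nbhs.
exact: (sw.1 x Ax _ (open_nbhs_nbhs (conj (dom_open k) xk))).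
Qed.

(** Components in chart [k] of the derivative of [w] in direction [v]. *)
Definition velocity k v (x : V) : 'rV[R]_n := \row_l 'D_v (fun z => phi k (w z) 0 l) x.

Definition pullback k v1 v2 (x : V) : R :=
  (velocity k v1 x *m metric k (phi k (w x)) *m (velocity k v2 x)^T) 0 0.

Lemma smooth_component k l : smooth_on (chart_part k) (fun z => phi k (w z) 0 l).
Proof.
apply: (smooth_on_coord (G := phi k \o w)); [exact: open_chart_part|exact: sw.2].
Qed.

Lemma velocity_transition k k' v x : A x -> dom k (w x) -> dom k' (w x) ->
  velocity k' v x = velocity k v x *m 'J (phi k' \o psi k) (phi k (w x)).
Proof.
move=> Ax xk xk'; have yA : overlap k k' (phi k (w x)) by exists (w x).
have oO : open (overlap k k') by exact: open_overlap.
have sT : smooth_on (overlap k k') (phi k' \o psi k) by exact: smooth_transition.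
rewrite (jacobian_smooth oO sT yA); apply/rowP => l; rewrite !mxE.
rewrite (@derive_near R V (chart_part k `&` chart_part k') _
  ((fun y => (phi k' \o psi k) y 0 l) \o (phi k \o w)) _ _).
- rewrite (is_derive_val (@chain_rule R _ n (fun y => (phi k' \o psi k) y 0 l) (phi k \o w) x v _ _)).
  + by apply: eq_bigr => p _; rewrite !mxE mulrC.
  + exact: smooth_on_differentiable oO (smooth_on_coord l oO sT) yA.
  + by apply: smooth_on_derivable (sw.2 k) _.
- by apply: openI; exact: open_chart_part.
- by [].
- by move=> y [[Ay yk] [_ yk']] /=; rewrite phiK.
Qed.

Lemma pullback_chart k k' v1 v2 x : A x -> dom k (w x) -> dom k' (w x) ->
  pullback k v1 v2 x = pullback k' v1 v2 x.
Proof.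
move=> Ax xk xk'; rewrite /pullback !(velocity_transition _ Ax xk xk').
by rewrite (metric_transition xk xk') trmx_mul !mulmxA.
Qed.

Lemma pullbackE k v1 v2 x : pullback k v1 v2 x =
  \sum_l \sum_m metric k (phi k (w x)) l m *
    'D_v1 (fun z => phi k (w z) 0 l) x * 'D_v2 (fun z => phi k (w z) 0 m) x.
Proof.
rewrite /pullback mxE exchange_big; apply: eq_bigr => m _; rewrite !mxE mulr_suml.
by apply: eq_bigr => l _; rewrite !mxE [X in X * _]mulrC.
Qed.

Lemma pullback_sym k v1 v2 x : A x -> dom k (w x) ->
  pullback k v1 v2 x = pullback k v2 v1 x.
Proof.
move=> Ax xk; have ki : img k (phi k (w x)) by exists (w x).
have E (X : 'M[R]_1) : X 0 0 = X^T 0 0 by rewrite mxE.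
by rewrite /pullback E !trmx_mul trmxK Defs.metric_sym // mulmxA.
Qed.

Lemma smooth_metric_along k l m :
  smooth_on (chart_part k) (fun z => metric k (phi k (w z)) l m).
Proof.
apply: (@smooth_on_comp _ _ _ _ _ (img k) (fun y => metric k y l m) (phi k \o w)).
- exact: open_chart_part.
- exact: img_open.
- exact: metric_smooth.
- by move=> x [Ax xk]; exists (w x).
- exact: sw.2.
Qed.

Lemma smooth_pullback k v1 v2 : smooth_on (chart_part k) (pullback k v1 v2).
Proof.
have oC := open_chart_part k.
apply: (@smooth_on_eq _ _ _ _ (fun x => \sum_l \sum_m metric k (phi k (w x)) l m *
    'D_v1 (fun z => phi k (w z) 0 l) x * 'D_v2 (fun z => phi k (w z) 0 m) x)) => //.
  by move=> x _; rewrite pullbackE.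
apply: (smooth_on_sum oC) => l; apply: (smooth_on_sum oC) => m.
apply: (smooth_onM oC); first apply: (smooth_onM oC).
- exact: smooth_metric_along.
- exact: smooth_on_derive (@smooth_component k l).
- exact: smooth_on_derive (@smooth_component k m).
Qed.

Lemma is_derive_metric_along k l m v x : chart_part k x ->
  is_derive x v (fun z => metric k (phi k (w z)) l m)
    (\sum_p pd p (fun y => metric k y l m) (phi k (w x)) * 'D_v (fun z => phi k (w z) 0 p) x).
Proof.
move=> [Ax xk]; have ki : img k (phi k (w x)) by exists (w x).
apply: (@chain_rule R _ n (fun y => metric k y l m) (phi k \o w)).
  apply: smooth_on_differentiable ki; [exact: img_open|exact: metric_smooth].
exact: smooth_on_derivable (sw.2 k) _.
Qed.

Lemma derive_pullback k v v1 v2 x : chart_part k x ->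
  let U l := fun z => phi k (w z) 0 l in
  'D_v (pullback k v1 v2) x = \sum_l \sum_m
    ((\sum_p pd p (fun y => metric k y l m) (phi k (w x)) * 'D_v (U p) x) *
        'D_v1 (U l) x * 'D_v2 (U m) x +
     metric k (phi k (w x)) l m * 'D_v ('D_v1 (U l)) x * 'D_v2 (U m) x +
     metric k (phi k (w x)) l m * 'D_v1 (U l) x * 'D_v ('D_v2 (U m)) x).
Proof.
move=> xC U; have -> : pullback k v1 v2 = (fun x => \sum_l \sum_m
  metric k (phi k (w x)) l m * 'D_v1 (U l) x * 'D_v2 (U m) x).
  by apply/funext => z; rewrite pullbackE.
apply: is_derive_val; apply: is_derive_summ => l; apply: is_derive_summ => m.
have D2 v' l' : is_derive x v ('D_v' (U l')) ('D_v ('D_v' (U l')) x).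
  exact: smooth_is_derive (smooth_on_derive _ (@smooth_component k l')) xC.
apply: is_derive_eq (is_derive_mul (is_derive_mul (is_derive_metric_along l m v xC)
  (D2 v1 l)) (D2 v2 m)) _.
by rewrite mulrDl.
Qed.

End SmoothMaps.

(** * Koszul's formula and chart independence of the tension *)

Section ChristoffelAlgebra.
Context {R : realType} {n : nat}.
Implicit Types (f : 'I_n -> 'I_n -> 'I_n -> R).

Definition sum3 f : R := \sum_p \sum_q \sum_s f p q s.

Lemma sum3_swap12 f : sum3 f = sum3 (fun p q s => f q p s).
Proof. exact: exchange_big. Qed.

Lemma sum3_swap23 f : sum3 f = sum3 (fun p q s => f p s q).
Proof. by apply: eq_bigr => p _; exact: exchange_big. Qed.

Lemma eq_sum3 f f' : (forall p q s, f p q s = f' p q s) -> sum3 f = sum3 f'.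
Proof.
by move=> E; apply: eq_bigr => p _; apply: eq_bigr => q _; apply: eq_bigr => s _.
Qed.

Lemma sum3D f f' : sum3 f + sum3 f' = sum3 (fun p q s => f p q s + f' p q s).
Proof.
rewrite /sum3 -big_split; apply: eq_bigr => p _; rewrite -big_split.
by apply: eq_bigr => q _; rewrite -big_split.
Qed.

Lemma sum3Z c f : c * sum3 f = sum3 (fun p q s => c * f p q s).
Proof.
rewrite /sum3 mulr_sumr; apply: eq_bigr => p _; rewrite mulr_sumr.
by apply: eq_bigr => q _; rewrite mulr_sumr.
Qed.

(** Lowering the upper index of the Christoffel symbols cancels the inverse
    metric in their definition. *)
Lemma lower_christoffel (g : 'rV[R]_n -> 'M[R]_n) y p q m :
  g y \in unitmx -> (g y)^T = g y ->
  \sum_l g y l m * christoffel g l p q y =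
  2^-1 * (pd p (fun y => g y q m) y + pd q (fun y => g y p m) y - pd m (fun y => g y p q) y).
Proof.
move=> gu gs; rewrite /christoffel.
under eq_bigr => l _ do rewrite mulrCA.
rewrite -mulr_sumr; congr (_ * _).
under eq_bigr => l _ do rewrite mulr_sumr.
rewrite exchange_big /= (bigD1 m) //= [X in _ + X]big1 ?addr0.
  under eq_bigr => l _ do rewrite mulrA.
  rewrite -mulr_suml; have := mulmxV gu => /matrixP/(_ m m); rewrite !mxE eqxx.
  under eq_bigr => l _ do rewrite -{1}gs mxE.
  by move=> ->; rewrite mul1r.
move=> s sm; under eq_bigr => l _ do rewrite mulrA.
rewrite -mulr_suml; have := mulmxV gu => /matrixP/(_ m s).
rewrite !mxE eq_sym (negbTE sm) mulr0n.
under eq_bigr => l _ do rewrite -{1}gs mxE.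
by move=> ->; rewrite mul0r.
Qed.

Lemma koszul_rhs_eq (a b c a' b' c' : R) : a = a' -> b = b' -> c = c' ->
  2^-1 * (a + b - c) = 2^-1 * (a' + b' - c').
Proof. by move=> -> -> ->. Qed.

(** The algebraic content of Koszul's formula: [A], [B], [C] are the components of
    three vectors, and [AB], [AC], [CB] those of their mutual derivatives. *)
Lemma koszul_algebra (g : 'rV[R]_n -> 'M[R]_n) y (A B C : 'I_n -> R)
    (AB AC CB : 'I_n -> R) :
  g y \in unitmx -> (g y)^T = g y ->
  let dg p l m := pd p (fun y => g y l m) y in
  \sum_l \sum_m g y l m *
     (AC l + \sum_p \sum_q christoffel g l p q y * A p * C q) * B m =
  2^-1 * (\sum_l \sum_m ((\sum_p dg p l m * A p) * C l * B m
              + g y l m * AC l * B m + g y l m * C l * AB m) +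
          \sum_l \sum_m ((\sum_p dg p l m * C p) * A l * B m
              + g y l m * AC l * B m + g y l m * A l * CB m) -
          \sum_l \sum_m ((\sum_p dg p l m * B p) * A l * C m
              + g y l m * AB l * C m + g y l m * A l * CB m)).
Proof.
move=> gu gs dg.
have gsym l m : g y l m = g y m l by rewrite -{1}gs mxE.
have split3 (X Y Z : 'I_n -> 'I_n -> R) : \sum_l \sum_m (X l m + Y l m + Z l m) =
    \sum_l \sum_m X l m + \sum_l \sum_m Y l m + \sum_l \sum_m Z l m.
  by rewrite -!big_split /=; apply: eq_bigr => l _; rewrite -!big_split.
have dgE (X Y Z : 'I_n -> R) : \sum_l \sum_m (\sum_p dg p l m * X p) * Y l * Z m =
    sum3 (fun p l m => dg p l m * X p * Y l * Z m).
  rewrite sum3_swap12 sum3_swap23; apply: eq_bigr => l _; apply: eq_bigr => m _.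
  by rewrite !mulr_suml.
rewrite !split3 !dgE.
have -> : \sum_l \sum_m g y l m * AB l * C m = \sum_l \sum_m g y l m * C l * AB m.
  rewrite exchange_big; apply: eq_bigr => l _; apply: eq_bigr => m _.
  by rewrite gsym; ring.
have -> : \sum_l \sum_m g y l m *
     (AC l + \sum_p \sum_q christoffel g l p q y * A p * C q) * B m =
    \sum_l \sum_m g y l m * AC l * B m +
    sum3 (fun p q m => 2^-1 * (dg p q m + dg q p m - dg m p q) * A p * C q * B m).
  have -> : sum3 (fun p q m => 2^-1 * (dg p q m + dg q p m - dg m p q) * A p * C q * B m) =
    \sum_l \sum_m g y l m * (\sum_p \sum_q christoffel g l p q y * A p * C q) * B m.
    have -> : sum3 (fun p q m => 2^-1 * (dg p q m + dg q p m - dg m p q) * A p * C q * B m) =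
       sum3 (fun p q m => \sum_l g y l m * christoffel g l p q y * A p * C q * B m).
      apply: eq_sum3 => p q m; rewrite -(lower_christoffel p q m gu gs) !mulr_suml.
      by [].
    rewrite sum3_swap23 sum3_swap12 [RHS]exchange_big; apply: eq_bigr => m _.
    transitivity (\sum_l \sum_p \sum_q g y l m * christoffel g l p q y * A p * C q * B m).
      rewrite [RHS]exchange_big; apply: eq_bigr => p _; exact: exchange_big.
    apply: eq_bigr => l _; rewrite mulr_sumr mulr_suml.
    apply: eq_bigr => p _; rewrite mulr_sumr mulr_suml; apply: eq_bigr => q _; ring.
  rewrite -big_split; apply: eq_bigr => l _; rewrite -big_split; apply: eq_bigr => m _.
  by rewrite mulrDr mulrDl.
have E1 : sum3 (fun p l m => dg p l m * C p * A l * B m) =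
          sum3 (fun p q m => dg q p m * A p * C q * B m).
  by rewrite sum3_swap12; apply: eq_sum3 => p q s; ring.
have E2 : sum3 (fun p l m => dg p l m * B p * A l * C m) =
          sum3 (fun p q m => dg m p q * A p * C q * B m).
  by rewrite sum3_swap12 sum3_swap23; apply: eq_sum3 => p q s; ring.
have -> : sum3 (fun p q m => 2^-1 * (dg p q m + dg q p m - dg m p q) * A p * C q * B m) =
  2^-1 * (sum3 (fun p l m => dg p l m * A p * C l * B m) +
          sum3 (fun p l m => dg p l m * C p * A l * B m) -
          sum3 (fun p l m => dg p l m * B p * A l * C m)).
  rewrite E1 E2 -[- sum3 _]mulN1r sum3Z !sum3D sum3Z; apply: eq_sum3 => p q s; ring.
by field.
Qed.

End ChristoffelAlgebra.

Section Koszul.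
Context {R : realType} {n : nat} {M : compact_riemannian R n}.
Context {V : normedModType R} (A : set V) (w : V -> M).
Hypotheses (oA : open A) (sw : smooth_into A w).

(** The covariant Hessian of [w], paired with a derivative of [w], is
    expressed by first derivatives of the pulled back metric: this is Koszul's
    formula for commuting vector fields. *)
Lemma koszul k va vc vb x : chart_part A w k x ->
  let U l := fun z => phi k (w z) 0 l in
  \sum_l \sum_m metric k (phi k (w x)) l m *
     ('D_va ('D_vc (U l)) x + \sum_p \sum_q christoffel (metric k) l p q (phi k (w x)) *
        'D_va (U p) x * 'D_vc (U q) x) * 'D_vb (U m) x =
  2^-1 * ('D_va (pullback w k vc vb) x + 'D_vc (pullback w k va vb) x
          - 'D_vb (pullback w k va vc) x).
Proof.
move=> xC U; have [Ax xk] := xC; have ki : img k (phi k (w x)) by exists (w x).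
have sc v1 v2 l : 'D_v1 ('D_v2 (U l)) x = 'D_v2 ('D_v1 (U l)) x.
  apply: schwarz xC; [exact: open_chart_part|exact: smooth_component].
rewrite !(derive_pullback oA sw _ _ _ xC) -/U.
have := @koszul_algebra R n (metric k) (phi k (w x)) (fun l => 'D_va (U l) x)
  (fun l => 'D_vb (U l) x) (fun l => 'D_vc (U l) x) (fun l => 'D_va ('D_vb (U l)) x)
  (fun l => 'D_va ('D_vc (U l)) x) (fun l => 'D_vc ('D_vb (U l)) x)
  (metric_unit ki) (Defs.metric_sym ki).
move=> ->; apply: koszul_rhs_eq.
- by [].
- by apply: eq_bigr => l _; apply: eq_bigr => m _; rewrite (sc vc va l).
- by apply: eq_bigr => l _; apply: eq_bigr => m _; rewrite (sc vb va l) (sc vb vc m).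
Qed.

End Koszul.

Section TensionCharts.
Context {R : realType}.

Lemma smooth_into_psi n (M : compact_riemannian R n) (i : 'I_(ncharts M).+1) :
  smooth_into (img i) (psi i : _ -> M).
Proof.
split=> [y|j]; first exact: psi_cts.
apply: smooth_onW (@smooth_transition R n M i j) => y [[x xi <-] /=].
by rewrite phiK // => xj; exists x.
Qed.

(** Transformation law of the Christoffel symbols: Koszul's formula for the
    inverse chart, whose pulled back metric is the metric in that chart. *)
Lemma christoffel_transition n (M : compact_riemannian R n) (i j : 'I_(ncharts M).+1)
    y (a c l : 'I_n) : overlap i j y ->
  let F p := fun y => (phi j \o psi i) y 0 p in
  let y' := phi j (psi i y : M) in
  pd a (pd c (F l)) y + \sum_p \sum_q christoffel (metric j) l p q y' *
      pd a (F p) y * pd c (F q) y =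
  \sum_d christoffel (metric i) d a c y * pd d (F l) y.
Proof.
move=> yij F y'; pose x : M := psi i y.
have [yi xi xj] : [/\ img i y, dom i x & dom j x] := overlapP yij.
have yE : phi i x = y := (img_psi yi).2.
have yC : chart_part (img i) (psi i : _ -> M) j y by [].
have sw := @smooth_into_psi n M i.
have oi : open (img i) by exact: img_open.
have oO : open (overlap i j) by exact: open_overlap.
pose J := 'J (phi j \o psi i) y.
have JE : J = \matrix_(e, b) pd e (F b) y := jacobian_smooth oO (@smooth_transition R n M i j) yij.
have gE e b z : overlap i j z ->
    pullback (psi i : _ -> M) j (delta_mx 0 e) (delta_mx 0 b) z = metric i z e b.
  move=> zij; have [zi zi' zj'] := overlapP zij; rewrite -[in RHS](img_psi zi).2.
  rewrite (metric_transition zi' zj') (img_psi zi).2 pullbackE.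
  rewrite (jacobian_smooth oO (@smooth_transition R n M i j) zij) mxE exchange_big.
  apply: eq_bigr => m _; rewrite !mxE mulr_suml; apply: eq_bigr => l' _.
  by rewrite !mxE [X in X * _]mulrC.
have dgE e b v : 'D_v (pullback (psi i : _ -> M) j (delta_mx 0 e) (delta_mx 0 b)) y =
    'D_v (fun z => metric i z e b) y.
  by apply: (derive_near _ oO yij) => z; exact: gE.
pose Z : 'rV[R]_n := \row_l (pd a (pd c (F l)) y + \sum_p \sum_q
  christoffel (metric j) l p q y' * pd a (F p) y * pd c (F q) y
  - \sum_d christoffel (metric i) d a c y * pd d (F l) y).
have JEm e b : J e b = pd e (F b) y by rewrite JE mxE.
suff Z0 : Z *m metric j y' *m J^T = 0.
  have y'j : img j y' by exists x.
  have Ju : J^T \in unitmx.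
    rewrite unitmx_tr /J -[in 'J _ _]yE; exact: jac_transition_unit.
  have Z1 : Z *m metric j y' = 0 by rewrite -[LHS](mulmxK Ju) Z0 mul0mx.
  have : Z = 0 by rewrite -[LHS](mulmxK (metric_unit y'j)) Z1 mul0mx.
  by move=> /rowP/(_ l); rewrite !mxE => /eqP; rewrite subr_eq0 => /eqP.
apply/rowP => b; rewrite [RHS]mxE mxE.
have K := @koszul R n M _ (img i) (psi i) oi sw j (delta_mx 0 a) (delta_mx 0 c)
  (delta_mx 0 b) y yC.
have yi' : metric i y \in unitmx := metric_unit yi.
have {}K := etrans (etrans K (koszul_rhs_eq (dgE c b _) (dgE a b _) (dgE a c _)))
  (esym (@lower_christoffel R n (metric i) y a c b yi' (Defs.metric_sym yi))).
rewrite /= in K.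
have E1 : \sum_m (Z *m metric j y') 0 m * J^T m b = \sum_l \sum_m metric j y' l m * Z 0 l * J b m.
  rewrite exchange_big; apply: eq_bigr => m _; rewrite !mxE mulr_suml.
  by apply: eq_bigr => l' _; rewrite !mxE [X in X * _]mulrC.
rewrite E1.
have E2 : \sum_d metric i y d b * christoffel (metric i) d a c y =
    \sum_l \sum_m metric j y' l m * (\sum_d christoffel (metric i) d a c y * J d l) * J b m.
  have gi d : metric i y d b = \sum_l \sum_m metric j y' l m * J d l * J b m.
    rewrite -(gE d b y yij) pullbackE; apply: eq_bigr => l' _; apply: eq_bigr => m _.
    by rewrite !JEm.
  under eq_bigr => d _ do rewrite gi mulr_suml.
  rewrite exchange_big; apply: eq_bigr => l' _.
  under eq_bigr => d _ do rewrite mulr_suml.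
  rewrite exchange_big; apply: eq_bigr => m _; rewrite mulr_sumr mulr_suml.
  apply: eq_bigr => d _; ring.
rewrite E2 in K; move/eqP: K; rewrite -subr_eq0 => /eqP K; rewrite -[RHS]K -sumrB.
apply: eq_bigr => l' _; rewrite -sumrB; apply: eq_bigr => m _.
rewrite [X in _ = _ * X - _](_ : _ = J b m); last by rewrite JEm.
rewrite -mulrBl -mulrBr; congr (_ * _ * _); rewrite mxE; congr (_ - _).
by apply: eq_bigr => d _; rewrite JEm.
Qed.

Lemma trace_congruence n (J g Q : 'M[R]_n) : J \in unitmx -> g \in unitmx ->
  \tr (invmx (J *m g *m J^T) *m (J *m Q *m J^T)) = \tr (invmx g *m Q).
Proof.
move=> Ju gu; have JTu : J^T \in unitmx by rewrite unitmx_tr.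
have JgJu : J *m g *m J^T \in unitmx by rewrite !unitmx_mul Ju gu.
have -> : invmx (J *m g *m J^T) = invmx J^T *m invmx g *m invmx J.
  rewrite -[RHS]mulmx1 -(mulmxV JgJu) !mulmxA -[_ *m invmx J *m J]mulmxA mulVmx // mulmx1.
  by rewrite -[_ *m invmx g *m g]mulmxA mulVmx // mulmx1 mulVmx // mul1mx.
rewrite !mulmxA -[_ *m invmx J *m J]mulmxA mulVmx // mulmx1 mxtrace_mulC !mulmxA.
by rewrite mulmxV // mul1mx.
Qed.

Section ChartTension.
Context {n m : nat} {M : compact_riemannian R m} {N : compact_riemannian R n}.

Definition chart_hessian (i : 'I_(ncharts M).+1) (k : 'I_(ncharts N).+1)
    (u : M -> N) (y : 'rV[R]_m) (l : 'I_n) : 'M[R]_m :=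
  let U l := fun y => phi k (u (psi i y)) 0 l in
  \matrix_(a, b) (pd a (pd b (U l)) y - \sum_c christoffel (metric i) c a b y * pd c (U l) y
    + \sum_p \sum_q christoffel (metric k) l p q (phi k (u (psi i y))) *
        pd a (U p) y * pd b (U q) y).

(** Second derivatives of the transition map cancel against the inhomogeneous term
    in [christoffel_transition]. *)
Lemma chart_hessian_transition i j k (u : M -> N) x l :
  smooth_into (img j) (fun y => u (psi j y)) -> dom i x -> dom j x -> dom k (u x) ->
  let J := 'J (phi j \o psi i) (phi i x) in
  chart_hessian i k u (phi i x) l = J *m chart_hessian j k u (phi j x) l *m J^T.
Proof.
move=> su xi xj xk J; have yij : overlap i j (phi i x) by exists x.
have oO : open (overlap i j) by exact: open_overlap.
have oj : open (img j) by exact: img_open.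
have xC : chart_part (img j) (fun y => u (psi j y)) k (phi j x).
  by split; [exists x|rewrite /= phiK].
set C := chart_part _ _ _ in xC; have oC : open C by exact: open_chart_part su _.
pose U l := fun y => phi k (u (psi j y)) 0 l; pose F e := fun y => (phi j \o psi i) y 0 e.
have sU l' : smooth_on C (U l') by exact: (@smooth_component R n N _ _ _ oj su k l').
have sT : smooth_on (overlap i j) (phi j \o psi i) by exact: smooth_transition.
have sF e : smooth_on (overlap i j) (F e) := smooth_on_coord e oO sT.
pose A := overlap i j `&` (phi j \o psi i) @^-1` C.
have Ax : A (phi i x) by split => //=; rewrite phiK.
have oA : open A.
  rewrite openE => z [zij zC]; apply: filterI; first exact: open_nbhs_nbhs.
  exact: (smooth_on_continuous sT zij (open_nbhs_nbhs (conj oC zC))).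
have UE l' z : A z -> phi k (u (psi i z)) 0 l' = (U l' \o (phi j \o psi i)) z.
  by move=> [/overlapP[zi zi' zj] _]; rewrite /= /U phiK.
have D1 l' b z : A z -> pd b (fun y => phi k (u (psi i y)) 0 l') z =
    \sum_e pd e (U l') ((phi j \o psi i) z) * pd b (F e) z.
  move=> Az; have [zij zC] := Az; rewrite /pd (derive_near _ oA Az (UE l')).
  apply: is_derive_val; apply: chain_rule.
    exact: smooth_on_differentiable oC (sU l') zC.
  exact: smooth_on_derivable sT zij.
have xE : (phi j \o psi i) (phi i x) = phi j x by rewrite /= phiK.
have D2 a b : pd a (pd b (fun y => phi k (u (psi i y)) 0 l)) (phi i x) =
    \sum_e ((\sum_f pd f (pd e (U l)) (phi j x) * pd a (F f) (phi i x)) * pd b (F e) (phi i x)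
      + pd e (U l) (phi j x) * pd a (pd b (F e)) (phi i x)).
  rewrite {1}/pd (derive_near _ oA Ax (D1 l b)); apply: is_derive_val.
  apply: is_derive_summ => e; rewrite -!xE; apply: is_derive_mul.
    apply: (@chain_rule R _ m (pd e (U l)) (phi j \o psi i)).
      by apply: smooth_on_differentiable oC (smooth_on_derive _ (sU l)) _; rewrite xE.
    exact: smooth_on_derivable sT yij.
  exact: (smooth_is_derive _ (smooth_on_derive _ (sF e)) yij).
have JE e b : J e b = pd e (F b) (phi i x) by rewrite /J (jacobian_smooth oO sT yij) mxE.
have {}D1 l' b : pd b (fun y => phi k (u (psi i y)) 0 l') (phi i x) =
    \sum_e pd e (U l') (phi j x) * J b e.
  by rewrite (D1 _ _ _ Ax) xE; apply: eq_bigr => e _; rewrite JE.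
apply/matrixP => a b; rewrite mxE D2.
pose H := chart_hessian j k u (phi j x) l.
have -> : (J *m H *m J^T) a b = \sum_e \sum_f H f e * J a f * J b e.
  rewrite mxE; apply: eq_bigr => e _; rewrite !mxE mulr_suml; apply: eq_bigr => f _.
  by rewrite [J a f * _]mulrC.
pose G l' p q := christoffel (metric k) l' p q (phi k (u x)).
have -> : \sum_p \sum_q christoffel (metric k) l p q (phi k (u (psi i (phi i x)))) *
    pd a (fun y => phi k (u (psi i y)) 0 p) (phi i x) *
    pd b (fun y => phi k (u (psi i y)) 0 q) (phi i x) =
    \sum_e \sum_f (\sum_p \sum_q G l p q * pd f (U p) (phi j x) * pd e (U q) (phi j x)) *
       J a f * J b e.
  rewrite phiK //.
  transitivity (\sum_p \sum_q \sum_e \sum_f G l p q * pd f (U p) (phi j x) *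
     pd e (U q) (phi j x) * J a f * J b e).
    apply: eq_bigr => p _; apply: eq_bigr => q _; rewrite !D1 mulr_sumr.
    apply: eq_bigr => e _; rewrite mulr_sumr mulr_suml; apply: eq_bigr => f _.
    by rewrite /G; ring.
  under eq_bigr => p _ do rewrite exchange_big.
  rewrite [LHS]exchange_big; apply: eq_bigr => e _.
  under eq_bigr => p _ do rewrite exchange_big.
  rewrite [LHS]exchange_big; apply: eq_bigr => f _.
  rewrite !mulr_suml; apply: eq_bigr => p _; rewrite !mulr_suml; apply: eq_bigr => q _.
  by [].
have -> : \sum_c christoffel (metric i) c a b (phi i x) *
     pd c (fun y => phi k (u (psi i y)) 0 l) (phi i x) =
   \sum_e pd e (U l) (phi j x) * (pd a (pd b (F e)) (phi i x) +
     \sum_f \sum_g christoffel (metric j) e f g (phi j x) * J a f * J b g).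
  transitivity (\sum_e pd e (U l) (phi j x) *
      \sum_c christoffel (metric i) c a b (phi i x) * pd c (F e) (phi i x)).
    under eq_bigr => c _ do rewrite D1 mulr_sumr.
    rewrite exchange_big; apply: eq_bigr => e _; rewrite mulr_sumr.
    by apply: eq_bigr => c _; rewrite JE; ring.
  apply: eq_bigr => e _; rewrite -(christoffel_transition a b e yij) phiK //.
  congr (_ * (_ + _)); apply: eq_bigr => f _; apply: eq_bigr => g _.
  by rewrite !JE.
have -> : \sum_e pd e (U l) (phi j x) * (pd a (pd b (F e)) (phi i x) +
     \sum_f \sum_g christoffel (metric j) e f g (phi j x) * J a f * J b g) =
   \sum_e pd e (U l) (phi j x) * pd a (pd b (F e)) (phi i x) +
   \sum_e \sum_f (\sum_c christoffel (metric j) c f e (phi j x) * pd c (U l) (phi j x)) * J a f * J b e.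
  under eq_bigr => e _ do rewrite mulrDr.
  rewrite big_split; congr (_ + _).
  under eq_bigr => e _ do rewrite mulr_sumr.
  rewrite [LHS]exchange_big [RHS]exchange_big; apply: eq_bigr => f _.
  under eq_bigr => e _ do rewrite mulr_sumr.
  rewrite [LHS]exchange_big; apply: eq_bigr => g _.
  rewrite !mulr_suml; apply: eq_bigr => e _; ring.
have comb (X Y Z W : R) : X + Y - (Y + Z) + W = X - Z + W by ring.
rewrite [X in X - _]big_split comb -sumrB -big_split; apply: eq_bigr => e _.
rewrite mulr_suml -sumrB -big_split; apply: eq_bigr => f _.
have -> : H f e = pd f (pd e (U l)) (phi j x)
    - \sum_c christoffel (metric j) c f e (phi j x) * pd c (U l) (phi j x)
    + \sum_p \sum_q G l p q * pd f (U p) (phi j x) * pd e (U q) (phi j x).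
  by rewrite /H /chart_hessian mxE phiK.
by rewrite -!JE /=; ring.
Qed.

Lemma chart_tension_transition i j k (u : M -> N) x l :
  smooth_into (img j) (fun y => u (psi j y)) -> dom i x -> dom j x -> dom k (u x) ->
  \tr (invmx (metric i (phi i x)) *m chart_hessian i k u (phi i x) l) =
  \tr (invmx (metric j (phi j x)) *m chart_hessian j k u (phi j x) l).
Proof.
move=> su xi xj xk; rewrite (chart_hessian_transition l su xi xj xk).
rewrite (metric_transition xi xj) trace_congruence //.
  exact: jac_transition_unit.
by apply: metric_unit; exists x.
Qed.

End ChartTension.

Lemma tension_trace n (S : compact_riemannian R 2) (N : compact_riemannian R n)
    (u : S -> N) x l :
  tension u x 0 l = \tr (invmx (metric_at x) *m
    (chart_hessian (chart_at x) (chart_at (u x)) u (phi (chart_at x) x) l)^T).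
Proof.
rewrite mxE; apply: eq_bigr => a _; rewrite mxE; apply: eq_bigr => b _.
by rewrite !mxE phiK //; exact: chart_atP.
Qed.

End TensionCharts.

(** * Classical and weak differentials *)

Section SupportedIntegrals.
Context {R : realType}.
Notation leb2 := (@leb2 R).
Notation RR := (measurableTypeR R * measurableTypeR R)%type.

Lemma integrable_restrict (A K : set RR) (w : RR -> R) : measurable A -> measurable K ->
  K `<=` A -> (forall z, A z -> ~ K z -> w z = 0) ->
  leb2.-integrable K (EFin \o w) -> leb2.-integrable A (EFin \o w).
Proof.
move=> mA mK KA w0 wK; apply/(integrable_mkcond _ mA).
have -> : (EFin \o w) \_ A = (EFin \o w) \_ K.
  apply/funext => z; rewrite /patch; case: ifPn => [/set_mem Az|/negP zA].
    by case: ifPn => // /negP zK; rewrite /= w0 // => Kz; apply: zK; rewrite inE.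
  by rewrite ifF //; apply/negP => /set_mem Kz; apply: zA; rewrite inE; exact: KA.
exact/(integrable_mkcond _ mK).
Qed.

Lemma supp_integrable (A K : set 'rV[R]_2) (w : 'rV[R]_2 -> R) : open A ->
  compact K -> K `<=` A -> (forall y, A y -> {for y, continuous w}) ->
  (forall y, A y -> ~ K y -> w y = 0) ->
  leb2.-integrable (pt @^-1` A : set RR) (EFin \o (w \o pt)).
Proof.
move=> oA cK KA cw w0; apply: (@integrable_restrict _ (pt @^-1` K)).
- exact: measurable_open2.
- by apply: measurable_closed2; exact: compact_closed_rV.
- by move=> z /KA.
- by move=> z; exact: w0.
- exact: continuous_integrable2 cw.
Qed.

Lemma test_bound (A : set 'rV[R]_2) eta : test_function A eta ->
  exists2 C, 0 <= C & forall z, `|eta z| <= C.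
Proof.
move=> [se [K [cK _ K0]]]; have [M M0 KM] := compact_sub_square cK.
apply: (@bounded_support R 2 eta M).
  by move=> y; exact: (smooth_on_continuous se I).
by move=> z zM; apply: K0 => /KM; rewrite leNgt zM.
Qed.

Lemma weak_integrable (A : set 'rV[R]_2) w eta : open A -> locally_integrable2 A w ->
  test_function A eta ->
  leb2.-integrable (pt @^-1` A : set RR) (fun z => (w (pt z) * eta (pt z))%:E).
Proof.
move=> oA lw te; have [C C0 HC] := test_bound te; have [se [K [cK KA K0]]] := te.
have mK : measurable (pt @^-1` K : set RR).
  by apply: measurable_closed2; exact: compact_closed_rV.
apply: (@integrable_restrict _ (pt @^-1` K)) => //.
- exact: measurable_open2.
- by move=> z /KA.
- by move=> z _ /K0 /= ->; rewrite mulr0.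
- have := @integrableMl _ RR R leb2 _ mK (fun z => (w (pt z))%:E) (eta \o pt).
  apply.
  + exact: lw.
  + apply: (measurable_funS (E := setT)) => //.
    have := @continuous_measurable2 R setT eta openT; rewrite preimage_setT; apply.
    by move=> y _; exact: (smooth_on_continuous se I).
  + exists C; split; first exact: num_real.
    by move=> r Cr z _; exact: le_trans (HC _) (ltW Cr).
Qed.

Lemma pd_zero_off (K : set 'rV[R]_2) (f : 'rV[R]_2 -> R) a : closed K ->
  (forall y, ~ K y -> f y = 0) -> forall y, ~ K y -> pd a f y = 0.
Proof.
move=> cK f0 y Ky; have oK : open (~` K) by exact: closed_openC.
rewrite /pd (derive_near (g := cst 0) _ oK Ky); last by move=> z; exact: f0.
exact: derive_cst.
Qed.

(** Integration by parts: the products with test functions have compact support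
    in [A]. *)
Lemma weak_pd_smooth (A : set 'rV[R]_2) (F wa : 'rV[R]_2 -> R) a : open A ->
  smooth_on A F -> (forall y, A y -> wa y = pd a F y) -> weak_pd A a F wa.
Proof.
move=> oA sF waE; have cF y : A y -> {for y, continuous F} by exact: smooth_on_continuous.
have cdF y : A y -> {for y, continuous (pd a F)}.
  exact: smooth_on_continuous (smooth_on_derive _ sF).
have lw : locally_integrable2 A wa.
  move=> K cK KA.
  have mK : measurable (pt @^-1` K : set RR).
    by apply: measurable_closed2; exact: compact_closed_rV.
  apply: (@eq_integrable _ RR R leb2 _ mK (EFin \o (pd a F \o pt))).
    by move=> z /set_mem Kz /=; rewrite waE //; exact: KA.
  exact: continuous_integrable2 cdF.
split => //; first by move=> K cK KA; exact: continuous_integrable2 cF.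
move=> eta te; have [se [K [cK KA K0]]] := te; have clK := compact_closed_rV cK.
have mA : measurable (pt @^-1` A : set RR) by exact: measurable_open2.
have ceta y : {for y, continuous eta} := smooth_on_continuous se I.
have cdeta y : {for y, continuous (pd a eta)} := smooth_on_continuous (smooth_on_derive _ se) I.
have I1 : leb2.-integrable (pt @^-1` A : set RR) (fun z => (F (pt z) * pd a eta (pt z))%:E).
  apply: (@supp_integrable A K (fun y => F y * pd a eta y)) => //.
    by move=> y Ay; apply: continuousM; [exact: cF|exact: cdeta].
  by move=> y _ Ky; rewrite (pd_zero_off _ clK K0) ?mulr0.
have I2 := weak_integrable oA lw te.
have sG : smooth_on A (fun y => F y * eta y).
  have se' : smooth_on A eta := smooth_onW (@subsetT _ A) se.
  exact: (smooth_onM oA sF se').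
have G0 y : ~ K y -> F y * eta y = 0 by move=> /K0 ->; rewrite mulr0.
have E : (\int[leb2]_(z in pt @^-1` A) (F (pt z) * pd a eta (pt z))%:E +
   \int[leb2]_(z in pt @^-1` A) (wa (pt z) * eta (pt z))%:E = 0)%E.
  rewrite -integralD // -[RHS](integral_pd_compact a oA cK KA sG G0) integral_mkcond.
  apply: eq_integral => z _; rewrite /patch; case: ifPn => [/set_mem Az|/negP zA].
    rewrite -EFinD; congr EFin.
    have De : is_derive (pt z) (delta_mx 0 a) eta (pd a eta (pt z)).
      exact: smooth_is_derive se I.
    have DF : is_derive (pt z) (delta_mx 0 a) F (pd a F (pt z)).
      exact: smooth_is_derive sF Az.
    by rewrite {2}/pd (is_derive_val (is_derive_mul DF De)) waE // addrC.
  rewrite (pd_zero_off _ clK G0) // => /KA Az; apply: zA.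
  by rewrite inE.
rewrite /Rintegral; apply/eqP; rewrite -addr_eq0 -fineD ?E //; exact: integrable_fin_num.
Qed.

End SupportedIntegrals.

Section WeakDifferential.
Context {R : realType} {n : nat}.
Context {S : compact_riemannian R 2} {N : compact_riemannian R n}.
Notation leb2 := (@leb2 R).
Notation RR := (measurableTypeR R * measurableTypeR R)%type.

Lemma pd_transition m (M : compact_manifold R m) (i j : 'I_(ncharts M).+1)
    (g : M -> R) x a : dom i x -> dom j x -> differentiable (g \o psi j) (phi j x) ->
  pd a (g \o psi i) (phi i x) =
  \sum_e 'J (phi j \o psi i) (phi i x) a e * pd e (g \o psi j) (phi j x).
Proof.
move=> xi xj dg; have yij : overlap i j (phi i x) by exists x.
have oO : open (overlap i j) by exact: open_overlap.
have sT : smooth_on (overlap i j) (phi j \o psi i) by exact: smooth_transition.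
have E y : overlap i j y -> (g \o psi i) y = ((g \o psi j) \o (phi j \o psi i)) y.
  by move=> /overlapP[yi yi' yj] /=; rewrite phiK.
rewrite {1}/pd (derive_near _ oO yij E).
have xE : (phi j \o psi i) (phi i x) = phi j x by rewrite /= phiK.
rewrite (is_derive_val (@chain_rule R _ m (g \o psi j) (phi j \o psi i) _ _ _ _)).
- by apply: eq_bigr => e _; rewrite xE (jacobian_smooth oO sT yij) mxE mulrC.
- by rewrite xE.
- exact: smooth_on_derivable sT yij.
Qed.

Definition smooth_map (w : S -> N) : Prop := forall i : 'I_(ncharts S).+1,
  smooth_into (img i) (fun y => w (psi i y)).

Definition classical_diff (w : S -> N) (x : S) : 'M[R]_(2, n) :=
  \matrix_(a, l) pd a (fun y => phi (chart_at (w x)) (w (psi (chart_at x) y)) 0 l)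
    (phi (chart_at x) x).

Lemma smooth_function_map (f : N -> R) w i : smooth_function f -> smooth_map w ->
  smooth_on (img i) (f \o w \o psi i).
Proof.
move=> sf sw; have oi : open (img i) by exact: img_open.
apply: smooth_on_local => y yi; pose k := chart_at (w (psi i y)).
have oC : open (chart_part (img i) (fun y => w (psi i y)) k).
  exact: (open_chart_part oi (sw i)).
exists (chart_part (img i) (fun y => w (psi i y)) k).
  by split => //; exact: chart_atP.
apply: (@smooth_on_eq _ _ _ _ ((f \o psi k) \o (phi k \o (fun y => w (psi i y))))) => //.
  by move=> z [_ zk] /=; rewrite phiK.
apply: (@smooth_on_comp _ _ _ oC n (img k)).
- exact: img_open.
- exact: sf.
- by move=> z [_ zk]; exists (w (psi i z)).
- exact: (sw i).2.
Qed.

Lemma pullback_classical (f : N -> R) w i y a : smooth_function f -> smooth_map w ->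
  img i y -> pullback_diff f w (classical_diff w) i y a 0 = pd a (f \o w \o psi i) y.
Proof.
move=> sf sw yi; pose x : S := psi i y; have [xi xE] := img_psi yi; rewrite -/x in xi xE.
pose j := chart_at x; have xj : dom j x by exact: chart_atP.
pose k := chart_at (w x); have wk : dom k (w x) by exact: chart_atP.
have oj : open (img j) by exact: img_open.
have xj' : img j (phi j x) by exists x.
have sfw : smooth_on (img j) ((f \o w) \o psi j) by exact: smooth_function_map.
rewrite -xE (pd_transition (g := f \o w) a xi xj); last first.
  exact: smooth_on_differentiable oj sfw xj'.
rewrite /pullback_diff mxE; apply: eq_bigr => e _; rewrite -/x xE; congr (_ * _).
rewrite !mxE; pose C := chart_part (img j) (fun y => w (psi j y)) k.
have oC : open C by exact: (open_chart_part oj (sw j)).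
have xC : C (phi j x) by split => //=; rewrite phiK.
rewrite {1}/pd (@derive_near _ _ C _ ((f \o psi k) \o (phi k \o (fun y => w (psi j y)))) _ _ oC xC); last first.
  by move=> z [_ zk] /=; rewrite phiK.
have kE : (phi k \o (fun y => w (psi j y))) (phi j x) = phi k (w x) by rewrite /= phiK.
have wk' : img k (phi k (w x)) by exists (w x).
have ok : open (img k) by exact: img_open.
rewrite (is_derive_val (@chain_rule _ _ _ (f \o psi k) (phi k \o (fun y => w (psi j y))) _ _ _ _)).
- by apply: eq_bigr => l _; rewrite !mxE kE mulrC.
- by rewrite kE; exact: smooth_on_differentiable ok (sf k) wk'.
- by apply: smooth_on_derivable ((sw j).2 k) _.
Qed.

(** For smooth maps the chain rule holds pointwise, and classical derivatives are
    weak ones. *)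
Lemma classical_weak w : smooth_map w -> weak_differential w (classical_diff w).
Proof.
move=> sw f sf i a; apply: weak_pd_smooth.
- exact: img_open.
- exact: smooth_function_map.
- by move=> y yi; exact: pullback_classical.
Qed.

(** The difference is orthogonal to all test functions. *)
Lemma weak_pd_unique (A : set 'rV[R]_2) a w wa wb : open A ->
  weak_pd A a w wa -> weak_pd A a w wb ->
  exists Z : set RR, [/\ measurable Z, leb2 Z = 0%E &
    forall z, A (pt z) -> ~ Z z -> wa (pt z) = wb (pt z)].
Proof.
move=> oA [_ la Ha] [_ lb Hb].
have [|eta te|Z [mZ Z0 HZ]] := @weakly_zero_ae R A (fun y => wa y - wb y) oA.
- move=> K cK KA; have mK : measurable (pt @^-1` K : set RR).
    by apply: measurable_closed2; exact: compact_closed_rV.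
  exact: (integrableB mK (la K cK KA) (lb K cK KA)).
- have Ia := weak_integrable oA la te; have Ib := weak_integrable oA lb te.
  have mA : measurable (pt @^-1` A : set RR) by exact: measurable_open2.
  under eq_integral => z _ do rewrite mulrBl EFinB.
  rewrite integralB //.
  have := Ha eta te; rewrite (Hb eta te) => /oppr_inj H.
  rewrite -[X in (X - _)%E]fineK; last exact: integrable_fin_num.
  rewrite -[X in (_ - X)%E]fineK; last exact: integrable_fin_num.
  by move: H; rewrite /Rintegral => ->; rewrite subee.
exists Z; split => // z Az nZ; apply/eqP; rewrite -subr_eq0; apply/eqP.
exact: HZ.
Qed.

(** The functions are a cutoff and its products with the coordinates; where the
    cutoff is positive, the differentials of these products recover those of the
    coordinates. *)
Lemma local_separation (q : N) : exists B : set N, exists f : 'I_n.+1 -> N -> R,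
  [/\ open B, B q, forall l, smooth_function (f l) &
   forall q' m (X : 'M[R]_(m, n)), B q' ->
     (forall l, X *m cov_diff (f l) q' = 0) -> X = 0].
Proof.
pose k := chart_at q; have qk : dom k q by exact: chart_atP.
pose c := phi k q; have ok : open (img k) by exact: img_open.
have ck : img k c by exists q.
have /nbhs_ballP[d /= d0 dk] := open_nbhs_nbhs (conj ok ck).
pose r := d / 4; have r0 : 0 < r by rewrite divr_gt0.
pose K : set 'rV[R]_n := [set y | `|y - c| <= 2 * r].
have cK : compact K by exact: compact_square.
have Kk : K `<=` img k.
  move=> y /= yc; apply: dk; rewrite -ball_normE/= distrC (le_lt_trans yc) //.
  by rewrite /r; lra.
have chi0 y : ~ K y -> cutoff c r y = 0.
  by move=> /negP; rewrite -ltNge => yK; apply: cutoff_support => //; exact: ltW.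
pose F (l : 'I_n.+1) (y : 'rV[R]_n) : R :=
  if unlift ord0 l is Some l' then cutoff c r y * y 0 l' else cutoff c r y.
have sF l : smooth_on [set: 'rV[R]_n] (F l).
  rewrite /F; case: unliftP => [l' _|_]; last exact: smooth_on_cutoff.
  apply: (smooth_onM openT); first exact: smooth_on_cutoff.
  exact: (@smooth_on_coordinate R n setT l' openT).
have F0 l y : ~ K y -> F l y = 0.
  by move=> /chi0; rewrite /F; case: unlift => [l'|] ->; rewrite ?mul0r.
pose B : set N := dom k `&` phi k @^-1` [set y | 0 < cutoff c r y].
have cchi : continuous (cutoff c r).
  by move=> y; exact: (smooth_on_continuous (@smooth_on_cutoff R n c r) I).
exists B, (fun l => extend0 k (F l)); split.
- rewrite openE => x [xk xc]; apply: filterI.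
    by apply: open_nbhs_nbhs; split => //; exact: dom_open.
  have oP : open [set y : 'rV[R]_n | 0 < cutoff c r y].
    by apply: (open_comp (f := cutoff c r) (D := [set x | 0 < x])) => //; exact: open_gt.
  exact: (phi_continuous xk (open_nbhs_nbhs (conj oP xc))).
- by split => //=; exact: cutoff_center.
- by move=> l; exact: smooth_extend0 (sF l) cK Kk (F0 l).
move=> q' m X [q'k q'c] HX; pose k' := chart_at q'.
have q'k' : dom k' q' by exact: chart_atP.
pose J := 'J (phi k \o psi k') (phi k' q').
have Ju : J \in unitmx by exact: jac_transition_unit.
have q'i : img k (phi k q') by exists q'.
have E l : X *m J *m (\col_e pd e (F l) (phi k q')) = 0.
  rewrite -mulmxA -[RHS](HX l); congr (_ *m _); apply/colP => b; rewrite !mxE.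
  have sE : smooth_on (img k) (extend0 k (F l) \o psi k).
    have sE0 : smooth_function (extend0 k (F l) : N -> R).
      exact: smooth_extend0 (sF l) cK Kk (F0 l).
    exact: sE0.
  rewrite (@pd_transition n N k' k (extend0 k (F l)) q' b q'k' q'k); last first.
    exact: smooth_on_differentiable ok sE q'i.
  apply: eq_bigr => e _; rewrite !mxE; congr (_ * _).
  apply: (derive_near _ ok q'i) => y yk; have [yd yE] := img_psi yk.
  by rewrite /= extend0E // yE.
suff XJ0 : X *m J = 0 by rewrite -[X](mulmxK Ju) XJ0 mul0mx.
move: (X *m J) E => Y E; apply/matrixP => i l; have := E ord0 => /matrixP/(_ i 0).
have := E (lift ord0 l) => /matrixP/(_ i 0); rewrite !mxE /F liftK unlift_none.
have D e : pd e (fun y : 'rV[R]_n => cutoff c r y * y 0 l) (phi k q') =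
   pd e (cutoff c r) (phi k q') * phi k q' 0 l + cutoff c r (phi k q') * (e == l)%:R.
  have D1 := smooth_is_derive (delta_mx 0 e) (@smooth_on_cutoff R n c r) (I : setT (phi k q')).
  have D2 : is_derive (phi k q') (delta_mx 0 e) (fun y : 'rV[R]_n => y 0 l) (e == l)%:R.
    apply: is_derive_eq (@is_derive_coord R _ n id l (phi k q') (delta_mx 0 e) _) _.
      exact: derivable_id.
    by rewrite derive_id mxE eqxx eq_sym.
  exact: is_derive_val (is_derive_mul D1 D2).
under eq_bigr => e _ do rewrite mxE D mulrDr mulrA.
rewrite big_split /= -mulr_suml => H1; under eq_bigr => e _ do rewrite mxE.
move=> H0; move: H1; rewrite H0 mul0r add0r (bigD1 l) //= big1 ?addr0.
  by rewrite eqxx mulr1 => /eqP; rewrite mulf_eq0 (gt_eqF q'c) orbF => /eqP ->.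
by move=> e /negbTE ->; rewrite !mulr0.
Qed.

(** The sets given by [local_separation] are reduced to finitely many by
    compactness; on each of them finitely many functions determine the
    differential, and for each function [weak_pd_unique] applies. *)
Lemma weak_differential_unique (w : S -> N) D D' (j : 'I_(ncharts S).+1) :
  weak_differential w D -> weak_differential w D' ->
  exists Z : set RR, [/\ measurable Z, leb2 Z = 0%E &
    forall z, img j (pt z) -> chart_at (psi j (pt z) : S) = j -> ~ Z z ->
      D (psi j (pt z)) = D' (psi j (pt z))].
Proof.
move=> wD wD'; have oj : open (img j) by exact: img_open.
have nullU (P : RR -> Prop) (Q Q' : RR -> Prop) :
    (exists Z : set RR, [/\ measurable Z, leb2 Z = 0%E & forall z, P z -> ~ Z z -> Q z]) ->
    (exists Z : set RR, [/\ measurable Z, leb2 Z = 0%E & forall z, P z -> ~ Z z -> Q' z]) ->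
    exists Z : set RR, [/\ measurable Z, leb2 Z = 0%E & forall z, P z -> ~ Z z -> Q z /\ Q' z].
  move=> [Z [mZ Z0 HZ]] [Z' [mZ' Z'0 HZ']]; exists (Z `|` Z'); split.
  - exact: measurableU.
  - exact: etrans (@measureU0 _ RR R leb2 Z Z' mZ mZ' Z'0) Z0.
  - move=> z Pz nZ; split; [apply: HZ|apply: HZ'] => //.
      by move=> ?; apply: nZ; left.
    by move=> ?; apply: nZ; right.
have nullA (I : finType) (P : RR -> Prop) (Q : I -> RR -> Prop) :
    (forall i, exists Z : set RR, [/\ measurable Z, leb2 Z = 0%E &
      forall z, P z -> ~ Z z -> Q i z]) ->
    exists Z : set RR, [/\ measurable Z, leb2 Z = 0%E &
      forall z, P z -> ~ Z z -> forall i, Q i z].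
  move=> H; suff [Z [mZ Z0 HZ]] : exists Z : set RR, [/\ measurable Z, leb2 Z = 0%E &
      forall z, P z -> ~ Z z -> forall i, i \in enum I -> Q i z].
    by exists Z; split => // z Pz nZ i; apply: HZ => //; rewrite mem_enum.
  elim: (enum I) => [|i s IH].
    by exists set0; split => //; rewrite measure0.
  have [Z [mZ Z0 HZ]] := nullU _ _ _ (H i) IH; exists Z; split => // z Pz nZ i'.
  by have [Hi Hs] := HZ z Pz nZ; rewrite inE => /predU1P[->|/Hs].
have /choice[B HB] (q : N) := local_separation q.
(* Finite subcovers, from the filter of finite sequences ordered by inclusion. *)
have [Q NQ] : exists Q : seq N, forall x, exists2 q, q \in Q & B q x.
  pose F : set_system (seq N) := fun A =>
    exists s0 : seq N, forall s : seq N, {subset s0 <= s} -> A s.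
  have FF : Filter F.
    split; first by exists [::].
      move=> X Y [s sX] [s' sY]; exists (s ++ s') => s'' H; split.
        by apply: sX => q qs; apply: H; rewrite mem_cat qs.
      by apply: sY => q qs; apply: H; rewrite mem_cat qs orbT.
    by move=> X Y XY [s sX]; exists s => s' /sX; exact: XY.
  have [|Q HQ] := (compact_near_coveringP [set: N]).1 (@manifold_compact R n N)
      (seq N) F (fun s x => exists2 q, q \in s & B q x) FF.
    move=> q _; have [_ [oB Bq _ _]] := HB q.
    exists (B q, (fun s : seq N => is_true (q \in s)) : set (seq N)) => /=; first split.
    - exact: open_nbhs_nbhs.
    - by exists [:: q] => s; apply; rewrite mem_head.
    - by move=> [x s] [/= Bx qs]; exists q.
  by exists Q => x; exact: (HQ Q (fun _ H => H) x I).
pose P (z : RR) := img j (pt z) /\ chart_at (psi j (pt z) : S) = j.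
suff H q : exists Z : set RR, [/\ measurable Z, leb2 Z = 0%E &
    forall z, P z -> ~ Z z -> B q (w (psi j (pt z))) ->
      D (psi j (pt z)) = D' (psi j (pt z))].
  have [Z [mZ Z0 HZ]] : exists Z : set RR, [/\ measurable Z, leb2 Z = 0%E &
      forall z, P z -> ~ Z z -> forall q, q \in Q -> B q (w (psi j (pt z))) ->
      D (psi j (pt z)) = D' (psi j (pt z))].
    elim: Q {NQ} => [|q s IH]; first by exists set0; split => //; rewrite measure0.
    have [Z [mZ Z0 HZ]] := nullU _ _ _ (H q) IH; exists Z; split => // z Pz nZ q'.
    by have [Hi Hs] := HZ z Pz nZ; rewrite inE => /predU1P[->|/Hs].
  exists Z; split => // z zj zc nZ; have [q qQ Bq] := NQ (w (psi j (pt z))).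
  exact: (HZ z (conj zj zc) nZ q qQ Bq).
have [f [oB Bq sf sep]] := HB q.
have [Z [mZ Z0 HZ]] := nullA ('I_n.+1 * 'I_2)%type (fun z => img j (pt z)) _
  (fun p => weak_pd_unique oj (wD _ (sf p.1) j p.2) (wD' _ (sf p.1) j p.2)).
exists Z; split => // z [zj zc] nZ Bz; apply/eqP; rewrite -subr_eq0; apply/eqP.
apply: (sep (w (psi j (pt z)))) => // l; rewrite mulmxBl; apply/eqP; rewrite subr_eq0.
apply/eqP/colP => a; have := HZ z zj nZ (l, a); rewrite /pullback_diff zc /=.
have -> : 'J (phi j \o psi j) (pt z) = 1%:M.
  have zjj : overlap j j (pt z) by rewrite overlap_self.
  have [zd zE] := img_psi zj.
  have H := jac_transition_inv zd zd; rewrite zE in H.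
  have oO : open (overlap j j) by exact: open_overlap.
  rewrite (jacobian_smooth oO (@smooth_transition R 2 S j j) zjj).
  apply/matrixP => b e; rewrite !mxE.
  rewrite /pd (@derive_near _ _ _ _ (fun y : 'rV[R]_2 => y 0 e) _ _ oO zjj); last first.
    by move=> y; rewrite overlap_self => yj /=; rewrite (img_psi yj).2.
  rewrite -(@derive_coord R _ 2 id) ?derive_id ?mxE ?eqxx //.
  by rewrite eq_sym.
by rewrite !mul1mx.
Qed.

(** [du] is some weak differential, hence agrees almost everywhere with the
    classical one. *)
Lemma du_classical w (j : 'I_(ncharts S).+1) : smooth_map w ->
  exists Z : set RR, [/\ measurable Z, leb2 Z = 0%E &
    forall z, img j (pt z) -> chart_at (psi j (pt z) : S) = j -> ~ Z z ->
      du w (psi j (pt z)) = classical_diff w (psi j (pt z))].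
Proof.
move=> sw; have wc := classical_weak sw.
have wd : weak_differential w (du w).
  by apply: (@xgetPex _ (fun=> 0) [set D | weak_differential w D]); exists (classical_diff w).
exact: (weak_differential_unique j wd wc).
Qed.

End WeakDifferential.

(** * Metrics on surfaces: two by two matrices *)

Section TwoByTwo.
Context {R : realType}.
Implicit Types (g P S : 'M[R]_2).

Lemma det2 g : \det g = g 0 0 * g 1 1 - g 0 1 * g 1 0.
Proof.
have l00 : lift 0 0 = 1 :> 'I_2 by apply/val_inj.
have l10 : lift 1 0 = 0 :> 'I_2 by apply/val_inj.
rewrite (expand_det_row _ 0) sum2 /cofactor !det_mx11 !mxE l00 l10 /=.
by rewrite addn0 expr0 expr1; ring.
Qed.

Lemma invmx2 g : \det g != 0 -> invmx g = (\det g)^-1 *: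
  \matrix_(a, b) (if a == b then (if a == 0 then g 1 1 else g 0 0) else - g a b).
Proof.
move=> d0; have gu : g \in unitmx by rewrite unitmxE unitfE.
set B := (X in _ = X); suff gB : g *m B = 1%:M.
  by rewrite -[B]mul1mx -(mulVmx gu) -mulmxA gB mulmx1.
have d0' := d0; rewrite det2 in d0'.
by apply/matrixP; apply: ord2P; apply: ord2P; rewrite !mxE sum2 !mxE /= det2; field.
Qed.

Lemma trace_invmx2 g P : \det g != 0 -> \tr (invmx g *m P) =
  (\det g)^-1 * (g 1 1 * P 0 0 - g 0 1 * P 1 0 - g 1 0 * P 0 1 + g 0 0 * P 1 1).
Proof.
by move=> d0; rewrite invmx2 // /mxtrace sum2 !mxE !sum2 !mxE /=; ring.
Qed.

Lemma sym2 g : g^T = g -> g 1 0 = g 0 1.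
Proof. by move=> gs; rewrite -[in LHS]gs mxE. Qed.

Lemma posdef2 g : g^T = g -> (forall v : 'rV[R]_2, v != 0 -> 0 < (v *m g *m v^T) 0 0) ->
  [/\ 0 < g 0 0, 0 < g 1 1 & 0 < \det g].
Proof.
move=> gs gp; have q v : (v *m g *m v^T) 0 0 =
   v 0 0 * (g 0 0 * v 0 0 + g 0 1 * v 0 1) + v 0 1 * (g 0 1 * v 0 0 + g 1 1 * v 0 1).
  by rewrite mxE sum2 !mxE !sum2 (sym2 gs); ring.
have pq (x y : R) : (x != 0) || (y != 0) ->
    0 < x * (g 0 0 * x + g 0 1 * y) + y * (g 0 1 * x + g 1 1 * y).
  move=> xy; have := gp (\row_k if k == 0 then x else y); rewrite q !mxE /=; apply.
  apply: contraTneq xy => /rowP E; have := E 0; have := E 1; rewrite !mxE /= => -> ->.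
  by rewrite eqxx.
have E0 : 0 < g 0 0 by have := pq 1 0; rewrite oner_eq0 /=; lra.
have G0 : 0 < g 1 1 by have := pq 0 1; rewrite oner_eq0 orbT /=; lra.
split => //; have := pq (- g 0 1) (g 0 0); rewrite (gt_eqF E0) orbT => /(_ isT).
have -> : - g 0 1 * (g 0 0 * - g 0 1 + g 0 1 * g 0 0) +
  g 0 0 * (g 0 1 * - g 0 1 + g 1 1 * g 0 0) = g 0 0 * \det g.
  by rewrite det2 (sym2 gs); ring.
by rewrite pmulr_rgt0.
Qed.

(** Completing the square expresses the trace by the form [P] at the vector
    [(- g 0 1, g 0 0)]. *)
Lemma trace_ge0 g P : g^T = g -> 0 < g 0 0 -> 0 < \det g ->
  P 1 0 = P 0 1 -> 0 <= P 0 0 ->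
  (forall x y : R, 0 <= x ^+ 2 * P 0 0 + 2 * x * y * P 0 1 + y ^+ 2 * P 1 1) ->
  0 <= \tr (invmx g *m P).
Proof.
move=> gs E0 D0 Ps P0 Pp; rewrite trace_invmx2 ?gt_eqF // (sym2 gs) Ps.
rewrite mulr_ge0 ?invr_ge0 ?(ltW D0) // -(pmulr_rge0 _ E0).
have -> : g 0 0 * (g 1 1 * P 0 0 - g 0 1 * P 0 1 - g 0 1 * P 0 1 + g 0 0 * P 1 1) =
  \det g * P 0 0 + ((- g 0 1) ^+ 2 * P 0 0 + 2 * (- g 0 1) * g 0 0 * P 0 1 + g 0 0 ^+ 2 * P 1 1).
  by rewrite det2 (sym2 gs); ring.
by rewrite addr_ge0 // mulr_ge0 // ltW.
Qed.

Definition tensor_sq g S : R := \tr (invmx g *m S *m invmx g *m S^T).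

(** The norm of a symmetric tensor, by completing squares (Cholesky). *)
Lemma tensor_sqE g S : g^T = g -> 0 < g 0 0 -> 0 < \det g -> S 1 0 = S 0 1 ->
  (g 0 0 * \det g) ^+ 2 * tensor_sq g S =
    (\det g * S 0 0) ^+ 2 + 2 * \det g * (S 0 1 * g 0 0 - S 0 0 * g 0 1) ^+ 2 +
    (S 1 1 * g 0 0 ^+ 2 - 2 * S 0 1 * g 0 0 * g 0 1 + S 0 0 * g 0 1 ^+ 2) ^+ 2.
Proof.
move=> gs E0 D0 Ss; rewrite /tensor_sq -2!mulmxA trace_invmx2 ?gt_eqF //.
have d0 : \det g != 0 by rewrite gt_eqF.
rewrite !mxE !sum2 !mxE !sum2 invmx2 // !mxE /= Ss (sym2 gs).
have -> : g 1 1 = (\det g + g 0 1 ^+ 2) / g 0 0.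
  by rewrite det2 (sym2 gs); field; rewrite gt_eqF.
by field; rewrite d0 gt_eqF.
Qed.

Lemma tensor_sq_ge0 g S : g^T = g -> 0 < g 0 0 -> 0 < \det g -> S 1 0 = S 0 1 ->
  0 <= tensor_sq g S.
Proof.
move=> gs E0 D0 Ss; have ED : 0 < (g 0 0 * \det g) ^+ 2 by rewrite exprn_gt0 ?mulr_gt0.
rewrite -(pmulr_rge0 _ ED) tensor_sqE // !addr_ge0 ?sqr_ge0 //.
by rewrite mulr_ge0 ?sqr_ge0 // mulr_ge0 // ltW.
Qed.

Lemma tensor_sq_swap g S : g^T = g -> 0 < g 0 0 -> 0 < g 1 1 -> 0 < \det g -> S 1 0 = S 0 1 ->
  (g 1 1 * \det g) ^+ 2 * tensor_sq g S =
    (\det g * S 1 1) ^+ 2 + 2 * \det g * (S 0 1 * g 1 1 - S 1 1 * g 0 1) ^+ 2 +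
    (S 0 0 * g 1 1 ^+ 2 - 2 * S 0 1 * g 1 1 * g 0 1 + S 1 1 * g 0 1 ^+ 2) ^+ 2.
Proof.
move=> gs E0 G0 D0 Ss; have d0 : \det g != 0 by rewrite gt_eqF.
rewrite /tensor_sq -2!mulmxA trace_invmx2 //.
rewrite !mxE !sum2 !mxE !sum2 invmx2 // !mxE /= Ss (sym2 gs).
have -> : g 0 0 = (\det g + g 0 1 ^+ 2) / g 1 1.
  by rewrite det2 (sym2 gs); field; rewrite gt_eqF.
by field; rewrite d0 gt_eqF.
Qed.

(** Each of the two expansions of [tensor_sq] as a sum of squares bounds some of
    the entries. *)
Lemma tensor_entry_bound g S : g^T = g -> 0 < g 0 0 -> 0 < g 1 1 -> 0 < \det g ->
  S 1 0 = S 0 1 -> forall a b, `|S a b| <= (g 0 0 + g 1 1) * Num.sqrt (tensor_sq g S).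
Proof.
move=> gs E0 G0 D0 Ss; have T0 := tensor_sq_ge0 gs E0 D0 Ss.
have q0 := tensor_sqE gs E0 D0 Ss; have q1 := tensor_sq_swap gs E0 G0 D0 Ss.
set T := tensor_sq g S in T0 q0 q1 *.
have DE : \det g = g 0 0 * g 1 1 - g 0 1 ^+ 2 by rewrite det2 (sym2 gs) expr2.
move: DE D0 q0 q1 E0 G0; set D := \det g; set E := g 0 0; set F := g 0 1; set G := g 1 1.
set a := S 0 0; set b := S 0 1; set c := S 1 1 => DE D0 q0 q1 E0 G0.
have D20 : 0 < D ^+ 2 by rewrite exprn_gt0.
have aT : a ^+ 2 <= E ^+ 2 * T.
  rewrite -(ler_pM2l D20); have -> : D ^+ 2 * (E ^+ 2 * T) = (E * D) ^+ 2 * T by ring.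
  rewrite q0 exprMn -addrA lerDl addr_ge0 ?sqr_ge0 // mulr_ge0 ?sqr_ge0 //.
  by rewrite mulr_ge0 // ltW.
have cT : c ^+ 2 <= G ^+ 2 * T.
  rewrite -(ler_pM2l D20); have -> : D ^+ 2 * (G ^+ 2 * T) = (G * D) ^+ 2 * T by ring.
  rewrite q1 exprMn -addrA lerDl addr_ge0 ?sqr_ge0 // mulr_ge0 ?sqr_ge0 //.
  by rewrite mulr_ge0 // ltW.
have bT : b ^+ 2 <= (2 * E * G) * T.
  have H : 2 * (b * E - a * F) ^+ 2 <= E ^+ 2 * D * T.
    rewrite -(ler_pM2l D0); have -> : D * (E ^+ 2 * D * T) = (E * D) ^+ 2 * T by ring.
    rewrite q0; have := sqr_ge0 (D * a); have := sqr_ge0 (c * E ^+ 2 - 2 * b * E * F + a * F ^+ 2).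
    by lra.
  rewrite -(ler_pM2l (exprn_gt0 2 E0)).
  have F2 : F ^+ 2 * a ^+ 2 <= F ^+ 2 * (E ^+ 2 * T) by rewrite ler_wpM2l ?sqr_ge0.
  have FEG : F ^+ 2 * (E ^+ 2 * T) <= (E * G) * (E ^+ 2 * T).
    by rewrite ler_wpM2r ?mulr_ge0 ?sqr_ge0 //; lra.
  have := sqr_ge0 (b * E - 2 * a * F); move: H; rewrite DE => H H'.
  have -> : E ^+ 2 * b ^+ 2 = 2 * (b * E - a * F) ^+ 2 + 2 * (F ^+ 2 * a ^+ 2)
       - (b * E - 2 * a * F) ^+ 2 by ring.
  have -> : E ^+ 2 * (2 * E * G * T) = E ^+ 2 * (E * G - F ^+ 2) * T + F ^+ 2 * (E ^+ 2 * T)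
    + (E * G) * (E ^+ 2 * T) by ring.
  lra.
have sq (x k : R) : 0 <= k -> x ^+ 2 <= k ^+ 2 * T -> k <= E + G -> `|x| <= (E + G) * Num.sqrt T.
  move=> k0 xk kEG; apply: (@le_trans _ _ (k * Num.sqrt T)); last by rewrite ler_wpM2r ?sqrtr_ge0.
  rewrite -[leRHS]ger0_norm ?mulr_ge0 ?sqrtr_ge0 // -ler_sqr ?nnegrE ?normr_ge0 //.
  by rewrite !real_normK ?num_real // exprMn sqr_sqrtr.
have EG0 : 0 <= E + G by lra.
have bEG : b ^+ 2 <= (E + G) ^+ 2 * T.
  apply: le_trans bT _; rewrite ler_wpM2r //.
  by have := sqr_ge0 E; have := sqr_ge0 G; rewrite sqrrD; lra.
apply: ord2P; apply: ord2P; rewrite ?Ss -/a -/b -/c.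
- by apply: (sq _ E) => //; lra.
- exact: (sq _ (E + G)).
- exact: (sq _ (E + G)).
- by apply: (sq _ G) => //; lra.
Qed.

End TwoByTwo.

Section SurfaceMetric.
Context {R : realType} {S : compact_riemannian R 2}.

Lemma surface_metric (i : 'I_(ncharts S).+1) y : img i y ->
  [/\ 0 < metric i y 0 0, 0 < metric i y 1 1 & 0 < \det (metric i y)].
Proof. by move=> yi; apply: posdef2 => [|v v0]; [exact: Defs.metric_sym|exact: metric_pos]. Qed.

Definition area_density (i : 'I_(ncharts S).+1) (y : 'rV[R]_2) : R :=
  Num.sqrt (\det (metric i y)).

Lemma jdet_det (F : 'rV[R]_2 -> 'rV[R]_2) (A : set 'rV[R]_2) y : open A ->
  smooth_on A F -> A y -> jdet F y = \det ('J F y).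
Proof.
move=> oA sF Ay; rewrite (jacobian_smooth oA sF Ay) det2 !mxE /jdet /gradF.
by rewrite [X in _ - X]mulrC.
Qed.

Lemma area_density_transition (i j : 'I_(ncharts S).+1) (x : S) : dom i x -> dom j x ->
  area_density i (phi i x) =
  area_density j (phi j x) * `|\det ('J (phi j \o psi i) (phi i x))|.
Proof.
move=> xi xj; rewrite /area_density (metric_transition xi xj) !det_mulmx det_tr.
set d := \det ('J _ _); have xj' : img j (phi j x) by exists x.
have [_ _ D0] := surface_metric xj'.
rewrite (_ : d * _ * d = d ^+ 2 * \det (metric j (phi j x))); last by ring.
by rewrite sqrtrM ?sqr_ge0 // sqrtr_sqr mulrC.
Qed.

Lemma smooth_metric_det (i : 'I_(ncharts S).+1) :
  smooth_on (img i) (fun y => \det (metric i y)).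
Proof.
have oi : open (img i) by exact: img_open.
have sm a b := @metric_smooth R 2 S i a b.
apply: (@smooth_on_eq _ _ _ _ (fun y => metric i y 0 0 * metric i y 1 1
   - metric i y 0 1 * metric i y 1 0)) => //.
  by move=> y _; rewrite det2.
by apply: (smooth_onB oi); apply: (smooth_onM oi); exact: sm.
Qed.

Lemma smooth_metric_trace (i : 'I_(ncharts S).+1) (P : 'rV[R]_2 -> 'M[R]_2) :
  (forall a b, smooth_on (img i) (fun y => P y a b)) ->
  smooth_on (img i) (fun y => \tr (invmx (metric i y) *m P y)).
Proof.
move=> sP; have oi : open (img i) by exact: img_open.
have sm a b := @metric_smooth R 2 S i a b.
apply: (@smooth_on_eq _ _ _ _ (fun y => (\det (metric i y)) `^ (-1) *
  (metric i y 1 1 * P y 0 0 - metric i y 0 1 * P y 1 0 - metric i y 1 0 * P y 0 1 +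
   metric i y 0 0 * P y 1 1))) => //.
  move=> y yi; have [_ _ D0] := surface_metric yi.
  by rewrite trace_invmx2 ?gt_eqF // powR_inv1 // ltW.
apply: (smooth_onM oi).
  apply: (@smooth_on_comp1 _ _ _ oi [set x : R | 0 < x] (fun x => x `^ (-1))
    (fun y => \det (metric i y))).
  - exact: open_gt.
  - exact: smooth_on_powR.
  - by move=> y yi; have [] := surface_metric yi.
  - exact: smooth_metric_det.
apply: (smooth_onD oi); last by apply: (smooth_onM oi); [exact: sm|exact: sP].
apply: (smooth_onB oi); last by apply: (smooth_onM oi); [exact: sm|exact: sP].
by apply: (smooth_onB oi); apply: (smooth_onM oi); (exact: sm || exact: sP).
Qed.

Lemma smooth_area_density (i : 'I_(ncharts S).+1) : smooth_on (img i) (area_density i).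
Proof.
have oi : open (img i) by exact: img_open.
apply: (@smooth_on_eq _ _ _ _ (fun y => (\det (metric i y)) `^ (2^-1))) => //.
  by move=> y yi; have [_ _ /ltW D0] := surface_metric yi; rewrite powR12_sqrt.
apply: (@smooth_on_comp1 _ _ _ oi [set x : R | 0 < x] (fun x => x `^ (2^-1))
    (fun y => \det (metric i y))).
- exact: open_gt.
- exact: smooth_on_powR.
- by move=> y yi; have [] := surface_metric yi.
- exact: smooth_metric_det.
Qed.

End SurfaceMetric.

(** * Energy and stress in a chart *)

Section Pull.
Context {R : realType} {n : nat} {M : compact_riemannian R n}.
Context {V : normedModType R} (A : set V) (w : V -> M).
Hypotheses (oA : open A) (sw : smooth_into A w).

(** The metric pulled back by [w], on constant vector fields. *)
Definition pull (w : V -> M) (v1 v2 x : V) : R := pullback w (chart_at (w x)) v1 v2 x.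

Lemma pull_chart k v1 v2 x : A x -> dom k (w x) -> pull w v1 v2 x = pullback w k v1 v2 x.
Proof. by move=> Ax xk; apply: (pullback_chart oA sw) => //; exact: chart_atP. Qed.

Lemma pull_sym v1 v2 x : A x -> pull w v1 v2 x = pull w v2 v1 x.
Proof. by move=> Ax; apply: (@pullback_sym R n M V A w) => //; exact: chart_atP. Qed.

Lemma smooth_pull v1 v2 : smooth_on A (pull w v1 v2).
Proof.
apply: smooth_on_local => x Ax; pose k := chart_at (w x).
have oC : open (chart_part A w k) by exact: (open_chart_part oA sw).
exists (chart_part A w k); first by split => //; exact: chart_atP.
apply: (@smooth_on_eq _ _ _ _ (pullback w k v1 v2)) => //.
  by move=> y [Ay yk]; rewrite (pull_chart _ _ Ay yk).
exact: (smooth_pullback oA sw).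
Qed.

End Pull.

Lemma continuous_powR_ge0 {R : realType} (T : topologicalType) (f : T -> R) (q : R) y :
  1 <= q -> (forall z, 0 <= f z) -> {for y, continuous f} ->
  {for y, continuous (fun z => f z `^ q)}.
Proof.
move=> q1 f0 cf; have := f0 y; rewrite le_eqVlt => /predU1P[fy0|fy0]; last first.
  apply: (continuous_comp (g := fun x : R => x `^ q)) => //.
  exact: (smooth_on_continuous (@smooth_on_powR R q) fy0).
apply/cvgrPdist_le => e e0; rewrite -fy0 powR0 ?gt_eqF ?(lt_le_trans ltr01) //.
have me0 : 0 < Order.min e 1 by rewrite lt_min e0 ltr01.
have /cvgrPdist_le/(_ _ me0) := cf; rewrite -fy0; apply: filterS => z.
rewrite !sub0r !normrN !ger0_norm ?powR_ge0 // le_min => /andP[ze z1].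
have := f0 z; rewrite le_eqVlt => /predU1P[<-|z0].
  by rewrite powR0 ?gt_eqF ?(lt_le_trans ltr01) // ltW.
by apply: le_trans ze; apply: ge1r_powR => //; rewrite z0.
Qed.

(** The entries of [P] are the values of [h] on the rows of [C]. *)
Lemma gram_psd {R : realType} n (h : 'M[R]_n) (C : 'M[R]_(2, n)) : h^T = h ->
  (forall v : 'rV[R]_n, 0 <= (v *m h *m v^T) 0 0) ->
  let P := C *m h *m C^T in
  [/\ P 1 0 = P 0 1, 0 <= P 0 0 &
   forall x y : R, 0 <= x ^+ 2 * P 0 0 + 2 * x * y * P 0 1 + y ^+ 2 * P 1 1].
Proof.
move=> hs hp P; have Ps : P 1 0 = P 0 1.
  by apply: sym2; rewrite /P !trmx_mul trmxK hs mulmxA.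
have Pp (x y : R) : 0 <= x ^+ 2 * P 0 0 + 2 * x * y * P 0 1 + y ^+ 2 * P 1 1.
  pose v : 'rV[R]_2 := \row_k if k == 0 then x else y.
  have := hp (v *m C); have -> : v *m C *m h *m (v *m C)^T = v *m P *m v^T.
    by rewrite trmx_mul !mulmxA.
  move: Ps; move: P => P Ps; rewrite mxE sum2 !mxE !sum2 !mxE /= Ps.
  by rewrite [X in 0 <= X -> _](_ : _ = x ^+ 2 * P 0 0 + 2 * x * y * P 0 1 + y ^+ 2 * P 1 1) //; ring.
by split => //; have := Pp 1 0; rewrite expr1n expr0n /= mulr0 !mul0r !addr0 mul1r.
Qed.

Lemma metric_ge0 {R : realType} n (M : compact_riemannian R n) (i : 'I_(ncharts M).+1) y
  (v : 'rV[R]_n) : img i y -> 0 <= (v *m metric i y *m v^T) 0 0.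
Proof.
by move=> yi; have [->|v0] := eqVneq v 0; [rewrite !mul0mx mxE|exact/ltW/metric_pos].
Qed.

Section Densities.
Context {R : realType} {n : nat}.
Context {S : compact_riemannian R 2} {N : compact_riemannian R n} (w : S -> N).
Notation leb2 := (@leb2 R).
Notation RR := (measurableTypeR R * measurableTypeR R)%type.
Notation chart := 'I_(ncharts S).+1.

Lemma metric_at_sym m (M : compact_riemannian R m) (x : M) : (metric_at x)^T = metric_at x.
Proof. by apply: Defs.metric_sym; exists x => //; exact: chart_atP. Qed.

Lemma metric_at_ge0 m (M : compact_riemannian R m) (x : M) (v : 'rV[R]_m) :
  0 <= (v *m metric_at x *m v^T) 0 0.
Proof. by apply: metric_ge0; exists x => //; exact: chart_atP. Qed.

Lemma du_normsq_ge0 x : 0 <= du_normsq w x.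
Proof.
have [Ps P0 Pp] := gram_psd (du w x) (metric_at_sym (w x)) (metric_at_ge0 (w x)).
have [E0 _ D0] : [/\ 0 < metric_at x 0 0, 0 < metric_at x 1 1 & 0 < \det (metric_at x)].
  by apply: surface_metric; exists x => //; exact: chart_atP.
exact: trace_ge0 (metric_at_sym x) E0 D0 Ps P0 Pp.
Qed.

Definition pull_mx (i : chart) (y : 'rV[R]_2) : 'M[R]_2 :=
  \matrix_(a, b) pull (fun y => w (psi i y)) (delta_mx 0 a) (delta_mx 0 b) y.

Definition energy_density (i : chart) (y : 'rV[R]_2) : R :=
  2^-1 * \tr (invmx (metric i y) *m pull_mx i y).

Definition stress_mx (i : chart) (y : 'rV[R]_2) : 'M[R]_2 :=
  pull_mx i y - energy_density i y *: metric i y.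

Definition stress_norm (i : chart) (y : 'rV[R]_2) : R :=
  Num.sqrt (tensor_sq (metric i y) (stress_mx i y)).

Definition velocity_mx (i : chart) (y : 'rV[R]_2) : 'M[R]_(2, n) :=
  \matrix_(a, l) velocity (fun y => w (psi i y)) (chart_at (w (psi i y))) (delta_mx 0 a) y 0 l.

Lemma pull_mxE i y : pull_mx i y =
  velocity_mx i y *m metric_at (w (psi i y)) *m (velocity_mx i y)^T.
Proof.
apply/matrixP => a b; rewrite mxE /pull pullbackE mxE exchange_big.
apply: eq_bigr => m _; rewrite !mxE mulr_suml; apply: eq_bigr => l _.
by rewrite !mxE [X in X * _]mulrC.
Qed.

Lemma pull_mx_psd i y : [/\ pull_mx i y 1 0 = pull_mx i y 0 1, 0 <= pull_mx i y 0 0 &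
  forall x x' : R, 0 <= x ^+ 2 * pull_mx i y 0 0 + 2 * x * x' * pull_mx i y 0 1
                       + x' ^+ 2 * pull_mx i y 1 1].
Proof.
rewrite pull_mxE; exact: gram_psd (metric_at_sym _) (metric_at_ge0 _).
Qed.

Lemma energy_density_ge0 i y : img i y -> 0 <= energy_density i y.
Proof.
move=> yi; have [E0 _ D0] := surface_metric yi; have [Ps P0 Pp] := pull_mx_psd i y.
by rewrite mulr_ge0 //; exact: trace_ge0 (Defs.metric_sym yi) E0 D0 Ps P0 Pp.
Qed.

Lemma stress_mx_sym i y : img i y -> stress_mx i y 1 0 = stress_mx i y 0 1.
Proof.
move=> yi; have [Ps _ _] := pull_mx_psd i y.
have E a b : stress_mx i y a b = pull_mx i y a b - energy_density i y * metric i y a b.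
  by rewrite /stress_mx; move: (pull_mx i y) (energy_density i y) => P e; rewrite !mxE.
by rewrite !E Ps (sym2 (Defs.metric_sym yi)).
Qed.

Hypothesis sw : smooth_map w.

Lemma velocity_mx_transition i j (x : S) : dom i x -> dom j x ->
  velocity_mx i (phi i x) = 'J (phi j \o psi i) (phi i x) *m velocity_mx j (phi j x).
Proof.
move=> xi xj; apply/matrixP => a l; rewrite !mxE !phiK //.
pose k := chart_at (w x); have oj : open (img j) by exact: img_open.
pose C := chart_part (img j) (fun y => w (psi j y)) k.
have oC : open C by exact: (open_chart_part oj (sw j)).
have xC : C (phi j x) by split; [exists x|rewrite /= phiK //; exact: chart_atP].
have sC : smooth_on C (fun y => phi k (w (psi j y)) 0 l).
  exact: (@smooth_component R n N _ _ _ oj (sw j) k l).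
have := pd_transition (g := fun z => phi k (w z) 0 l) a xi xj
  (smooth_on_differentiable oC sC xC).
rewrite /pd /= => ->; apply: eq_bigr => e _; congr (_ * _).
by rewrite [RHS]mxE [RHS]mxE (phiK xj).
Qed.

Lemma pull_mx_transition i j (x : S) : dom i x -> dom j x ->
  let J := 'J (phi j \o psi i) (phi i x) in
  pull_mx i (phi i x) = J *m pull_mx j (phi j x) *m J^T.
Proof.
move=> xi xj J; rewrite !pull_mxE !phiK // (velocity_mx_transition xi xj).
by rewrite trmx_mul !mulmxA.
Qed.

Lemma energy_density_transition i j (x : S) : dom i x -> dom j x ->
  energy_density i (phi i x) = energy_density j (phi j x).
Proof.
move=> xi xj; rewrite /energy_density (pull_mx_transition xi xj).
rewrite (metric_transition xi xj) trace_congruence //; first exact: jac_transition_unit.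
by apply: metric_unit; exists x.
Qed.

Lemma stress_mx_transition i j (x : S) : dom i x -> dom j x ->
  let J := 'J (phi j \o psi i) (phi i x) in
  stress_mx i (phi i x) = J *m stress_mx j (phi j x) *m J^T.
Proof.
move=> xi xj J; rewrite /stress_mx (energy_density_transition xi xj).
rewrite (pull_mx_transition xi xj) (metric_transition xi xj) -/J.
by rewrite mulmxBr mulmxBl -scalemxAr -scalemxAl.
Qed.

Lemma stress_norm_transition i j (x : S) : dom i x -> dom j x ->
  stress_norm i (phi i x) = stress_norm j (phi j x).
Proof.
move=> xi xj; rewrite /stress_norm; congr Num.sqrt.
have xj' : img j (phi j x) by exists x.
have gu := metric_unit xj'; have Ju := jac_transition_unit xi xj.
rewrite /tensor_sq (stress_mx_transition xi xj) (metric_transition xi xj).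
move: Ju gu; move: ('J _ _) (metric j _) (stress_mx j _) => J g T Ju gu.
have JTu : J^T \in unitmx by rewrite unitmx_tr.
have E : J^T *m invmx (J *m g *m J^T) *m J = invmx g.
  have gJu : J *m g *m J^T \in unitmx by rewrite !unitmx_mul Ju gu.
  apply: (can_inj (mulKmx gu)); rewrite mulmxV // !mulmxA.
  apply: (can_inj (mulKmx Ju)); rewrite !mulmxA mulmxV // mul1mx mulmx1.
  by [].
rewrite !trmx_mul trmxK -2!mulmxA.
have -> : J *m T *m J^T *m (invmx (J *m g *m J^T) *m (J *m (T^T *m J^T))) =
   J *m (T *m invmx g *m T^T) *m J^T by rewrite -E !mulmxA.
by rewrite trace_congruence // !mulmxA.
Qed.

Lemma classical_velocity (x : S) :
  classical_diff w x = velocity_mx (chart_at x) (phi (chart_at x) x).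
Proof.
by apply/matrixP => a l; rewrite !mxE phiK //; exact: chart_atP.
Qed.

Lemma pullback_metric_classical x : du w x = classical_diff w x ->
  pullback_metric w x = pull_mx (chart_at x) (phi (chart_at x) x).
Proof.
by move=> E; rewrite /pullback_metric E classical_velocity pull_mxE phiK //; exact: chart_atP.
Qed.

Lemma energy_density_classical x : du w x = classical_diff w x ->
  2^-1 * du_normsq w x = energy_density (chart_at x) (phi (chart_at x) x).
Proof. by move=> E; rewrite /du_normsq pullback_metric_classical. Qed.

Lemma stress_norm_classical x : du w x = classical_diff w x ->
  tensor_norm x (stress_energy w x) = stress_norm (chart_at x) (phi (chart_at x) x).
Proof.
move=> E; rewrite /tensor_norm /stress_energy energy_density_classical //.
by rewrite pullback_metric_classical.
Qed.

Lemma smooth_pull_mx i a b : smooth_on (img i) (fun y => pull_mx i y a b).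
Proof.
have oi : open (img i) by exact: img_open.
apply: (@smooth_on_eq _ _ _ _ (pull (fun y => w (psi i y)) (delta_mx 0 a) (delta_mx 0 b))) => //.
  by move=> y _; rewrite mxE.
exact: (smooth_pull oi (sw i)).
Qed.

Lemma smooth_energy_density i : smooth_on (img i) (energy_density i).
Proof.
have oi : open (img i) by exact: img_open.
apply: (smooth_onZ oi); apply: smooth_metric_trace => a b; exact: smooth_pull_mx.
Qed.

Lemma smooth_stress_mx i a b : smooth_on (img i) (fun y => stress_mx i y a b).
Proof.
have oi : open (img i) by exact: img_open.
apply: (@smooth_on_eq _ _ _ _ (fun y => pull_mx i y a b - energy_density i y * metric i y a b)) => //.
  by move=> y _; rewrite !mxE.
apply: (smooth_onB oi); first exact: smooth_pull_mx.
by apply: (smooth_onM oi); [exact: smooth_energy_density|exact: metric_smooth].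
Qed.

Lemma smooth_mulmx (A : set 'rV[R]_2) (X Y : 'rV[R]_2 -> 'M[R]_2) : open A ->
  (forall a b, smooth_on A (fun y => X y a b)) -> (forall a b, smooth_on A (fun y => Y y a b)) ->
  forall a b, smooth_on A (fun y => (X y *m Y y) a b).
Proof.
move=> oA sX sY a b.
apply: (@smooth_on_eq _ _ _ _ (fun y => \sum_c X y a c * Y y c b)) => //.
  by move=> y _; rewrite mxE.
by apply: (smooth_on_sum oA) => c; apply: (smooth_onM oA).
Qed.

Lemma smooth_invmx (i : chart) a b : smooth_on (img i) (fun y => invmx (metric i y) a b).
Proof.
have oi : open (img i) by exact: img_open.
apply: (@smooth_on_eq _ _ _ _ (fun y => \tr (invmx (metric i y) *m delta_mx b a))) => //.
  move=> y _; rewrite /mxtrace sum2 !mxE !sum2 !mxE.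
  by move: a b; apply: ord2P; apply: ord2P; rewrite /=; ring.
apply: (smooth_metric_trace (P := fun=> delta_mx b a)) => c d.
exact: smooth_on_cst.
Qed.

Lemma smooth_tensor_sq i : smooth_on (img i) (fun y => tensor_sq (metric i y) (stress_mx i y)).
Proof.
have oi : open (img i) by exact: img_open.
pose X y := invmx (metric i y) *m stress_mx i y *m invmx (metric i y) *m (stress_mx i y)^T.
apply: (@smooth_on_eq _ _ _ _ (fun y => \sum_a X y a a)) => //.
apply: (smooth_on_sum oi) => a.
apply: (smooth_mulmx (X := fun y => invmx (metric i y) *m stress_mx i y *m invmx (metric i y))
  (Y := fun y => (stress_mx i y)^T) oi) => [{}a b|{}a b].
  apply: (smooth_mulmx (X := fun y => invmx (metric i y) *m stress_mx i y)
    (Y := fun y => invmx (metric i y)) oi) => {}a {}b; last exact: smooth_invmx.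
  apply: (smooth_mulmx (X := fun y => invmx (metric i y)) (Y := stress_mx i) oi) => {}a {}b.
    exact: smooth_invmx.
  exact: smooth_stress_mx.
apply: (@smooth_on_eq _ _ _ _ (fun y => stress_mx i y b a)) => //.
  by move=> y _; rewrite [RHS]mxE.
exact: smooth_stress_mx.
Qed.

Lemma continuous_stress_norm i y : img i y -> {for y, continuous (stress_norm i)}.
Proof.
move=> yi; apply: (continuous_comp (g := @Num.sqrt R)); last exact: sqrt_continuous.
exact: smooth_on_continuous (@smooth_tensor_sq i) yi.
Qed.

Lemma transition_jdet (i j : chart) y : overlap i j y ->
  jdet (phi j \o psi i) y != 0 /\
  `|jdet (phi j \o psi i) y| = `|\det ('J (phi j \o psi i) y)|.
Proof.
move=> yij; have oO : open (overlap i j) by exact: open_overlap.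
rewrite (jdet_det oO (@smooth_transition R 2 S i j) yij); split => //.
have [yi xi xj] := overlapP yij; have := jac_transition_unit xi xj.
by rewrite (img_psi yi).2 unitmxE unitfE.
Qed.

(** The area integral is computed in the charts [chart_at x] instead of [i0]; on
    each of the pieces [cov_le] for the transition map changes the coordinates. *)
Lemma energy_le (i0 : chart) (O : set 'rV[R]_2) (Omega : set S) (B : R) :
  open O -> O `<=` img i0 ->
  (forall x, Omega x -> exists2 y, O y & psi i0 y = x) ->
  (\int[leb2]_(z in pt @^-1` O)
     (energy_density i0 (pt z) * area_density i0 (pt z))%:E <= B%:E)%E ->
  (energy w Omega <= (9 * B *+ (ncharts S).+1)%:E)%E.
Proof.
move=> oO Oi OO IB; pose c0 := (9 * B)%:E.
apply: (@le_trans _ _ (\sum_(j < (ncharts S).+1) c0)%E); last first.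
  by rewrite /c0 sumEFin sumr_const card_ord.
apply: lee_sum => j _; pose F := phi j \o psi i0; pose Oj := overlap i0 j `&` O.
pose f2 y := energy_density j y * area_density j y.
have oj : open (img j) by exact: img_open.
have oOv : open (overlap i0 j) by exact: open_overlap.
have oOj : open Oj by exact: openI.
have sF : smooth_on Oj F.
  by apply: smooth_onW (@smooth_transition R 2 S i0 j) => y [].
have FO y : Oj y -> img j (F y).
  by move=> [/overlapP[yi xi xj] _]; exists (psi i0 y).
have cf2 y : img j y -> {for y, continuous f2}.
  move=> yj; apply: continuousM.
    exact: smooth_on_continuous (@smooth_energy_density j) yj.
  exact: smooth_on_continuous (@smooth_area_density R S j) yj.
have f20 y : img j y -> 0 <= f2 y.
  by move=> yj; rewrite mulr_ge0 ?sqrtr_ge0 ?energy_density_ge0.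
have dF y : Oj y -> jdet F y != 0 by move=> [/transition_jdet[]].
have [Z [mZ Z0 HZ]] := du_classical j sw.
apply: (@le_trans _ _ (\int[leb2]_(z in pt @^-1` (F @` (Oj `&` setT))) (f2 (pt z))%:E)%E).
  apply: (le_integral_off_null mZ Z0).
  - move=> z [zj zc Oz]; rewrite mule_ge0 // lee_fin ?sqrtr_ge0 //.
    by rewrite mulr_ge0 // du_normsq_ge0.
  - by move=> z [y [yO _] yz]; rewrite lee_fin -yz f20 //; exact: FO.
  - move=> z [zj zc Oz] nZ; have [y Oy yx] := OO _ Oz.
    have [xj xE] := img_psi zj; have [xi yE] := img_psi (Oi _ Oy).
    split.
      exists y; last by rewrite /F /= yx xE.
      split => //; split => //; exists (psi j (pt z)); last by rewrite -yx yE.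
      by split => //; rewrite -yx.
    rewrite (energy_density_classical (HZ z zj zc nZ)) zc xE -EFinM.
    by rewrite lee_fin.
apply: le_trans (cov_le oOj oj sF FO cf2 f20 dF closedT) _.
rewrite /c0 EFinM lee_wpmul2l //; apply: le_trans IB; apply: le_integral_ge0.
- by move=> z [/FO Fz _]; rewrite lee_fin mulr_ge0 // f20.
- move=> z /Oi zi; rewrite lee_fin mulr_ge0 ?sqrtr_ge0 //.
  exact: energy_density_ge0.
- move=> z [[zij Oz] _]; split => //; have [zi xi xj] := overlapP zij.
  have zE := (img_psi zi).2.
  rewrite lee_fin /f2 (transition_jdet zij).2 -[in leRHS]zE.
  rewrite (energy_density_transition xi xj) (area_density_transition xi xj).
  by rewrite zE mulrA.
Qed.

Lemma chart_at_first (x : S) (j : chart) : chart_at x = j <->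
  dom j x /\ forall j' : chart, (j' < j)%N -> ~ dom j' x.
Proof.
have H (k : chart) : dom k x -> (chart_at x <= k)%N.
  move=> xk; pose P (i : chart) := `[< dom i x >].
  have kP : k \in enum P by rewrite mem_enum; exact/asboolP.
  have : sorted (fun a b : chart => (a < b)%N) (enum P).
    rewrite /enum_mem -enumT; apply: sorted_filter; first by move=> a b c; exact: ltn_trans.
    have := iota_ltn_sorted 0 (ncharts S).+1; rewrite -val_enum_ord.
    by rewrite sorted_map.
  rewrite /chart_at /pick -/P; case: (enum P) kP => //= a s.
  rewrite inE => /predU1P[-> //|ks] /order_path_min H; apply: ltnW.
  by have /allP/(_ k ks) := H (fun b a c => @ltn_trans b a c).
split=> [<-|[xj Hj]].
  split; first exact: chart_atP.
  by move=> j' jx /H; rewrite leqNgt jx.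
apply/val_inj/eqP; rewrite eqn_leq H //= leqNgt; apply/negP => /Hj; apply.
exact: chart_atP.
Qed.

(** The converse change of coordinates: by [chart_at_first] the part of the chart
    where [chart_at] is [j] is the image of a relatively closed subset of an
    overlap. *)
Lemma stress_le (i0 : chart) (q B : R) : 1 <= q ->
  (area_integral setT (fun x => (tensor_norm x (stress_energy w x) `^ q)%:E) <= B%:E)%E ->
  (\int[leb2]_(z in pt @^-1` img i0)
     (stress_norm i0 (pt z) `^ q * area_density i0 (pt z))%:E <= (9 * B)%:E)%E.
Proof.
move=> q1 IB; pose f2 y := stress_norm i0 y `^ q * area_density i0 y.
have oi0 : open (img i0) by exact: img_open.
have cf2 y : img i0 y -> {for y, continuous f2}.
  move=> yi; apply: continuousM.
    apply: continuous_powR_ge0 => //; first by move=> z; exact: sqrtr_ge0.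
    exact: continuous_stress_norm.
  exact: smooth_on_continuous (@smooth_area_density R S i0) yi.
have f20 y : img i0 y -> 0 <= f2 y.
  by move=> _; rewrite mulr_ge0 ?sqrtr_ge0 ?powR_ge0.
pose E (i j : chart) := overlap i j `&`
  ~` (\bigcup_(j' in [set j' : chart | (j' < j)%N]) overlap i j').
pose W (j : chart) : set RR := pt @^-1` E i0 j.
have EP (i j : chart) y : E i j y <-> img i y /\ chart_at (psi i y : S) = j.
  rewrite chart_at_first; split.
    move=> [yij nO]; have [yi xi xj] := overlapP yij; split => //; split => //.
    move=> j' j'j xj'; apply: nO; exists j' => //; exists (psi i y) => //.
    by rewrite (img_psi yi).2.
  move=> [yi [xj Hj]]; have [xi yE] := img_psi yi; split; first by exists (psi i y).
  by move=> [j' /= j'j /overlapP[_ _]]; exact: Hj.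
have oU (i j : chart) : open (\bigcup_(j' in [set j' : chart | (j' < j)%N]) overlap i j').
  by apply: bigcup_open => j' _; exact: open_overlap.
have mW j : measurable (W j).
  rewrite /W /E preimage_setI; apply: measurableI.
    by apply: measurable_open2; exact: open_overlap.
  by apply: measurable_closed2; apply: open_closedC; exact: oU.
have WU : pt @^-1` img i0 = \big[setU/set0]_(j <- index_enum chart) W j.
  rewrite -bigcup_seq; apply/seteqP; split => z.
    by move=> zi; exists (chart_at (psi i0 (pt z) : S)); [exact: mem_index_enum|exact/EP].
  by move=> [j _ /EP[]].
rewrite WU (ge0_integral_bigsetU _ mW).
- apply: (@le_trans _ _ (\sum_(j < (ncharts S).+1) 9%:E *
     \int[leb2]_(z in [set z | [/\ img j (pt z), chart_at (psi j (pt z) : S) = j &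
        [set: S] (psi j (pt z))]])
      ((tensor_norm (psi j (pt z)) (stress_energy w (psi j (pt z))) `^ q)%:E *
        (Num.sqrt (\det (metric j (pt z))))%:E))%E).
    apply: lee_sum => j _; pose F := phi i0 \o psi j; pose O := overlap j i0.
    pose C := ~` (\bigcup_(j' in [set j' : chart | (j' < j)%N]) overlap j j').
    have cC : closed C by apply: open_closedC; exact: oU.
    have oO : open O by exact: open_overlap.
    have sF : smooth_on O F by exact: smooth_transition.
    have FO y : O y -> img i0 (F y) by move=> /overlapP[yj xj xi]; exists (psi j y).
    have dF y : O y -> jdet F y != 0 by move=> /transition_jdet[].
    have -> : W j = pt @^-1` (F @` (O `&` C)).
      apply/seteqP; split => z.
        move=> Wz; have [zi zc] := (EP _ _ _).1 Wz.
        have [[zij _ xj] nO] : [/\ overlap i0 j (pt z), True & dom j (psi i0 (pt z))] /\ True.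
          by move: Wz => [zij _]; have [] := overlapP zij.
        have [xi zE] := img_psi zi.
        exists (phi j (psi i0 (pt z))); last by rewrite /F /= phiK // zE.
        have Ejj : E j j (phi j (psi i0 (pt z))).
          by apply/EP; split; [exists (psi i0 (pt z))|rewrite phiK].
        by split; [exists (psi i0 (pt z))|case: Ejj].
      move=> [y [yO yC] yz]; rewrite /W /= -yz; apply/EP.
      have [yj xj xi] := overlapP yO; split; first exact: FO.
      rewrite /F /= phiK //.
      have [] : E j j y by split => //; rewrite overlap_self.
      by move=> a b; have [] := (EP j j y).1 (conj a b).
    apply: le_trans (cov_le oO oi0 sF FO cf2 f20 dF cC) _.
    rewrite lee_wpmul2l //; have [Z [mZ Z0 HZ]] := du_classical j sw.
    apply: (le_integral_off_null mZ Z0).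
    + by move=> z [Oz _]; rewrite lee_fin mulr_ge0 // f20 //; exact: FO.
    + by move=> z _; rewrite mule_ge0 // lee_fin ?powR_ge0 ?sqrtr_ge0.
    + move=> z [Oz Cz] nZ; have [zj xj xi] := overlapP Oz.
      have zE := (img_psi zj).2.
      have zc : chart_at (psi j (pt z) : S) = j.
        have [] : E j j (pt z) by split => //; rewrite overlap_self.
        by move=> a b; have [] := (EP j j (pt z)).1 (conj a b).
      split => //; rewrite (stress_norm_classical (HZ z zj zc nZ)) zc zE -EFinM lee_fin.
      rewrite /f2 (transition_jdet Oz).2 -[in leRHS]zE.
      rewrite (stress_norm_transition xj xi) -/(area_density j _).
      by rewrite (area_density_transition xj xi) zE mulrA.
  rewrite -ge0_sume_distrr; first by rewrite EFinM lee_wpmul2l.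
  by move=> j _; apply: integral_ge0 => z _; rewrite mule_ge0 // lee_fin ?powR_ge0 ?sqrtr_ge0.
- exact: index_enum_uniq.
- by move=> j j' _ _ [z [/EP[_ <-] /EP[_ <-]]].
- have mf2 := continuous_measurable2 oi0 cf2.
  by rewrite -WU; apply/measurable_EFinP; exact: mf2.
- by rewrite -WU => z zi; rewrite lee_fin f20.
Qed.

End Densities.

(** * Geodesic balls and coordinate squares *)

Section Distances.
Context {R : realType} {S : compact_riemannian R 2}.
Notation chart := 'I_(ncharts S).+1.
Notation mu := (@lebesgue_measure R).

Lemma smooth_extend_cutoff n (M : compact_manifold R n) (k : 'I_(ncharts M).+1)
    (c : 'rV[R]_n) (r : R) (G : 'rV[R]_n -> R) : 0 < r ->
  (forall y, `|y - c| <= 2 * r -> img k y) -> smooth_on setT G ->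
  smooth_function (extend0 k (fun y => cutoff c r y * G y) : M -> R).
Proof.
move=> r0 ck sG; apply: (@smooth_extend0 _ _ _ _ _ [set y | `|y - c| <= 2 * r]).
- by apply: (smooth_onM openT); [exact: smooth_on_cutoff|].
- exact: compact_square.
- exact: ck.
- move=> y /= /negP; rewrite -ltNge => yK; rewrite cutoff_support ?mul0r //.
  exact: ltW.
Qed.

Lemma smooth_component_curve (c : R -> S) (f : S -> R) : smooth_into setT c ->
  smooth_function f -> smooth_on setT (f \o c).
Proof.
move=> sc sf; apply: smooth_on_local => s _; pose k := chart_at (c s).
have oC : open (chart_part setT c k) by exact: (open_chart_part openT sc).
exists (chart_part setT c k); first by split => //; exact: chart_atP.
apply: (@smooth_on_eq _ _ _ _ ((f \o psi k) \o (phi k \o c))) => //.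
  by move=> z [_ zk] /=; rewrite phiK.
apply: (@smooth_on_comp _ _ _ oC 2 (img k)).
- exact: img_open.
- exact: sf.
- by move=> z [_ zk]; exists (c z).
- exact: sc.2.
Qed.

Lemma quadratic2 (g : 'M[R]_2) (v : 'rV[R]_2) : g^T = g -> (v *m g *m v^T) 0 0 =
  g 0 0 * v 0 0 ^+ 2 + 2 * g 0 1 * v 0 0 * v 0 1 + g 1 1 * v 0 1 ^+ 2.
Proof. by move=> gs; rewrite mxE sum2 !mxE !sum2 (sym2 gs); ring. Qed.

(** The dual metric bounds differentials of functions. *)
Lemma covector_bound (g : 'M[R]_2) (a b : R) (v : 'rV[R]_2) : g^T = g ->
  0 < g 0 0 -> 0 < g 1 1 -> 0 < \det g ->
  (a * v 0 0 + b * v 0 1) ^+ 2 <=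
  (a ^+ 2 + b ^+ 2) * (g 0 0 + g 1 1) * (\det g)^-1 * (v *m g *m v^T) 0 0.
Proof.
move=> gs E0 G0 D0.
rewrite quadratic2 //; set x := v 0 0; set y := v 0 1; set Q := _ + g 1 1 * _.
have cs : (a * x + b * y) ^+ 2 <= (a ^+ 2 + b ^+ 2) * (x ^+ 2 + y ^+ 2).
  rewrite -subr_ge0 (_ : _ - _ = (a * y - b * x) ^+ 2) ?sqr_ge0 //; ring.
apply: le_trans cs _; rewrite -!mulrA ler_wpM2l ?addr_ge0 ?sqr_ge0 //.
rewrite mulrCA ler_pdivlMl //.
have E1 : g 0 0 * Q = (g 0 0 * x + g 0 1 * y) ^+ 2 + \det g * y ^+ 2.
  by rewrite /Q det2 (sym2 gs); ring.
have E2 : g 1 1 * Q = (g 1 1 * y + g 0 1 * x) ^+ 2 + \det g * x ^+ 2.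
  by rewrite /Q det2 (sym2 gs); ring.
rewrite [leRHS]mulrDl E1 E2; have := sqr_ge0 (g 0 0 * x + g 0 1 * y).
have := sqr_ge0 (g 1 1 * y + g 0 1 * x); lra.
Qed.

(** An upper bound for the squared length of the gradient of [f], in terms of the
    partial derivatives. *)
Definition gradient_sq (f : S -> R) (k : chart) (y : 'rV[R]_2) : R :=
  (pd 0 (f \o psi k) y ^+ 2 + pd 1 (f \o psi k) y ^+ 2) *
  (metric k y 0 0 + metric k y 1 1) * (\det (metric k y))^-1.

(** Near each point one chart gives a bound, and [S] is compact. *)
Lemma gradient_bounded (f : S -> R) : smooth_function f ->
  exists2 L, 0 < L & forall x : S, exists2 k : chart, dom k x & gradient_sq f k (phi k x) <= L.
Proof.
move=> sf; pose P (L : R) (x : S) := exists2 k : chart, dom k x & gradient_sq f k (phi k x) <= L.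
have cS := (compact_near_coveringP [set: S]).1 (@manifold_compact R 2 S) R (+oo%R) P _.
have [x _|M [Mr HM]] := cS.
  pose k := chart_at x; have xk : dom k x by exact: chart_atP.
  have xi : img k (phi k x) by exists x.
  have cf a : {for phi k x, continuous (pd a (f \o psi k))}.
    exact: smooth_on_continuous (smooth_on_derive _ (sf k)) xi.
  have cm a b : {for phi k x, continuous (fun y => metric k y a b)}.
    exact: smooth_on_continuous (@metric_smooth R 2 S k a b) xi.
  have cD : {for phi k x, continuous (fun y => \det (metric k y))}.
    exact: smooth_on_continuous (@smooth_metric_det R S k) xi.
  have cg : {for phi k x, continuous (gradient_sq f k)}.
    apply: continuousM; first apply: continuousM.
    - exact: (cvgD (cvgM (cf 0) (cf 0)) (cvgM (cf 1) (cf 1))).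
    - exact: (cvgD (cm 0 0) (cm 1 1)).
    - have [_ _ D0] := surface_metric xi.
      exact: (cvgV (lt0r_neq0 D0) cD).
  have c1 : nbhs x (fun x' => gradient_sq f k (phi k x') < gradient_sq f k (phi k x) + 1).
    have cgx : {for x, continuous (gradient_sq f k \o phi k)}.
      by apply: continuous_comp => //; exact: phi_continuous.
    by apply: (cvgr_lt _ cgx); rewrite ltrDl.
  exists ([set x' | dom k x' /\ gradient_sq f k (phi k x') < gradient_sq f k (phi k x) + 1],
    [set L | gradient_sq f k (phi k x) + 1 <= L]) => /=; first split.
  - by apply: filterI => //; apply: open_nbhs_nbhs; split => //; exact: dom_open.
  - exact: (nbhs_pinfty_ge (num_real _)).
  - move=> [x' L] [/= [x'k x'g] xL]; exists k => //.
    exact: le_trans (ltW x'g) xL.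
exists (`|M| + 1); first by rewrite ltr_wpDl.
by move=> x; apply: HM => //; rewrite (le_lt_trans (ler_norm M)) // ltrDl.
Qed.

Lemma curve_speed (c : R -> S) (s : R) : smooth_into setT c ->
  let v : 'rV[R]_2 := 'D_1 (phi (chart_at (c s)) \o c) (s : R) in
  (v *m metric_at (c s) *m v^T) 0 0 = pull c 1 1 s.
Proof.
move=> sc v; rewrite /pull /pullback; have -> // : v = velocity c (chart_at (c s)) 1 s.
apply/rowP => l; rewrite mxE /v derive_coord //.
by apply: smooth_on_derivable (sc.2 (chart_at (c s))) _; split => //; exact: chart_atP.
Qed.

(** The derivative of [f \o c] is at most the gradient times the speed. *)
Lemma lipschitz_curve (f : S -> R) : smooth_function f ->
  exists2 L, 0 < L & forall c : R -> S, smooth_into setT c ->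
    (`|f (c 1) - f (c 0)|%:E <= L%:E * curve_length c)%E.
Proof.
move=> sf; have [L2 L20 HL] := gradient_bounded sf.
pose L := Num.sqrt L2; have L0 : 0 < L by rewrite sqrtr_gt0.
exists L => // c sc; have sfc := smooth_component_curve sc sf.
have dfc (s : R) : `|'D_1 (f \o c) s| <= L * Num.sqrt (pull c 1 1 s).
  have [k ck gk] := HL (c s); have ki : img k (phi k (c s)) by exists (c s).
  have [E0 G0 D0] := surface_metric ki.
  have oC : open (chart_part setT c k) by exact: (open_chart_part openT sc).
  have sC : chart_part setT c k s by split.
  have ok : open (img k) by exact: img_open.
  have -> : 'D_1 (f \o c) s = pd 0 (f \o psi k) (phi k (c s)) * velocity c k 1 s 0 0 +
      pd 1 (f \o psi k) (phi k (c s)) * velocity c k 1 s 0 1.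
    rewrite (derive_near (g := (f \o psi k) \o (phi k \o c)) _ oC sC); last first.
      by move=> z [_ zk] /=; rewrite phiK.
    rewrite (is_derive_val (@chain_rule _ _ _ (f \o psi k) (phi k \o c) _ _ _ _)).
    - by rewrite sum2 !mxE.
    - exact: smooth_on_differentiable ok (sf k) ki.
    - exact: smooth_on_derivable (sc.2 k) sC.
  have B := covector_bound (pd 0 (f \o psi k) (phi k (c s))) (pd 1 (f \o psi k) (phi k (c s)))
    (velocity c k 1 s) (Defs.metric_sym ki) E0 G0 D0.
  have p0 : 0 <= pull c 1 1 s by exact: metric_at_ge0.
  have pE : (velocity c k 1 s *m metric k (phi k (c s)) *m (velocity c k 1 s)^T) 0 0 = pull c 1 1 s.
    by rewrite (@pull_chart _ _ _ _ setT c openT sc k).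
  rewrite pE -/(gradient_sq f k (phi k (c s))) in B.
  rewrite -[leRHS]ger0_norm ?mulr_ge0 ?sqrtr_ge0 // -ler_sqr ?nnegrE ?normr_ge0 //.
  rewrite !real_normK ?num_real // exprMn !sqr_sqrtr ?(ltW L20) //.
  by apply: le_trans B _; rewrite ler_wpM2r.
have FTC : (\int[mu]_(s in `[0%R, 1%R]) ('D_1 (f \o c) s)%:E = (f (c 1))%:E - (f (c 0))%:E)%E.
  have cont (s : R) : {for s, continuous (f \o c)} by exact: smooth_on_continuous sfc I.
  apply: (continuous_FTC2 (F := f \o c)).
  - exact: ltr01.
  - apply: continuous_subspaceT => s.
    exact: (smooth_on_continuous (smooth_on_derive _ sfc) I).
  - split.
    + by move=> s _; exact: smooth_on_derivable sfc I.
    + by apply: cvg_at_right_filter; exact: cont.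
    + by apply: cvg_at_left_filter; exact: cont.
  - by move=> s _; rewrite derive1E.
have cD : continuous ('D_1 (f \o c)).
  by move=> s; exact: (smooth_on_continuous (smooth_on_derive _ sfc) I).
have mD : measurable_fun (`[0, 1]%classic : set R) (fun s => ('D_1 (f \o c) s)%:E).
  apply/measurable_EFinP; apply: (measurable_funS (E := setT)) => //.
  exact: continuous_measurable_fun.
have -> : (`|f (c 1) - f (c 0)|%:E =
    `| \int[mu]_(s in `[0%R, 1%R]) ('D_1 (f \o c) s)%:E |)%E by rewrite FTC -EFinB abse_EFin.
apply: le_trans (le_abse_integral mu _ mD) _ => //.
have -> : (\int[mu]_(s in `[0%R, 1%R]) `|('D_1 (f \o c) s)%:E| =
    L%:E * \int[mu]_(s in `[0%R, 1%R]) (L^-1 * `|'D_1 (f \o c) s|)%:E)%E.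
  rewrite -ge0_integralZl //.
  - by apply: eq_integral => s _; rewrite -EFinM mulVKf ?gt_eqF.
  - apply/measurable_EFinP; apply: measurable_funM; first exact: measurable_cst.
    by apply: measurableT_comp => //; exact/measurable_EFinP.
  - by move=> s _; rewrite lee_fin mulr_ge0 ?invr_ge0 ?(ltW L0).
  - by rewrite lee_fin ltW.
rewrite lee_wpmul2l ?lee_fin ?(ltW L0) //; apply: le_integral_ge0.
- by move=> s _; rewrite lee_fin mulr_ge0 ?invr_ge0 ?(ltW L0).
- by move=> s _; rewrite lee_fin sqrtr_ge0.
- move=> s Is; split => //.
  have H : L^-1 * `|'D_1 (f \o c) s| <= Num.sqrt (pull c 1 1 s) by rewrite ler_pdivrMl.
  by rewrite -(curve_speed s sc) -lee_fin in H.
Qed.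

(** The coordinates, cut off near [p] and extended by zero, are Lipschitz for the
    distance. *)
Lemma geo_ball_square (i : chart) (p : S) : dom i p ->
  exists C r0 : R, [/\ 0 < C, 0 < r0 & forall r x, 0 < r < r0 -> geo_ball r p x ->
    dom i x /\ `|phi i x - phi i p| < C * r].
Proof.
move=> pi; pose y0 := phi i p; have oi : open (img i) by exact: img_open.
have yi : img i y0 by exists p.
have /nbhs_ballP[d /= d0 dk] := open_nbhs_nbhs (conj oi yi).
pose b := d / 4; have b0 : 0 < b by rewrite divr_gt0.
have sq y : `|y - y0| <= 2 * b -> img i y.
  move=> yc; apply: dk; rewrite -ball_normE/= distrC (le_lt_trans yc) //.
  by rewrite /b; lra.
pose f (G : 'rV[R]_2 -> R) : S -> R := extend0 i (fun y => cutoff y0 b y * G y).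
have sf G : smooth_on setT G -> smooth_function (f G) by exact: smooth_extend_cutoff.
have s1 : smooth_on setT (cst 1 : 'rV[R]_2 -> R) by exact: smooth_on_cst openT.
pose G1 (k : 'I_2) (y : 'rV[R]_2) : R := y 0 k - y0 0 k.
have sG1 k : smooth_on setT (G1 k).
  apply: (smooth_onB openT); first exact: (@smooth_on_coordinate R 2 setT k openT).
  exact: (@smooth_on_cst R _ _ setT (y0 0 k) openT).
have [L0 L00 H0] := lipschitz_curve (sf _ s1).
have /choice[L1 H1] (k : 'I_2) : exists L1, 0 < L1 /\ forall c : R -> S, smooth_into setT c ->
    (`|f (G1 k) (c 1) - f (G1 k) (c 0)|%:E <= L1%:E * curve_length c)%E.
  by have [L1 ? ?] := lipschitz_curve (sf _ (sG1 k)); exists L1.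
pose L := L0 + L1 0 + L1 1.
have Lk k : 0 < L1 k by have [] := H1 k.
have LP : 0 < L by rewrite /L; have := Lk 0; have := Lk 1; lra.
pose m := cutoff y0 b y0; have m0 : 0 < m by exact: cutoff_center.
pose C := 2 * L / m; exists (C + 1), (m / 2 / L); split.
- by rewrite addr_gt0 // divr_gt0 // mulr_gt0.
- by rewrite !divr_gt0.
move=> r x /andP[r0 rL] /ereal_inf_lt[_ [c [sc c0 c1] <-] cr].
have lip (h : S -> R) (K : R) : 0 < K -> K <= L -> (`|h (c 1) - h (c 0)|%:E <= K%:E * curve_length c)%E ->
    `|h x - h p| <= L * r.
  move=> K0 KL; rewrite c0 c1 => H; rewrite -lee_fin; apply: le_trans H _.
  rewrite EFinM; apply: (@le_trans _ _ (K%:E * r%:E)%E).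
    by rewrite lee_wpmul2l ?lee_fin ?(ltW K0) // ltW.
  by rewrite -!EFinM lee_fin ler_wpM2r // ltW.
have fp G : f G p = m * G y0 by rewrite /f extend0E.
have fx0 : m / 2 < f (cst 1) x.
  have LL : L0 <= L by rewrite /L; have := Lk 0; have := Lk 1; lra.
  have := lip _ _ L00 LL (H0 c sc); rewrite fp /= mulr1 ler_distl => /andP[H _].
  have : L * r < m / 2 by rewrite mulrC -ltr_pdivlMr.
  move: H; lra.
have xi : dom i x.
  apply: contrapT => nx; move: fx0; rewrite /f /extend0; case: asboolP => // _.
  by rewrite ltNge ltW // divr_gt0.
split => //; have chi : m / 2 < cutoff y0 b (phi i x).
  by move: fx0; rewrite /f (extend0E _ xi) /= mulr1.
have m20 : 0 < m / 2 by rewrite divr_gt0.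
apply: (@le_lt_trans _ _ (C * r)); last by rewrite mulrDl mul1r ltrDl.
apply: norm_rV_le; first by rewrite !mulr_ge0 ?invr_ge0 ?(ltW r0) ?(ltW m0) ?(ltW LP).
move=> k; have [_ Hk] := H1 k.
have LL : L1 k <= L.
  by move: k {Hk}; apply: ord2P; rewrite /L; have := Lk 0; have := Lk 1; lra.
have := lip _ _ (Lk k) LL (Hk c sc); rewrite fp /f extend0E // /G1 subrr mulr0 subr0.
rewrite normrM (gtr0_norm (lt_trans m20 chi)) => H.
have -> : (phi i x - phi i p) 0 k = phi i x 0 k - y0 0 k by rewrite !mxE.
have : m / 2 * `|phi i x 0 k - y0 0 k| <= L * r.
  by apply: le_trans H; rewrite ler_wpM2r // ltW.
by rewrite -ler_pdivlMl ?divr_gt0 // => /le_trans; apply; rewrite /C invfM invrK; lra.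
Qed.

(** Straight segments are short curves; the parameter [2 s / (1 + s ^ 2)]
    keeps the curve, which must be defined on the whole line, in the segment. *)
Lemma square_geo_ball (i : chart) (p : S) : dom i p ->
  exists c d : R, [/\ 0 < c, 0 < d &
    forall r y, 0 < r -> `|y - phi i p| <= d -> `|y - phi i p| < c * r ->
      geo_ball r p (psi i y)].
Proof.
move=> pi; pose y0 := phi i p; have oi : open (img i) by exact: img_open.
have yi : img i y0 by exists p.
have /nbhs_ballP[d0 /= d00 dk] := open_nbhs_nbhs (conj oi yi).
pose d := d0 / 2; have dp : 0 < d by rewrite divr_gt0.
pose K : set 'rV[R]_2 := [set y | `|y - y0| <= d].
have Ki : K `<=` img i.
  move=> y /= yc; apply: dk; rewrite -ball_normE/= distrC (le_lt_trans yc) //.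
  by rewrite /d; lra.
have [B B0 HB] : exists2 B, 0 < B & forall y, K y -> metric i y 0 0 + metric i y 1 1 <= B.
  have cK : compact K by exact: compact_square.
  have ct : {within K, continuous (fun y => metric i y 0 0 + metric i y 1 1)}.
    apply: continuous_in_subspaceT => y /set_mem /Ki yi'.
    exact: (cvgD (smooth_on_continuous (@metric_smooth R 2 S i 0 0) yi')
      (smooth_on_continuous (@metric_smooth R 2 S i 1 1) yi')).
  have /compact_bounded[M [Mr HM]] := continuous_compact ct cK.
  exists (`|M| + 1); first by rewrite ltr_wpDl.
  move=> y Ky; apply: le_trans (ler_norm _) _; apply: (HM (`|M| + 1)); last by exists y.
  by rewrite (le_lt_trans (ler_norm M)) // ltrDl.
pose La := 2 * Num.sqrt (2 * B).
have La0 : 0 < La by rewrite mulr_gt0 // sqrtr_gt0 mulr_gt0.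
exists La^-1, d; split => //; first by rewrite invr_gt0.
move=> r y r0 yd yr; pose v := y - y0.
pose h (s : R) : R := 2 * s * (1 + s * s) `^ (-1).
have q0 (s : R) : 0 < 1 + s * s by rewrite ltr_wpDr // -expr2 sqr_ge0.
have hE s : h s = 2 * s / (1 + s * s) by rewrite /h powR_inv1 // ltW.
have sid : smooth_on [set: R] (fun s : R => s).
  by apply: (@smooth_on_linear R _ setT) => //; [exact: openT|move=> a x z].
have sh : smooth_on setT h.
  apply: (smooth_onM openT); first by apply: (smooth_onZ openT).
  apply: (@smooth_on_comp1 _ _ _ openT [set x : R | 0 < x] (fun x => x `^ (-1))).
  - exact: open_gt.
  - exact: smooth_on_powR.
  - by move=> s _; exact: q0.
  - apply: (smooth_onD openT); first exact: (@smooth_on_cst R _ _ setT (1 : R) openT).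
    by apply: (smooth_onM openT).
have h1 s : `|h s| <= 1.
  rewrite hE normrM normfV (gtr0_norm (q0 s)) ler_pdivrMr // mul1r ler_norml.
  have := sqr_ge0 (s - 1); have := sqr_ge0 (s + 1); rewrite !expr2 => ? ?.
  by apply/andP; split; lra.
have dh (s : R) : `|'D_1 h s| <= 2.
  have D1 : is_derive s 1 (fun s : R => s) (1 : R) by exact: is_derive_id.
  have Dq : is_derive s 1 (fun s : R => h s * (1 + s * s)) ('D_1 h s * (1 + s * s) + h s * (0 + (1 * s + s * 1))).
    apply: is_derive_mul; first exact: smooth_is_derive sh I.
    exact: (is_derive_add (is_derive_cst (1 : R) s 1) (is_derive_mul D1 D1)).
  have E2 : (fun s : R => h s * (1 + s * s)) = (fun s => 2 * s).
    by apply/funext => z; rewrite hE mulfVK // gt_eqF.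
  have D2 : is_derive s 1 (fun s : R => h s * (1 + s * s)) (0 * s + 2 * 1 : R).
    rewrite E2; apply: (@is_derive_mul R _ (cst 2) (fun s => s)) => //.
  have E3 : 'D_1 h s * (1 + s * s) + h s * (2 * s) = 2.
    by have := is_derive_val Dq; rewrite (is_derive_val D2); lra.
  have hs0 : h s * (1 + s * s) = 2 * s by rewrite hE mulfVK // gt_eqF.
  have := q0 s; have ss := sqr_ge0 s; rewrite expr2 in ss.
  have E4 : 'D_1 h s * ((1 + s * s) * (1 + s * s)) = 2 * (1 - s * s).
    have -> : 'D_1 h s * ((1 + s * s) * (1 + s * s)) =
      ('D_1 h s * (1 + s * s) + h s * (2 * s)) * (1 + s * s) - h s * (1 + s * s) * (2 * s) by ring.
    by rewrite E3 hs0; ring.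
  move=> q; have q2 : 0 < (1 + s * s) * (1 + s * s) by rewrite mulr_gt0.
  have -> : 'D_1 h s = 2 * (1 - s * s) / ((1 + s * s) * (1 + s * s)).
    by rewrite -E4 mulfK // gt_eqF.
  rewrite normrM normfV (gtr0_norm q2) ler_pdivrMr // ler_norml.
  have := mulr_ge0 ss ss; move: (s * s) ss => z z0 zz.
  by apply/andP; split; lra.
pose l (s : R) : 'rV[R]_2 := y0 + h s *: v.
have lK s : K (l s).
  rewrite /K /l /= addrAC subrr add0r normrZ (le_trans _ yd) // ler_piMl //.
have sl : smooth_on setT l.
  apply: (smooth_on_rV openT) => k.
  apply: (@smooth_on_eq R _ _ setT (fun s => y0 0 k + v 0 k * h s) _ openT).
    by move=> s _; rewrite !mxE mulrC.
  apply: (smooth_onD openT); first exact: (@smooth_on_cst R _ _ setT (y0 0 k) openT).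
  exact: (smooth_onZ openT).
pose c (s : R) : S := psi i (l s).
have sc : smooth_into setT c.
  have cc s : {for s, continuous c}.
    apply: (continuous_comp (f := l)); first exact: smooth_on_continuous sl I.
    exact: (psi_cts (Ki _ (lK s))).
  split=> // j; have oA : open ([set: R] `&` c @^-1` dom j).
    rewrite setTI; apply: open_comp; first by move=> s _; exact: cc.
    exact: dom_open.
  have oO : open (overlap i j) by exact: open_overlap.
  have sT := @smooth_transition R 2 S i j.
  have sl' : smooth_on ([set: R] `&` c @^-1` dom j) l := smooth_onW (@subsetT _ _) sl.
  apply: (smooth_on_comp_rV oA oO sT _ sl') => s [_ cj].
  by exists (c s); rewrite /c ?(img_psi (Ki _ (lK s))).2 //; split => //; exact: (img_psi (Ki _ (lK s))).1.
have c0 : c 0 = p by rewrite /c /l hE mulr0 mul0r scale0r addr0 phiK.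
have c1 : c 1 = psi i y.
  have h11 : h 1 = 1 by rewrite hE; field.
  by rewrite /c /l h11 scale1r /v addrC subrK.
apply: (@le_lt_trans _ _ (curve_length c)).
  by apply: ereal_inf_lbound; exists c.
apply: (@le_lt_trans _ _ (La * `|v|)%:E); last first.
  by rewrite lte_fin mulrC -ltr_pdivlMr // mulrC.
have -> : (La * `|v|)%:E = (\int[mu]_(s in `[0%R, 1%R]) (cst (La * `|v|)%:E s))%E.
  transitivity ((La * `|v|)%:E * mu (`[0%R, 1%R]%classic : set R))%E.
    by rewrite lebesgue_measure_itv /= lte_fin ltr01 -EFinD subr0 mule1.
  by rewrite integral_cst.
apply: le_integral_ge0.
- by move=> s _; rewrite lee_fin sqrtr_ge0.
- by move=> s _; rewrite lee_fin mulr_ge0 // ltW.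
move=> s Is; split => //.
suff H : Num.sqrt (pull c 1 1 s) <= La * `|v| by rewrite -(curve_speed s sc) -lee_fin in H.
have li := Ki _ (lK s); have [ci cE] := img_psi li; have [E0 G0 D0] := surface_metric li.
rewrite (@pull_chart _ _ _ _ setT c openT sc i) //.
have ve : velocity c i 1 s = 'D_1 h s *: v.
  apply/rowP => k; rewrite !mxE.
  have -> : (fun z => phi i (c z) 0 k) = (fun z => y0 0 k + h z * v 0 k).
    by apply/funext => z; rewrite /c (img_psi (Ki _ (lK z))).2 !mxE.
  have Dh : is_derive s 1 h ('D_1 h s) by exact: smooth_is_derive sh I.
  apply: is_derive_val; apply: is_derive_eq (is_derive_add (is_derive_cst (y0 0 k) s 1)
     (is_derive_mul Dh (is_derive_cst (v 0 k) s 1))) _.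
  by rewrite /= add0r mulr0 addr0 /v !mxE.
rewrite /pullback ve /c cE.
have -> : ('D_1 h s *: v *m metric i (l s) *m ('D_1 h s *: v)^T) 0 0 =
    'D_1 h s ^+ 2 * (v *m metric i (l s) *m v^T) 0 0.
  by rewrite linearZ /= -!scalemxAl -scalemxAr scalerA mxE expr2.
rewrite sqrtrM ?sqr_ge0 // sqrtr_sqr /La -mulrA ler_pM ?sqrtr_ge0 //.
rewrite -[`|v|]ger0_norm // -sqrtr_sqr -sqrtrM ?mulr_ge0 ?(ltW B0) //.
rewrite ler_wsqrtr //.
rewrite (quadratic2 v (Defs.metric_sym li)).
have Bl := HB _ (lK s).
have vk k : v 0 k ^+ 2 <= `|v| ^+ 2.
  by rewrite -[v 0 k ^+ 2]real_normK ?num_real // lerXn2r ?nnegrE ?coord_le_norm.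
have D1 : 0 <= metric i (l s) 0 0 * v 0 0 ^+ 2 - 2 * metric i (l s) 0 1 * v 0 0 * v 0 1
    + metric i (l s) 1 1 * v 0 1 ^+ 2.
  rewrite -(pmulr_rge0 _ E0); rewrite [X in 0 <= X](_ : _ = (metric i (l s) 0 0 * v 0 0 -
    metric i (l s) 0 1 * v 0 1) ^+ 2 + \det (metric i (l s)) * v 0 1 ^+ 2).
    by rewrite addr_ge0 ?sqr_ge0 // mulr_ge0 ?sqr_ge0 // ltW.
  by rewrite det2 (sym2 (Defs.metric_sym li)); ring.
have T1 : metric i (l s) 0 0 * v 0 0 ^+ 2 <= metric i (l s) 0 0 * `|v| ^+ 2.
  by rewrite ler_wpM2l // ltW.
have T2 : metric i (l s) 1 1 * v 0 1 ^+ 2 <= metric i (l s) 1 1 * `|v| ^+ 2.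
  by rewrite ler_wpM2l // ltW.
have T3 : (metric i (l s) 0 0 + metric i (l s) 1 1) * `|v| ^+ 2 <= B * `|v| ^+ 2.
  by rewrite ler_wpM2r // sqr_ge0.
by lra.
Qed.

(** The outer ball lies in a coordinate square, and the inner ball contains one. *)
Lemma annulus_square (i : chart) (p : S) : dom i p ->
  exists C c r0 : R, [/\ 0 < C, 0 < c, 0 < r0 &
    forall r x, 0 < r < r0 -> annulus (r / 2) r p x ->
      [/\ dom i x, c * r <= `|phi i x - phi i p| & `|phi i x - phi i p| < C * r]].
Proof.
move=> pi; have [C [r1 [C0 r10 H1]]] := geo_ball_square pi.
have [c [d [c0 d0 H2]]] := square_geo_ball pi.
exists C, (c / 2), (Order.min r1 (d / C)); split => //.
- by rewrite divr_gt0.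
- by rewrite lt_min r10 divr_gt0.
move=> r x; rewrite lt_min => /and3P[r0 rr1 rd] [xr nx].
have [xi xC] := H1 r x (introT andP (conj r0 rr1)) xr; split => //.
rewrite leNgt; apply/negP => xc; apply: nx; apply: subset_closure.
rewrite -(phiK xi); apply: H2.
- by rewrite divr_gt0.
- by rewrite (le_trans (ltW xC)) // mulrC -ler_pdivlMr // ltW.
- by rewrite (lt_le_trans xc) // mulrA [leRHS]mulrAC.
Qed.

End Distances.

(** * The flow equation in a chart *)

Section Slices.
Context {R : realType} {V W : normedModType R}.
Implicit Types (f : R * V -> W).

Lemma derive_slice f t v y : 'D_((0, v) : R * V) f (t, y) = 'D_v (fun y => f (t, y)) y.
Proof.
rewrite /derive; set g := (X in lim (X @ _)); set g' := (X in _ = lim (X @ _)).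
suff -> : g = g' by [].
apply/funext => h; rewrite /g /g' /=.
by rewrite (_ : h *: (0, v) + (t, y) = (t, h *: v + y)) //; congr pair; rewrite /= scaler0 add0r.
Qed.

Lemma derivable_slice f t v y : derivable f (t, y) ((0, v) : R * V) ->
  derivable (fun y => f (t, y)) y v.
Proof.
rewrite /derivable; set g := (X in cvg (X @ _) -> _); set g' := (X in _ -> cvg (X @ _)).
suff -> : g = g' by [].
apply/funext => h; rewrite /g /g' /=.
by rewrite (_ : h *: (0, v) + (t, y) = (t, h *: v + y)) //; congr pair; rewrite /= scaler0 add0r.
Qed.

Lemma derive_time f t y : 'D_((1, 0) : R * V) f (t, y) = 'D_1 (fun s : R => f (s, y)) t.
Proof.
rewrite /derive; set g := (X in lim (X @ _)); set g' := (X in _ = lim (X @ _)).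
suff -> : g = g' by [].
apply/funext => h; rewrite /g /g' /=.
by rewrite (_ : h *: (1, 0) + (t, y) = (h *: (1 : R) + t, y)) //; congr pair; rewrite /= scaler0 add0r.
Qed.

Lemma derivable_time f t y : derivable f (t, y) ((1, 0) : R * V) ->
  derivable (fun s : R => f (s, y)) t 1.
Proof.
rewrite /derivable; set g := (X in cvg (X @ _) -> _); set g' := (X in _ -> cvg (X @ _)).
suff -> : g = g' by [].
apply/funext => h; rewrite /g /g' /=.
by rewrite (_ : h *: (1, 0) + (t, y) = (h *: (1 : R) + t, y)) //; congr pair; rewrite /= scaler0 add0r.
Qed.

Lemma diter_slice f t vs :
  diter vs (fun y => f (t, y)) = (fun y => diter [seq ((0, v) : R * V) | v <- vs] f (t, y)).
Proof.
elim: vs => //= v vs ->; apply/funext => y; rewrite -derive_slice; by [].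
Qed.

Lemma continuous_pair_l (t : R) (y : V) : {for y, continuous (fun y : V => (t, y))}.
Proof.
apply: (@cvg_pair _ _ _ (nbhs y) (nbhs t) (nbhs y) _ _ _ (cst t) id); last exact: cvg_id.
exact: cvg_cst.
Qed.

Lemma smooth_slice (A : set (R * V)) f t : smooth_on A f ->
  smooth_on [set y | A (t, y)] (fun y => f (t, y)).
Proof.
move=> sf vs y Ay; have [cf df] := sf [seq ((0, v) : R * V) | v <- vs] _ Ay.
rewrite diter_slice; split.
  by apply: (continuous_comp (f := fun y : V => (t, y))) => //; exact: continuous_pair_l.
by move=> v; apply: derivable_slice.
Qed.

End Slices.

Lemma smooth_slice_into {R : realType} {V : normedModType R} n (M : compact_manifold R n) (A : set (R * V)) (w : R * V -> M) t :
  smooth_into A w -> smooth_into [set y | A (t, y)] (fun y => w (t, y)).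
Proof.
move=> [cw sw]; split.
  move=> y Ay; apply: (continuous_comp (f := fun y : V => (t, y))); last exact: cw.
  exact: (@continuous_pair_l R V).
by move=> j; exact: (@smooth_slice R V _ _ _ t (sw j)).
Qed.

Section Flow.
Context {R : realType} {n : nat}.
Context {S : compact_riemannian R 2} {N : compact_riemannian R n}.
Context (T : R) (u : R -> S -> N).
Notation chart := 'I_(ncharts S).+1.
Notation RV := (R * 'rV[R]_2)%type.

Definition cylinder (i : chart) : set RV := [set ty : RV | 0 < ty.1 < T /\ img i ty.2].
Definition chart_flow (i : chart) (ty : RV) : N := u ty.1 (psi i ty.2).

Hypothesis su : forall i, smooth_into (cylinder i) (chart_flow i).
Hypothesis heat : forall t x, 0 < t < T ->
  'D_1 (fun s : R => phi (chart_at (u t x)) (u s x)) t = tension (u t) x.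

Definition dt : RV := (1, 0).
Definition dx (a : 'I_2) : RV := (0, delta_mx 0 a).

Lemma open_cylinder i : open (cylinder i).
Proof.
have -> : cylinder i = (fst @^-1` `]0, T[%classic) `&` (snd @^-1` img i).
  by apply/seteqP; split => -[t y] /=; rewrite in_itv.
apply: openI; apply: open_comp; [|exact: interval_open| |exact: img_open].
  by move=> z _; exact: cvg_fst.
by move=> z _; exact: cvg_snd.
Qed.

Lemma flow_smooth_map t : 0 < t < T -> smooth_map (u t).
Proof.
move=> t0T i; have [H1 H2] := smooth_slice_into t (su i); split.
  by move=> y yi; exact: (H1 y (conj t0T yi)).
move=> j vs y [yi yj]; exact: (H2 j vs y (conj (conj t0T yi) yj)).
Qed.

Section InChart.
Variable i : chart.
Let A := cylinder i.
Let W := chart_flow i.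
Let oA : open A := open_cylinder (i := i).

Definition flow_metric (v w : RV) : RV -> R := pull (chart_flow i) v w.

Lemma smooth_flow_metric v w : smooth_on (cylinder i) (flow_metric v w).
Proof. exact: (smooth_pull oA (su i)). Qed.

Lemma flow_metric_sym v w z : cylinder i z -> flow_metric v w z = flow_metric w v z.
Proof. exact: pull_sym. Qed.

Lemma flow_metric_slice t y a b :
  pull_mx (u t) i y a b = flow_metric (dx a) (dx b) (t, y).
Proof.
rewrite mxE /flow_metric /pull !pullbackE /chart_flow /=.
apply: eq_bigr => l _; apply: eq_bigr => m _.
by rewrite /dx !derive_slice.
Qed.

(** The tension is defined in the chart [chart_at x]; by
    [chart_tension_transition] any chart of the domain serves. *)
Lemma chart_heat (t : R) (y : 'rV[R]_2) l : cylinder i (t, y) ->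
  let k := chart_at (u t (psi i y)) in
  'D_dt (fun z => phi k (chart_flow i z) 0 l) (t, y) =
  \tr (invmx (metric i y) *m chart_hessian i k (u t) y l).
Proof.
move=> Az k; have t0T : 0 < t < T by case: Az.
have yi : img i y by case: Az.
pose x : S := psi i y; have [xi xE] := img_psi yi.
have xk : dom k (u t x) by exact: chart_atP.
have zC : chart_part A W k (t, y) by [].
have dz l' : derivable (fun s : R => phi k (u s x) 0 l') t 1.
  apply: (@derivable_time R _ _ (fun z => phi k (W z) 0 l')).
  exact: smooth_on_derivable (@smooth_component R n N _ _ _ oA (su i) k l') zC.
rewrite /dt derive_time /= -derive_coord; last exact/derivable_rVP.
have := heat x t0T; rewrite -/k => ->; rewrite tension_trace.
have xs := metric_at_sym x.
rewrite -mxtrace_tr trmx_mul trmxK trmx_inv xs mxtrace_mulC.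
rewrite -(chart_tension_transition l (flow_smooth_map t0T (chart_at x)) xi (chart_atP x) xk).
by rewrite xE.
Qed.

Lemma derive_pull_chart k v v1 v2 z : chart_part (cylinder i) (chart_flow i) k z ->
  'D_v (pullback (chart_flow i) k v1 v2) z = 'D_v (flow_metric v1 v2) z.
Proof.
move=> zC; have oC : open (chart_part A W k) by exact: (open_chart_part oA (su i)).
apply: (derive_near _ oC zC) => z' [Az' z'k].
by rewrite /flow_metric (pull_chart oA (su i) _ _ Az' z'k).
Qed.

(** Pairing the flow equation with a derivative of the flow, by Koszul's
    formula. *)
Lemma flow_pairing (t : R) (y : 'rV[R]_2) (w : RV) : cylinder i (t, y) ->
  let z := (t, y) : RV in
  flow_metric dt w z = \sum_a \sum_c invmx (metric i y) a c *
    (2^-1 * ('D_(dx c) (flow_metric (dx a) w) z + 'D_(dx a) (flow_metric (dx c) w) z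
             - 'D_w (flow_metric (dx c) (dx a)) z)
     - \sum_d christoffel (metric i) d c a y * flow_metric (dx d) w z).
Proof.
move=> Az z; pose k := chart_at (u t (psi i y)).
have zC : chart_part A W k z by split => //; exact: chart_atP.
pose U l : RV -> R := fun z => phi k (W z) 0 l.
pose h l m := metric k (phi k (W z)) l m.
pose B w := fun l => \sum_m h l m * 'D_w (U m) z.
have PE v : flow_metric v w z = \sum_l 'D_v (U l) z * B w l.
  rewrite /flow_metric /pull pullbackE; apply: eq_bigr => l _; rewrite mulr_sumr.
  by apply: eq_bigr => m _; rewrite -/k /h /U; ring.
have KE c a : 2^-1 * ('D_(dx c) (flow_metric (dx a) w) z + 'D_(dx a) (flow_metric (dx c) w) z
             - 'D_w (flow_metric (dx c) (dx a)) z) =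
   \sum_l ('D_(dx c) ('D_(dx a) (U l)) z + \sum_p \sum_q christoffel (metric k) l p q (phi k (W z))
     * 'D_(dx c) (U p) z * 'D_(dx a) (U q) z) * B w l.
  have K := koszul oA (su i) (dx c) (dx a) w zC.
  apply: (etrans _ (etrans (esym K) _)).
    by apply: koszul_rhs_eq; rewrite derive_pull_chart.
  apply: eq_bigr => l _; rewrite mulr_sumr; apply: eq_bigr => m _.
  by rewrite /h /U; ring.
have HE l a c : chart_hessian i k (u t) y l c a =
   ('D_(dx c) ('D_(dx a) (U l)) z + \sum_p \sum_q christoffel (metric k) l p q (phi k (W z))
     * 'D_(dx c) (U p) z * 'D_(dx a) (U q) z)
   - \sum_d christoffel (metric i) d c a y * 'D_(dx d) (U l) z.
  have d1 a' l' y' : 'D_(dx a') (U l') (t, y') = pd a' (fun y => phi k (u t (psi i y)) 0 l') y'.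
    by rewrite /dx derive_slice.
  rewrite mxE /dx derive_slice -!/(dx _).
  have -> : (fun y => 'D_(dx a) (U l) (t, y)) = pd a (fun y => phi k (u t (psi i y)) 0 l).
    by apply/funext => y'; rewrite d1.
  rewrite addrAC; congr (_ + _ - _).
    by apply: eq_bigr => p _; apply: eq_bigr => q _; rewrite !d1.
  by apply: eq_bigr => d _; rewrite d1.
rewrite PE; under eq_bigr => l _ do rewrite (chart_heat l Az) -/k.
transitivity (\sum_l \sum_a \sum_c invmx (metric i y) a c * chart_hessian i k (u t) y l c a * B w l).
  apply: eq_bigr => l _; rewrite /mxtrace mulr_suml; apply: eq_bigr => a _.
  by rewrite mxE mulr_suml.
rewrite exchange_big; apply: eq_bigr => a _; rewrite exchange_big; apply: eq_bigr => c _.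
rewrite KE; under [X in _ - X]eq_bigr => d _ do rewrite PE mulr_sumr.
rewrite [X in _ - X]exchange_big -sumrB mulr_sumr; apply: eq_bigr => l _.
rewrite HE -mulrA mulrBl; congr (_ * (_ - _)); rewrite mulr_suml.
by apply: eq_bigr => d _; rewrite mulrA.
Qed.

End InChart.

End Flow.

(** * Energy and momentum identities *)

Section ConformalMetric.
Context {R : realType} {S : compact_riemannian R 2} (i : 'I_(ncharts S).+1).

Lemma pd_product (A : set 'rV[R]_2) (f h k : 'rV[R]_2 -> R) b y : open A ->
  smooth_on A f -> smooth_on A h -> (forall y, A y -> f y * h y = k y) -> A y ->
  pd b f y * h y + f y * pd b h y = pd b k y.
Proof.
move=> oA sf sh fh Ay; rewrite -[RHS]/('D_(delta_mx 0 b) k y) -(derive_near _ oA Ay fh).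
symmetry; apply: is_derive_val; apply: is_derive_mul.
  exact: smooth_is_derive sf Ay.
exact: smooth_is_derive sh Ay.
Qed.

(** The inverse metric times the area density; in dimension two it depends on
    the conformal class of the metric only, and has determinant one. *)
Definition cmetric (y : 'rV[R]_2) : 'M[R]_2 := area_density i y *: invmx (metric i y).

Lemma smooth_cmetric a b : smooth_on (img i) (fun y => cmetric y a b).
Proof.
have oi : open (img i) by exact: img_open.
apply: (@smooth_on_eq _ _ _ _ (fun y => area_density i y * invmx (metric i y) a b)) => //.
  by move=> y _; rewrite [RHS]mxE.
apply: (smooth_onM oi); [exact: smooth_area_density|exact: smooth_invmx].
Qed.

Lemma area_density_sq y : img i y -> 0 < area_density i y /\
  area_density i y * area_density i y = metric i y 0 0 * metric i y 1 1 - metric i y 0 1 * metric i y 0 1.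
Proof.
move=> yi; have [_ _ D0] := surface_metric yi; rewrite sqrtr_gt0; split => //.
by rewrite -expr2 sqr_sqrtr ?(ltW D0) // det2 (sym2 (Defs.metric_sym yi)).
Qed.

Lemma cmetricE y : img i y -> [/\ cmetric y 0 0 * area_density i y = metric i y 1 1,
  cmetric y 0 1 * area_density i y = - metric i y 0 1,
  cmetric y 1 0 * area_density i y = - metric i y 0 1 &
  cmetric y 1 1 * area_density i y = metric i y 0 0].
Proof.
move=> yi; have [_ _ D0] := surface_metric yi; have [s0 sE] := area_density_sq yi.
have DE : \det (metric i y) = area_density i y * area_density i y.
  by rewrite -expr2 sqr_sqrtr // ltW.
have g10 := sym2 (Defs.metric_sym yi).
rewrite /cmetric invmx2 ?gt_eqF // DE; move: s0; move: (area_density i y) => s s0.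
by rewrite !mxE /= ?g10; split; field; rewrite gt_eqF.
Qed.

Lemma cmetric_sym y : img i y -> cmetric y 1 0 = cmetric y 0 1.
Proof.
move=> yi; have [s0 _] := area_density_sq yi; have [_ e1 e2 _] := cmetricE yi.
by apply: (mulIf (lt0r_neq0 s0)); rewrite e1 e2.
Qed.

Lemma pd_metric_sym b y : img i y ->
  pd b (fun y => metric i y 1 0) y = pd b (fun y => metric i y 0 1) y.
Proof.
move=> yi; have oi : open (img i) by exact: img_open.
by apply: (derive_near _ oi yi) => z zi; exact: sym2 (Defs.metric_sym zi).
Qed.

(** The product rule, applied to [cmetricE]. *)
Lemma pd_cmetric b y : img i y ->
  let s := area_density i in
  [/\ pd b (fun y => cmetric y 0 0) y * s y + cmetric y 0 0 * pd b s y = pd b (fun y => metric i y 1 1) y,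
   pd b (fun y => cmetric y 0 1) y * s y + cmetric y 0 1 * pd b s y = - pd b (fun y => metric i y 0 1) y,
   pd b (fun y => cmetric y 1 0) y * s y + cmetric y 1 0 * pd b s y = - pd b (fun y => metric i y 0 1) y,
   pd b (fun y => cmetric y 1 1) y * s y + cmetric y 1 1 * pd b s y = pd b (fun y => metric i y 0 0) y &
   2 * s y * pd b s y = pd b (fun y => metric i y 0 0) y * metric i y 1 1
     + metric i y 0 0 * pd b (fun y => metric i y 1 1) y
     - 2 * metric i y 0 1 * pd b (fun y => metric i y 0 1) y].
Proof.
move=> yi s; have oi : open (img i) by exact: img_open.
have ss : smooth_on (img i) s by exact: smooth_area_density.
have sg a c := @metric_smooth R 2 S i a c.
have dg a c : is_derive y (delta_mx 0 b) (fun y => metric i y a c) (pd b (fun y => metric i y a c) y).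
  exact: smooth_is_derive (sg a c) yi.
have dN : pd b (fun y => - metric i y 0 1) y = - pd b (fun y => metric i y 0 1) y.
  have H := @is_derive_mul R _ (cst (-1)) _ y (delta_mx 0 b) 0 _ (is_derive_cst (-1 : R) y (delta_mx 0 b)) (dg 0 1).
  have E : (fun y => - metric i y 0 1) = (fun y => cst (-1) y * metric i y 0 1).
    by apply/funext => z; rewrite /= mulN1r.
  by rewrite {1}/pd E (is_derive_val H) /= mul0r add0r mulN1r.
split.
- by apply: (pd_product b oi (@smooth_cmetric 0 0) ss _ yi) => z /cmetricE[].
- by rewrite -dN; apply: (pd_product b oi (@smooth_cmetric 0 1) ss _ yi) => z /cmetricE[].
- by rewrite -dN; apply: (pd_product b oi (@smooth_cmetric 1 0) ss _ yi) => z /cmetricE[].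
- by apply: (pd_product b oi (@smooth_cmetric 1 1) ss _ yi) => z /cmetricE[].
have H1 : pd b (fun y => s y * s y) y = 2 * s y * pd b s y.
  have Ds : is_derive y (delta_mx 0 b) s (pd b s y) by exact: smooth_is_derive ss yi.
  by rewrite {1}/pd (is_derive_val (is_derive_mul Ds Ds)); ring.
rewrite -H1; have sE z : img i z -> s z * s z = metric i z 0 0 * metric i z 1 1 +
     (-1) * (metric i z 0 1 * metric i z 0 1).
  by move=> zi; rewrite (area_density_sq zi).2; ring.
rewrite {1}/pd (derive_near _ oi yi sE).
rewrite (is_derive_val (is_derive_add (is_derive_mul (dg 0 0) (dg 1 1))
  (is_derive_mul (is_derive_cst (-1 : R) y (delta_mx 0 b)) (is_derive_mul (dg 0 1) (dg 0 1))))).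
by rewrite /cst /=; ring.
Qed.

(** The relations of [pd_cmetric] solved for the derivatives of the conformal
    metric, in independent quantities; the identities below become identities of
    rational functions. *)
Lemma cmetric_solved y : img i y ->
  let s := area_density i y in
  let E := metric i y 0 0 in let F := metric i y 0 1 in let G := (s * s + F * F) / E in
  let dE b := pd b (fun y => metric i y 0 0) y in
  let dF b := pd b (fun y => metric i y 0 1) y in
  let dG b := pd b (fun y => metric i y 1 1) y in
  let ds b := (dE b * G + E * dG b - 2 * F * dF b) / (2 * s) in
  [/\ s != 0, E != 0, metric i y 1 1 = G,
   [/\ cmetric y 0 0 = G / s, cmetric y 0 1 = - F / s, cmetric y 1 0 = - F / s & cmetric y 1 1 = E / s] &
   forall b, [/\ pd b (fun y => cmetric y 0 0) y = (dG b - G / s * ds b) / s,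
     pd b (fun y => cmetric y 0 1) y = (- dF b - - F / s * ds b) / s,
     pd b (fun y => cmetric y 1 0) y = (- dF b - - F / s * ds b) / s &
     pd b (fun y => cmetric y 1 1) y = (dE b - E / s * ds b) / s]].
Proof.
move=> yi s E F G dE dF dG ds.
have [E0 _ D0] := surface_metric yi; have [s0 sE] := area_density_sq yi.
have [e1 e2 e3 e4] := cmetricE yi.
have sn : s != 0 := lt0r_neq0 s0; have En : E != 0 := lt0r_neq0 E0.
have GE : metric i y 1 1 = G.
  by rewrite /G /s /F sE addrNK /E mulrAC divff ?mul1r.
have m1 : cmetric y 0 0 = G / s by rewrite -GE -e1 mulfK.
have m2 : cmetric y 0 1 = - F / s by rewrite -e2 mulfK.
have m3 : cmetric y 1 0 = - F / s by rewrite -e3 mulfK.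
have m4 : cmetric y 1 1 = E / s by rewrite /E -e4 mulfK.
split=> // b; have [a1 a2 a3 a4 a5] := pd_cmetric b yi.
have dsE : pd b (area_density i) y = ds b.
  rewrite /ds -GE -a5 mulrAC mulfV ?mul1r //.
  by rewrite mulf_neq0.
split.
- by rewrite /dG -a1 m1 dsE addrK mulfK.
- by rewrite /dF -a2 m2 dsE addrK mulfK.
- by rewrite /dF -a3 m3 dsE addrK mulfK.
- by rewrite /dE -a4 m4 dsE addrK mulfK.
Qed.

(** The divergence of the conformal metric is a contraction of the Christoffel
    symbols. *)
Lemma div_cmetric y b : img i y -> \sum_a pd a (fun y => cmetric y a b) y =
  - \sum_a \sum_c cmetric y a c * christoffel (metric i) b c a y.
Proof.
move=> yi; have [_ _ D0] := surface_metric yi; have [s0 sE] := area_density_sq yi.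
have g10 := sym2 (Defs.metric_sym yi).
have DE : \det (metric i y) = area_density i y * area_density i y.
  by rewrite -expr2 sqr_sqrtr // ltW.
have iv := invmx2 (lt0r_neq0 D0); rewrite DE in iv.
have [sn En GE [m1 m2 m3 m4] dm] := cmetric_solved yi.
have [c1 c2 c3 c4] := dm 0; have [d1 d2 d3 d4] := dm 1.
rewrite /christoffel iv; move: b; apply: ord2P.
  rewrite !sum2 !(pd_metric_sym _ yi) c1 d3 m1 m2 m3 m4 !mxE /= ?g10 GE.
  move: (pd 0 (fun y => metric i y 0 0) y) (pd 0 (fun y => metric i y 0 1) y)
    (pd 0 (fun y => metric i y 1 1) y) (pd 1 (fun y => metric i y 0 0) y)
    (pd 1 (fun y => metric i y 0 1) y) (pd 1 (fun y => metric i y 1 1) y)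
    (area_density i y) (metric i y 0 0) (metric i y 0 1) sn En =>
    Ea Fa Ga Eb Fb Gb s E F sn En.
  by field; rewrite sn En.
rewrite !sum2 !(pd_metric_sym _ yi) c2 d4 m1 m2 m3 m4 !mxE /= ?g10 ?GE.
move: (pd 0 (fun y => metric i y 0 0) y) (pd 0 (fun y => metric i y 0 1) y)
  (pd 0 (fun y => metric i y 1 1) y) (pd 1 (fun y => metric i y 0 0) y)
  (pd 1 (fun y => metric i y 0 1) y) (pd 1 (fun y => metric i y 1 1) y)
  (area_density i y) (metric i y 0 0) (metric i y 0 1) sn En =>
  Ea Fa Ga Eb Fb Gb s E F sn En.
by field; rewrite sn En.
Qed.

(** The conformal metric has determinant one, hence its derivatives are
    orthogonal to the metric. *)
Lemma cmetric_traceless y b : img i y ->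
  \sum_c \sum_d pd b (fun y => cmetric y c d) y * metric i y c d = 0.
Proof.
move=> yi; have g10 := sym2 (Defs.metric_sym yi).
have [sn En GE _ dm] := cmetric_solved yi; have [c1 c2 c3 c4] := dm b.
rewrite !sum2 c1 c2 c3 c4 g10 GE.
move: (pd b (fun y => metric i y 0 0) y) (pd b (fun y => metric i y 0 1) y)
    (pd b (fun y => metric i y 1 1) y) (area_density i y) (metric i y 0 0)
    (metric i y 0 1) sn En => Ea Fa Ga s E F sn En.
by field; rewrite sn En.
Qed.

Lemma cmetric_mul y a b : img i y ->
  \sum_c cmetric y a c * metric i y c b = (a == b)%:R * area_density i y.
Proof.
move=> yi; have := mulVmx (metric_unit yi) => /matrixP/(_ a b); rewrite !mxE => <-.
by rewrite mulrC mulr_sumr; apply: eq_bigr => c _; rewrite mxE mulrA.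
Qed.

End ConformalMetric.

Section SpaceTime.
Context {R : realType}.
Notation RV := (R * 'rV[R]_2)%type.

Lemma smooth_snd (A : set RV) (O : set 'rV[R]_2) (g : 'rV[R]_2 -> R) : open A -> open O ->
  (forall z, A z -> O z.2) -> smooth_on O g -> smooth_on A (fun z => g z.2).
Proof.
move=> oA oO AO sg; have s2 : smooth_on A (snd : RV -> 'rV[R]_2).
  apply: (smooth_on_rV oA) => k; apply: smooth_on_linear => //.
    move=> z; apply: continuous_coord; exact: cvg_snd.
  by move=> a [x1 x2] [z1 z2] /=; rewrite !mxE.
exact: (smooth_on_comp oA oO sg AO s2).
Qed.

End SpaceTime.

Lemma double_sumD {R : realType} (A B : 'I_2 -> 'I_2 -> R) :
  \sum_c \sum_d (A c d + B c d) = \sum_c \sum_d A c d + \sum_c \sum_d B c d.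
Proof. by rewrite !sum2; ring. Qed.

Lemma double_sumB {R : realType} (D A B : 'I_2 -> 'I_2 -> R) (e : R) :
  \sum_c \sum_d D c d * (A c d - e * B c d) =
  \sum_c \sum_d D c d * A c d - e * \sum_c \sum_d D c d * B c d.
Proof. by rewrite !sum2; ring. Qed.

(** With [m] for [cmetric], the divergence of [m] absorbs the Christoffel symbols. *)
Lemma contraction_algebra {R : realType} (s : R) (inv m X Y dm : 'I_2 -> 'I_2 -> R)
    (G : 'I_2 -> 'I_2 -> 'I_2 -> R) (p : 'I_2 -> R) :
  (forall a c, s * inv a c = m a c) -> m 1 0 = m 0 1 ->
  (forall d, \sum_a dm a d = - \sum_a \sum_c m a c * G d c a) ->
  s * (\sum_a \sum_c inv a c * (2^-1 * (X c a + X a c - Y c a) - \sum_d G d c a * p d)) =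
  \sum_a \sum_c (dm a c * p c + m a c * X a c) - 2^-1 * \sum_a \sum_c m a c * Y c a.
Proof.
move=> sm ms H; have := H 0; have := H 1; rewrite !sum2 => H1 H0.
have -> : dm 0 0 = - (m 0 0 * G 0 0 0 + m 0 1 * G 0 1 0 + (m 1 0 * G 0 0 1 + m 1 1 * G 0 1 1)) - dm 1 0.
  by rewrite -H0 addrK.
have -> : dm 0 1 = - (m 0 0 * G 1 0 0 + m 0 1 * G 1 1 0 + (m 1 0 * G 1 0 1 + m 1 1 * G 1 1 1)) - dm 1 1.
  by rewrite -H1 addrK.
have -> : s * (inv 0 0 * (2^-1 * (X 0 0 + X 0 0 - Y 0 0) - (G 0 0 0 * p 0 + G 1 0 0 * p 1)) +
    inv 0 1 * (2^-1 * (X 1 0 + X 0 1 - Y 1 0) - (G 0 1 0 * p 0 + G 1 1 0 * p 1)) +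
   (inv 1 0 * (2^-1 * (X 0 1 + X 1 0 - Y 0 1) - (G 0 0 1 * p 0 + G 1 0 1 * p 1)) +
    inv 1 1 * (2^-1 * (X 1 1 + X 1 1 - Y 1 1) - (G 0 1 1 * p 0 + G 1 1 1 * p 1)))) =
  m 0 0 * (2^-1 * (X 0 0 + X 0 0 - Y 0 0) - (G 0 0 0 * p 0 + G 1 0 0 * p 1)) +
    m 0 1 * (2^-1 * (X 1 0 + X 0 1 - Y 1 0) - (G 0 1 0 * p 0 + G 1 1 0 * p 1)) +
   (m 1 0 * (2^-1 * (X 0 1 + X 1 0 - Y 0 1) - (G 0 0 1 * p 0 + G 1 0 1 * p 1)) +
    m 1 1 * (2^-1 * (X 1 1 + X 1 1 - Y 1 1) - (G 0 1 1 * p 0 + G 1 1 1 * p 1))).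
  by rewrite -!sm; ring.
by rewrite ms; field.
Qed.

Section EnergyIdentities.
Context {R : realType} {n : nat}.
Context {S : compact_riemannian R 2} {N : compact_riemannian R n}.
Context (T : R) (u : R -> S -> N).
Notation RV := (R * 'rV[R]_2)%type.
Notation chart := 'I_(ncharts S).+1.
Hypothesis su : forall i, smooth_into (cylinder T i) (chart_flow u i).
Hypothesis heat : forall t x, 0 < t < T ->
  'D_1 (fun s : R => phi (chart_at (u t x)) (u s x)) t = tension (u t) x.
Context (i : chart).

Let P v w := flow_metric u i v w.
Let sP v w : smooth_on (cylinder T i) (P v w).
Proof. exact: (@smooth_flow_metric R n S N T u su i v w). Qed.
Let Psym v w z : cylinder T i z -> P v w z = P w v z.
Proof. by move=> Az; exact: (flow_metric_sym (T := T)). Qed.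
Let oA : open (cylinder T i) := open_cylinder (T := T) (i := i).
Let oi : open (img i) := @img_open R 2 S i.

(** The energy density times the area density; it depends on the metric only
    through [cmetric]. *)
Definition flow_energy (z : RV) : R :=
  2^-1 * \sum_a \sum_b cmetric i z.2 a b * flow_metric u i (dx a) (dx b) z.

Lemma cmetric_time (a b : 'I_2) : smooth_on (cylinder T i) (fun z : RV => cmetric i z.2 a b).
Proof.
by apply: (smooth_snd oA oi _ (@smooth_cmetric R S i a b)) => z [].
Qed.

Lemma smooth_flow_energy : smooth_on (cylinder T i) flow_energy.
Proof.
apply: (smooth_onZ oA); apply: (smooth_on_sum oA) => a; apply: (smooth_on_sum oA) => b.
by apply: (smooth_onM oA); [exact: cmetric_time|exact: sP].
Qed.

Lemma flow_energyE t y : img i y ->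
  flow_energy (t, y) = energy_density (u t) i y * area_density i y.
Proof.
move=> yi; rewrite /flow_energy /energy_density -mulrA; congr (_ * _).
rewrite mulrC /mxtrace mulr_sumr; apply: eq_bigr => a _; rewrite mxE mulr_sumr.
apply: eq_bigr => b _; rewrite [cmetric _ _ _ _]mxE -mulrA; congr (_ * (_ * _)).
have [Ps _ _] := @pull_mx_psd R n S N (u t) i y.
by rewrite -flow_metric_slice; move: a b; apply: ord2P; apply: ord2P; rewrite ?Ps.
Qed.

Lemma flow_metric_pd v w a t y :
  'D_(dx a) (P v w) (t, y) = pd a (fun y => P v w (t, y)) y.
Proof. by rewrite /dx derive_slice. Qed.

Let sPt v w t : 0 < t < T -> smooth_on (img i) (fun y => P v w (t, y)).
Proof.
move=> t0T; apply: smooth_onW (@smooth_slice R 'rV[R]_2 R _ _ t (sP v w)) => y yi.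
by split.
Qed.

(** The flow equation paired with a time or space derivative, in divergence
    form. *)
Lemma flow_divergence t y w : cylinder T i (t, y) ->
  area_density i y * P dt w (t, y) =
  \sum_a \sum_c pd a (fun y => cmetric i y a c * P (dx c) w (t, y)) y
  - 2^-1 * \sum_a \sum_c cmetric i y a c * 'D_w (P (dx c) (dx a)) (t, y).
Proof.
move=> Az; have [/= t0T yi] := Az; rewrite /P (flow_pairing su heat w Az) -/P.
have sc a c : smooth_on (img i) (fun y => cmetric i y a c) by exact: smooth_cmetric.
have D a c : pd a (fun y => cmetric i y a c * P (dx c) w (t, y)) y =
   pd a (fun y => cmetric i y a c) y * P (dx c) w (t, y) +
   cmetric i y a c * pd a (fun y => P (dx c) w (t, y)) y.
  apply: is_derive_val; apply: is_derive_mul.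
    exact: smooth_is_derive (sc a c) yi.
  exact: smooth_is_derive (sPt (dx c) w t0T) yi.
have mE a c : area_density i y * invmx (metric i y) a c = cmetric i y a c by rewrite mxE.
apply: etrans (@contraction_algebra R _ _ _ (fun c a => 'D_(dx c) (P (dx a) w) (t, y))
  (fun c a => 'D_w (P (dx c) (dx a)) (t, y)) _ _ (fun d => P (dx d) w (t, y))
  mE (cmetric_sym yi) (fun d => div_cmetric d yi)) _.
congr (_ - _); apply: eq_bigr => a _; apply: eq_bigr => c _.
by rewrite D flow_metric_pd.
Qed.

(** [flow_divergence] in the direction of time; the derivative of the energy density
    is the last term there. *)
Lemma flow_energy_time t y : cylinder T i (t, y) ->
  'D_dt flow_energy (t, y) =
  \sum_a pd a (fun y => \sum_b cmetric i y a b * P dt (dx b) (t, y)) y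
  - area_density i y * P dt dt (t, y).
Proof.
move=> Az; have [/= t0T yi] := Az; pose Dt a b := 'D_dt (P (dx a) (dx b)) (t, y).
have DP a b : is_derive ((t, y) : RV) dt (P (dx a) (dx b)) (Dt a b).
  exact: smooth_is_derive (sP (dx a) (dx b)) Az.
have E a c : Dt c a = Dt a c.
  by apply: (derive_near _ oA Az) => z Az'; exact: Psym.
have FD : area_density i y * P dt dt (t, y) =
    \sum_a \sum_c pd a (fun y => cmetric i y a c * P (dx c) dt (t, y)) y
    - 2^-1 * \sum_a \sum_c cmetric i y a c * Dt c a := flow_divergence dt Az.
have H0 : 'D_dt flow_energy (t, y) = 2^-1 * \sum_a \sum_b cmetric i y a b * Dt a b.
  have D0 a b : is_derive ((t, y) : RV) dt (fun z : RV => cmetric i z.2 a b) 0.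
    apply: is_derive_eq (smooth_is_derive dt (cmetric_time a b) Az) _.
    by rewrite /dt derive_time /= derive_cst.
  have H := is_derive_mul (is_derive_cst (2^-1 : R) ((t, y) : RV) dt)
    (is_derive_summ (fun a => is_derive_summ (fun b => is_derive_mul (D0 a b) (DP a b)))).
  rewrite (is_derive_val H) mul0r add0r /cst; congr (_ * _).
  by apply: eq_bigr => a _; apply: eq_bigr => b _; rewrite mul0r add0r.
move: Dt DP E FD H0 => Dt _ E FD H0.
rewrite H0 FD; have sc a c : smooth_on (img i) (fun y => cmetric i y a c) by exact: smooth_cmetric.
have -> : \sum_a pd a (fun y => \sum_b cmetric i y a b * P dt (dx b) (t, y)) y =
   \sum_a \sum_b pd a (fun y => cmetric i y a b * P (dx b) dt (t, y)) y.
  apply: eq_bigr => a _; apply: is_derive_val; apply: is_derive_summ => b.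
  have Eb : pd a (fun y => cmetric i y a b * P (dx b) dt (t, y)) y =
      pd a (fun y => cmetric i y a b * P dt (dx b) (t, y)) y.
    apply: (derive_near _ oi yi) => z zi.
    by rewrite (Psym (dx b) dt (conj t0T zi : cylinder T i (t, z))).
  rewrite Eb; apply: smooth_is_derive yi.
  by apply: (smooth_onM oi); [exact: sc|exact: sPt].
rewrite subKr; congr (_ * _); apply: eq_bigr => a _; apply: eq_bigr => c _.
by rewrite E.
Qed.

Definition flux (t : R) (a b : 'I_2) (y : 'rV[R]_2) : R :=
  \sum_c cmetric i y a c * stress_mx (u t) i y c b.

(** The divergence of the stress-energy tensor is the tension paired with the
    differential, and the tension is the velocity of the flow.  The last term comes
    from the derivatives of the metric; by [cmetric_traceless] the trace part of
    [pull_mx] drops out of it. *)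
Lemma momentum_divergence t y b : cylinder T i (t, y) ->
  area_density i y * P dt (dx b) (t, y) = \sum_a pd a (flux t a b) y +
  2^-1 * \sum_c \sum_d pd b (fun y => cmetric i y c d) y * stress_mx (u t) i y c d.
Proof.
move=> Az; have [/= t0T yi] := Az; rewrite (flow_divergence (dx b) Az).
have sc a c : smooth_on (img i) (fun y => cmetric i y a c) by exact: smooth_cmetric.
have fE a z : img i z -> flux t a b z = \sum_c cmetric i z a c * P (dx c) (dx b) (t, z)
    + (a == b)%:R * (-1) * flow_energy (t, z).
  move=> zi; rewrite (flow_energyE t zi) /flux.
  have sE c : stress_mx (u t) i z c b = P (dx c) (dx b) (t, z) - energy_density (u t) i z * metric i z c b.
    rewrite /stress_mx /P -flow_metric_slice; move: (pull_mx (u t) i z) => Q.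
    by rewrite !mxE.
  under eq_bigr => c _ do rewrite sE mulrBr mulrCA.
  rewrite sumrB -mulr_sumr (cmetric_mul _ _ zi); ring.
have sF : smooth_on (img i) (fun y => flow_energy (t, y)).
  apply: smooth_onW (@smooth_slice R 'rV[R]_2 R _ _ t smooth_flow_energy) => z zi.
  by split.
have dF a : pd a (fun y => flow_energy (t, y)) y = 2^-1 * \sum_c \sum_d
   (pd a (fun y => cmetric i y c d) y * P (dx c) (dx d) (t, y) +
    cmetric i y c d * pd a (fun y => P (dx c) (dx d) (t, y)) y).
  have H := is_derive_mul (is_derive_cst (2^-1 : R) y (delta_mx 0 a))
    (is_derive_summ (fun c => is_derive_summ (fun d => is_derive_mul
      (smooth_is_derive (delta_mx 0 a) (sc c d) yi)
      (smooth_is_derive (delta_mx 0 a) (sPt (dx c) (dx d) t0T) yi)))).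
  by rewrite {1}/pd (is_derive_val H) mul0r add0r.
have dflux a : pd a (flux t a b) y =
   \sum_c pd a (fun y => cmetric i y a c * P (dx c) (dx b) (t, y)) y
   - (a == b)%:R * pd a (fun y => flow_energy (t, y)) y.
  rewrite {1}/pd (derive_near _ oi yi (fE a)).
  have sM c : smooth_on (img i) (fun y => cmetric i y a c * P (dx c) (dx b) (t, y)).
    by apply: (smooth_onM oi); [exact: sc|exact: sPt].
  have H := is_derive_add (is_derive_summ (fun c => smooth_is_derive (delta_mx 0 a) (sM c) yi))
    (is_derive_mul (is_derive_cst ((a == b)%:R * (-1) : R) y (delta_mx 0 a))
       (smooth_is_derive (delta_mx 0 a) sF yi)).
  by rewrite (is_derive_val H) mul0r add0r /cst; congr (_ + _); rewrite mulrN1 mulNr.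
have sE c d : stress_mx (u t) i y c d = P (dx c) (dx d) (t, y) - energy_density (u t) i y * metric i y c d.
  rewrite /stress_mx /P -flow_metric_slice; move: (pull_mx (u t) i y) => Q.
  by rewrite !mxE.
have -> : \sum_c \sum_d pd b (fun y => cmetric i y c d) y * stress_mx (u t) i y c d =
   \sum_c \sum_d pd b (fun y => cmetric i y c d) y * P (dx c) (dx d) (t, y)
   - energy_density (u t) i y * (\sum_c \sum_d pd b (fun y => cmetric i y c d) y * metric i y c d).
  under eq_bigr => c _ do under eq_bigr => d _ do rewrite sE.
  exact: (double_sumB (fun c d => pd b (fun y => cmetric i y c d) y)
    (fun c d => P (dx c) (dx d) (t, y)) (fun c d => metric i y c d)).
rewrite (cmetric_traceless b yi) mulr0 subr0.
have -> : \sum_a pd a (flux t a b) y =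
   \sum_a \sum_c pd a (fun y => cmetric i y a c * P (dx c) (dx b) (t, y)) y
   - pd b (fun y => flow_energy (t, y)) y.
  under eq_bigr => a _ do rewrite dflux.
  rewrite sumrB; congr (_ - _); rewrite (bigD1 b) //= eqxx mul1r big1 ?addr0 //.
  by move=> a /negbTE ->; rewrite mul0r.
rewrite dF.
have Es a c : 'D_(dx b) (P (dx c) (dx a)) (t, y) = pd b (fun y => P (dx a) (dx c) (t, y)) y.
  rewrite flow_metric_pd; apply: (derive_near _ oi yi) => z zi.
  exact: (Psym (dx c) (dx a) (conj t0T zi : cylinder T i (t, z))).
under [X in _ - 2^-1 * X]eq_bigr => a _ do under eq_bigr => c _ do rewrite Es.
rewrite -addrA; congr (_ + _); rewrite double_sumD mulrDr opprD addrAC addNr add0r.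
by [].
Qed.

End EnergyIdentities.

(** * Evolution of the localized energy *)

Section LocalEnergy.
Context {R : realType} {n : nat}.
Context {S : compact_riemannian R 2} {N : compact_riemannian R n}.
Context (T : R) (u : R -> S -> N).
Notation RV := (R * 'rV[R]_2)%type.
Notation leb2 := (@leb2 R).
Notation RR := (measurableTypeR R * measurableTypeR R)%type.
Notation chart := 'I_(ncharts S).+1.
Hypothesis su : forall i, smooth_into (cylinder T i) (chart_flow u i).
Hypothesis heat : forall t x, 0 < t < T ->
  'D_1 (fun s : R => phi (chart_at (u t x)) (u s x)) t = tension (u t) x.
Context (i : chart).

Let oA : open (cylinder T i) := open_cylinder (T := T) (i := i).
Let oi : open (img i) := @img_open R 2 S i.

Let sPt v w t : 0 < t < T -> smooth_on (img i) (fun y => flow_metric u i v w (t, y)).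
Proof.
move=> t0T; have sP := @smooth_flow_metric R n S N T u su i v w.
by apply: smooth_onW (@smooth_slice R 'rV[R]_2 R _ _ t sP) => y yi; split.
Qed.

(** The gradient of [chi]. *)
Definition raised (chi : 'rV[R]_2 -> R) (b : 'I_2) (y : 'rV[R]_2) : R :=
  \sum_a pd a chi y * invmx (metric i y) a b.

Definition energy_flux (chi : 'rV[R]_2 -> R) t a y : R :=
  chi y * (\sum_b cmetric i y a b * flow_metric u i dt (dx b) (t, y))
  - \sum_b raised chi b y * flux u i t a b y.

Definition remainder (chi : 'rV[R]_2 -> R) t y : R :=
  \sum_a \sum_b pd a (raised chi b) y * flux u i t a b y
  - \sum_b raised chi b y * (2^-1 * \sum_c \sum_d
      pd b (fun y => cmetric i y c d) y * stress_mx (u t) i y c d).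

Lemma evolution_algebra (s chi ptt : R) (dchi X dX Y Q C : 'I_2 -> R)
    (inv m dY fl dfl : 'I_2 -> 'I_2 -> R) :
  (forall a b, s * inv a b = m a b) ->
  (forall a, X a = \sum_b m a b * Q b) -> (forall b, Y b = \sum_a dchi a * inv a b) ->
  (forall b, s * Q b = \sum_a dfl a b + C b) ->
  chi * (\sum_a dX a - s * ptt) =
  \sum_a (dchi a * X a + chi * dX a - \sum_b (dY a b * fl a b + Y b * dfl a b))
  + (\sum_a \sum_b dY a b * fl a b - \sum_b Y b * C b) - chi * (s * ptt).
Proof.
move=> sm XE YE QE; have CE b : C b = s * Q b - \sum_a dfl a b by rewrite QE addrC addKr.
rewrite !sum2 !XE !YE !CE !sum2 -!sm; ring.
Qed.

Lemma smooth_stress_slice a b t : 0 < t < T -> smooth_on (img i) (fun y => stress_mx (u t) i y a b).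
Proof. by move=> t0T; apply: smooth_stress_mx; exact: (flow_smooth_map su t0T). Qed.

Lemma smooth_flux t a b : 0 < t < T -> smooth_on (img i) (flux u i t a b).
Proof.
move=> t0T; apply: (smooth_on_sum oi) => c; apply: (smooth_onM oi).
  exact: smooth_cmetric.
exact: smooth_stress_slice.
Qed.

Lemma smooth_raised chi b : smooth_on setT chi -> smooth_on (img i) (raised chi b).
Proof.
move=> sc; apply: (smooth_on_sum oi) => a; apply: (smooth_onM oi).
  exact: smooth_onW (@subsetT _ _) (smooth_on_derive (delta_mx 0 a) sc).
exact: smooth_invmx.
Qed.

Lemma smooth_momentum t a : 0 < t < T ->
  smooth_on (img i) (fun y => \sum_b cmetric i y a b * flow_metric u i dt (dx b) (t, y)).
Proof.
move=> t0T; apply: (smooth_on_sum oi) => b; apply: (smooth_onM oi).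
  exact: smooth_cmetric.
exact: sPt.
Qed.

Lemma smooth_energy_flux chi t a : smooth_on setT chi -> 0 < t < T ->
  smooth_on (img i) (energy_flux chi t a).
Proof.
move=> sc t0T; apply: (smooth_onB oi).
  apply: (smooth_onM oi); first exact: smooth_onW (@subsetT _ _) sc.
  exact: smooth_momentum.
apply: (smooth_on_sum oi) => b; apply: (smooth_onM oi); first exact: smooth_raised.
exact: smooth_flux.
Qed.

Lemma smooth_remainder chi t : smooth_on setT chi -> 0 < t < T ->
  smooth_on (img i) (remainder chi t).
Proof.
move=> sc t0T; apply: (smooth_onB oi).
  apply: (smooth_on_sum oi) => a; apply: (smooth_on_sum oi) => b; apply: (smooth_onM oi).
    exact: smooth_on_derive (delta_mx 0 a) (smooth_raised b sc).
  exact: smooth_flux.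
apply: (smooth_on_sum oi) => b; apply: (smooth_onM oi); first exact: smooth_raised.
apply: (smooth_onZ oi); apply: (smooth_on_sum oi) => c; apply: (smooth_on_sum oi) => d.
apply: (smooth_onM oi); last exact: smooth_stress_slice.
exact: smooth_on_derive (delta_mx 0 b) (@smooth_cmetric R S i c d).
Qed.

(** The momentum that [flow_energy_time] pairs with the gradient of [chi] is
    replaced by the divergence of the stress, by [momentum_divergence]: what
    remains is a divergence, a term linear in the stress and a nonpositive
    term. *)
Lemma evolution_pointwise (chi : 'rV[R]_2 -> R) t y : smooth_on setT chi -> cylinder T i (t, y) ->
  chi y * 'D_dt (flow_energy u i) (t, y) =
  \sum_a pd a (energy_flux chi t a) y + remainder chi t y
  - chi y * (area_density i y * flow_metric u i dt dt (t, y)).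
Proof.
move=> sc Az; have [/= t0T yi] := Az.
rewrite (flow_energy_time su heat Az).
have sc' : smooth_on (img i) chi := smooth_onW (@subsetT _ _) sc.
have DF a : pd a (energy_flux chi t a) y =
   pd a chi y * (\sum_b cmetric i y a b * flow_metric u i dt (dx b) (t, y)) +
   chi y * pd a (fun y => \sum_b cmetric i y a b * flow_metric u i dt (dx b) (t, y)) y
   - \sum_b (pd a (raised chi b) y * flux u i t a b y + raised chi b y * pd a (flux u i t a b) y).
  have e z : img i z -> energy_flux chi t a z =
     chi z * (\sum_b cmetric i z a b * flow_metric u i dt (dx b) (t, z)) +
     (-1) * (\sum_b raised chi b z * flux u i t a b z) by move=> _; rewrite mulN1r.
  rewrite {1}/pd (derive_near _ oi yi e).
  have H := is_derive_add (is_derive_mul (smooth_is_derive (delta_mx 0 a) sc' yi)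
      (smooth_is_derive (delta_mx 0 a) (smooth_momentum a t0T) yi))
    (is_derive_mul (is_derive_cst (-1 : R) y (delta_mx 0 a))
       (is_derive_summ (fun b => is_derive_mul
          (smooth_is_derive (delta_mx 0 a) (smooth_raised b sc) yi)
          (smooth_is_derive (delta_mx 0 a) (smooth_flux a b t0T) yi)))).
  by rewrite (is_derive_val H) /cst mul0r add0r mulN1r.
have mE a b : area_density i y * invmx (metric i y) a b = cmetric i y a b by rewrite mxE.
have QE b := momentum_divergence su heat b Az.
have := evolution_algebra (chi y) (flow_metric u i dt dt (t, y))
  (fun a => pd a (fun y => \sum_b cmetric i y a b * flow_metric u i dt (dx b) (t, y)) y)
  (fun a b => pd a (raised chi b) y) (fun a b => flux u i t a b y)
  mE (fun a => erefl) (fun b => erefl (raised chi b y)) QE.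
move=> ->; congr (_ + _ - _); apply: eq_bigr => a _; by rewrite DF.
Qed.

Lemma continuous_bound (I : finType) (K : set 'rV[R]_2) (f : I -> 'rV[R]_2 -> R) :
  compact K -> K `<=` img i -> (forall k, smooth_on (img i) (f k)) ->
  exists2 B, 0 <= B & forall k y, K y -> `|f k y| <= B.
Proof.
move=> cK Ki sf; have H k : exists B, 0 <= B /\ forall y, K y -> `|f k y| <= B.
  have ct : {within K, continuous (f k)}.
    apply: continuous_in_subspaceT => y /set_mem /Ki yi.
    exact: (smooth_on_continuous (sf k) yi).
  have /compact_bounded[M [Mr HM]] := continuous_compact ct cK.
  exists (`|M| + 1); split; first by rewrite addr_ge0.
  move=> y Ky; apply: (HM (`|M| + 1)); last by exists y.
  by rewrite (le_lt_trans (ler_norm M)) // ltrDl.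
have /choice[B HB] := H; exists (\sum_k B k).
  by apply: sumr_ge0 => k _; have [] := HB k.
move=> k y Ky; have [B0 /(_ y Ky) kB] := HB k; apply: le_trans kB _.
by rewrite (bigD1 k) //= lerDl sumr_ge0 // => j _; have [] := HB j.
Qed.

Lemma sum2_bound (f : 'I_2 -> R) M : (forall k, `|f k| <= M) -> `|\sum_k f k| <= 2 * M.
Proof.
move=> fM; rewrite sum2 (le_trans (ler_normD _ _)) //.
by rewrite mulr_natl mulr2n lerD.
Qed.

Lemma norm_mul_bound (x y a b : R) : `|x| <= a -> `|y| <= b -> `|x * y| <= a * b.
Proof. by move=> xa yb; rewrite normrM ler_pM. Qed.

(** Two derivatives fall on the cutoff function, at the scale [r]. *)
Lemma remainder_bound (K : set 'rV[R]_2) (y0 : 'rV[R]_2) : compact K -> K `<=` img i ->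
  exists2 C, 0 <= C & forall r t y, 0 < r <= 1 -> 0 < t < T -> K y ->
    `|remainder (cutoff y0 r) t y| <= C / r ^+ 2 * stress_norm (u t) i y.
Proof.
move=> cK Ki; have [c c0 Hc] := @cutoff_pd_bound R 2.
have [B1 B10 H1] := continuous_bound cK Ki (fun p : 'I_2 * 'I_2 => @smooth_cmetric R S i p.1 p.2).
have [B2 B20 H2] := continuous_bound cK Ki (fun p : 'I_2 * 'I_2 => @smooth_invmx R S i p.1 p.2).
have [B3 B30 H3] := continuous_bound cK Ki (fun p : 'I_2 * 'I_2 * 'I_2 =>
  smooth_on_derive (delta_mx 0 p.2 : 'rV[R]_2) (@smooth_cmetric R S i p.1.1 p.1.2)).
have [B4 B40 H4] := continuous_bound cK Ki (fun p : 'I_2 * 'I_2 * 'I_2 =>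
  smooth_on_derive (delta_mx 0 p.2 : 'rV[R]_2) (@smooth_invmx R S i p.1.1 p.1.2)).
have [B5 B50 H5] := continuous_bound cK Ki (fun p : 'I_2 * 'I_2 => @metric_smooth R 2 S i p.1 p.2).
pose B := B1 + B2 + B3 + B4 + 2 * B5.
have B0 : 0 <= B by rewrite /B; lra.
exists (40 * c * B ^+ 3); first by rewrite !mulr_ge0 ?exprn_ge0.
move=> r t y /andP[r0 r1] t0T Ky; have yi := Ki _ Ky.
have cm a b : `|cmetric i y a b| <= B by apply: le_trans (H1 (a, b) y Ky) _; rewrite /B; lra.
have ci a b : `|invmx (metric i y) a b| <= B by apply: le_trans (H2 (a, b) y Ky) _; rewrite /B; lra.
have dcm a b e : `|pd e (fun y => cmetric i y a b) y| <= B.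
  by apply: le_trans (H3 (a, b, e) y Ky) _; rewrite /B; lra.
have dci a b e : `|pd e (fun y => invmx (metric i y) a b) y| <= B.
  by apply: le_trans (H4 (a, b, e) y Ky) _; rewrite /B; lra.
have EG : metric i y 0 0 + metric i y 1 1 <= B.
  have := le_trans (ler_norm _) (H5 (0, 0) y Ky); have := le_trans (ler_norm _) (H5 (1, 1) y Ky).
  by rewrite /B /=; lra.
set sn := stress_norm (u t) i y; have sn0 : 0 <= sn by exact: sqrtr_ge0.
have sB a b : `|stress_mx (u t) i y a b| <= B * sn.
  have [E0 G0 D0] := surface_metric yi.
  apply: le_trans (tensor_entry_bound (Defs.metric_sym yi) E0 G0 D0 (stress_mx_sym (u t) yi) a b) _.
  by rewrite ler_wpM2r // sqrtr_ge0.
set q := c / r ^+ 2; have q0 : 0 <= q by rewrite divr_ge0 ?sqr_ge0.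
have cr : c / r <= q.
  rewrite /q ler_wpM2l // lef_pV2 ?posrE ?exprn_gt0 //.
  by rewrite expr2 ler_piMl // ltW.
have d1 a : `|pd a (cutoff y0 r) y| <= q by have [H _] := Hc y0 r y a 0 r0; exact: le_trans H cr.
have d2 a b : `|pd b (pd a (cutoff y0 r)) y| <= q by have [_ H] := Hc y0 r y a b r0.
have Yb b : `|raised (cutoff y0 r) b y| <= 2 * (q * B).
  by apply: sum2_bound => a; exact: norm_mul_bound.
have schi := @smooth_on_cutoff R 2 y0 r.
have dY a b : `|pd a (raised (cutoff y0 r) b) y| <= 2 * (q * B + q * B).
  have -> : pd a (raised (cutoff y0 r) b) y = \sum_e (pd a (pd e (cutoff y0 r)) y * invmx (metric i y) e b
     + pd e (cutoff y0 r) y * pd a (fun y => invmx (metric i y) e b) y).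
    apply: is_derive_val; apply: is_derive_summ => e; apply: is_derive_mul.
      exact: smooth_is_derive (smooth_on_derive (delta_mx 0 e) schi) I.
    exact: smooth_is_derive (@smooth_invmx R S i e b) yi.
  apply: sum2_bound => e; apply: (le_trans (ler_normD _ _)).
  by apply: lerD; exact: norm_mul_bound.
have fl a b : `|flux u i t a b y| <= 2 * (B * (B * sn)).
  by apply: sum2_bound => e; exact: norm_mul_bound.
have R1 : `|\sum_a \sum_b pd a (raised (cutoff y0 r) b) y * flux u i t a b y| <=
    2 * (2 * (2 * (q * B + q * B) * (2 * (B * (B * sn))))).
  by apply: sum2_bound => a; apply: sum2_bound => b; exact: norm_mul_bound.
have R2 : `|\sum_b raised (cutoff y0 r) b y * (2^-1 * \sum_c \sum_d
      pd b (fun y => cmetric i y c d) y * stress_mx (u t) i y c d)| <=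
    2 * (2 * (q * B) * (2^-1 * (2 * (2 * (B * (B * sn)))))).
  apply: sum2_bound => b; apply: norm_mul_bound => //; apply: norm_mul_bound.
    by rewrite ger0_norm.
  by apply: sum2_bound => e; apply: sum2_bound => d; exact: norm_mul_bound.
apply: le_trans (ler_normB _ _) _; apply: le_trans (lerD R1 R2) _.
have -> : 40 * c * B ^+ 3 / r ^+ 2 * sn = 40 * q * B ^+ 3 * sn by rewrite /q; ring.
by rewrite le_eqVlt; apply/orP; left; apply/eqP; field.
Qed.

(** The flux has compact support. *)
Lemma integral_flux (chi : 'rV[R]_2 -> R) (K : set 'rV[R]_2) t a : compact K -> K `<=` img i ->
  smooth_on setT chi -> (forall y, ~ K y -> chi y = 0) -> 0 < t < T ->
  (\int[leb2]_(z in pt @^-1` K) (pd a (energy_flux chi t a) (pt z))%:E = 0)%E.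
Proof.
move=> cK Ki sc c0 t0T; have clK := compact_closed_rV cK.
have F0 y : ~ K y -> energy_flux chi t a y = 0.
  move=> Ky; rewrite /energy_flux c0 // mul0r sub0r big1 ?oppr0 // => b _.
  by rewrite /raised big1 ?mul0r // => e _; rewrite (pd_zero_off _ clK c0) ?mul0r.
rewrite -[RHS](integral_pd_compact a oi cK Ki (smooth_energy_flux a sc t0T) F0).
rewrite integral_mkcond; apply: eq_integral => z _; rewrite /patch; case: ifPn => // /negP zK.
by rewrite (pd_zero_off _ clK F0) // => Kz; apply: zK; rewrite inE.
Qed.

Lemma evolution_integral (chi : 'rV[R]_2 -> R) (K : set 'rV[R]_2) t : compact K -> K `<=` img i ->
  smooth_on setT chi -> (forall y, 0 <= chi y) -> (forall y, ~ K y -> chi y = 0) -> 0 < t < T ->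
  (\int[leb2]_(z in pt @^-1` K) (chi (pt z) * 'D_dt (flow_energy u i) (t, pt z))%:E <=
   \int[leb2]_(z in pt @^-1` K) `|remainder chi t (pt z)|%:E)%E.
Proof.
move=> cK Ki sc chi0 c0 t0T.
have mK : measurable (pt @^-1` K : set RR).
  by apply: measurable_closed2; exact: compact_closed_rV.
have int (f : 'rV[R]_2 -> R) : (forall y, img i y -> {for y, continuous f}) ->
    leb2.-integrable (pt @^-1` K) (fun z => (f (pt z))%:E).
  exact: continuous_integrable2.
have I0 a : leb2.-integrable (pt @^-1` K) (fun z => (pd a (energy_flux chi t a) (pt z))%:E).
  apply: int => y yi.
  exact: (smooth_on_continuous (smooth_on_derive _ (smooth_energy_flux a sc t0T)) yi).
have IR : leb2.-integrable (pt @^-1` K) (fun z => `|remainder chi t (pt z)|%:E).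
  apply: (int (fun y => `|remainder chi t y|)) => y yi.
  exact: (cvg_norm (smooth_on_continuous (smooth_remainder sc t0T) yi)).
have sE : smooth_on (img i) (fun y => 'D_dt (flow_energy u i) (t, y)).
  have H := @smooth_slice R 'rV[R]_2 R _ _ t (smooth_on_derive dt (@smooth_flow_energy R n S N T u su i)).
  by apply: smooth_onW H => y yi; split.
have IL : leb2.-integrable (pt @^-1` K)
    (fun z => (chi (pt z) * 'D_dt (flow_energy u i) (t, pt z))%:E).
  apply: (int (fun y => chi y * 'D_dt (flow_energy u i) (t, y))) => y yi.
  exact: (cvgM (smooth_on_continuous sc I) (smooth_on_continuous sE yi)).
pose f0 z := (pd 0 (energy_flux chi t 0) (pt z))%:E.
pose f1 z := (pd 1 (energy_flux chi t 1) (pt z))%:E.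
have I01 : leb2.-integrable (pt @^-1` K) (f0 \+ f1)%E by exact: (integrableD mK (I0 0) (I0 1)).
apply: (@le_trans _ _ (\int[leb2]_(z in pt @^-1` K)
    ((f0 \+ f1) z + `|remainder chi t (pt z)|%:E))%E).
  apply: le_integral => //; first exact: integrableD.
  move=> z /set_mem Kz; have zi := Ki _ Kz.
  rewrite (evolution_pointwise sc (conj t0T zi : cylinder T i (t, pt z))) sum2.
  have gen (a b x y : R) : 0 <= y -> a + b + x - y <= a + b + `|x|.
    by move=> y0; have := ler_norm x; lra.
  rewrite /f0 /f1 -!EFinD lee_fin; apply: gen.
  rewrite mulr_ge0 // mulr_ge0 ?sqrtr_ge0 //.
  exact: metric_at_ge0.
rewrite integralD // (integralD mK (I0 0) (I0 1)) !integral_flux //.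
by rewrite adde0 add0e.
Qed.

End LocalEnergy.

(** * Growth of the localized energy *)

Section Growth.
Context {R : realType} {n : nat}.
Context {S : compact_riemannian R 2} {N : compact_riemannian R n}.
Context (T : R) (u : R -> S -> N).
Notation RV := (R * 'rV[R]_2)%type.
Notation leb2 := (@leb2 R).
Notation RR := (measurableTypeR R * measurableTypeR R)%type.
Notation chart := 'I_(ncharts S).+1.

(** The first term dominates for [M <= x]. *)
Lemma young_powR (x M q : R) : 0 <= x -> 0 < M -> 1 <= q -> x <= M `^ (1 - q) * x `^ q + M.
Proof.
move=> x0 M0 q1; have [xM|Mx] := leP x M.
  by apply: le_trans xM _; rewrite lerDr mulr_ge0 ?powR_ge0.
have xp : 0 < x := lt_trans M0 Mx.
apply: (@le_trans _ _ (M `^ (1 - q) * x `^ q)); last by rewrite lerDl ltW.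
have xE : x = x `^ (1 - q) * x `^ q.
  by rewrite -powRD ?subrK ?powRr1 // (gt_eqF xp) implybT.
rewrite {1}xE ler_wpM2r ?powR_ge0 // -opprB !powRN.
by rewrite lef_pV2 ?posrE ?powR_gt0 //; apply: ge0_ler_powR; rewrite ?nnegrE ?subr_ge0 // ltW.
Qed.

Lemma square_area (y0 : 'rV[R]_2) (h : R) : 0 <= h ->
  leb2 (pt @^-1` [set y | `|y - y0| <= h] : set RR) = (4 * h ^+ 2)%:E.
Proof.
move=> h0; have -> : (pt @^-1` [set y | `|y - y0| <= h] : set RR) =
    `[y0 0 0 - h, y0 0 0 + h] `*` `[y0 0 1 - h, y0 0 1 + h].
  apply/seteqP; split => -[x y] /=; rewrite norm_le_2 !mxE /= !ler_distl !in_itv /=.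
    by move/andP.
  by move=> [-> ->].
rewrite leb2_box; last 2 first.
- by lra.
- by lra.
by congr EFin; ring.
Qed.

Hypothesis su : forall i, smooth_into (cylinder T i) (chart_flow u i).
Hypothesis heat : forall t x, 0 < t < T ->
  'D_1 (fun s : R => phi (chart_at (u t x)) (u s x)) t = tension (u t) x.
Context (i : chart) (y0 : 'rV[R]_2) (d : R).
Let K : set 'rV[R]_2 := [set y | `|y - y0| <= d].
Hypothesis Ki : K `<=` img i.

Let oi : open (img i) := @img_open R 2 S i.
Let oA : open (cylinder T i) := open_cylinder (T := T) (i := i).
Let cK : compact K := compact_square (c := y0) (r := d).
Let mK : measurable (pt @^-1` K : set RR).
Proof. by apply: measurable_closed2; exact: compact_closed_rV. Qed.

Definition local_energy (r t : R) : R :=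
  \int[leb2]_(z in pt @^-1` [set y : 'rV[R]_2 | `|y - y0| <= d])
     (cutoff y0 r (pt z) * flow_energy u i (t, pt z)).

(** The growth rate of the local energy at scale [r]: Young's inequality with
    the parameter [sigma * r ^ (- 2 / q)] plays the role of Hoelder's. *)
Lemma energy_rate_bound (q sigma : R) : 1 <= q -> 0 < sigma ->
  exists2 C, 0 <= C & forall r t, 0 < r <= 1 -> 2 * r <= d -> 0 < t < T ->
    (area_integral setT (fun x => (tensor_norm x (stress_energy (u t) x) `^ q)%:E)
       <= (sigma `^ q)%:E)%E ->
    (\int[leb2]_(z in pt @^-1` K)
       (cutoff y0 r (pt z) * 'D_dt (flow_energy u i) (t, pt z))%:E <=
     (C * r `^ (- (2 / q)))%:E)%E.
Proof.
move=> q1 s0; have q0 : 0 < q := lt_le_trans ltr01 q1.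
have [C1 C10 HC1] := remainder_bound T u y0 cK Ki.
have sV : smooth_on (img i) (fun y => area_density i y `^ (-1)).
  apply: (@smooth_on_comp1 _ _ _ oi [set x : R | 0 < x] (fun x => x `^ (-1)) (area_density i)).
  - exact: open_gt.
  - exact: smooth_on_powR.
  - by move=> y yi; have [] := area_density_sq yi.
  - exact: smooth_area_density.
have [B B0 HB] := continuous_bound cK Ki (fun _ : unit => sV).
exists (C1 * sigma * (9 * B + 16)); first by rewrite !mulr_ge0 ?addr_ge0 ?mulr_ge0 // ltW.
move=> r t r01 rd t0T Ht; have /andP[r0 r1] := r01.
pose Kr : set 'rV[R]_2 := [set y | `|y - y0| <= 2 * r].
have KrK : Kr `<=` K by move=> y /= yr; exact: le_trans yr rd.
have cKr : compact Kr by exact: compact_square.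
have clKr := compact_closed_rV cKr.
have mKr : measurable (pt @^-1` Kr : set RR) by exact: measurable_closed2.
have chi0 y : ~ Kr y -> cutoff y0 r y = 0.
  by move=> /negP; rewrite -ltNge => yK; apply: cutoff_support => //; exact: ltW.
have -> : (\int[leb2]_(z in pt @^-1` K)
       (cutoff y0 r (pt z) * 'D_dt (flow_energy u i) (t, pt z))%:E =
   \int[leb2]_(z in pt @^-1` Kr)
       (cutoff y0 r (pt z) * 'D_dt (flow_energy u i) (t, pt z))%:E)%E.
  rewrite integral_mkcond [RHS]integral_mkcond; apply: eq_integral => z _.
  rewrite /patch; have [Kz|Kz] := pselect (Kr (pt z)).
    by rewrite !mem_set //; exact: KrK.
  rewrite [RHS]ifF; last by apply/negP => /set_mem.
  by case: ifP => // _; rewrite chi0 // mul0r.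
apply: le_trans (evolution_integral su heat cKr _ (@smooth_on_cutoff R 2 y0 r)
  (@cutoff_ge0 R 2 y0 r) chi0 t0T) _; first by move=> y /KrK/Ki.
have sm := flow_smooth_map su t0T.
(* With this parameter both terms of Young's inequality are of order M r^2 after
   integration over a square of area 16 r^2. *)
pose M := sigma * r `^ (- (2 / q)); have M0 : 0 < M by rewrite mulr_gt0 // powR_gt0.
pose f y := stress_norm (u t) i y `^ q * area_density i y.
have f0 y : 0 <= f y by rewrite mulr_ge0 ?powR_ge0 ?sqrtr_ge0.
pose a := C1 / r ^+ 2 * (M `^ (1 - q) * B); pose b := C1 / r ^+ 2 * M.
have a0 : 0 <= a by rewrite !mulr_ge0 ?invr_ge0 ?sqr_ge0 ?powR_ge0.
have b0 : 0 <= b by rewrite mulr_ge0 ?divr_ge0 ?sqr_ge0 // ltW.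
have If : (\int[leb2]_(z in pt @^-1` Kr) (f (pt z))%:E <= (9 * sigma `^ q)%:E)%E.
  apply: le_trans (stress_le sm i q1 Ht); apply: le_integral_ge0.
  - by move=> z _; rewrite lee_fin.
  - by move=> z _; rewrite lee_fin; exact: f0.
  - by move=> z Kz; split; [exact/Ki/KrK|].
have mf : measurable_fun (pt @^-1` Kr : set RR) (f \o pt).
  apply: (@measurable_funS _ _ RR R (pt @^-1` img i)).
  - exact: measurable_open2.
  - by move=> z /KrK/Ki.
  - apply: continuous_measurable2 => // y yi; apply: continuousM.
      apply: continuous_powR_ge0 => //; first by move=> z; exact: sqrtr_ge0.
      exact: continuous_stress_norm.
    exact: smooth_on_continuous (@smooth_area_density R S i) yi.
apply: (@le_trans _ _ (\int[leb2]_(z in pt @^-1` Kr) (a%:E * (f (pt z))%:E + b%:E))%E).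
  apply: le_integral_ge0.
  - by move=> z _; rewrite lee_fin.
  - by move=> z _; rewrite -EFinM -EFinD lee_fin; exact: (addr_ge0 (mulr_ge0 a0 (f0 _)) b0).
  move=> z Kz; split => //; rewrite -EFinM -EFinD lee_fin.
  have zK := KrK _ Kz; have zi := Ki zK; have [s00 _] := area_density_sq zi.
  apply: le_trans (HC1 r t (pt z) r01 t0T zK) _; rewrite /a /b -!mulrA -mulrDr.
  rewrite -!mulrDr !ler_wpM2l ?invr_ge0 ?sqr_ge0 //.
  apply: le_trans (young_powR (sqrtr_ge0 _) M0 q1) _; rewrite lerD2r ler_wpM2l ?powR_ge0 //.
  have := HB tt _ zK; rewrite powR_inv1 ?(ltW s00) // => H.
  have {}H := le_trans (ler_norm _) H.
  rewrite /f mulrCA -[leLHS]mulr1 ler_wpM2l ?powR_ge0 //.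
  by rewrite -(mulVf (lt0r_neq0 s00)) ler_wpM2r // ltW.
rewrite ge0_integralD; last 5 first.
- exact: mKr.
- by move=> z _; rewrite -EFinM lee_fin; exact: (mulr_ge0 a0 (f0 _)).
- by apply: emeasurable_funM; [exact: measurable_cst|exact/measurable_EFinP].
- by move=> z _; rewrite lee_fin.
- exact: measurable_cst.
rewrite ge0_integralZl; last 4 first.
- exact: mKr.
- exact/measurable_EFinP.
- by move=> z _; rewrite lee_fin; exact: f0.
- by rewrite lee_fin.
have -> : (\int[leb2]_(z in pt @^-1` Kr) b%:E = b%:E * (4 * (2 * r) ^+ 2)%:E)%E.
  have r20 : 0 <= 2 * r by rewrite mulr_ge0 // ltW.
  rewrite -(square_area y0 r20).
  exact: (@integral_cst _ RR R leb2 _ mKr).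
apply: (@le_trans _ _ (a%:E * (9 * sigma `^ q)%:E + b%:E * (4 * (2 * r) ^+ 2)%:E)%E).
  by rewrite leeD2r // lee_wpmul2l // lee_fin.
rewrite -!EFinM -EFinD lee_fin /a /b.
have r2 : r ^+ 2 != 0 by rewrite expf_neq0 // gt_eqF.
have EM : M `^ (1 - q) * sigma `^ q = M * r ^+ 2.
  rewrite /M powRM ?powR_ge0 ?(ltW s0) // mulrAC -powRD; last by rewrite (gt_eqF s0) implybT.
  rewrite subrK powRr1 ?(ltW s0) // -mulrA; congr (_ * _).
  rewrite -powRrM -powR_mulrn ?(ltW r0) // -powRD; last by rewrite (gt_eqF r0) implybT.
  by congr (_ `^ _); field; rewrite gt_eqF.
have -> : C1 / r ^+ 2 * (M `^ (1 - q) * B) * (9 * sigma `^ q) =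
   C1 / r ^+ 2 * (9 * B) * (M `^ (1 - q) * sigma `^ q) by ring.
rewrite EM (_ : C1 * sigma * (9 * B + 16) * r `^ (- (2 / q)) = C1 * (9 * B + 16) * M); last first.
  by rewrite /M; ring.
by rewrite le_eqVlt; apply/orP; left; apply/eqP; field; exact: lt0r_neq0.
Qed.

(** Differentiation under the integral sign on the compact set [K]. *)
Lemma local_energy_derive r t : 0 < t < T ->
  is_derive t 1 (local_energy r)
    (\int[leb2]_(z in pt @^-1` K) (cutoff y0 r (pt z) * 'D_dt (flow_energy u i) (t, pt z))).
Proof.
move=> /andP[t0 tT]; pose a := t / 2; pose b := (t + T) / 2.
have a0 : 0 < a by rewrite divr_gt0.
have bT : b < T by rewrite /b; lra.
have Ia : `]a, b[%classic t by rewrite /= in_itv /= /a /b; apply/andP; split; lra.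
have I0T s : s \in `[a, b] -> 0 < s < T.
  by rewrite in_itv /= => /andP[? ?]; apply/andP; split; lra.
pose f (s : R) (z : RR) : R := cutoff y0 r (pt z) * flow_energy u i (s, pt z).
have sE := @smooth_flow_energy R n S N T u su i.
have schi := @smooth_on_cutoff R 2 y0 r.
have Dz s z : s \in `[a, b] -> (pt @^-1` K) z ->
    is_derive s 1 (f ^~ z) (cutoff y0 r (pt z) * 'D_dt (flow_energy u i) (s, pt z)).
  move=> sab Kz; have zA : cylinder T i (s, pt z) by split; [exact: I0T|exact: Ki].
  have D1 : is_derive s 1 (fun s : R => flow_energy u i (s, pt z)) ('D_dt (flow_energy u i) (s, pt z)).
    apply: DeriveDef; last by rewrite /dt derive_time.
    by apply: (@derivable_time R 'rV[R]_2 R); exact: smooth_on_derivable sE zA.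
  apply: is_derive_eq (is_derive_mul (is_derive_cst (cutoff y0 r (pt z)) s 1) D1) _.
  by rewrite mul0r add0r.
have [B B0 HB] : exists2 B, 0 <= B & forall s y, s \in `[a, b] -> K y ->
     `|cutoff y0 r y * 'D_dt (flow_energy u i) (s, y)| <= B.
  have cP : compact (`[a, b]%classic `*` K) by apply: compact_setX => //; exact: segment_compact.
  have ct : {within `[a, b]%classic `*` K, continuous
      (fun z : RV => cutoff y0 r z.2 * 'D_dt (flow_energy u i) z)}.
    apply: continuous_in_subspaceT => z /set_mem [z1 z2].
    have zA : cylinder T i z by split; [exact: I0T|exact: Ki].
    have c1 : {for z, continuous (fun z : RV => cutoff y0 r z.2)}.
      apply: (@continuous_comp _ _ _ (fun z : RV => z.2) (cutoff y0 r)); first exact: cvg_snd.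
      exact: (smooth_on_continuous schi I).
    exact: (cvgM c1 (smooth_on_continuous (smooth_on_derive dt sE) zA)).
  have /compact_bounded[M [Mr HM]] := continuous_compact ct cP.
  exists (`|M| + 1); first by rewrite addr_ge0.
  move=> s y sab Ky; apply: (HM (`|M| + 1)); last by exists (s, y).
  by rewrite (le_lt_trans (ler_norm M)) // ltrDl.
have sub s : `]a, b[%classic s -> s \in `[a, b] by move=> sI; exact: subset_itv_oo_cc sI.
have intf s : `]a, b[%classic s -> leb2.-integrable (pt @^-1` K) (EFin \o f s).
  move=> /sub/I0T s0T.
  apply: (@continuous_integrable2 R (img i) K (fun y => cutoff y0 r y * flow_energy u i (s, y))) => //.
  move=> y yi; apply: continuousM; first exact: smooth_on_continuous schi I.
  apply: (continuous_comp (f := fun y : 'rV[R]_2 => (s, y))); first exact: continuous_pair_l.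
  by apply: smooth_on_continuous sE _; split.
have derf s z : `]a, b[%classic s -> (pt @^-1` K) z -> derivable (f ^~ z) s 1.
  by move=> /sub sab Kz; have [] := Dz s z sab Kz.
have B_ge0 (z : RR) : 0 <= cst B z by [].
have intB : leb2.-integrable (pt @^-1` K) (EFin \o cst B).
  apply: (@continuous_integrable2 R (img i) K (cst B)) => // y yi.
  exact: cst_continuous.
have ubB s z : `]a, b[%classic s -> (pt @^-1` K) z -> `|partial1of2 f s z| <= cst B z.
  move=> /sub sab Kz; rewrite partial1of2E (is_derive_val (Dz s z sab Kz)).
  exact: HB.
apply: DeriveDef.
  exact: (derivable_under_integral mK Ia intf derf B_ge0 intB ubB).
have := differentiation_under_integral mK Ia intf derf B_ge0 intB ubB.
rewrite derive1E => ->; apply: eq_Rintegral => z /set_mem Kz.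
by rewrite partial1of2E (is_derive_val (Dz t z (sub _ Ia) Kz)).
Qed.

Lemma local_energy_integrable (r t : R) : 0 < t < T ->
  leb2.-integrable (pt @^-1` K) (fun z => (cutoff y0 r (pt z) * flow_energy u i (t, pt z))%:E).
Proof.
move=> t0T; have sE := @smooth_flow_energy R n S N T u su i.
apply: (@continuous_integrable2 R (img i) K (fun y => cutoff y0 r y * flow_energy u i (t, y))) => //.
move=> y yi; apply: continuousM; first exact: (smooth_on_continuous (@smooth_on_cutoff R 2 y0 r) I).
apply: (continuous_comp (f := fun y : 'rV[R]_2 => (t, y))); first exact: continuous_pair_l.
by apply: smooth_on_continuous sE _; split.
Qed.

Lemma local_energy_growth (q sigma : R) : 1 <= q -> 0 < sigma ->
  exists2 C, 0 <= C & forall r t1 t2, 0 < r <= 1 -> 2 * r <= d -> 0 < t1 -> t1 <= t2 -> t2 < T ->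
    (forall t, t1 <= t < T ->
      (area_integral setT (fun x => (tensor_norm x (stress_energy (u t) x) `^ q)%:E)
       <= (sigma `^ q)%:E)%E) ->
    local_energy r t2 - local_energy r t1 <= C * r `^ (- (2 / q)) * (t2 - t1).
Proof.
move=> q1 s0; have [C C0 HC] := energy_rate_bound q1 s0; exists C => //.
move=> r t1 t2 r01 rd t10 t12 t2T Ht.
have in0T t : t \in `[t1, t2] -> 0 < t < T.
  by rewrite in_itv /= => /andP[? ?]; apply/andP; split; [exact: lt_le_trans t10 _|exact: le_lt_trans t2T].
have [||c ct ->] := @MVT_segment R (local_energy r) (fun t => \int[leb2]_(z in pt @^-1` K)
    (cutoff y0 r (pt z) * 'D_dt (flow_energy u i) (t, pt z))) t1 t2 t12.
- by move=> t tI; apply: local_energy_derive; apply: in0T; exact: subset_itv_oo_cc tI.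
- apply: continuous_in_subspaceT => t /set_mem tI.
  have [D _] := local_energy_derive r (in0T t tI).
  by apply: differentiable_continuous; exact/derivable1_diffP.
rewrite ler_wpM2r ?subr_ge0 // -lee_fin; have c0T := in0T c ct.
rewrite /Rintegral fineK.
  apply: HC => //; apply: Ht; move: ct; rewrite in_itv /= => /andP[-> cc] /=.
  exact: le_lt_trans t2T.
apply: integrable_fin_num => //.
apply: (@continuous_integrable2 R (img i) K
  (fun y => cutoff y0 r y * 'D_dt (flow_energy u i) (c, y))) => // y yi.
have sE : smooth_on (img i) (fun y => 'D_dt (flow_energy u i) (c, y)).
  have H := @smooth_slice R 'rV[R]_2 R _ _ c (smooth_on_derive dt (@smooth_flow_energy R n S N T u su i)).
  by apply: smooth_onW H => z zi; split.
exact: (cvgM (smooth_on_continuous (@smooth_on_cutoff R 2 y0 r) I) (smooth_on_continuous sE yi)).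
Qed.

End Growth.

(** * The outer energy scale *)

(** The infimum of [G r t + K r * (T - t)] over all [r] and [t] is nearly attained
    at some [(r0, t0)].  After [t0], the function [G r0] plus [K r0 * (T - t)]
    stays within [e] of this infimum. *)
Lemma vanishing_gap {R : realType} (G : R -> R -> R) (K : R -> R) (a T d0 : R) :
  a < T -> 0 < d0 ->
  (forall r t, 0 < r <= d0 -> a < t < T -> 0 <= G r t) ->
  (forall r, 0 < r <= d0 -> 0 <= K r) ->
  (forall r t1 t2, 0 < r <= d0 -> a < t1 -> t1 <= t2 -> t2 < T ->
     G r t2 - G r t1 <= K r * (t2 - t1)) ->
  forall e, 0 < e -> exists r0 t0, [/\ 0 < r0 <= d0, a < t0 < T &
    forall r t, 0 < r <= d0 -> t0 <= t < T -> G r0 t - G r t <= e + K r * (T - t)].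
Proof.
move=> aT d00 G0 K0 GK e e0.
pose E : set R := [set x | exists r t, [/\ 0 < r <= d0, a < t < T & x = G r t + K r * (T - t)]].
have E0 : has_lbound E.
  exists 0 => _ [r [t [rd tT ->]]]; have /andP[_ tT'] := tT.
  by rewrite addr_ge0 ?G0 ?mulr_ge0 ?K0 // subr_ge0 ltW.
have EN : nonempty E.
  exists (G d0 ((a + T) / 2) + K d0 * (T - (a + T) / 2)), d0, ((a + T) / 2).
  by split => //; [rewrite d00 lexx|apply/andP; split; lra].
have [_ [r0 [t0 [rd tT ->]]] Ee] := inf_adherent e0 (conj EN E0).
exists r0, t0; split => // r t rd' /andP[t0t tT']; have /andP[at0 _] := tT.
have H1 := GK r0 t0 t rd at0 t0t tT'.
have H2 : inf E <= G r t + K r * (T - t).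
  by apply: ge_inf => //; exists r, t; split => //; rewrite (lt_le_trans at0 t0t).
have H3 : K r0 * (t - t0) <= K r0 * (T - t0) by rewrite ler_wpM2l ?K0 // lerD2r ltW.
lra.
Qed.

(** At the scale [s ^ (q / 2)] the factor [r ^ (- (2 / q)) * s] is constant; a large
    multiple of this scale makes it small. *)
Lemma scale_choice {R : realType} (C e b q : R) : 0 <= C -> 0 < e -> 0 < b -> 1 <= q ->
  exists2 D, 0 < D & forall s r, 0 < s -> D * s `^ (q / 2) <= r ->
    C * (b * r) `^ (- (2 / q)) * s <= e.
Proof.
move=> C0 e0 b0 q1; have q0 : 0 < q := lt_le_trans ltr01 q1.
(* With (b * r) ^ (2 / q) = M * s the left side is C / M. *)
pose M := C / e + 1; have M0 : 0 < M by rewrite ltr_wpDl // divr_ge0 // ltW.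
exists (M `^ (q / 2) / b); first by rewrite divr_gt0 // powR_gt0.
move=> s r s0 Dr; have Ms : 0 < M * s by rewrite mulr_gt0.
have br : (M * s) `^ (q / 2) <= b * r.
  rewrite powRM ?(ltW M0) ?(ltW s0) //; apply: le_trans (ler_wpM2l (ltW b0) Dr).
  by rewrite mulrA mulrCA divff ?mulr1 // lt0r_neq0.
have br0 : 0 < b * r := lt_le_trans (powR_gt0 _ Ms) br.
have pw : (b * r) `^ (- (2 / q)) <= (M * s)^-1.
  rewrite powRN lef_pV2 ?posrE ?powR_gt0 //.
  have {1}-> : M * s = ((M * s) `^ (q / 2)) `^ (2 / q).
    rewrite -powRrM (_ : q / 2 * (2 / q) = 1) ?powRr1 ?ltW //.
    by field; exact: lt0r_neq0.
  by apply: ge0_ler_powR => //; rewrite ?nnegrE ?powR_ge0 // ltW // divr_gt0.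
apply: (@le_trans _ _ (C * (M * s)^-1 * s)); first by rewrite ler_wpM2r ?(ltW s0) // ler_wpM2l.
rewrite invfM -!mulrA mulVf ?lt0r_neq0 // mulr1 ler_pdivrMr // /M mulrDr mulr1.
by rewrite mulrCA divff ?lt0r_neq0 // mulr1 lerDl ltW.
Qed.

Section Scale.
Context {R : realType} {n : nat}.
Context {S : compact_riemannian R 2} {N : compact_riemannian R n}.
Notation leb2 := (@leb2 R).
Notation RR := (measurableTypeR R * measurableTypeR R)%type.

Lemma area_integral_ge0 (Omega : set S) (f : S -> \bar R) :
  (forall x, (0 <= f x)%E) -> (0 <= area_integral Omega f)%E.
Proof.
move=> f0; apply: sume_ge0 => i _; apply: integral_ge0 => z _.
by rewrite mule_ge0 // lee_fin sqrtr_ge0.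
Qed.

Lemma tensor_Lnorm_le (q sigma : R) (A : S -> 'M[R]_2) : 1 <= q -> 0 < sigma ->
  (tensor_Lnorm q A <= sigma%:E)%E ->
  (area_integral setT (fun x => (tensor_norm x (A x) `^ q)%:E) <= (sigma `^ q)%:E)%E.
Proof.
move=> q1 s0; have q0 : 0 < q := lt_le_trans ltr01 q1; rewrite /tensor_Lnorm.
set X := area_integral _ _ => HX.
have X0 : (0 <= X)%E by apply: area_integral_ge0 => x; rewrite lee_fin powR_ge0.
have -> : X = ((X `^ q^-1) `^ q)%E by rewrite -poweRrM mulVf ?poweRe1 // lt0r_neq0.
rewrite -poweR_EFin; apply: gt0_ler_poweR => //; first exact: ltW.
- by rewrite in_itv /= poweR_ge0 leey.
- by rewrite in_itv /= leey andbT lee_fin ltW.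
Qed.

Context (T : R) (u : R -> S -> N).
Hypothesis su : forall i, smooth_into (cylinder T i) (chart_flow u i).
Hypothesis heat : forall t x, 0 < t < T ->
  'D_1 (fun s : R => phi (chart_at (u t x)) (u s x)) t = tension (u t) x.
Context (p : S).
Let i := chart_at p.
Let y0 := phi i p.

Lemma flow_energy_ge0 t y : img i y -> 0 <= flow_energy u i (t, y).
Proof.
move=> yi; rewrite flow_energyE // mulr_ge0 ?sqrtr_ge0 //; exact: energy_density_ge0.
Qed.

(** On the coordinate annulus that covers [U_(r/2)^r (p)] the large cutoff
    function is bounded below and the small one vanishes, so the difference of
    the two local energies bounds the energy of the annulus. *)
Lemma annulus_energy_le : exists d C b A r1 : R,
  [/\ 0 < d, 0 < C, 0 < b & 0 < A] /\
  [/\ 0 < r1, [set y | `|y - y0| <= d] `<=` img i &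
  forall r0 r t, 0 < t < T -> 0 < r0 -> 0 < r < r1 -> C * r <= r0 -> C * r <= d -> b * r <= r0 ->
    (energy (u t) (annulus (r / 2) r p) <=
     (A * (local_energy u i y0 d r0 t - local_energy u i y0 d (b * r) t))%:E)%E].
Proof.
have pi : dom i p := chart_atP p.
have [C [c [r1 [C0 c0 r10 Han]]]] := annulus_square pi.
have yi : img i y0 by exists p.
have [d d0 Kd] : exists2 d, 0 < d & [set y | `|y - y0| <= d] `<=` img i.
  have /nbhs_ballP[e /= e0 He] := open_nbhs_nbhs (conj (@img_open R 2 S i) yi).
  exists (e / 2); first by rewrite divr_gt0.
  move=> y /= yd; apply: He; rewrite -ball_normE /= distrC.
  by apply: le_lt_trans yd _; rewrite ltr_pdivrMr // ltr_pMr // ltrDl.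
pose kappa : R := flat 0 2; have k0 : 0 < kappa by exact: flat_gt0.
pose A := 9 * kappa^-1 * (ncharts S).+1%:R.
exists d, C, (c / 3), A, r1; split.
  by split => //; rewrite ?divr_gt0 // /A !mulr_gt0 ?invr_gt0.
split => // r0 r t t0T r00 rr Cr Cd br; have /andP[rp _] := rr.
set s := c / 3 * r; have s0 : 0 < s by rewrite mulr_gt0 ?divr_gt0.
pose K : set 'rV[R]_2 := [set y | `|y - y0| <= d].
pose O : set 'rV[R]_2 := [set y | 2 * s < `|y - y0| < C * r].
have OK : O `<=` K by move=> y /andP[_ yC]; exact: le_trans (ltW yC) Cd.
have cd : continuous (fun y : 'rV[R]_2 => `|y - y0|).
  move=> y; apply: continuous_comp; last exact: norm_continuous.
  exact: (cvgB cvg_id (cvg_cst _)).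
have oO : open O.
  rewrite (_ : O = (fun y => `|y - y0|) @^-1` [set x | 2 * s < x] `&`
     (fun y => `|y - y0|) @^-1` [set x | x < C * r]); last first.
    by apply/seteqP; split => y /=; rewrite /O /= => /andP.
  apply: openI; apply: open_comp; [by move=> y _; exact: cd|exact: open_gt|by move=> y _; exact: cd|exact: open_lt].
pose G r' (z : RR) := cutoff y0 r' (pt z) * flow_energy u i (t, pt z).
have IG r' : leb2.-integrable (pt @^-1` K) (EFin \o G r').
  exact: (local_energy_integrable su Kd r' t0T).
have mK : measurable (pt @^-1` K : set RR).
  by apply: measurable_closed2; apply: compact_closed_rV; exact: compact_square.
have ID : leb2.-integrable (pt @^-1` K) (EFin \o (fun z => G r0 z - G s z)).
  exact: (integrableB mK (IG r0) (IG s)).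
have IZ : leb2.-integrable (pt @^-1` K) (EFin \o (fun z => kappa^-1 * (G r0 z - G s z))).
  exact: (integrableZl mK kappa^-1 ID).
have EI : (\int[leb2]_(z in pt @^-1` K) (kappa^-1 * (G r0 z - G s z))%:E =
   (kappa^-1 * (local_energy u i y0 d r0 t - local_energy u i y0 d s t))%:E)%E.
  have EB : \int[leb2]_(z in pt @^-1` K) (G r0 z - G s z) =
     local_energy u i y0 d r0 t - local_energy u i y0 d s t.
    exact: (RintegralB mK (IG r0) (IG s)).
  rewrite -EB -(RintegralZl kappa^-1 mK ID) [RHS]fineK //.
  exact: integrable_fin_num IZ.
have sm := flow_smooth_map su t0T.
have -> : A * (local_energy u i y0 d r0 t - local_energy u i y0 d s t) =
   9 * (kappa^-1 * (local_energy u i y0 d r0 t - local_energy u i y0 d s t)) *+ (ncharts S).+1.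
  have alg (k m X : R) : 9 * k * m * X = 9 * (k * X) * m by ring.
  by rewrite -mulr_natr; exact: alg.
apply: (energy_le sm oO (subset_trans OK Kd)).
  move=> x /(Han _ _ rr)[dx lo hi]; exists (phi i x); last exact: phiK.
  (* The small cutoff function vanishes beyond 2 s, short of c r. *)
  have cs : c * r = 3 * s by rewrite /s; field.
  by rewrite /O /= hi andbT; apply: lt_le_trans lo; rewrite cs ltr_pM2r // ltr_nat.
rewrite -EI; apply: le_integral_ge0.
- by move=> z /OK/Kd zi; rewrite lee_fin -flow_energyE //; exact: flow_energy_ge0.
- move=> z /Kd zi; rewrite lee_fin mulr_ge0 ?invr_ge0 ?(ltW k0) // subr_ge0.
  by rewrite ler_wpM2r ?flow_energy_ge0 //; exact: cutoff_homo.
- move=> z Oz; have zi := Kd _ (OK _ Oz); split; first exact: OK.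
  have /andP[lo hi] := Oz; rewrite lee_fin -flow_energyE // /G (cutoff_support s0 (ltW lo)) mul0r subr0.
  rewrite mulrA ler_peMl ?flow_energy_ge0 // -(mulVf (lt0r_neq0 k0)).
  rewrite ler_wpM2l ?invr_ge0 ?(ltW k0) //; apply: cutoff_ge => //.
  exact: le_trans (ltW hi) Cr.
Qed.

Lemma outer_scale_le (eps rho l : R) (v : S -> N) : 0 < eps -> 0 <= l <= rho ->
  (forall r, l < r < rho -> (energy v (annulus (r / 2) r p) <= (eps / 2)%:E)%E) ->
  0 <= outer_scale eps rho p v <= l.
Proof.
move=> e0 lr Hl; rewrite /outer_scale; set E := [set _ | _].
have El : E l.
  split => //; apply: (@le_lt_trans _ _ (eps / 2)%:E); last first.
    by rewrite lte_fin ltr_pdivrMr // ltr_pMr // ltrDl.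
  apply: ge_ereal_sup => _ [r rI <-]; apply: Hl; by move: rI; rewrite /= in_itv.
have E0 : lbound E 0 by move=> x [/andP[]].
apply/andP; split; first by apply: lb_le_inf => //; exists l.
by apply: ge_inf => //; exists 0.
Qed.

End Scale.

Theorem corollary4p5 (R : realType) (n : nat)
    (S : compact_riemannian R 2) (N : compact_riemannian R n)
    (T : R) (hT : 0 < T) (u : R -> S -> N) (hu : harmonic_map_flow T u)
    (q sigma tau : R) (hq : 1 <= q) (hsigma : 0 < sigma) (htau : 0 <= tau < T)
    (hS : (ereal_sup [set tensor_Lnorm q (stress_energy (u t)) | t in `[tau, T[]
             <= sigma%:E)%E)
    (p : S) (eps : R) (heps : 0 < eps) :
  \forall rho \near 0^'+,
    (fun t : R => outer_scale eps rho p (u t))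
      =O_ (T^'-) (fun t : R => (T - t) `^ (q / 2)).
Proof.
have [_ _ su heat] := hu; have /andP[tau0 tauT] := htau.
have q0 : 0 < q := lt_le_trans ltr01 hq.
have [d [C [b [A [r1 [[d0 C0 b0 A0] [r10 Kd Hann]]]]]]] := annulus_energy_le su p.
have stress t : tau <= t < T ->
    (area_integral setT (fun x => (tensor_norm x (stress_energy (u t) x) `^ q)%:E) <= (sigma `^ q)%:E)%E.
  move=> tI; apply: tensor_Lnorm_le => //; apply: le_trans hS; apply: ereal_sup_ubound.
  by exists t => //; rewrite /= in_itv.
have [C2 C20 Hgrow] := local_energy_growth su heat Kd hq hsigma.
pose G := local_energy u (chart_at p) (phi (chart_at p) p) d.
pose d1 := Num.min 1 (d / 2).
have d10 : 0 < d1 by rewrite lt_min ltr01 divr_gt0.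
have d1P r : r <= d1 -> r <= 1 /\ 2 * r <= d.
  by rewrite le_min ler_pdivlMr // mulrC => /andP[].
have in0T t : tau < t < T -> 0 < t < T by move=> /andP[tt ->]; rewrite (le_lt_trans tau0 tt).
pose e := eps / (4 * A); have e0 : 0 < e by rewrite divr_gt0 // mulr_gt0.
have [r0 [t0 [/andP[r00 r0d] /andP[t0tau t0T] Hgap]]] : exists r0 t0,
    [/\ 0 < r0 <= d1, tau < t0 < T & forall r t, 0 < r <= d1 -> t0 <= t < T ->
       G r0 t - G r t <= e + C2 * r `^ (- (2 / q)) * (T - t)].
  apply: vanishing_gap => //.
  - move=> r t /andP[r0 _] /in0T tI; apply: Rintegral_ge0 => z /Kd zi.
    by rewrite mulr_ge0 ?cutoff_ge0 ?(flow_energy_ge0 u).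
  - by move=> r _; rewrite mulr_ge0 // powR_ge0.
  - move=> r t1 t2 /andP[rp /d1P[rl rd]] t1tau t12 t2T.
    apply: Hgrow => //; first by rewrite rp.
      exact: le_lt_trans tau0 t1tau.
    by move=> t /andP[t1t tT]; apply: stress; rewrite tT andbT (le_trans (ltW t1tau)).
have [D D0 HD] := scale_choice C20 e0 b0 hq.
pose rho0 := Num.min r1 (Num.min (Num.min (r0 / C) (d / C)) (Num.min (r0 / b) (d1 / b))).
have rho00 : 0 < rho0 by rewrite !lt_min r10 !divr_gt0.
near=> rho; have rho_gt0 : 0 < rho by near: rho; exact: nbhs_right_gt.
have : rho < rho0 by near: rho; exact: nbhs_right_lt.
rewrite /rho0 !lt_min !ltr_pdivlMr // => /andP[rhor1 /andP[/andP[Cr0 Cd] /andP[br0 bd]]].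
have Tt_near : \forall t \near T^'-, T - t < (rho / D) `^ (2 / q).
  by apply: nbhs_left_ltBl; rewrite powR_gt0 // divr_gt0.
apply/eqO_exP; exists D => //.
near=> t; have tT : t < T by near: t; exact: nbhs_left_lt.
have t0t : t0 < t by near: t; exact: nbhs_left_gt.
have Tt : 0 < T - t by rewrite subr_gt0.
have lrho : D * (T - t) `^ (q / 2) <= rho.
  have small : T - t < (rho / D) `^ (2 / q) by near: t.
  have pw : rho / D = ((rho / D) `^ (2 / q)) `^ (q / 2).
    rewrite -powRrM (_ : 2 / q * (q / 2) = 1) ?powRr1 ?divr_ge0 ?(ltW D0) ?(ltW rho_gt0) //.
    by field; exact: lt0r_neq0.
  rewrite mulrC -ler_pdivlMr // pw.
  apply: ge0_ler_powR; rewrite ?nnegrE ?powR_ge0 ?(ltW Tt) ?(ltW small) //.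
  by rewrite divr_ge0 // ltW.
have l0 : 0 <= D * (T - t) `^ (q / 2) by rewrite mulr_ge0 ?powR_ge0 // ltW.
have /andP[scale0 scale_le] : 0 <= outer_scale eps rho p (u t) <= D * (T - t) `^ (q / 2).
  apply: outer_scale_le => //; first by rewrite l0.
  move=> r /andP[lr rrho]; have rp : 0 < r := le_lt_trans l0 lr.
  have tt : 0 < t < T by rewrite tT andbT (le_lt_trans tau0) // (lt_trans t0tau).
  have mono k x : 0 < k -> k * rho < x -> k * r <= x.
    by move=> k0 kx; apply: le_trans (ltW kx); rewrite ler_wpM2l ?ltW.
  rewrite ![rho * _]mulrC in Cr0 Cd br0 bd.
  apply: le_trans (Hann r0 r t tt r00 _ (mono _ _ C0 Cr0) (mono _ _ C0 Cd) (mono _ _ b0 br0)) _.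
    by rewrite rp (lt_trans rrho).
  rewrite lee_fin; have brp : 0 < b * r <= d1 by rewrite mulr_gt0 // (mono _ _ b0 bd).
  have tI : t0 <= t < T by rewrite ltW.
  have H1 := Hgap (b * r) t brp tI.
  have H2 := HD (T - t) r Tt (ltW lr).
  apply: (@le_trans _ _ (A * (e + e))).
    by rewrite ler_wpM2l ?(ltW A0) //; apply: le_trans H1 _; rewrite lerD2l.
  by rewrite /e le_eqVlt; apply/orP; left; apply/eqP; field; exact: lt0r_neq0.
by rewrite !ger0_norm ?powR_ge0.
Unshelve. all: by end_near. Qed.
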